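(* Let $F_n=F_{n,0}$ and $G_n=G_{n,2}$ be as in the context, and define for $n\ge0$ $$\widetilde F_n(z)=(-1)^n\Big(F_n(z)+\sum_{\ell=1}^n\binom{n+\ell}{n}F_{n-\ell}(z)\Big),\qquad \widetilde G_n(z)=G_n(z)+\sum_{\ell=1}^n(-1)^\ell\binom{n+\ell}{n}G_{n-\ell}(z),$$ and $\widetilde F_{-1}=\widetilde G_{-1}:=0$. Then for all $n\ge0$: (1) $\Delta_0\widetilde F_n=\widetilde F_{n-1}$ and $\xi_0\widetilde F_n=\widetilde G_n$; (2) $\Delta_2\widetilde G_n=\widetilde G_{n-1}$ and $\xi_2\widetilde G_n=\widetilde F_{n-1}$.
   Context: Write $z=x+iy\in\mathbb H$. For $k\in 2\mathbb Z$, $\Delta_k=y^2(\partial_x^2+\partial_y^2)-iky(\partial_x+i\partial_y)$, and the Bruinier–Funke operator is $\xi_k f=2iy^k\overline{\partial f/\partial\bar z}$ with $\partial/\partial\bar z=\frac12(\partial_x+i\partial_y)$. Eisenstein series: $E_k(z,s)=\frac12\sum_{(m,n)\ne(0,0)}\frac{y^s}{(mz+n)^k|mz+n|^{2s}}$ (for $\mathrm{Re}(2s+k)>2$, meromorphically continued in $s$); $\widehat E_k(z,s)=\pi^{-(s+k/2)}\Gamma(s+\frac k2+\frac{|k|}2)E_k(z,s)$; $\widehat{\widehat E}_k(z,s)=(s+\frac k2)(s+\frac k2-1)\widehat E_k(z,s)$, entire in $s$, with Taylor expansion at $s=0$ written $\sum_n F_{n,k}(z)s^n$ for $k\le0$ and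 $\sum_nG_{n,k}(z)s^n$ for $k\ge2$. Here $F_n:=F_{n,0}$, $G_n:=G_{n,2}$. *)

(* Defs.v *)
From Stdlib Require Import Reals ZArith ClassicalEpsilon.
From Coquelicot Require Import Coquelicot.

Open Scope R_scope.

Definition Ci : C := (0, 1)%R.

Definition cpowR (a : R) (s : C) : C :=
  Cmult (RtoC (exp (Re s * ln a))) (cos (Im s * ln a), sin (Im s * ln a)).

Definition Czpow (w : C) (k : Z) : C :=
  match k with
  | Z0 => RtoC 1
  | Zpos p => pow_n w (Pos.to_nat p)
  | Zneg p => Cinv (pow_n w (Pos.to_nat p))
  end.

Definition Cgamma (s : C) : C :=
  (RInt_gen (fun t => Re (cpowR t (Cminus s (RtoC 1))) * exp (- t))
            (at_right 0) (Rbar_locally p_infty),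
   RInt_gen (fun t => Im (cpowR t (Cminus s (RtoC 1))) * exp (- t))
            (at_right 0) (Rbar_locally p_infty)).

Definition Eterm (k : Z) (z s : C) (m n : Z) : C :=
  if (Z.eqb m 0 && Z.eqb n 0)%bool then RtoC 0
  else
    let w := Cplus (Cmult (RtoC (IZR m)) z) (RtoC (IZR n)) in
    Cdiv (cpowR (Im z) s)
         (Cmult (Czpow w k) (cpowR (Cmod w ^ 2) s)).

Definition Epartial (k : Z) (z s : C) (N : nat) : C :=
  sum_n (fun i => sum_n (fun j =>
     Eterm k z s (Z.of_nat i - Z.of_nat N) (Z.of_nat j - Z.of_nat N))%Z (2 * N))
  (2 * N).

(** E_k(z,s) = 1/2 sum_{(m,n) <> (0,0)} ...   (meaningful for Re(2s+k) > 2,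
    where the double series converges absolutely) *)
Definition Eis (k : Z) (z s : C) : C :=
  Cmult (RtoC (1 / 2)) (@lim (CompleteNormedModule.CompleteSpace _ C_CompleteNormedModule) (filtermap (Epartial k z s) eventually)).

Definition Ehat (k : Z) (z s : C) : C :=
  Cmult (Cmult (cpowR PI (Copp (Cplus s (RtoC (IZR k / 2)))))
               (Cgamma (Cplus s (RtoC (IZR k / 2 + IZR (Z.abs k) / 2)))))
        (Eis k z s).

Definition EEhat_conv (k : Z) (z s : C) : C :=
  Cmult (Cmult (Cplus s (RtoC (IZR k / 2))) (Cplus s (RtoC (IZR k / 2 - 1))))
        (Ehat k z s).

Definition entire (g : C -> C) : Prop := forall s : C, ex_derive g s.

(** \hat{\hat E}_k(z,.) : the (unique, by the identity theorem) entire function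
    of s agreeing with EEhat_conv on the half plane Re(2s+k) > 2. *)
Definition EEhat (k : Z) (z : C) : C -> C :=
  epsilon (inhabits (fun _ : C => RtoC 0))
    (fun g => entire g /\
       forall s : C, 2 < 2 * Re s + IZR k -> g s = EEhat_conv k z s).

Definition Cderiv (g : C -> C) (s : C) : C :=
  epsilon (inhabits (RtoC 0)) (fun l => is_derive g s l).

Definition taylor_coef (g : C -> C) (n : nat) : C :=
  Cdiv (Nat.iter n Cderiv g (RtoC 0)) (RtoC (INR (fact n))).

Definition Fnk (n : nat) (k : Z) (z : C) : C := taylor_coef (EEhat k z) n.
Definition Gnk (n : nat) (k : Z) (z : C) : C := taylor_coef (EEhat k z) n.
Definition F (n : nat) (z : C) : C := Fnk n 0 z.
Definition G (n : nat) (z : C) : C := Gnk n 2 z.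

Definition RDer (h : R -> C) (t : R) : C :=
  (Derive (fun u => Re (h u)) t, Derive (fun u => Im (h u)) t).
Definition dx (f : C -> C) (z : C) : C := RDer (fun t => f (Re z + t, Im z)) 0.
Definition dy (f : C -> C) (z : C) : C := RDer (fun t => f (Re z, Im z + t)) 0.

Definition Lap (k : Z) (f : C -> C) (z : C) : C :=
  Cminus (Cmult (RtoC (Im z ^ 2)) (Cplus (dx (dx f) z) (dy (dy f) z)))
         (Cmult (Cmult Ci (RtoC (IZR k * Im z)))
                (Cplus (dx f z) (Cmult Ci (dy f z)))).

Definition dzbar (f : C -> C) (z : C) : C :=
  Cmult (RtoC (1 / 2)) (Cplus (dx f z) (Cmult Ci (dy f z))).
Definition xiop (k : Z) (f : C -> C) (z : C) : C :=
  Cmult (Cmult (RtoC 2) Ci) (Cmult (RtoC (powerRZ (Im z) k)) (Cconj (dzbar f z))).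

Definition Ft (n : nat) (z : C) : C :=
  Cmult (RtoC ((-1) ^ n))
    (Cplus (F n z)
       (sum_n_m (fun l => Cmult (RtoC (Binomial.C (n + l) n)) (F (n - l) z)) 1 n)).
Definition Gt (n : nat) (z : C) : C :=
  Cplus (G n z)
    (sum_n_m (fun l => Cmult (RtoC ((-1) ^ l * Binomial.C (n + l) n)) (G (n - l) z)) 1 n).

Definition Ftm1 (n : nat) (z : C) : C :=
  match n with O => RtoC 0 | S m => Ft m z end.
Definition Gtm1 (n : nat) (z : C) : C :=
  match n with O => RtoC 0 | S m => Gt m z end.

(* Main.v *)
(** Write [z = x + i y], [Q_(m,n) = |m z + n|^2 / y] and [theta(t) = sum_(m,n) exp (- pi t Q_(m,n))].
    Poisson summation in one variable gives [theta(1/t) = t theta(t)]; folding the Mellin transform of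
    [theta - 1] onto [(1, oo)] then yields the entire continuation

      1/2 + s (s - 1) int_1^oo (theta - 1) (t^(s-1) + t^(-s)) / 2 dt

    of the completed series of weight [0], and applying [d/dy + i d/dx] termwise gives

      s (s + 1) int_1^oo (d/dy + i d/dx) theta (t^s + t^(-s-1)) / 2 dt

    in weight [2].  An entire function is only assumed to be complex differentiable, so the identity
    theorem needed to recognize these formulas as the continuations goes back to Goursat's bisection
    argument.

    The Taylor coefficients at [s = 0] are therefore integrals of [theta - 1] against explicit weights in
    [ln t], and [xi_0 F_n = (-1)^n G_n] is differentiation under the integral sign.  Since [Delta_0] acts on
    [exp (- pi t Q)] as [d/dt t^2 d/dt], integration by parts gives [Delta_0 F_n = F_(n-2) - F_(n-1)], the
    boundary term being cancelled by the inversion formula.  The binomial combinations solve this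
    recursion by summation by parts, and the identities for [Delta_2] and [xi_2] follow from those for
    [Delta_0] and [xi_0] because the partial derivatives commute. *)

Require Import Defs.
From Stdlib Require Import Reals ZArith Lra Lia Psatz ClassicalEpsilon FunctionalExtensionality List.
From Coquelicot Require Import Coquelicot.
Open Scope R_scope.

(** * Goursat's lemma *)

(** [EEhat] and [Cderiv] are choice operators and [Eis] is an abstract limit, so nothing can be
    computed from them until an explicit entire function, with all its derivatives, is at hand. This
    is why the Mellin integrals carry an index [j]: the j-th derivative in s is an integral of the
    same shape with j powers of [ln t], and the iterated derivatives at 0 are read off. Everything
    to be differentiated in x, y or t is a lattice sum of polynomials times a Gaussian. Such terms
    are kept as syntax, so that derivatives, bounds and commutation are proved once for all lists;
    differentiation under sums and integrals rests on one second-order Taylor estimate, uniform in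
    the summation or integration variable. The Fourier coefficients of a periodized Gaussian are
    found without evaluating a Gaussian integral: they satisfy a linear differential equation in the
    width, their limit for large width removes the dependence on the frequency, and the last
    constant is fixed at the self-dual point. Gamma enters only through its integral, rescaled by pi
    Q. *)

Lemma RInt_near_const (f : R -> R) (a d c M : R) : 0 <= d -> ex_RInt f a (a + d) ->
  (forall x, a <= x <= a + d -> Rabs (f x - c) <= M) ->
  Rabs (RInt f a (a + d) - c * d) <= M * d.
Proof.
  intros Hd Hex Hb.
  assert (E : RInt (fun x => f x - c) a (a + d) = RInt f a (a + d) - c * d).
  { rewrite (RInt_minus (V := R_CompleteNormedModule) f (fun _ => c)); auto.
    - rewrite RInt_const. unfold minus, plus, opp, scal; simpl. unfold mult; simpl. ring.
    - apply ex_RInt_const. }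
  rewrite <- E.
  replace (M * d) with ((a + d - a) * M) by ring.
  apply abs_RInt_le_const; try lra; auto.
  apply (ex_RInt_minus (V := R_NormedModule) f (fun _ => c)); auto.
  apply ex_RInt_const.
Qed.

(** Separate continuity: all that integrals along horizontal and vertical sides require. *)
Definition cont_xy (U : R -> R -> R) :=
  (forall x y, continuous (fun u => U u y) x) /\ (forall x y, continuous (fun v => U x v) y).

(** The integral of U dx + V dy, counterclockwise around the rectangle with lower left corner (a, b)
    and sides d, e. *)
Definition rect_int (U V : R -> R -> R) (a b d e : R) : R :=
  RInt (fun x => U x b - U x (b + e)) a (a + d)
  + RInt (fun y => V (a + d) y - V a y) b (b + e).

Lemma cont_ex_RInt (f : R -> R) a b : (forall x, continuous f x) -> ex_RInt f a b.
Proof. intros H. apply (ex_RInt_continuous (V := R_CompleteNormedModule)). auto. Qed.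

Lemma cont_minus (f g : R -> R) x : continuous f x -> continuous g x ->
  continuous (fun x => f x - g x) x.
Proof. intros. apply (continuous_minus (V := R_NormedModule) f g); auto. Qed.

Lemma RInt_minus' (f g : R -> R) a b : ex_RInt f a b -> ex_RInt g a b ->
  RInt (fun x => f x - g x) a b = RInt f a b - RInt g a b.
Proof. intros; apply (RInt_minus (V := R_CompleteNormedModule) f g); auto. Qed.

Lemma RInt_plus' (f g : R -> R) a b : ex_RInt f a b -> ex_RInt g a b ->
  RInt (fun x => f x + g x) a b = RInt f a b + RInt g a b.
Proof. intros; apply (RInt_plus (V := R_CompleteNormedModule) f g); auto. Qed.

Lemma RInt_Chasles' (f : R -> R) a b c : (forall x, continuous f x) ->
  RInt f a b + RInt f b c = RInt f a c.
Proof.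
  intros; apply (RInt_Chasles (V := R_CompleteNormedModule) f); apply cont_ex_RInt; auto.
Qed.

Section Goursat.
Variables U V : R -> R -> R.
Hypothesis HU : cont_xy U.
Hypothesis HV : cont_xy V.

Let cU y x : continuous (fun u => U u y) x := proj1 HU x y.
Let cV x y : continuous (fun v => V x v) y := proj2 HV x y.

Lemma rect_int_split (a b d e : R) : rect_int U V a b (d + d) (e + e) =
  rect_int U V a b d e + rect_int U V (a + d) b d e
  + rect_int U V a (b + e) d e + rect_int U V (a + d) (b + e) d e.
Proof.
  unfold rect_int.
  rewrite !RInt_minus'; try (apply cont_ex_RInt; intros; auto).
  replace (b + (e + e)) with (b + e + e) by ring.
  replace (a + (d + d)) with (a + d + d) by ring.
  assert (HX : forall y, RInt (fun x => U x y) a (a + d + d) =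
     RInt (fun x => U x y) a (a + d) + RInt (fun x => U x y) (a + d) (a + d + d))
    by (intros y; symmetry; apply RInt_Chasles'; auto).
  assert (HY : forall x, RInt (V x) b (b + e + e) =
     RInt (V x) b (b + e) + RInt (V x) (b + e) (b + e + e))
    by (intros y; symmetry; apply RInt_Chasles'; auto).
  rewrite !HX, !HY. ring.
Qed.

(** The affine parts of U and V at (x0, y0) contribute - q e d + q d e = 0, because the y-derivative
    of U is the x-derivative of V. What remains is of size eps (d + e) on sides of total length d +
    e. *)
Lemma rect_int_small (x0 y0 p q r : R) :
  differentiable_pt_lim U x0 y0 p q -> differentiable_pt_lim V x0 y0 q r ->
  forall eps, 0 < eps -> exists delta, 0 < delta /\ forall a b d e,
    0 <= d -> 0 <= e -> d + e < delta -> a <= x0 <= a + d -> b <= y0 <= b + e ->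
    Rabs (rect_int U V a b d e) <= eps * (d + e) ^ 2.
Proof.
  intros DU DV eps Heps.
  destruct (DU (mkposreal (eps / 2) ltac:(lra))) as [d1 H1].
  destruct (DV (mkposreal (eps / 2) ltac:(lra))) as [d2 H2].
  simpl in H1, H2.
  exists (Rmin d1 d2). split. { apply Rmin_pos; apply cond_pos. }
  intros a b d e Hd He Hs Hx Hy.
  assert (Hs1 : d + e < d1) by (eapply Rlt_le_trans; [exact Hs|apply Rmin_l]).
  assert (Hs2 : d + e < d2) by (eapply Rlt_le_trans; [exact Hs|apply Rmin_r]).
  assert (B1 : forall x y, a <= x <= a + d -> b <= y <= b + e ->
     Rabs (U x y - U x0 y0 - (p * (x - x0) + q * (y - y0))) <= eps / 2 * (d + e)).
  { intros x y Kx Ky. eapply Rle_trans. apply H1; apply Rabs_def1; lra.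
    apply Rmult_le_compat_l; try lra. apply Rmax_lub; apply Rabs_le; lra. }
  assert (B2 : forall x y, a <= x <= a + d -> b <= y <= b + e ->
     Rabs (V x y - V x0 y0 - (q * (x - x0) + r * (y - y0))) <= eps / 2 * (d + e)).
  { intros x y Kx Ky. eapply Rle_trans. apply H2; apply Rabs_def1; lra.
    apply Rmult_le_compat_l; try lra. apply Rmax_lub; apply Rabs_le; lra. }
  assert (C1 : Rabs (RInt (fun x => U x b - U x (b + e)) a (a + d) - (- q * e) * d) <= (eps * (d + e)) * d).
  { apply RInt_near_const; auto.
    - apply cont_ex_RInt. intros; apply cont_minus; auto.
    - intros x Kx. pose proof (B1 x b Kx ltac:(lra)) as K1. pose proof (B1 x (b + e) Kx ltac:(lra)) as K2.
      apply Rabs_le_between in K1. apply Rabs_le_between in K2. apply Rabs_le. lra. }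
  assert (C2 : Rabs (RInt (fun y => V (a + d) y - V a y) b (b + e) - (q * d) * e) <= (eps * (d + e)) * e).
  { apply RInt_near_const; auto.
    - apply cont_ex_RInt. intros; apply cont_minus; auto.
    - intros y Ky. pose proof (B2 (a + d) y ltac:(lra) Ky) as K1. pose proof (B2 a y ltac:(lra) Ky) as K2.
      apply Rabs_le_between in K1. apply Rabs_le_between in K2. apply Rabs_le. lra. }
  unfold rect_int. apply Rabs_le_between in C1. apply Rabs_le_between in C2.
  apply Rabs_le. nra.
Qed.

Variables (a0 b0 d0 e0 : R).
Hypothesis Hd0 : 0 < d0.
Hypothesis He0 : 0 < e0.

Let rect (n : nat) (ab : R * R) : R :=
  rect_int U V (fst ab) (snd ab) (d0 / 2 ^ n) (e0 / 2 ^ n).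

(** Pigeonhole on the four quarters: inner sides cancel in [rect_int_split], so one quarter carries
    at least a fourth of the integral. *)
Lemma quarter_large n ab :
  exists ab', (fst ab <= fst ab' /\ fst ab' + d0 / 2 ^ S n <= fst ab + d0 / 2 ^ n /\
               snd ab <= snd ab' /\ snd ab' + e0 / 2 ^ S n <= snd ab + e0 / 2 ^ n) /\
              Rabs (rect n ab) <= 4 * Rabs (rect (S n) ab').
Proof.
  destruct ab as [a b]. unfold rect; simpl fst; simpl snd.
  pose proof (pow_lt 2 n ltac:(lra)) as P2.
  set (d := d0 / 2 ^ S n). set (e := e0 / 2 ^ S n).
  assert (Ed : d0 / 2 ^ n = d + d) by (unfold d; simpl; field; lra).
  assert (Ee : e0 / 2 ^ n = e + e) by (unfold e; simpl; field; lra).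
  assert (0 < d) by (unfold d; simpl; apply Rdiv_lt_0_compat; lra).
  assert (0 < e) by (unfold e; simpl; apply Rdiv_lt_0_compat; lra).
  rewrite Ed, Ee, rect_int_split.
  set (w1 := rect_int U V a b d e). set (w2 := rect_int U V (a + d) b d e).
  set (w3 := rect_int U V a (b + e) d e). set (w4 := rect_int U V (a + d) (b + e) d e).
  assert (T : Rabs (w1 + w2 + w3 + w4) <= Rabs w1 + Rabs w2 + Rabs w3 + Rabs w4).
  { repeat (eapply Rle_trans; [apply Rabs_triang|]; apply Rplus_le_compat_r); lra. }
  assert (Q : Rabs (w1 + w2 + w3 + w4) <= 4 * Rabs w1 \/ Rabs (w1 + w2 + w3 + w4) <= 4 * Rabs w2 \/
    Rabs (w1 + w2 + w3 + w4) <= 4 * Rabs w3 \/ Rabs (w1 + w2 + w3 + w4) <= 4 * Rabs w4).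
  { destruct (Rle_dec (Rabs (w1 + w2 + w3 + w4)) (4 * Rabs w1)); auto.
    destruct (Rle_dec (Rabs (w1 + w2 + w3 + w4)) (4 * Rabs w2)); auto.
    destruct (Rle_dec (Rabs (w1 + w2 + w3 + w4)) (4 * Rabs w3)); auto.
    right; right; right. lra. }
  destruct Q as [Q|[Q|[Q|Q]]];
    [exists (a, b)|exists (a + d, b)|exists (a, b + e)|exists (a + d, b + e)];
    simpl; (split; [lra|exact Q]).
Qed.

Fixpoint corner (n : nat) : R * R :=
  match n with
  | O => (a0, b0)
  | S m => proj1_sig (constructive_indefinite_description _ (quarter_large m (corner m)))
  end.

Lemma corner_step n :
  fst (corner n) <= fst (corner (S n)) /\
  fst (corner (S n)) + d0 / 2 ^ S n <= fst (corner n) + d0 / 2 ^ n /\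
  snd (corner n) <= snd (corner (S n)) /\
  snd (corner (S n)) + e0 / 2 ^ S n <= snd (corner n) + e0 / 2 ^ n.
Proof.
  simpl. destruct (constructive_indefinite_description _ _) as [ab' [H1 H2]].
  exact H1.
Qed.

Lemma corner_large n : Rabs (rect 0 (a0, b0)) <= 4 ^ n * Rabs (rect n (corner n)).
Proof.
  induction n as [|n IH].
  - simpl pow. rewrite Rmult_1_l. simpl corner. lra.
  - eapply Rle_trans. exact IH.
    replace (4 ^ S n) with (4 ^ n * 4) by (simpl; ring). rewrite Rmult_assoc.
    apply Rmult_le_compat_l. apply pow_le; lra.
    simpl corner. destruct (constructive_indefinite_description _ _) as [ab' [H1 H2]].
    exact H2.
Qed.

(** The supremum of the left endpoints lies below every right endpoint. *)
Lemma nested_point (u : nat -> R) (d : R) : 0 < d ->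
  (forall n, u n <= u (S n) /\ u (S n) + d / 2 ^ S n <= u n + d / 2 ^ n) ->
  exists l, forall n, u n <= l <= u n + d / 2 ^ n.
Proof.
  intros Hd H.
  assert (M : forall n p, u n <= u (n + p)%nat /\ u (n + p)%nat + d / 2 ^ (n + p) <= u n + d / 2 ^ n).
  { intros n p. induction p as [|p IH]. rewrite Nat.add_0_r; lra.
    rewrite Nat.add_succ_r. specialize (H (n + p)%nat). lra. }
  assert (P : forall n, 0 < d / 2 ^ n) by (intros; apply Rdiv_lt_0_compat; auto; apply pow_lt; lra).
  destruct (completeness (fun r => exists n, r = u n)) as [l [L1 L2]].
  - exists (u O + d). intros r [n ->]. pose proof (M O n) as K. simpl in K.
    specialize (P n). lra.
  - exists (u O). now exists O.
  - exists l. intros n. split. apply L1. now exists n.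
    apply L2. intros r [m ->].
    destruct (Nat.le_ge_cases n m) as [K|K].
    + replace m with (n + (m - n))%nat by lia.
      pose proof (M n (m - n)%nat). pose proof (P (n + (m - n))%nat). lra.
    + pose proof (M m (n - m)%nat) as Q. replace (m + (n - m))%nat with n in Q by lia.
      pose proof (P n). lra.
Qed.

(** At depth n the integral has shrunk by at most 4^n, while near the common point it is o(4^-n).
    Only pointwise differentiability enters; the equality of the cross derivatives is expressed by
    the shared [q]. *)
Theorem goursat :
  (forall x y, exists p q r, differentiable_pt_lim U x y p q /\ differentiable_pt_lim V x y q r) ->
  rect_int U V a0 b0 d0 e0 = 0.
Proof.
  intros HD.
  destruct (nested_point (fun n => fst (corner n)) d0 Hd0) as [x0 Hx].
  { intros n. pose proof (corner_step n). tauto. }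
  destruct (nested_point (fun n => snd (corner n)) e0 He0) as [y0 Hy].
  { intros n. pose proof (corner_step n). tauto. }
  destruct (HD x0 y0) as (p & q & r & DU & DV).
  assert (Z : Rabs (rect_int U V a0 b0 d0 e0) <= 0).
  2:{ destruct (Req_dec (rect_int U V a0 b0 d0 e0) 0); auto.
      pose proof (Rabs_pos_lt _ H). lra. }
  apply le_epsilon. intros eps Heps. rewrite Rplus_0_l.
  assert (Hs : 0 < (d0 + e0) ^ 2) by (apply pow_lt; lra).
  (* The factor 4^n is compensated by the square of (d0 + e0) / 2^n, which leaves exactly [eps]. *)
  destruct (rect_int_small x0 y0 p q r DU DV (eps / (d0 + e0) ^ 2)) as (delta & Hdelta & K).
  { apply Rdiv_lt_0_compat; lra. }
  destruct (pow_lt_1_zero (1 / 2) ltac:(rewrite Rabs_pos_eq; lra) (delta / (d0 + e0))) as [n Hn].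
  { apply Rdiv_lt_0_compat; lra. }
  specialize (Hn n (Nat.le_refl n)).
  pose proof (pow_lt 2 n ltac:(lra)) as P2.
  assert (E2 : (1 / 2) ^ n = / 2 ^ n) by (unfold Rdiv; rewrite Rmult_1_l; apply pow_inv).
  rewrite E2, Rabs_pos_eq in Hn by (left; apply Rinv_0_lt_compat; lra).
  pose proof (corner_large n) as L. unfold rect in L; simpl fst in L; simpl snd in L.
  replace (d0 / 2 ^ 0) with d0 in L by (simpl; field).
  replace (e0 / 2 ^ 0) with e0 in L by (simpl; field).
  eapply Rle_trans. exact L.
  specialize (K (fst (corner n)) (snd (corner n)) (d0 / 2 ^ n) (e0 / 2 ^ n)).
  assert (E : d0 / 2 ^ n + e0 / 2 ^ n = (d0 + e0) * / 2 ^ n) by (field; lra).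
  assert (K' : Rabs (rect_int U V (fst (corner n)) (snd (corner n)) (d0 / 2 ^ n) (e0 / 2 ^ n))
             <= eps / (d0 + e0) ^ 2 * (d0 / 2 ^ n + e0 / 2 ^ n) ^ 2).
  { apply K; auto.
    - left; apply Rdiv_lt_0_compat; lra.
    - left; apply Rdiv_lt_0_compat; lra.
    - rewrite E. apply Rmult_lt_reg_l with (/ (d0 + e0)). apply Rinv_0_lt_compat; lra.
      rewrite <- Rmult_assoc, Rinv_l, Rmult_1_l by lra. rewrite Rmult_comm. exact Hn. }
  eapply Rle_trans. apply Rmult_le_compat_l. apply pow_le; lra. exact K'.
  rewrite E. right.
  replace (4 ^ n) with (2 ^ n * 2 ^ n) by (rewrite <- Rpow_mult_distr; f_equal; ring).
  field. lra.
Qed.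
End Goursat.

(** * Identity theorem for entire functions *)

(** Complex differentiability written with [Cmod], the form in which all estimates below are made;
    the two lemmas that follow connect it with [is_derive]. *)
Definition cdiff (f : C -> C) (s l : C) : Prop :=
  forall eps, 0 < eps -> exists d, 0 < d /\ forall u : C, Cmod (u - s) < d ->
    Cmod (f u - f s - (u - s) * l) <= eps * Cmod (u - s).

Lemma cdiff_is_derive (f : C -> C) (s l : C) :
  cdiff f s l <-> @is_derive C_AbsRing C_NormedModule f s l.
Proof.
  split.
  - intros H. split. apply (is_linear_scal_l (K := C_AbsRing) (V := C_NormedModule) l).
    intros x Hx.
    apply (is_filter_lim_locally_unique (V := AbsRing_NormedModule C_AbsRing) s x) in Hx. subst x.
    intros eps. destruct (H eps (cond_pos eps)) as (d & Hd & K).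
    exists (mkposreal d Hd). intros u Hu. apply K. exact Hu.
  - intros [_ H] eps Heps. specialize (H s (fun P HP => HP) (mkposreal eps Heps)).
    destruct H as [d K]. exists d. split. apply cond_pos.
    intros u Hu. apply (K u). exact Hu.
Qed.

(** [C] is a normed module over itself in two ways that are distinct as structures. The identity and
    product rules live in this one, [entire] in the previous one. *)
Lemma cdiff_is_derive' (f : C -> C) (s l : C) :
  cdiff f s l <-> @is_derive C_AbsRing (AbsRing_NormedModule C_AbsRing) f s l.
Proof.
  split.
  - intros H. split. apply (is_linear_scal_l (K := C_AbsRing) (V := AbsRing_NormedModule C_AbsRing) l).
    intros x Hx.
    apply (is_filter_lim_locally_unique (V := AbsRing_NormedModule C_AbsRing) s x) in Hx. subst x.
    intros eps. destruct (H eps (cond_pos eps)) as (d & Hd & K).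
    exists (mkposreal d Hd). intros u Hu. apply K. exact Hu.
  - intros [_ H] eps Heps. specialize (H s (fun P HP => HP) (mkposreal eps Heps)).
    destruct H as [d K]. exists d. split. apply cond_pos.
    intros u Hu. apply (K u). exact Hu.
Qed.

Lemma cdiff_unique f s l l' : cdiff f s l -> cdiff f s l' -> l = l'.
Proof.
  intros H H'.
  assert (Z : Cmod (l - l') <= 0).
  { apply le_epsilon. intros eps Heps. rewrite ?(Rplus_0_l eps).
    destruct (H (eps / 2) ltac:(lra)) as (d & Hd & K).
    destruct (H' (eps / 2) ltac:(lra)) as (d' & Hd' & K').
    set (r := Rmin d d' / 2).
    assert (Hr : 0 < r) by (unfold r; pose proof (Rmin_pos d d' Hd Hd'); lra).
    assert (Er : Cmod (s + RtoC r - s) = r).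
    { replace (s + RtoC r - s)%C with (RtoC r) by ring. rewrite Cmod_R. apply Rabs_pos_eq; lra. }
    specialize (K (s + RtoC r)%C). specialize (K' (s + RtoC r)%C). rewrite Er in K, K'.
    assert (r < d) by (unfold r; pose proof (Rmin_l d d'); unfold r in Hr; lra).
    assert (r < d') by (unfold r; pose proof (Rmin_r d d'); unfold r in Hr; lra).
    specialize (K H0). specialize (K' H1).
    replace (s + RtoC r - s)%C with (RtoC r) in K, K' by ring.
    assert (E : Cmod (RtoC r * (l - l')) <= eps * r).
    { replace (RtoC r * (l - l'))%C with
        ((f (s + RtoC r) - f s - RtoC r * l') + - (f (s + RtoC r) - f s - RtoC r * l))%C by ring.
      eapply Rle_trans. apply Cmod_triangle. rewrite Cmod_opp. lra. }
    rewrite Cmod_mult, Cmod_R, Rabs_pos_eq in E by lra. nra. }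
  assert (Z' : Cmod (l - l') = 0) by (pose proof (Cmod_ge_0 (l - l')); lra).
  apply Cmod_eq_0 in Z'.
  replace l with ((l - l') + l')%C by ring. rewrite Z'. ring.
Qed.

Lemma cdiff_ext f g s l : (forall u, f u = g u) -> cdiff f s l -> cdiff g s l.
Proof.
  intros E H eps Heps. destruct (H eps Heps) as (d & Hd & K). exists d; split; auto.
  intros u Hu. rewrite <- !E. auto.
Qed.

Lemma cdiff_const c s : cdiff (fun _ => c) s 0%C.
Proof. apply cdiff_is_derive. apply (is_derive_const (K := C_AbsRing) (V := C_NormedModule)). Qed.

Lemma cdiff_id s : cdiff (fun u => u) s 1%C.
Proof. apply cdiff_is_derive'. apply (is_derive_id (K := C_AbsRing)). Qed.

Lemma cdiff_plus f g s a b : cdiff f s a -> cdiff g s b ->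
  cdiff (fun u => (f u + g u)%C) s (a + b)%C.
Proof.
  rewrite !cdiff_is_derive. apply (is_derive_plus (K := C_AbsRing) (V := C_NormedModule)).
Qed.

Lemma cdiff_mult f g s a b : cdiff f s a -> cdiff g s b ->
  cdiff (fun u => (f u * g u)%C) s (a * g s + f s * b)%C.
Proof.
  rewrite !cdiff_is_derive'. intros. apply (is_derive_mult (K := C_AbsRing)); auto.
  intros; apply Cmult_comm.
Qed.

Lemma cdiff_scal c f s a : cdiff f s a -> cdiff (fun u => (c * f u)%C) s (c * a)%C.
Proof.
  intros H. replace (c * a)%C with (0 * f s + c * a)%C by ring.
  apply (cdiff_mult (fun _ => c)); auto. apply cdiff_const.
Qed.

Lemma cdiff_comp f g s a b : cdiff f (g s) a -> cdiff g s b ->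
  cdiff (fun u => f (g u)) s (b * a)%C.
Proof.
  intros Hf Hg. apply cdiff_is_derive. apply cdiff_is_derive in Hf. apply cdiff_is_derive' in Hg.
  apply (is_derive_comp (K := C_AbsRing) (V := C_NormedModule)); auto.
Qed.

Lemma MVT_between (f f1 : R -> R) (x h : R) :
  (forall u, Rmin x (x + h) <= u <= Rmax x (x + h) -> is_derive f u (f1 u)) ->
  exists c, Rmin x (x + h) <= c <= Rmax x (x + h) /\ f (x + h) - f x = f1 c * h.
Proof.
  intros H. destruct (MVT_gen f x (x + h) f1) as (c & Hc & E).
  - intros u Hu. apply H. lra.
  - intros u Hu. apply continuity_pt_filterlim.
    apply (ex_derive_continuous (V := R_NormedModule) f). exists (f1 u). auto.
  - exists c. split; auto. rewrite E. ring.
Qed.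

(** The mean value theorem twice, the second time on the segment from x to the intermediate point.
    The factor 1/2 is given away; every second-order remainder below comes from here. *)
Lemma taylor2_bound (f f1 f2 : R -> R) (x h M : R) :
  (forall u, Rmin x (x + h) <= u <= Rmax x (x + h) -> is_derive f u (f1 u)) ->
  (forall u, Rmin x (x + h) <= u <= Rmax x (x + h) -> is_derive f1 u (f2 u)) ->
  (forall u, Rmin x (x + h) <= u <= Rmax x (x + h) -> Rabs (f2 u) <= M) ->
  Rabs (f (x + h) - f x - h * f1 x) <= h ^ 2 * M.
Proof.
  intros H1 H2 HM.
  destruct (MVT_between f f1 x h H1) as (c & Hc & E).
  assert (Q : Rmin x (x + (c - x)) >= Rmin x (x + h) /\ Rmax x (x + (c - x)) <= Rmax x (x + h)).
  { replace (x + (c - x)) with c by ring. split.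
    - apply Rle_ge. apply Rmin_glb. apply Rmin_l. tauto.
    - apply Rmax_lub. apply Rmax_l. tauto. }
  destruct (MVT_between f1 f2 x (c - x)) as (c' & Hc' & E').
  { intros u Hu. apply H2. lra. }
  replace (x + (c - x)) with c in E' by ring.
  replace (f (x + h) - f x - h * f1 x) with (h * (f2 c' * (c - x))).
  2:{ rewrite E, <- E'. ring. }
  rewrite !Rabs_mult.
  assert (Rabs (c - x) <= Rabs h).
  { apply Rabs_le. unfold Rmin, Rmax in Hc. destruct (Rle_dec x (x + h)).
    rewrite Rabs_pos_eq by lra. lra. rewrite Rabs_left by lra. lra. }
  assert (Rabs (f2 c') <= M) by (apply HM; lra).
  replace (h ^ 2 * M) with (Rabs h * (M * Rabs h)).
  2:{ rewrite <- (pow2_abs h). ring. }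
  apply Rmult_le_compat_l. apply Rabs_pos.
  apply Rmult_le_compat; auto; apply Rabs_pos.
Qed.

Lemma exp_le x y : x <= y -> exp x <= exp y.
Proof. intros [H| ->]. left; now apply exp_increasing. lra. Qed.

(** * The complex exponential *)

Definition Cexp (u : C) : C := (exp (Re u) * cos (Im u), exp (Re u) * sin (Im u)).

Lemma Cexp_plus u v : Cexp (u + v) = (Cexp u * Cexp v)%C.
Proof.
  destruct u as [a b], v as [c d]. unfold Cexp, Cmult, Cplus; simpl.
  rewrite exp_plus, cos_plus, sin_plus. f_equal; ring.
Qed.

Lemma Cexp_0 : Cexp 0 = 1%C.
Proof. unfold Cexp; simpl. rewrite exp_0, cos_0, sin_0. apply injective_projections; simpl; ring. Qed.

Lemma Cmod_Cexp u : Cmod (Cexp u) = exp (Re u).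
Proof.
  unfold Cmod, Cexp; simpl fst; simpl snd.
  replace ((exp (Re u) * cos (Im u)) ^ 2 + (exp (Re u) * sin (Im u)) ^ 2)
    with (exp (Re u) ^ 2 * (Rsqr (sin (Im u)) + Rsqr (cos (Im u)))) by (unfold Rsqr; ring).
  rewrite sin2_cos2, Rmult_1_r. apply sqrt_pow2. left; apply exp_pos.
Qed.

Lemma Re_le_Cmod u : Rabs (Re u) <= Cmod u.
Proof. eapply Rle_trans; [|apply Rmax_Cmod]. apply Rmax_l. Qed.
Lemma Im_le_Cmod u : Rabs (Im u) <= Cmod u.
Proof. eapply Rle_trans; [|apply Rmax_Cmod]. apply Rmax_r. Qed.

Lemma Cmod_le_sum u : Cmod u <= Rabs (Re u) + Rabs (Im u).
Proof.
  destruct u as [a b]. unfold Cmod; simpl.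
  pose proof (Rabs_pos a). pose proof (Rabs_pos b).
  rewrite <- (sqrt_pow2 (Rabs a + Rabs b)) by lra.
  apply sqrt_le_1_alt.
  replace (a * (a * 1)) with (Rabs a ^ 2) by (rewrite pow2_abs; ring).
  replace (b * (b * 1)) with (Rabs b ^ 2) by (rewrite pow2_abs; ring). nra.
Qed.

(** Second-order expansion of r -> exp (r u) on [0, 1], separately for the real and the imaginary
    part; each costs half of the constant 6. *)
Lemma Cexp_remainder u : Cmod (Cexp u - 1 - u) <= 6 * Cmod u ^ 2 * exp (Cmod u).
Proof.
  destruct u as [a b].
  pose proof (Re_le_Cmod (a, b)) as Ba. pose proof (Im_le_Cmod (a, b)) as Bb.
  simpl in Ba, Bb. set (m := Cmod (a, b)) in *.
  (* The second derivatives combine a^2 - b^2, bounded by m^2, and 2 a b, bounded by 2 m^2. *)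
  set (K := 3 * m ^ 2 * exp m).
  assert (BB : forall r s c : R, 0 <= r <= 1 -> Rabs s <= 1 -> Rabs c <= 1 ->
    Rabs ((a * a - b * b) * exp (r * a) * c + 2 * a * b * exp (r * a) * s) <= K).
  { intros r s c Hr Hs Hc.
    assert (E1 : exp (r * a) <= exp m).
    { apply exp_le. apply Rle_trans with (r * m).
      - apply Rmult_le_compat_l; try lra. pose proof (Rle_abs a). lra.
      - pose proof (Cmod_ge_0 (a, b)) as Hm0. fold m in Hm0. nra. }
    assert (E2 : Rabs (a * a - b * b) <= m ^ 2).
    { pose proof (Rabs_pos a). pose proof (Rabs_pos b).
      assert (a * a = Rabs a * Rabs a) by (rewrite <- Rabs_mult; symmetry; apply Rabs_pos_eq; nra).
      assert (b * b = Rabs b * Rabs b) by (rewrite <- Rabs_mult; symmetry; apply Rabs_pos_eq; nra).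
      apply Rabs_le. nra. }
    assert (E3 : Rabs (2 * a * b) <= 2 * m ^ 2).
    { rewrite !Rabs_mult, (Rabs_pos_eq 2) by lra. pose proof (Rabs_pos a). pose proof (Rabs_pos b).
      assert (Rabs a * Rabs b <= m * m) by (apply Rmult_le_compat; lra). nra. }
    eapply Rle_trans. apply Rabs_triang. rewrite !(Rabs_mult (_ * exp _)).
    rewrite (Rabs_mult (a * a - b * b)), (Rabs_mult (2 * a * b) (exp _)).
    rewrite (Rabs_pos_eq (exp (r * a))) by (left; apply exp_pos).
    pose proof (exp_pos (r * a)). pose proof (Rabs_pos (a * a - b * b)).
    pose proof (Rabs_pos (2 * a * b)).
    assert (Rabs (a * a - b * b) * exp (r * a) * Rabs c <= m ^ 2 * exp m * 1).
    { apply Rmult_le_compat; try apply Rmult_le_compat; auto; try lra; try apply Rabs_pos.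
      apply Rmult_le_pos; lra. }
    assert (Rabs (2 * a * b) * exp (r * a) * Rabs s <= 2 * m ^ 2 * exp m * 1).
    { apply Rmult_le_compat; try apply Rmult_le_compat; auto; try lra; try apply Rabs_pos.
      apply Rmult_le_pos; lra. }
    unfold K. lra. }
  assert (RR : Rabs (exp a * cos b - 1 - a) <= K).
  { pose proof (taylor2_bound (fun r => exp (r * a) * cos (r * b))
      (fun r => exp (r * a) * (a * cos (r * b) - b * sin (r * b)))
      (fun r => (a * a - b * b) * exp (r * a) * cos (r * b) + 2 * a * b * exp (r * a) * - sin (r * b))
      0 1 K) as T.
    rewrite Rplus_0_l, !Rmult_0_l, !Rmult_1_l, exp_0, cos_0, sin_0 in T.
    rewrite Rmin_left, Rmax_right in T by lra.
    replace (exp a * cos b - 1 - a) with (exp a * cos b - 1 * 1 - 1 * (a * 1 - b * 0)) by ring.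
    replace K with (1 ^ 2 * K) by ring. apply T.
    - intros u _. auto_derive; auto. ring.
    - intros u _. auto_derive; auto. ring.
    - intros u Hu. apply BB; auto. rewrite Rabs_Ropp. apply Rabs_le. apply SIN_bound.
      apply Rabs_le. apply COS_bound. }
  assert (II : Rabs (exp a * sin b - b) <= K).
  { pose proof (taylor2_bound (fun r => exp (r * a) * sin (r * b))
      (fun r => exp (r * a) * (a * sin (r * b) + b * cos (r * b)))
      (fun r => (a * a - b * b) * exp (r * a) * sin (r * b) + 2 * a * b * exp (r * a) * cos (r * b))
      0 1 K) as T.
    rewrite Rplus_0_l, !Rmult_0_l, !Rmult_1_l, exp_0, cos_0, sin_0 in T.
    rewrite Rmin_left, Rmax_right in T by lra.
    replace (exp a * sin b - b) with (exp a * sin b - 1 * 0 - 1 * (a * 0 + b * 1)) by ring.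
    replace K with (1 ^ 2 * K) by ring. apply T.
    - intros u _. auto_derive; auto. ring.
    - intros u _. auto_derive; auto. ring.
    - intros u Hu. apply BB; auto. apply Rabs_le. apply COS_bound.
      apply Rabs_le. apply SIN_bound. }
  eapply Rle_trans. apply Cmod_le_sum. unfold Cexp; simpl.
  replace (exp a * cos b + - (1) + - a) with (exp a * cos b - 1 - a) by ring.
  replace (exp a * sin b + - 0 + - b) with (exp a * sin b - b) by ring.
  replace (6 * (m * (m * 1)) * exp m) with (K + K) by (unfold K; ring). lra.
Qed.

Lemma cdiff_Cexp s : cdiff Cexp s (Cexp s).
Proof.
  intros eps Heps.
  set (B := 6 * exp 1 * exp (Re s)).
  assert (HB : 0 < B) by (unfold B; repeat apply Rmult_lt_0_compat; try apply exp_pos; lra).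
  exists (Rmin 1 (eps / B)). split.
  { apply Rmin_pos. lra. apply Rdiv_lt_0_compat; auto. }
  intros u Hu. set (h := (u - s)%C) in *.
  assert (H1 : Cmod h < 1) by (eapply Rlt_le_trans; [exact Hu|apply Rmin_l]).
  assert (H2 : Cmod h < eps / B) by (eapply Rlt_le_trans; [exact Hu|apply Rmin_r]).
  replace u with (s + h)%C by (unfold h; ring).
  rewrite Cexp_plus.
  replace (Cexp s * Cexp h - Cexp s - h * Cexp s)%C with (Cexp s * (Cexp h - 1 - h))%C by ring.
  rewrite Cmod_mult, Cmod_Cexp.
  pose proof (Cexp_remainder h) as K. pose proof (Cmod_ge_0 h) as H0. pose proof (exp_pos (Re s)).
  assert (exp (Cmod h) <= exp 1) by (apply exp_le; lra).
  pose proof (exp_pos (Cmod h)).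
  apply Rle_trans with (exp (Re s) * (6 * Cmod h ^ 2 * exp 1)).
  { apply Rmult_le_compat_l. lra. eapply Rle_trans. exact K.
    apply Rmult_le_compat_l. nra. lra. }
  replace (exp (Re s) * (6 * Cmod h ^ 2 * exp 1)) with (B * Cmod h * Cmod h) by (unfold B; ring).
  apply Rmult_le_compat_r; auto.
  apply Rmult_lt_compat_l with (r := B) in H2; auto.
  replace (B * (eps / B)) with eps in H2 by (field; lra). lra.
Qed.

(** * Cauchy-Riemann equations and means over circles *)

Definition centire (f : C -> C) := forall s, exists l, cdiff f s l.

Lemma centire_entire f : centire f <-> entire f.
Proof.
  split; intros H s; destruct (H s) as [l Hl]; exists l; now apply cdiff_is_derive.
Qed.

(** Cauchy-Riemann: the real part of multiplication by [l] is the linear form with coefficients Re l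
    and - Im l. The factor 1/2 on [eps] pays for comparing [Cmod] with the maximum norm. *)
Lemma cdiff_Re (f : C -> C) x y l : cdiff f (x, y) l ->
  differentiable_pt_lim (fun x y => Re (f (x, y))) x y (Re l) (- Im l).
Proof.
  intros H eps. destruct (H (eps / 2)) as (d & Hd & K). { pose proof (cond_pos eps); lra. }
  exists (mkposreal (d / 2) ltac:(lra)). simpl. intros u v Hu Hv.
  assert (B : Cmod ((u, v) - (x, y))%C <= 2 * Rmax (Rabs (u - x)) (Rabs (v - y))).
  { eapply Rle_trans. apply Cmod_le_sum. simpl.
    pose proof (Rmax_l (Rabs (u - x)) (Rabs (v - y))). pose proof (Rmax_r (Rabs (u - x)) (Rabs (v - y))).
    unfold Rminus in *. lra. }
  assert (B2 : Cmod ((u, v) - (x, y))%C < d).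
  { eapply Rle_lt_trans. exact B. assert (Rmax (Rabs (u - x)) (Rabs (v - y)) < d / 2) by (apply Rmax_lub_lt; auto). lra. }
  specialize (K _ B2).
  eapply Rle_trans. 2:{ eapply Rle_trans. exact K. apply Rle_trans with (eps / 2 * (2 * Rmax (Rabs (u - x)) (Rabs (v - y)))).
    apply Rmult_le_compat_l; auto. pose proof (cond_pos eps); lra. right; field. }
  eapply Rle_trans; [|apply Re_le_Cmod]. right. f_equal.
  destruct l as [l1 l2]; unfold Re, Im, Cminus, Cplus, Cmult, Copp; simpl. ring.
Qed.

(** Im f is the real part of - i f. *)
Lemma cdiff_Im (f : C -> C) x y l : cdiff f (x, y) l ->
  differentiable_pt_lim (fun x y => Im (f (x, y))) x y (Im l) (Re l).
Proof.
  intros H.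
  apply (cdiff_scal (- Ci)) in H. apply cdiff_Re in H.
  replace (Im l) with (Re (- Ci * l)%C) by (unfold Re, Im, Ci; simpl; ring).
  replace (Re l) with (- Im (- Ci * l)%C) by (unfold Re, Im, Ci; simpl; ring).
  eapply differentiable_pt_lim_ext; [|exact H].
  exists (mkposreal 1 Rlt_0_1). intros u v _ _. unfold Re, Im, Ci; simpl. ring.
Qed.

Lemma differentiable_cont_xy (U : R -> R -> R) :
  (forall x y, exists p q, differentiable_pt_lim U x y p q) -> cont_xy U.
Proof.
  intros H.
  assert (K : forall x y, continuity_2d_pt U x y).
  { intros x y. apply differentiable_continuity_pt. destruct (H x y) as (p & q & Hpq). now exists p, q. }
  split; intros x y.
  - apply filterlim_locally. intros eps. destruct (K x y eps) as [d Hd].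
    exists d. intros u Hu. apply (Hd u y). exact Hu. rewrite Rminus_diag, Rabs_R0. apply cond_pos.
  - apply filterlim_locally. intros eps. destruct (K x y eps) as [d Hd].
    exists d. intros v Hv. apply (Hd x v). rewrite Rminus_diag, Rabs_R0. apply cond_pos. exact Hv.
Qed.

(** In the coordinate z with h evaluated at w + exp z, circles around w become vertical segments of
    length 2 pi. Goursat on a rectangle, whose horizontal sides cancel by periodicity, makes the
    mean independent of the radius; letting the radius tend to 0 gives the value at w. *)
Lemma entire_mean_value (h : C -> C) (w : C) (u : R) : centire h ->
  RInt (fun t => Re (h (w + Cexp (u, t))%C)) 0 (2 * PI) = 2 * PI * Re (h w).
Proof.
  intros Hh. pose proof PI_RGT_0 as HPI.
  set (phi := fun z => h (w + Cexp z)%C).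
  assert (Hphi : centire phi).
  { intros s. destruct (Hh (w + Cexp s)%C) as [l Hl].
    exists ((0 + Cexp s) * l)%C. apply (cdiff_comp h (fun z => (w + Cexp z)%C)); auto.
    apply cdiff_plus. apply cdiff_const. apply cdiff_Cexp. }
  (* With this choice U dx + V dy is the imaginary part of phi dz. *)
  set (U := fun x y => Im (phi (x, y))). set (V := fun x y => Re (phi (x, y))).
  assert (DUV : forall x y, exists p q r, differentiable_pt_lim U x y p q /\ differentiable_pt_lim V x y q r).
  { intros x y. destruct (Hphi (x, y)) as [l Hl]. exists (Im l), (Re l), (- Im l).
    split. now apply cdiff_Im. now apply cdiff_Re. }
  assert (CU : cont_xy U).
  { apply differentiable_cont_xy. intros x y. destruct (DUV x y) as (p & q & r & K & _). now exists p, q. }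
  assert (CV : cont_xy V).
  { apply differentiable_cont_xy. intros x y. destruct (DUV x y) as (p & q & r & _ & K). now exists q, r. }
  assert (Inv : forall u0, u0 < u -> RInt (V u) 0 (0 + 2 * PI) = RInt (V u0) 0 (0 + 2 * PI)).
  { intros u0 Hu.
    pose proof (goursat U V CU CV u0 0 (u - u0) (2 * PI) ltac:(lra) ltac:(lra) DUV) as G.
    unfold rect_int in G. replace (u0 + (u - u0)) with u in G by ring.
    rewrite (RInt_ext _ (fun _ => 0)) in G.
    - rewrite RInt_const in G. rewrite (RInt_minus' (V u) (V u0)) in G.
      unfold scal in G; simpl in G; unfold mult in G; simpl in G. lra.
      apply cont_ex_RInt, CV. apply cont_ex_RInt, CV.
    - intros x _. unfold U, phi. replace (Cexp (x, 0 + 2 * PI)) with (Cexp (x, 0)). lra.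
      unfold Cexp; simpl. rewrite Rplus_0_l, cos_2PI, sin_2PI, cos_0, sin_0. reflexivity. }
  assert (Z : Rabs (RInt (V u) 0 (0 + 2 * PI) - Re (h w) * (2 * PI)) <= 0).
  { apply le_epsilon. intros eps Heps. rewrite ?(Rplus_0_l eps).
    destruct (Hh w) as [l Hl].
    set (e1 := eps / (2 * PI)). assert (He1 : 0 < e1) by (apply Rdiv_lt_0_compat; lra).
    destruct (Hl 1 Rlt_0_1) as (d & Hd & K).
    set (B := 1 + Cmod l). assert (HB : 0 < B) by (unfold B; pose proof (Cmod_ge_0 l); lra).
    (* Below d the difference quotient estimate applies, e1 / B makes the deviation at most e1, and
       exp u / 2 keeps the small circle inside the given one. *)
    set (r := Rmin (d / 2) (Rmin (e1 / B) (exp u / 2))).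
    assert (Hr : 0 < r).
    { unfold r. repeat apply Rmin_pos. lra. apply Rdiv_lt_0_compat; lra. pose proof (exp_pos u); lra. }
    assert (r <= d / 2 /\ r <= e1 / B /\ r <= exp u / 2).
    { unfold r. repeat split. apply Rmin_l. eapply Rle_trans. apply Rmin_r. apply Rmin_l.
      eapply Rle_trans. apply Rmin_r. apply Rmin_r. }
    rewrite (Inv (ln r)).
    2:{ rewrite <- (ln_exp u). apply ln_increasing; auto. pose proof (exp_pos u); lra. }
    replace eps with (e1 * (2 * PI)) by (unfold e1; field; lra).
    apply RInt_near_const. lra. apply cont_ex_RInt, CV.
    intros t Ht. unfold V, phi.
    assert (Er : Cmod (w + Cexp (ln r, t) - w)%C = r).
    { replace (w + Cexp (ln r, t) - w)%C with (Cexp (ln r, t)) by ring.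
      rewrite Cmod_Cexp. simpl. now apply exp_ln. }
    specialize (K (w + Cexp (ln r, t))%C). rewrite Er in K. specialize (K ltac:(lra)).
    set (x := (w + Cexp (ln r, t))%C) in *.
    replace (Re (h x) - Re (h w)) with (Re (h x - h w)%C) by (unfold Re, Cminus, Cplus; simpl; ring).
    eapply Rle_trans. apply Re_le_Cmod.
    replace (h x - h w)%C with ((h x - h w - (x - w) * l) + (x - w) * l)%C by ring.
    eapply Rle_trans. apply Cmod_triangle. rewrite Cmod_mult, Er.
    apply Rle_trans with (r * B). unfold B; lra.
    apply Rle_trans with (e1 / B * B). apply Rmult_le_compat_r; lra. right; field; lra. }
  rewrite Rplus_0_l in Z. change (RInt (V u) 0 (2 * PI) = 2 * PI * Re (h w)).
  destruct (Req_dec (RInt (V u) 0 (2 * PI) - Re (h w) * (2 * PI)) 0). lra.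
  pose proof (Rabs_pos_lt _ H). lra.
Qed.

Lemma centire_mult f g : centire f -> centire g -> centire (fun s => (f s * g s)%C).
Proof. intros Hf Hg s. destruct (Hf s), (Hg s). eexists. apply cdiff_mult; eauto. Qed.

(* On a large circle around [w] the function [h] lives on the arc [cos t <= 1/4]; the weight
   [exp (N (zeta + zeta ^ 2 / 2))] is [1] at the centre and at most [exp (- 3 N / 16)] on that arc. *)
Lemma entire_zero_Re (h : C -> C) (a : R) : centire h -> (forall s, a < Re s -> h s = 0%C) ->
  forall w, Re (h w) = 0.
Proof.
  intros Hh H0 w. pose proof PI_RGT_0 as HPI.
  (* Points of the circle of radius R0 with cos t > 1/4 have real part larger than a, where h
     vanishes. *)
  set (R0 := Rmax 1 (4 * (a - Re w))).
  assert (HR1 : 1 <= R0) by apply Rmax_l. assert (HR2 : 4 * (a - Re w) <= R0) by apply Rmax_r.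
  (* The linear term alone has positive real part for 0 < cos t <= 1/4. With c = cos t the square
     turns it into c + c^2 - 1/2, which is at most - 3/16 on all of -1 <= c <= 1/4. *)
  set (p := fun s : C => ((s - w) / RtoC R0 + (s - w) / RtoC R0 * ((s - w) / RtoC R0) / RtoC 2)%C).
  assert (Hlin : centire (fun s => ((s - w) / RtoC R0)%C)).
  { intros s.
    eexists. apply (cdiff_mult (fun s => (s - w)%C) (fun _ => (/ RtoC R0)%C)).
    apply cdiff_plus. apply cdiff_id. apply cdiff_const. apply cdiff_const. }
  assert (Hp : centire p).
  { intros s. destruct (Hlin s) as [l1 L1]. eexists. unfold p. apply cdiff_plus. exact L1.
    apply (cdiff_mult _ (fun _ => (/ RtoC 2)%C)). apply cdiff_mult; exact L1. apply cdiff_const. }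
  set (g := fun (N : R) s => (h s * Cexp (RtoC N * p s))%C).
  assert (Hg : forall N, centire (g N)).
  { intros N. apply centire_mult; auto. intros s. destruct (Hp s) as [l Hl].
    eexists. apply (cdiff_comp Cexp (fun s => (RtoC N * p s)%C)). apply cdiff_Cexp.
    apply cdiff_scal. exact Hl. }
  assert (Eu : forall t, Cexp (ln R0, t) = (RtoC R0 * (cos t, sin t))%C).
  { intros t. unfold Cexp; simpl. rewrite exp_ln by lra. unfold Cmult; simpl. f_equal; ring. }
  assert (R0 <> 0) by lra.
  assert (Ep : forall t, Re (p (w + Cexp (ln R0, t))%C) = cos t + (cos t * cos t - sin t * sin t) / 2).
  { intros t. rewrite Eu. unfold p.
    replace ((w + RtoC R0 * (cos t, sin t) - w) / RtoC R0)%C with ((cos t, sin t) : C).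
    2:{ generalize ((cos t, sin t) : C). intros e. field. intros E. apply RtoC_inj in E. lra. }
    unfold Cdiv. rewrite <- RtoC_inv. unfold Re, Cplus, Cmult, RtoC; simpl. field. lra. }
  assert (HM : exists M, forall t, 0 <= t <= 2 * PI -> Cmod (h (w + Cexp (ln R0, t))%C) <= M).
  { assert (Hphi : centire (fun z => h (w + Cexp z)%C)).
    { intros s. destruct (Hh (w + Cexp s)%C) as [l Hl].
      eexists. apply (cdiff_comp h (fun z => (w + Cexp z)%C)); eauto.
      apply cdiff_plus. apply cdiff_const. apply cdiff_Cexp. }
    assert (C1 : cont_xy (fun x y => Re (h (w + Cexp (x, y))%C))).
    { apply differentiable_cont_xy. intros x y. destruct (Hphi (x, y)) as [l Hl].
      exists (Re l), (- Im l). now apply (cdiff_Re (fun z => h (w + Cexp z)%C)). }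
    assert (C2 : cont_xy (fun x y => Im (h (w + Cexp (x, y))%C))).
    { apply differentiable_cont_xy. intros x y. destruct (Hphi (x, y)) as [l Hl].
      exists (Im l), (Re l). now apply (cdiff_Im (fun z => h (w + Cexp z)%C)). }
    destruct (continuity_ab_maj (fun t => Rabs (Re (h (w + Cexp (ln R0, t))%C)) + Rabs (Im (h (w + Cexp (ln R0, t))%C))) 0 (2 * PI)) as (tM & HtM & _).
    - lra.
    - intros t _. apply continuity_pt_filterlim.
      apply (continuous_plus (V := R_NormedModule)
        (fun t => Rabs (Re (h (w + Cexp (ln R0, t))%C)))
        (fun t => Rabs (Im (h (w + Cexp (ln R0, t))%C)))).
      + apply (continuous_comp (fun t => Re (h (w + Cexp (ln R0, t))%C)) Rabs). apply C1. apply continuous_Rabs.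
      + apply (continuous_comp (fun t => Im (h (w + Cexp (ln R0, t))%C)) Rabs). apply C2. apply continuous_Rabs.
    - eexists. intros t Ht. eapply Rle_trans. apply Cmod_le_sum. apply (HtM t Ht). }
  destruct HM as [M HM].
  assert (M0 : 0 <= M) by (eapply Rle_trans; [apply Cmod_ge_0|apply (HM 0); lra]).
  assert (Bd : forall N : R, 0 <= N -> Rabs (2 * PI * Re (h w)) <= M * exp (- (3 / 16) * N) * (2 * PI)).
  { intros N HN.
    replace (2 * PI * Re (h w)) with (2 * PI * Re (g N w)).
    2:{ unfold g, p. replace ((w - w) / RtoC R0)%C with (RtoC 0).
        replace (RtoC N * (0 + 0 * 0 / 2))%C with (RtoC 0). rewrite Cexp_0. rewrite Cmult_1_r. reflexivity.
        unfold Cdiv; ring. unfold Cdiv; ring. }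
    rewrite <- (entire_mean_value (g N) w (ln R0)) by auto.
    replace (M * exp (- (3 / 16) * N) * (2 * PI)) with ((2 * PI - 0) * (M * exp (- (3 / 16) * N))) by ring.
    assert (C1 : cont_xy (fun x y => Re (g N (w + Cexp (x, y))%C))).
    { apply differentiable_cont_xy. intros x y. destruct (Hg N (w + Cexp (x, y))%C) as [l Hl].
      eexists; eexists. apply (cdiff_Re (fun z => g N (w + Cexp z)%C)).
      apply (cdiff_comp (g N) (fun z => (w + Cexp z)%C)); eauto.
      apply cdiff_plus. apply cdiff_const. apply cdiff_Cexp. }
    apply abs_RInt_le_const. lra. apply cont_ex_RInt. apply C1.
    intros t Ht. eapply Rle_trans. apply Re_le_Cmod. unfold g. rewrite Cmod_mult, Cmod_Cexp.
    assert (RtoCRe : forall z, Re (RtoC N * z)%C = N * Re z) by (intros; unfold Re, Cmult; simpl; ring).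
    rewrite RtoCRe, Ep.
    destruct (Rle_dec (cos t) (1 / 4)) as [Hc|Hc].
    - apply Rmult_le_compat. apply Cmod_ge_0. left; apply exp_pos. auto.
      apply exp_le. pose proof (sin2_cos2 t) as S. unfold Rsqr in S.
      replace (sin t * sin t) with (1 - cos t * cos t) by lra.
      pose proof (COS_bound t).
      assert (cos t + (cos t * cos t - (1 - cos t * cos t)) / 2 <= - (3 / 16)) by nra. nra.
    - rewrite H0. rewrite Cmod_0, Rmult_0_l. apply Rmult_le_pos; auto. left; apply exp_pos.
      rewrite Eu. unfold Re, Cplus, Cmult; simpl. fold (Re w). nra. }
  destruct (Req_dec (Re (h w)) 0) as [|Hne]; auto. exfalso.
  pose proof (Rabs_pos_lt (2 * PI * Re (h w)) ltac:(apply Rmult_integral_contrapositive; split; lra)) as Hpos.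
  set (A := Rabs (2 * PI * Re (h w))) in *.
  (* This makes the exponential factor exp (- X) with X = 2 pi M / A; then A exp X <= 2 pi M = A X
     contradicts exp X >= 1 + X. *)
  set (N := 16 / 3 * (M * (2 * PI) / A)).
  assert (HN0 : 0 <= M * (2 * PI) / A) by (apply Rmult_le_pos; [nra|left; apply Rinv_0_lt_compat; auto]).
  specialize (Bd N ltac:(unfold N; lra)).
  replace (- (3 / 16) * N) with (- (M * (2 * PI) / A)) in Bd by (unfold N; field; lra).
  rewrite exp_Ropp in Bd.
  pose proof (exp_pos (M * (2 * PI) / A)) as Hep.
  apply Rmult_le_compat_r with (r := exp (M * (2 * PI) / A)) in Bd; [|lra].
  replace (M * / exp (M * (2 * PI) / A) * (2 * PI) * exp (M * (2 * PI) / A)) with (M * (2 * PI)) in Bd by (field; lra).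
  pose proof (exp_ineq1_le (M * (2 * PI) / A)) as Hi.
  assert (A * (1 + M * (2 * PI) / A) <= M * (2 * PI)).
  { eapply Rle_trans; [|exact Bd]. apply Rmult_le_compat_l; lra. }
  replace (A * (1 + M * (2 * PI) / A)) with (A + M * (2 * PI)) in H1 by (field; lra). lra.
Qed.

(** [entire_zero_Re] controls real parts only; multiplying f - g by i gives the imaginary part. *)
Theorem entire_identity (f g : C -> C) (a : R) : entire f -> entire g ->
  (forall s, a < Re s -> f s = g s) -> forall s, f s = g s.
Proof.
  intros Hf Hg H s. apply centire_entire in Hf. apply centire_entire in Hg.
  set (h := fun s => (f s + - (1) * g s)%C).
  assert (Hh : centire h).
  { intros u. destruct (Hf u), (Hg u). eexists. apply cdiff_plus; eauto. apply cdiff_scal; eauto. }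
  assert (H0 : forall s, a < Re s -> h s = 0%C).
  { intros u Hu. unfold h. rewrite H by auto. ring. }
  pose proof (entire_zero_Re h a Hh H0 s) as E1.
  assert (E2 : Re (Ci * h s)%C = 0).
  { apply (entire_zero_Re (fun s => (Ci * h s)%C) a).
    intros u. destruct (Hh u). eexists. apply cdiff_scal; eauto.
    intros u Hu. rewrite H0 by auto. ring. }
  assert (E : h s = 0%C).
  { apply injective_projections. exact E1. unfold Re, Ci, Cmult in E2; simpl in E2. simpl. lra. }
  unfold h in E. replace (f s) with (f s + - (1) * g s + g s)%C by ring. rewrite E. ring.
Qed.

(** * Sums over the integers *)

Fixpoint zsum (N : nat) (f : Z -> R) : R :=
  match N with
  | O => f 0%Z
  | S M => zsum M f + f (Z.of_nat (S M)) + f (- Z.of_nat (S M))%Z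
  end.

(** A total function, the limit of the symmetric partial sums; it is meaningful under [zadm],
    exponential domination with unspecified constants. *)
Definition Zsum (f : Z -> R) : R := real (Lim_seq (fun N => zsum N f)).

Definition zabs (n : Z) : R := Rabs (IZR n).
Definition zdom (c K : R) (f : Z -> R) : Prop := forall n, Rabs (f n) <= K * exp (- c * zabs n).
(** The exact sum of exp (- c |n|) over |n| > N; accordingly [mass c] is the sum over all
    integers. *)
Definition ztail (c : R) (N : nat) : R := 2 * exp (- c * INR (S N)) / (1 - exp (- c)).
Definition mass (c : R) : R := 1 + ztail c 0.

Lemma exp_neg_lt_1 c : 0 < c -> exp (- c) < 1.
Proof. intros. rewrite <- exp_0. apply exp_increasing. lra. Qed.

Lemma zsum_ext_in N f g : (forall n, f n = g n) -> zsum N f = zsum N g.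
Proof. intros E. induction N; simpl; rewrite ?IHN, ?E; auto. Qed.

Lemma zsum_plus N f g : zsum N (fun n => f n + g n) = zsum N f + zsum N g.
Proof. induction N; simpl; auto. rewrite IHN. ring. Qed.

Lemma zsum_minus N f g : zsum N (fun n => f n - g n) = zsum N f - zsum N g.
Proof. induction N; simpl; auto. rewrite IHN. ring. Qed.

Lemma zsum_scal N k f : zsum N (fun n => k * f n) = k * zsum N f.
Proof. induction N; simpl; auto. rewrite IHN. ring. Qed.

Lemma zsum_swap N M f : zsum N (fun m => zsum M (f m)) = zsum M (fun n => zsum N (fun m => f m n)).
Proof.
  induction N; simpl; auto. rewrite IHN. rewrite <- !zsum_plus. reflexivity.
Qed.

Lemma zabs_nat N : zabs (Z.of_nat N) = INR N.
Proof. unfold zabs. rewrite <- INR_IZR_INZ. apply Rabs_pos_eq, pos_INR. Qed.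
Lemma zabs_opp n : zabs (- n) = zabs n.
Proof. unfold zabs. rewrite opp_IZR. apply Rabs_Ropp. Qed.
Lemma zabs_pos n : 0 <= zabs n.
Proof. apply Rabs_pos. Qed.

Lemma tail_step c N : 0 < c -> ztail c N - ztail c (S N) = 2 * exp (- c * INR (S N)).
Proof.
  intros Hc. unfold ztail. rewrite (S_INR (S N)).
  replace (- c * (INR (S N) + 1)) with (- c * INR (S N) + - c) by ring.
  rewrite exp_plus. field. pose proof (exp_neg_lt_1 c Hc). lra.
Qed.

Lemma tail_pos c N : 0 < c -> 0 < ztail c N.
Proof.
  intros Hc. unfold ztail. pose proof (exp_neg_lt_1 c Hc).
  pose proof (exp_pos (- c * INR (S N))). apply Rdiv_lt_0_compat; lra.
Qed.

Lemma mass_ge_1 c : 0 < c -> 1 <= mass c.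
Proof. intros. unfold mass. pose proof (tail_pos c 0 H). lra. Qed.

Lemma zsum_step_bound c K f N : zdom c K f ->
  Rabs (f (Z.of_nat (S N)) + f (- Z.of_nat (S N))%Z) <= K * (2 * exp (- c * INR (S N))).
Proof.
  intros H. pose proof (H (Z.of_nat (S N))) as H1. pose proof (H (- Z.of_nat (S N))%Z) as H2.
  rewrite zabs_opp in H2. rewrite zabs_nat in H1, H2.
  eapply Rle_trans. apply Rabs_triang. lra.
Qed.

Lemma zsum_diff_bound c K f N p : 0 < c -> zdom c K f ->
  Rabs (zsum (N + p) f - zsum N f) <= K * (ztail c N - ztail c (N + p)).
Proof.
  intros Hc H. induction p.
  - rewrite Nat.add_0_r. rewrite !Rminus_diag, Rabs_R0. lra.
  - rewrite Nat.add_succ_r. set (M := (N + p)%nat) in *.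
    change (zsum (S M) f) with (zsum M f + f (Z.of_nat (S M)) + f (- Z.of_nat (S M))%Z).
    replace (zsum M f + f (Z.of_nat (S M)) + f (- Z.of_nat (S M))%Z - zsum N f)
      with ((zsum M f - zsum N f) + (f (Z.of_nat (S M)) + f (- Z.of_nat (S M))%Z)) by ring.
    eapply Rle_trans. apply Rabs_triang.
    pose proof (zsum_step_bound c K f M H). rewrite <- tail_step in H0 by auto. lra.
Qed.

Lemma zdom_pos c K f : zdom c K f -> 0 <= K.
Proof.
  intros H. specialize (H 0%Z). pose proof (Rabs_pos (f 0%Z)). pose proof (exp_pos (- c * zabs 0)). nra.
Qed.

Lemma zsum_bound c K f N : 0 < c -> zdom c K f -> Rabs (zsum N f) <= K * mass c.
Proof.
  intros Hc H. pose proof (zsum_diff_bound c K f 0 N Hc H) as D. simpl in D.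
  pose proof (H 0%Z) as H0. unfold zabs in H0. rewrite Rabs_R0, Rmult_0_r, exp_0 in H0.
  replace (zsum N f) with ((zsum N f - f 0%Z) + f 0%Z) by ring.
  eapply Rle_trans. apply Rabs_triang. pose proof (zdom_pos c K f H). pose proof (tail_pos c N Hc).
  unfold mass. nra.
Qed.

Lemma tail_lim c : 0 < c -> is_lim_seq (ztail c) 0.
Proof.
  intros Hc. pose proof (exp_neg_lt_1 c Hc) as H1. pose proof (exp_pos (- c)) as H0.
  apply (is_lim_seq_ext (fun N => 2 / (1 - exp (- c)) * exp (- c) * exp (- c) ^ N)).
  - intros N. unfold ztail. rewrite S_INR. replace (- c * (INR N + 1)) with (- c + INR N * - c) by ring.
    rewrite exp_plus. replace (exp (INR N * - c)) with (exp (- c) ^ N). field; lra.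
    rewrite <- Rpower_pow by auto. unfold Rpower. rewrite ln_exp. reflexivity.
  - replace (Finite 0) with (Rbar_mult (2 / (1 - exp (- c)) * exp (- c)) (Finite 0)) by (simpl; f_equal; ring).
    apply is_lim_seq_scal_l. apply is_lim_seq_geom. rewrite Rabs_pos_eq; lra.
Qed.

Lemma Zsum_lim c K f : 0 < c -> zdom c K f -> is_lim_seq (fun N => zsum N f) (Zsum f).
Proof.
  intros Hc H. unfold Zsum. apply Lim_seq_correct'. apply ex_lim_seq_cauchy_corr.
  intros eps. pose proof (tail_lim c Hc) as T. apply is_lim_seq_spec in T.
  pose proof (zdom_pos c K f H) as HK.
  destruct (T (mkposreal (eps / (2 * (K + 1))) ltac:(apply Rdiv_lt_0_compat; [apply cond_pos|lra]))) as [N HN].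
  simpl in HN. exists N. intros n m Hn Hm.
  assert (B : forall n, (N <= n)%nat -> Rabs (zsum n f - zsum N f) < eps / 2).
  { intros k Hk. pose proof (zsum_diff_bound c K f N (k - N) Hc H) as D.
    replace (N + (k - N))%nat with k in D by lia.
    eapply Rle_lt_trans. exact D. specialize (HN N (Nat.le_refl N)).
    rewrite Rminus_0_r in HN. rewrite Rabs_pos_eq in HN by (left; apply tail_pos; auto).
    pose proof (tail_pos c k Hc). pose proof (tail_pos c N Hc).
    apply Rle_lt_trans with (K * ztail c N). nra.
    apply Rle_lt_trans with ((K + 1) * ztail c N). nra.
    apply Rlt_le_trans with ((K + 1) * (eps / (2 * (K + 1)))). apply Rmult_lt_compat_l; lra.
    right. field. lra. }
  replace (zsum n f - zsum m f) with ((zsum n f - zsum N f) - (zsum m f - zsum N f)) by ring.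
  eapply Rle_lt_trans. apply Rabs_triang. rewrite Rabs_Ropp.
  pose proof (B n Hn). pose proof (B m Hm). lra.
Qed.

Lemma is_lim_seq_abs_le (u : nat -> R) (l M : R) :
  is_lim_seq u l -> (forall n, Rabs (u n) <= M) -> Rabs l <= M.
Proof.
  intros H B. apply is_lim_seq_abs in H.
  apply (is_lim_seq_le (fun n => Rabs (u n)) (fun _ => M) (Rabs l) M); auto.
  apply is_lim_seq_const.
Qed.

Lemma Zsum_tail c K f N : 0 < c -> zdom c K f -> Rabs (Zsum f - zsum N f) <= K * ztail c N.
Proof.
  intros Hc H. apply (is_lim_seq_abs_le (fun p => zsum (N + p) f - zsum N f)).
  - apply (is_lim_seq_minus' _ (fun _ => zsum N f)). 2: apply is_lim_seq_const.
    pose proof (Zsum_lim c K f Hc H) as L. apply (is_lim_seq_incr_n _ N) in L.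
    eapply is_lim_seq_ext; [|exact L]. intros p. simpl. f_equal. lia.
  - intros p. eapply Rle_trans. apply (zsum_diff_bound c K); auto.
    pose proof (zdom_pos c K f H). pose proof (tail_pos c (N + p) Hc). nra.
Qed.

Lemma Zsum_bound c K f : 0 < c -> zdom c K f -> Rabs (Zsum f) <= K * mass c.
Proof.
  intros Hc H. apply (is_lim_seq_abs_le (fun N => zsum N f)). eapply Zsum_lim; eauto.
  intros. apply zsum_bound; auto.
Qed.

Definition zadm (f : Z -> R) := exists c K, 0 < c /\ zdom c K f.

Lemma zdom_weaken c c' K K' f : c' <= c -> K <= K' -> zdom c K f -> zdom c' K' f.
Proof.
  intros Hc HK H n. pose proof (zdom_pos c K f H). eapply Rle_trans. apply H.
  apply Rmult_le_compat; auto. left; apply exp_pos. apply exp_le.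
  pose proof (zabs_pos n). nra.
Qed.

Lemma zadm_plus f g : zadm f -> zadm g -> zadm (fun n => f n + g n).
Proof.
  intros (c & K & Hc & H) (c' & K' & Hc' & H').
  exists (Rmin c c'), (K + K'). split. apply Rmin_pos; auto.
  pose proof (zdom_weaken _ (Rmin c c') _ K _ (Rmin_l _ _) (Rle_refl _) H) as A.
  pose proof (zdom_weaken _ (Rmin c c') _ K' _ (Rmin_r _ _) (Rle_refl _) H') as A'.
  intros n. eapply Rle_trans. apply Rabs_triang. specialize (A n). specialize (A' n). lra.
Qed.

Lemma zdom_scal c K f k : zdom c K f -> zdom c (Rabs k * K) (fun n => k * f n).
Proof.
  intros H n. rewrite Rabs_mult, Rmult_assoc. apply Rmult_le_compat_l; auto. apply Rabs_pos.
Qed.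

Lemma zadm_scal k f : zadm f -> zadm (fun n => k * f n).
Proof. intros (c & K & Hc & H). exists c, (Rabs k * K). split; auto. now apply zdom_scal. Qed.

Lemma Zsum_limit f : zadm f -> is_lim_seq (fun N => zsum N f) (Zsum f).
Proof. intros (c & K & Hc & H). eapply Zsum_lim; eauto. Qed.

Lemma Zsum_unique f (l : R) : is_lim_seq (fun N => zsum N f) l -> Zsum f = l.
Proof. intros H. unfold Zsum. now rewrite (is_lim_seq_unique _ _ H). Qed.

Lemma Zsum_ext f g : (forall n, f n = g n) -> Zsum f = Zsum g.
Proof.
  intros E. unfold Zsum. f_equal. apply Lim_seq_ext. intros N. now apply zsum_ext_in.
Qed.

Lemma Zsum_plus f g : zadm f -> zadm g -> Zsum (fun n => f n + g n) = Zsum f + Zsum g.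
Proof.
  intros Hf Hg. apply Zsum_unique.
  apply (is_lim_seq_ext (fun N => zsum N f + zsum N g)). intros; now rewrite zsum_plus.
  apply is_lim_seq_plus'; now apply Zsum_limit.
Qed.

Lemma Zsum_scal k f : zadm f -> Zsum (fun n => k * f n) = k * Zsum f.
Proof.
  intros Hf. apply Zsum_unique.
  apply (is_lim_seq_ext (fun N => k * zsum N f)). intros; now rewrite zsum_scal.
  apply (is_lim_seq_scal_l _ k (Zsum f)). now apply Zsum_limit.
Qed.

Lemma Zsum_le f g : zadm f -> zadm g -> (forall n, f n <= g n) -> Zsum f <= Zsum g.
Proof.
  intros Hf Hg H.
  apply (is_lim_seq_le (fun N => zsum N f) (fun N => zsum N g) (Zsum f) (Zsum g)).
  - intros N. induction N; simpl; auto. pose proof (H (Z.of_nat (S N))). pose proof (H (- Z.of_nat (S N))%Z). simpl in *. lra.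
  - now apply Zsum_limit.
  - now apply Zsum_limit.
Qed.

Lemma Zsum_abs f g : zadm f -> zadm g -> (forall n, Rabs (f n) <= g n) -> Rabs (Zsum f) <= Zsum g.
Proof.
  intros Hf Hg H. apply Rabs_le. split.
  - replace (- Zsum g) with (-1 * Zsum g) by ring. rewrite <- Zsum_scal by auto.
    apply Zsum_le; auto. now apply zadm_scal. intros n. specialize (H n). apply Rabs_le_between in H. lra.
  - apply Zsum_le; auto. intros n. specialize (H n). apply Rabs_le_between in H. lra.
Qed.

(** Shifting a symmetric partial sum exchanges one boundary term for another, and both tend to 0. *)
Lemma Zsum_shift f : zadm f -> Zsum (fun n => f (n + 1)%Z) = Zsum f.
Proof.
  intros Hf. apply Zsum_unique.
  apply (is_lim_seq_ext (fun N => zsum N f + (f (Z.of_nat N + 1)%Z - f (- Z.of_nat N)%Z))).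
  - intros N. induction N.
    + simpl. ring.
    + change (zsum (S N) f) with (zsum N f + f (Z.of_nat (S N)) + f (- Z.of_nat (S N))%Z).
      change (zsum (S N) (fun n => f (n + 1)%Z)) with
        (zsum N (fun n => f (n + 1)%Z) + f (Z.of_nat (S N) + 1)%Z + f (- Z.of_nat (S N) + 1)%Z).
      rewrite <- IHN. replace (Z.of_nat N + 1)%Z with (Z.of_nat (S N)) by lia.
      replace (- Z.of_nat (S N) + 1)%Z with (- Z.of_nat N)%Z by lia. ring.
  - destruct Hf as (c & K & Hc & H).
    replace (Finite (Zsum f)) with (Finite (Zsum f + 0)) by (f_equal; ring).
    apply is_lim_seq_plus'. eapply Zsum_lim; eauto.
    apply (is_lim_seq_le_le (fun N => - (K * ztail c N * exp c)) _ (fun N => K * ztail c N * exp c)).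
    + intros N. apply Rabs_le_between. pose proof (H (Z.of_nat N + 1)%Z) as H1. pose proof (H (- Z.of_nat N)%Z) as H2.
      rewrite zabs_opp, zabs_nat in H2. replace (Z.of_nat N + 1)%Z with (Z.of_nat (S N)) in * by lia.
      rewrite zabs_nat in H1.
      assert (E : 2 * exp (- c * INR N) <= ztail c N * exp c).
      { unfold ztail. rewrite S_INR. replace (- c * (INR N + 1)) with (- c * INR N + - c) by ring.
        rewrite exp_plus. pose proof (exp_neg_lt_1 c Hc). pose proof (exp_pos (- c * INR N)).
        replace (2 * (exp (- c * INR N) * exp (- c)) / (1 - exp (- c)) * exp c)
          with (2 * exp (- c * INR N) / (1 - exp (- c)) * (exp (- c) * exp c)) by (field; lra).
        rewrite <- exp_plus, Rplus_opp_l, exp_0, Rmult_1_r.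
        pose proof (exp_pos (- c)).
        apply (Rmult_le_reg_r (1 - exp (- c))). lra.
        unfold Rdiv. rewrite (Rmult_assoc (2 * _)), Rinv_l by lra. nra. }
      assert (exp (- c * INR (S N)) <= exp (- c * INR N)).
      { apply exp_le. rewrite S_INR. pose proof (pos_INR N). nra. }
      pose proof (zdom_pos c K f H).
      eapply Rle_trans. apply Rabs_triang. rewrite Rabs_Ropp. nra.
    + replace (Finite 0) with (Finite (- (K * 0 * exp c))) by (f_equal; ring).
      apply (is_lim_seq_opp _ (Finite (K * 0 * exp c))).
      apply (is_lim_seq_scal_r _ (exp c) (K * 0)). apply (is_lim_seq_scal_l _ K 0). now apply tail_lim.
    + replace (Finite 0) with (Finite (K * 0 * exp c)) by (f_equal; ring).
      apply (is_lim_seq_scal_r _ (exp c) (K * 0)). apply (is_lim_seq_scal_l _ K 0). now apply tail_lim.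
Qed.

(** * Double sums *)

Definition Zsum2 (f : Z -> Z -> R) : R := Zsum (fun m => Zsum (f m)).
Definition zdom2 (c K : R) (f : Z -> Z -> R) : Prop :=
  forall m n, Rabs (f m n) <= K * exp (- c * (zabs m + zabs n)).
Definition zadm2 (f : Z -> Z -> R) := exists c K, 0 < c /\ zdom2 c K f.

Lemma zdom2_inner c K f m : zdom2 c K f -> zdom c (K * exp (- c * zabs m)) (f m).
Proof.
  intros H n. rewrite Rmult_assoc, <- exp_plus. replace (- c * zabs m + - c * zabs n)
    with (- c * (zabs m + zabs n)) by ring. apply H.
Qed.

Lemma zdom2_outer c K f : 0 < c -> zdom2 c K f -> zdom c (K * mass c) (fun m => Zsum (f m)).
Proof.
  intros Hc H m. replace (K * mass c * exp (- c * zabs m)) with (K * exp (- c * zabs m) * mass c) by ring.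
  apply Zsum_bound; auto. now apply zdom2_inner.
Qed.

Lemma zdom2_swap c K f : zdom2 c K f -> zdom2 c K (fun m n => f n m).
Proof. intros H m n. rewrite Rplus_comm. apply H. Qed.

Lemma zdom2_pos c K f : zdom2 c K f -> 0 <= K.
Proof.
  intros H. specialize (H 0%Z 0%Z). pose proof (Rabs_pos (f 0%Z 0%Z)).
  pose proof (exp_pos (- c * (zabs 0 + zabs 0))). nra.
Qed.

Lemma zadm2_inner f m : zadm2 f -> zadm (f m).
Proof. intros (c & K & Hc & H). eexists; eexists; split; eauto. eapply zdom2_inner; eauto. Qed.
Lemma zadm2_outer f : zadm2 f -> zadm (fun m => Zsum (f m)).
Proof. intros (c & K & Hc & H). eexists; eexists; split; eauto. eapply zdom2_outer; eauto. Qed.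

(** Links the iterated sum with sums over the squares |m|, |n| <= N, the order of summation used in
    [Epartial]. *)
Lemma Zsum2_tail c K f N : 0 < c -> zdom2 c K f ->
  Rabs (Zsum2 f - zsum N (fun m => zsum N (f m))) <= 2 * K * mass c * ztail c N.
Proof.
  intros Hc H.
  replace (Zsum2 f - zsum N (fun m => zsum N (f m)))
    with ((Zsum2 f - zsum N (fun m => Zsum (f m))) + zsum N (fun m => Zsum (f m) - zsum N (f m)))
    by (rewrite zsum_minus; ring).
  eapply Rle_trans. apply Rabs_triang.
  pose proof (Zsum_tail c _ (fun m => Zsum (f m)) N Hc (zdom2_outer c K f Hc H)) as T1.
  fold (Zsum2 f) in T1.
  assert (T2 : Rabs (zsum N (fun m => Zsum (f m) - zsum N (f m))) <= K * ztail c N * mass c).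
  { apply (zsum_bound c); auto. intros m.
    replace (K * ztail c N * exp (- c * zabs m)) with (K * exp (- c * zabs m) * ztail c N) by ring.
    apply Zsum_tail; auto. now apply zdom2_inner. }
  lra.
Qed.

Lemma Zsum2_limit f : zadm2 f -> is_lim_seq (fun N => zsum N (fun m => zsum N (f m))) (Zsum2 f).
Proof.
  intros (c & K & Hc & H).
  apply (is_lim_seq_le_le (fun N => Zsum2 f - 2 * K * mass c * ztail c N) _
                          (fun N => Zsum2 f + 2 * K * mass c * ztail c N)).
  - intros N. pose proof (Zsum2_tail c K f N Hc H) as T. apply Rabs_le_between in T. lra.
  - replace (Finite (Zsum2 f)) with (Finite (Zsum2 f - 2 * K * mass c * 0)) by (f_equal; ring).
    apply is_lim_seq_minus'. apply is_lim_seq_const.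
    apply (is_lim_seq_scal_l _ (2 * K * mass c) 0). now apply tail_lim.
  - replace (Finite (Zsum2 f)) with (Finite (Zsum2 f + 2 * K * mass c * 0)) by (f_equal; ring).
    apply is_lim_seq_plus'. apply is_lim_seq_const.
    apply (is_lim_seq_scal_l _ (2 * K * mass c) 0). now apply tail_lim.
Qed.

Lemma Zsum2_ext f g : (forall m n, f m n = g m n) -> Zsum2 f = Zsum2 g.
Proof. intros E. apply Zsum_ext. intros m. apply Zsum_ext. auto. Qed.

(** Both iterated sums are limits of the same square sums, where the exchange is finite. *)
Lemma Zsum2_swap f : zadm2 f -> Zsum2 f = Zsum2 (fun m n => f n m).
Proof.
  intros H. assert (H' : zadm2 (fun m n => f n m)).
  { destruct H as (c & K & Hc & H). exists c, K. split; auto. now apply zdom2_swap. }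
  apply Zsum2_limit in H. apply Zsum2_limit in H'.
  apply (is_lim_seq_ext _ (fun N => zsum N (fun m => zsum N (f m)))) in H'.
  2:{ intros N. apply zsum_swap. }
  apply is_lim_seq_unique in H. apply is_lim_seq_unique in H'. rewrite H in H'.
  now injection H'.
Qed.

Lemma Zsum2_plus f g : zadm2 f -> zadm2 g -> Zsum2 (fun m n => f m n + g m n) = Zsum2 f + Zsum2 g.
Proof.
  intros Hf Hg. unfold Zsum2. rewrite <- Zsum_plus by now apply zadm2_outer.
  apply Zsum_ext. intros m. apply Zsum_plus; now apply zadm2_inner.
Qed.

Lemma Zsum2_scal k f : zadm2 f -> Zsum2 (fun m n => k * f m n) = k * Zsum2 f.
Proof.
  intros Hf. unfold Zsum2. rewrite <- Zsum_scal by now apply zadm2_outer.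
  apply Zsum_ext. intros m. apply Zsum_scal; now apply zadm2_inner.
Qed.

Lemma Zsum2_bound c K f : 0 < c -> zdom2 c K f -> Rabs (Zsum2 f) <= K * mass c * mass c.
Proof. intros Hc H. apply Zsum_bound; auto. now apply zdom2_outer. Qed.

Lemma zdom2_weaken c c' K K' f : c' <= c -> K <= K' -> zdom2 c K f -> zdom2 c' K' f.
Proof.
  intros Hc HK H m n. pose proof (zdom2_pos c K f H). eapply Rle_trans. apply H.
  apply Rmult_le_compat; auto. left; apply exp_pos. apply exp_le.
  pose proof (zabs_pos n). pose proof (zabs_pos m). nra.
Qed.

Lemma zadm2_plus f g : zadm2 f -> zadm2 g -> zadm2 (fun m n => f m n + g m n).
Proof.
  intros (c & K & Hc & H) (c' & K' & Hc' & H').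
  exists (Rmin c c'), (K + K'). split. apply Rmin_pos; auto.
  pose proof (zdom2_weaken _ (Rmin c c') _ K _ (Rmin_l _ _) (Rle_refl _) H) as A.
  pose proof (zdom2_weaken _ (Rmin c c') _ K' _ (Rmin_r _ _) (Rle_refl _) H') as A'.
  intros m n. eapply Rle_trans. apply Rabs_triang. specialize (A m n). specialize (A' m n). lra.
Qed.

Lemma zadm2_scal k f : zadm2 f -> zadm2 (fun m n => k * f m n).
Proof.
  intros (c & K & Hc & H). exists c, (Rabs k * K). split; auto.
  intros m n. rewrite Rabs_mult, Rmult_assoc. apply Rmult_le_compat_l; auto. apply Rabs_pos.
Qed.

(* A linear functional [dfun] on the class [dadm], bounded on functions dominated by the weight
   [dwt]: enough structure to differentiate under the "integral sign". *)
Record domfun (X : Type) := {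
  dadm : (X -> R) -> Prop;
  dfun : (X -> R) -> R;
  dwt : X -> R;
  dset : X -> Prop;
  dcst : R;
  dadm_plus : forall f g, dadm f -> dadm g -> dadm (fun x => f x + g x);
  dadm_scal : forall k f, dadm f -> dadm (fun x => k * f x);
  dfun_plus : forall f g, dadm f -> dadm g -> dfun (fun x => f x + g x) = dfun f + dfun g;
  dfun_scal : forall k f, dadm f -> dfun (fun x => k * f x) = k * dfun f;
  dfun_bound : forall f e, dadm f -> 0 <= e -> (forall x, dset x -> Rabs (f x) <= e * dwt x) ->
    Rabs (dfun f) <= e * dcst
}.
Arguments dadm {X}. Arguments dfun {X}. Arguments dwt {X}. Arguments dset {X}. Arguments dcst {X}.

Lemma is_derive_quadratic (f : R -> R) (x l M delta : R) : 0 < delta ->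
  (forall h, Rabs h < delta -> Rabs (f (x + h) - f x - h * l) <= h ^ 2 * M) -> is_derive f x l.
Proof.
  intros Hd H. apply is_derive_Reals. intros eps Heps.
  assert (HM : 0 <= M).
  { specialize (H (delta / 2)). rewrite Rabs_pos_eq in H by lra. specialize (H ltac:(lra)).
    pose proof (Rabs_pos (f (x + delta / 2) - f x - delta / 2 * l)). assert (0 < (delta / 2) ^ 2) by (apply pow_lt; lra). nra. }
  assert (P : 0 < Rmin delta (eps / (M + 1))) by (apply Rmin_pos; auto; apply Rdiv_lt_0_compat; lra).
  exists (mkposreal _ P). simpl. intros h Hh Hb.
  assert (B1 : Rabs h < delta) by (eapply Rlt_le_trans; [exact Hb|apply Rmin_l]).
  assert (B2 : Rabs h < eps / (M + 1)) by (eapply Rlt_le_trans; [exact Hb|apply Rmin_r]).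
  specialize (H h B1).
  replace ((f (x + h) - f x) / h - l) with ((f (x + h) - f x - h * l) / h) by (field; auto).
  unfold Rdiv. rewrite Rabs_mult, Rabs_inv.
  pose proof (Rabs_pos_lt h Hh) as Hp.
  apply Rle_lt_trans with (Rabs h * M).
  - rewrite <- (pow2_abs h) in H.
    apply (Rmult_le_compat_r (/ Rabs h)) in H; [|left; apply Rinv_0_lt_compat; auto].
    eapply Rle_trans. exact H. right. field. lra.
  - apply Rle_lt_trans with (Rabs h * (M + 1)). nra.
    apply Rlt_le_trans with (eps / (M + 1) * (M + 1)). apply Rmult_lt_compat_r; lra.
    right; field; lra.
Qed.

(** The remainder K0 (x + h) - K0 x - h K1 x is at most h^2 M [dwt] for every parameter, by
    [taylor2_bound]. The functional is linear and bounded on such functions, so the remainder of its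
    value is O(h^2). A bound on the second derivative thus takes the place of a dominated
    convergence argument. *)
Theorem dfun_derive {X} (D : domfun X) (K0 K1 K2 : R -> X -> R) (x M delta : R) :
  0 < delta ->
  (forall u, Rabs (u - x) < delta -> dadm D (K0 u)) -> dadm D (K1 x) ->
  (forall p u, dset D p -> Rabs (u - x) < delta ->
     is_derive (fun v => K0 v p) u (K1 u p) /\ is_derive (fun v => K1 v p) u (K2 u p) /\
     Rabs (K2 u p) <= M * dwt D p) ->
  0 <= M ->
  is_derive (fun u => dfun D (K0 u)) x (dfun D (K1 x)).
Proof.
  intros Hd A0 A1 H HM.
  apply (is_derive_quadratic _ x _ (M * dcst D) delta Hd).
  intros h Hh.
  assert (E : dfun D (K0 (x + h)) - dfun D (K0 x) - h * dfun D (K1 x)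
    = dfun D (fun p => K0 (x + h) p + (-1 * K0 x p + (- h) * K1 x p))).
  { assert (dadm D (K0 x)) by (apply A0; rewrite Rminus_diag, Rabs_R0; auto).
    assert (dadm D (K0 (x + h))) by (apply A0; replace (x + h - x) with h by ring; auto).
    rewrite dfun_plus, dfun_plus, !dfun_scal; auto using dadm_scal, dadm_plus. ring. }
  rewrite E, <- Rmult_assoc. apply dfun_bound.
  - assert (dadm D (K0 x)) by (apply A0; rewrite Rminus_diag, Rabs_R0; auto).
    assert (dadm D (K0 (x + h))) by (apply A0; replace (x + h - x) with h by ring; auto).
    auto using dadm_scal, dadm_plus.
  - nra.
  - intros p Hp. replace (K0 (x + h) p + (-1 * K0 x p + - h * K1 x p))
      with (K0 (x + h) p - K0 x p - h * K1 x p) by ring.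
    rewrite Rmult_assoc.
    assert (B : forall u, Rmin x (x + h) <= u <= Rmax x (x + h) -> Rabs (u - x) < delta).
    { intros u Hu. apply Rabs_def2 in Hh. apply Rabs_def1; unfold Rmin, Rmax in Hu; destruct (Rle_dec x (x + h)); lra. }
    apply (taylor2_bound (fun v => K0 v p) (fun v => K1 v p) (fun v => K2 v p)).
    + intros u Hu. now apply H, B.
    + intros u Hu. now apply H, B.
    + intros u Hu. now apply H, B.
Qed.

Definition Zsum_domfun (c : R) (Hc : 0 < c) : domfun Z.
Proof.
  refine {| dadm := zadm; dfun := Zsum; dwt := fun n => exp (- c * zabs n); dset := fun _ => True;
            dcst := mass c |}.
  - apply zadm_plus.
  - apply zadm_scal.
  - apply Zsum_plus.
  - intros; now apply Zsum_scal.
  - intros f e _ He H. apply Zsum_bound; auto. intros n. apply H. exact I.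
Defined.

Definition Zsum2_domfun (c : R) (Hc : 0 < c) : domfun (Z * Z).
Proof.
  refine {| dadm := fun f => zadm2 (fun m n => f (m, n)); dfun := fun f => Zsum2 (fun m n => f (m, n));
            dwt := fun p => exp (- c * (zabs (fst p) + zabs (snd p))); dset := fun _ => True;
            dcst := mass c * mass c |}.
  - intros f g. apply zadm2_plus.
  - intros k f. apply (zadm2_scal k (fun m n => f (m, n))).
  - intros f g. apply Zsum2_plus.
  - intros k f. apply (Zsum2_scal k (fun m n => f (m, n))).
  - intros f e _ He H. rewrite <- Rmult_assoc. apply Zsum2_bound; auto.
    intros m n. apply (H (m, n)). exact I.
Defined.

(** * Fourier coefficients of periodized Gaussians *)

Lemma pow_exp_bound (p : nat) : forall e, 0 < e -> exists K, 0 <= K /\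
  forall v, 0 <= v -> v ^ p <= K * exp (e * v).
Proof.
  induction p as [|p IH]; intros e He.
  - exists 1. split. lra. intros v Hv. simpl. rewrite Rmult_1_l.
    rewrite <- exp_0 at 1. apply exp_le. nra.
  - destruct (IH (e / 2) ltac:(lra)) as (K & HK & H).
    exists (2 / e * K). split. apply Rmult_le_pos; auto. apply Rlt_le, Rdiv_lt_0_compat; lra.
    intros v Hv. simpl. specialize (H v Hv).
    assert (B : v <= 2 / e * exp (e / 2 * v)).
    { pose proof (exp_ineq1_le (e / 2 * v)).
      replace v with (2 / e * (e / 2 * v)) at 1 by (field; lra).
      apply Rmult_le_compat_l. apply Rlt_le, Rdiv_lt_0_compat; lra. lra. }
    replace (e * v) with (e / 2 * v + e / 2 * v) by field. rewrite exp_plus.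
    replace (2 / e * K * (exp (e / 2 * v) * exp (e / 2 * v)))
      with (2 / e * exp (e / 2 * v) * (K * exp (e / 2 * v))) by ring.
    apply Rmult_le_compat; auto. now apply pow_le.
Qed.

(** The power p is carried along because differentiation in x changes it by one and differentiation
    in a raises it by two. *)
Definition gauss_term (p : nat) (x a : R) (n : Z) : R := (IZR n + x) ^ p * exp (- PI * a * (IZR n + x) ^ 2).
Definition gauss_sum (p : nat) (x a : R) : R := Zsum (gauss_term p x a).

Lemma gauss_term_dom (p : nat) (X a0 : R) : 0 < a0 -> exists c K, 0 < c /\ 0 <= K /\
  forall x a, Rabs x <= X -> a0 <= a -> zdom c K (gauss_term p x a).
Proof.
  intros Ha0. pose proof PI_RGT_0 as HPI.
  assert (Hc : 0 < PI * a0) by (apply Rmult_lt_0_compat; lra).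
  destruct (pow_exp_bound p (PI * a0) Hc) as (K & HK & H).
  exists (PI * a0), (K * exp (PI * a0) * exp (PI * a0 * X)). split; auto.
  split. { pose proof (exp_pos (PI * a0)). pose proof (exp_pos (PI * a0 * X)).
    apply Rmult_le_pos; [apply Rmult_le_pos|]; lra. }
  intros x a Hx Ha n. unfold gauss_term. set (v := Rabs (IZR n + x)).
  assert (Hv : 0 <= v) by apply Rabs_pos.
  rewrite Rabs_mult, <- RPow_abs, (Rabs_pos_eq (exp _)) by (left; apply exp_pos).
  fold v. replace ((IZR n + x) ^ 2) with (v ^ 2) by (unfold v; apply pow2_abs).
  specialize (H v Hv).
  (* From (v - 1)^2 >= 0. Half of the linear exponent then absorbs v^p, the other half remains as
     decay. *)
  assert (B : exp (- PI * a * v ^ 2) <= exp (PI * a0) * exp (- (2 * PI * a0 * v))).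
  { rewrite <- exp_plus. apply exp_le.
    assert (PI * a0 * v ^ 2 <= PI * a * v ^ 2).
    { apply Rmult_le_compat_r. apply pow_le; auto. apply Rmult_le_compat_l; lra. }
    assert (0 <= PI * a0 * (v - 1) ^ 2) by (apply Rmult_le_pos; [lra|apply pow2_ge_0]). nra. }
  assert (Bn : zabs n <= v + X).
  { unfold zabs, v. replace (IZR n) with (IZR n + x + - x) at 1 by ring.
    eapply Rle_trans. apply Rabs_triang. rewrite Rabs_Ropp. lra. }
  apply Rle_trans with (K * exp (PI * a0 * v) * (exp (PI * a0) * exp (- (2 * PI * a0 * v)))).
  { apply Rmult_le_compat; auto. now apply pow_le. left; apply exp_pos. }
  replace (K * exp (PI * a0 * v) * (exp (PI * a0) * exp (- (2 * PI * a0 * v))))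
    with (K * exp (PI * a0) * (exp (PI * a0 * v) * exp (- (2 * PI * a0 * v)))) by ring.
  rewrite (Rmult_assoc (K * exp (PI * a0))). apply Rmult_le_compat_l.
  { apply Rmult_le_pos; auto. left; apply exp_pos. }
  rewrite <- !exp_plus. apply exp_le. nra.
Qed.

Lemma gauss_term_adm p x a : 0 < a -> zadm (gauss_term p x a).
Proof.
  intros Ha. destruct (gauss_term_dom p (Rabs x) a Ha) as (c & K & Hc & HK & H).
  exists c, K. split; auto. apply H; lra.
Qed.

Lemma gauss_sum_bound p X a0 : 0 < a0 -> exists M, 0 <= M /\
  forall x a, Rabs x <= X -> a0 <= a -> Rabs (gauss_sum p x a) <= M.
Proof.
  intros Ha0. destruct (gauss_term_dom p X a0 Ha0) as (c & K & Hc & HK & H).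
  exists (K * mass c). split. pose proof (mass_ge_1 c Hc). nra.
  intros x a Hx Ha. apply Zsum_bound; auto.
Qed.

Definition gauss_term_dx (p : nat) (x a : R) (n : Z) : R :=
  INR p * gauss_term (pred p) x a n + (- 2 * PI * a) * gauss_term (S p) x a n.

Lemma gauss_term_derive_x p x a n : is_derive (fun u => gauss_term p u a n) x (gauss_term_dx p x a n).
Proof.
  unfold gauss_term, gauss_term_dx, gauss_term. auto_derive; auto. destruct p; simpl; ring.
Qed.

Lemma gauss_term_dx_derive_x p x a n : is_derive (fun u => gauss_term_dx p u a n) x
  (INR p * gauss_term_dx (pred p) x a n + (- 2 * PI * a) * gauss_term_dx (S p) x a n).
Proof.
  apply (is_derive_plus (K := R_AbsRing) (V := R_NormedModule)
     (fun u => INR p * gauss_term (pred p) u a n) (fun u => (- 2 * PI * a) * gauss_term (S p) u a n));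
  apply is_derive_scal, gauss_term_derive_x.
Qed.

Lemma gauss_sum_derive_x p x a : 0 < a ->
  is_derive (fun u => gauss_sum p u a) x (INR p * gauss_sum (pred p) x a + (- 2 * PI * a) * gauss_sum (S p) x a).
Proof.
  intros Ha.
  assert (Ex : INR p * gauss_sum (pred p) x a + (- 2 * PI * a) * gauss_sum (S p) x a = Zsum (gauss_term_dx p x a)).
  { unfold gauss_term_dx, gauss_sum. rewrite Zsum_plus by (apply zadm_scal; now apply gauss_term_adm).
    now rewrite !Zsum_scal by now apply gauss_term_adm. }
  rewrite Ex.
  (* These four powers are the ones that occur in the second x-derivative. *)
  destruct (gauss_term_dom (pred (pred p)) (Rabs x + 1) a Ha) as (c1 & K1 & Hc1 & HK1 & H1).
  destruct (gauss_term_dom (S (pred p)) (Rabs x + 1) a Ha) as (c2 & K2 & Hc2 & HK2 & H2).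
  destruct (gauss_term_dom p (Rabs x + 1) a Ha) as (c3 & K3 & Hc3 & HK3 & H3).
  destruct (gauss_term_dom (S (S p)) (Rabs x + 1) a Ha) as (c4 & K4 & Hc4 & HK4 & H4).
  set (c := Rmin (Rmin c1 c2) (Rmin c3 c4)).
  assert (Hc : 0 < c) by (unfold c; repeat apply Rmin_pos; auto).
  assert (c <= c1 /\ c <= c2 /\ c <= c3 /\ c <= c4) as (L1 & L2 & L3 & L4).
  { unfold c. pose proof (Rmin_l (Rmin c1 c2) (Rmin c3 c4)). pose proof (Rmin_r (Rmin c1 c2) (Rmin c3 c4)).
    pose proof (Rmin_l c1 c2). pose proof (Rmin_r c1 c2). pose proof (Rmin_l c3 c4). pose proof (Rmin_r c3 c4). lra. }
  set (b1 := Rabs (INR p) * (Rabs (INR (pred p)) * K1 + Rabs (- 2 * PI * a) * K2)).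
  set (b2 := Rabs (- 2 * PI * a) * (Rabs (INR (S p)) * K3 + Rabs (- 2 * PI * a) * K4)).
  apply (dfun_derive (Zsum_domfun c Hc) (fun u => gauss_term p u a) (fun u => gauss_term_dx p u a)
    (fun u n => INR p * gauss_term_dx (pred p) u a n + (- 2 * PI * a) * gauss_term_dx (S p) u a n) x (b1 + b2) 1 Rlt_0_1).
  - intros u _. now apply gauss_term_adm.
  - apply zadm_plus; apply zadm_scal; now apply gauss_term_adm.
  - intros n u _ Hu. split; [|split]. apply gauss_term_derive_x. apply gauss_term_dx_derive_x.
    assert (Bu : Rabs u <= Rabs x + 1).
    { replace u with ((u - x) + x) by ring. eapply Rle_trans. apply Rabs_triang. lra. }
    pose proof (zdom_weaken _ c _ K1 _ L1 (Rle_refl _) (H1 u a Bu (Rle_refl a)) n) as A1.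
    pose proof (zdom_weaken _ c _ K2 _ L2 (Rle_refl _) (H2 u a Bu (Rle_refl a)) n) as A2.
    pose proof (zdom_weaken _ c _ K3 _ L3 (Rle_refl _) (H3 u a Bu (Rle_refl a)) n) as A3.
    pose proof (zdom_weaken _ c _ K4 _ L4 (Rle_refl _) (H4 u a Bu (Rle_refl a)) n) as A4.
    simpl dwt. set (w := exp (- c * zabs n)) in *.
    unfold gauss_term_dx. eapply Rle_trans. apply Rabs_triang. rewrite Rmult_plus_distr_r.
    apply Rplus_le_compat.
    + unfold b1. rewrite Rabs_mult, (Rmult_assoc (Rabs _)). apply Rmult_le_compat_l. apply Rabs_pos.
      eapply Rle_trans. apply Rabs_triang. rewrite Rmult_plus_distr_r.
      apply Rplus_le_compat; rewrite Rabs_mult, (Rmult_assoc (Rabs _)); apply Rmult_le_compat_l; auto using Rabs_pos.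
    + unfold b2. rewrite Rabs_mult, (Rmult_assoc (Rabs _)). apply Rmult_le_compat_l. apply Rabs_pos.
      eapply Rle_trans. apply Rabs_triang. rewrite Rmult_plus_distr_r.
      apply Rplus_le_compat; rewrite Rabs_mult, (Rmult_assoc (Rabs _)); apply Rmult_le_compat_l; auto using Rabs_pos.
  - unfold b1, b2. apply Rplus_le_le_0_compat; apply Rmult_le_pos; auto using Rabs_pos;
    apply Rplus_le_le_0_compat; apply Rmult_le_pos; auto using Rabs_pos.
Qed.

Lemma gauss_term_derive_a p x a n : is_derive (fun u => gauss_term p x u n) a (- PI * gauss_term (S (S p)) x a n).
Proof. unfold gauss_term. auto_derive; auto. simpl. ring. Qed.

Lemma gauss_sum_derive_a p x a : 0 < a -> is_derive (fun u => gauss_sum p x u) a (- PI * gauss_sum (S (S p)) x a).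
Proof.
  intros Ha.
  assert (Ex : - PI * gauss_sum (S (S p)) x a = Zsum (fun n => - PI * gauss_term (S (S p)) x a n)).
  { rewrite Zsum_scal; auto. now apply gauss_term_adm. }
  rewrite Ex.
  destruct (gauss_term_dom (S (S (S (S p)))) (Rabs x) (a / 2) ltac:(lra)) as (c & K & Hc & HK & H).
  assert (Hu2 : forall u, Rabs (u - a) < a / 2 -> a / 2 <= u).
  { intros u Hu. apply Rabs_def2 in Hu. lra. }
  apply (dfun_derive (Zsum_domfun c Hc) (fun u => gauss_term p x u) (fun u n => - PI * gauss_term (S (S p)) x u n)
    (fun u n => - PI * (- PI * gauss_term (S (S (S (S p)))) x u n)) a (PI * (PI * K)) (a / 2) ltac:(lra)).
  - intros u Hu. apply gauss_term_adm. specialize (Hu2 u Hu). lra.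
  - apply zadm_scal. now apply gauss_term_adm.
  - intros n u _ Hu. split; [|split]. apply gauss_term_derive_a. apply is_derive_scal, gauss_term_derive_a.
    rewrite !Rabs_mult, Rabs_Ropp, (Rabs_pos_eq PI) by (pose proof PI_RGT_0; lra).
    rewrite !Rmult_assoc. pose proof PI_RGT_0.
    repeat (apply Rmult_le_compat_l; [lra|]). apply H. lra. now apply Hu2.
  - pose proof PI_RGT_0. apply Rmult_le_pos; [lra|]. apply Rmult_le_pos; lra.
Qed.

Lemma is_derive_cont (f : R -> R) x l : is_derive f x l -> continuous f x.
Proof. intros H. apply (ex_derive_continuous (V := R_NormedModule) f). now exists l. Qed.

Lemma gauss_sum_cont p a x : 0 < a -> continuous (fun u => gauss_sum p u a) x.
Proof. intros Ha. eapply is_derive_cont. now apply gauss_sum_derive_x. Qed.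

Lemma gauss_sum_periodic p x a : 0 < a -> gauss_sum p (x + 1) a = gauss_sum p x a.
Proof.
  intros Ha. unfold gauss_sum. rewrite <- (Zsum_shift (gauss_term p x a)) by now apply gauss_term_adm.
  apply Zsum_ext. intros n. unfold gauss_term. rewrite plus_IZR.
  replace (IZR n + 1 + x) with (IZR n + (x + 1)) by ring. reflexivity.
Qed.

Lemma cos_2PI_Z (x : R) (k : Z) : cos (x + 2 * PI * IZR k) = cos x.
Proof.
  assert (Hn : forall y n, cos (y + 2 * PI * INR n) = cos y).
  { intros y n. rewrite <- (cos_period y n). f_equal. ring. }
  destruct k as [|p|p].
  - f_equal. ring.
  - rewrite <- (Hn x (Pos.to_nat p)). rewrite INR_IPR. reflexivity.
  - rewrite <- (Hn (x + 2 * PI * IZR (Z.neg p)) (Pos.to_nat p)). f_equal.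
    rewrite INR_IPR. change (IZR (Z.neg p)) with (- IPR p). ring.
Qed.

(** One real family for both sines and cosines: derivatives shift the phase by pi / 2, products
    shift the frequency. *)
Definition trig (k : Z) (phi x : R) : R := cos (2 * PI * IZR k * x + phi).

Lemma trig_derive k phi x : is_derive (trig k phi) x (2 * PI * IZR k * trig k (phi + PI / 2) x).
Proof.
  unfold trig. auto_derive; auto.
  replace (2 * PI * IZR k * x + (phi + PI / 2)) with (PI / 2 + (2 * PI * IZR k * x + phi)) by ring.
  rewrite <- (Ropp_involutive (cos (PI / 2 + _))), <- sin_cos. ring.
Qed.

Lemma trig_cont k phi x : continuous (trig k phi) x.
Proof. eapply is_derive_cont. apply trig_derive. Qed.

Lemma trig_shift k phi x : trig k phi (x + 1) = trig k phi x.
Proof.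
  unfold trig. replace (2 * PI * IZR k * (x + 1) + phi) with (2 * PI * IZR k * x + phi + 2 * PI * IZR k) by ring.
  apply cos_2PI_Z.
Qed.

Lemma trig_shift_Z k phi x n : trig k phi (IZR n + x) = trig k phi x.
Proof.
  unfold trig. replace (2 * PI * IZR k * (IZR n + x) + phi) with (2 * PI * IZR k * x + phi + 2 * PI * IZR (k * n))
    by (rewrite mult_IZR; ring). apply cos_2PI_Z.
Qed.

Lemma cont_mult (f g : R -> R) x : continuous f x -> continuous g x -> continuous (fun x => f x * g x) x.
Proof. intros. apply (continuous_mult (K := R_AbsRing) f g); auto. Qed.

Lemma cont_plus (f g : R -> R) x : continuous f x -> continuous g x -> continuous (fun x => f x + g x) x.
Proof. intros. apply (continuous_plus (V := R_NormedModule) f g); auto. Qed.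

Lemma cont_const (c x : R) : continuous (fun _ => c) x.
Proof. apply continuous_const. Qed.

Lemma RInt_scal' (k : R) (f : R -> R) a b : ex_RInt f a b -> RInt (fun x => k * f x) a b = k * RInt f a b.
Proof. intros. apply (RInt_scal (V := R_CompleteNormedModule) f); auto. Qed.

Lemma RInt_ext' (f g : R -> R) a b : (forall x, f x = g x) -> RInt f a b = RInt g a b.
Proof. intros. apply RInt_ext. auto. Qed.

Lemma RInt_deriv (f f' : R -> R) a b : (forall x, is_derive f x (f' x)) -> (forall x, continuous f' x) ->
  RInt f' a b = f b - f a.
Proof.
  intros D C. apply is_RInt_unique. apply (is_RInt_derive (V := R_CompleteNormedModule) f f'); auto.
Qed.

Lemma RInt_by_parts (f f' g g' : R -> R) a b :
  (forall x, is_derive f x (f' x)) -> (forall x, is_derive g x (g' x)) ->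
  (forall x, continuous f' x) -> (forall x, continuous g' x) -> f b * g b = f a * g a ->
  RInt (fun x => f' x * g x) a b = - RInt (fun x => f x * g' x) a b.
Proof.
  intros Df Dg Cf Cg Hb.
  assert (cf : forall x, continuous f x) by (intros; eapply is_derive_cont; eauto).
  assert (cg : forall x, continuous g x) by (intros; eapply is_derive_cont; eauto).
  pose proof (RInt_deriv (fun x => f x * g x) (fun x => f' x * g x + f x * g' x) a b) as H.
  rewrite RInt_plus' in H.
  - assert (K : RInt (fun x => f' x * g x) a b + RInt (fun x => f x * g' x) a b = f b * g b - f a * g a).
    { apply H. intros x. apply (is_derive_mult (K := R_AbsRing) f g); auto. intros; apply Rmult_comm.
      intros x. apply cont_plus; apply cont_mult; auto. }
    lra.
  - apply cont_ex_RInt. intros; apply cont_mult; auto.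
  - apply cont_ex_RInt. intros; apply cont_mult; auto.
Qed.

Definition RInt_domfun (b : R) : domfun R.
Proof.
  refine {| dadm := fun f => forall x, continuous f x; dfun := fun f => RInt f b (b + 1);
            dwt := fun _ => 1; dset := fun x => b <= x <= b + 1; dcst := 1 |}.
  - intros; apply cont_plus; auto.
  - intros; apply cont_mult; auto. apply cont_const.
  - intros; apply RInt_plus'; apply cont_ex_RInt; auto.
  - intros; apply RInt_scal'; apply cont_ex_RInt; auto.
  - intros f e Hf He H. replace (e * 1) with ((b + 1 - b) * (e * 1)) by ring.
    apply abs_RInt_le_const; auto. lra. now apply cont_ex_RInt.
Defined.

Section Fourier.
Variable b : R.

(** The start b of the period stays free because the uniqueness argument for Fourier coefficients
    only reaches the midpoint b + 1/2. *)
Definition fourier_coef (k : Z) (phi a : R) : R := RInt (fun x => gauss_sum 0 x a * trig k phi x) b (b + 1).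

Lemma Etr_cont p a k phi x : 0 < a -> continuous (fun u => gauss_sum p u a * trig k phi u) x.
Proof. intros. apply cont_mult. now apply gauss_sum_cont. apply trig_cont. Qed.

(** Two integrations by parts over a period, with boundary terms cancelling by periodicity, express
    the second moment through the coefficient itself. The left side is its derivative in a, so this
    is a first-order linear equation. *)
Lemma fourier_coef_ode k phi a : 0 < a ->
  - PI * RInt (fun x => gauss_sum 2 x a * trig k phi x) b (b + 1)
  = (- / (2 * a) + PI * IZR k ^ 2 / a ^ 2) * fourier_coef k phi a.
Proof.
  intros Ha. pose proof PI_RGT_0.
  set (t1 := fun x => 2 * PI * IZR k * trig k (phi + PI / 2) x).
  set (t2 := fun x => - (2 * PI * IZR k) ^ 2 * trig k phi x).
  assert (T1 : forall x, is_derive (trig k phi) x (t1 x)) by (intros; apply trig_derive).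
  assert (T2 : forall x, is_derive t1 x (t2 x)).
  { intros x. unfold t1, t2.
    replace (- (2 * PI * IZR k) ^ 2 * trig k phi x)
      with (2 * PI * IZR k * (2 * PI * IZR k * trig k (phi + PI / 2 + PI / 2) x)).
    apply is_derive_scal, trig_derive.
    unfold trig. replace (2 * PI * IZR k * x + (phi + PI / 2 + PI / 2)) with (2 * PI * IZR k * x + phi + PI) by field.
    rewrite neg_cos. ring. }
  assert (CT1 : forall x, continuous t1 x) by (intros; eapply is_derive_cont; apply T2).
  assert (CT2 : forall x, continuous t2 x) by (intros; apply cont_mult; [apply cont_const|apply trig_cont]).
  assert (D1 : forall x, is_derive (fun u => gauss_sum 1 u a) x (INR 1 * gauss_sum 0 x a + - 2 * PI * a * gauss_sum 2 x a))
    by (intros; apply (gauss_sum_derive_x 1); auto).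
  assert (D0 : forall x, is_derive (fun u => gauss_sum 0 u a) x (INR 0 * gauss_sum 0 x a + - 2 * PI * a * gauss_sum 1 x a))
    by (intros; apply (gauss_sum_derive_x 0); auto).
  assert (CE : forall p x, continuous (fun u => gauss_sum p u a) x) by (intros; apply gauss_sum_cont; auto).
  pose proof (RInt_by_parts (fun u => gauss_sum 1 u a) _ (trig k phi) t1 b (b + 1) D1 T1) as P1.
  pose proof (RInt_by_parts (fun u => gauss_sum 0 u a) _ t1 t2 b (b + 1) D0 T2) as P0.
  assert (Per : forall p, gauss_sum p (b + 1) a = gauss_sum p b a) by (intros; apply gauss_sum_periodic; auto).
  rewrite (RInt_ext' _ (fun x => gauss_sum 0 x a * trig k phi x + (- 2 * PI * a) * (gauss_sum 2 x a * trig k phi x))) in P1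
    by (intros; simpl INR; ring).
  rewrite (RInt_ext' _ (fun x => (- 2 * PI * a) * (gauss_sum 1 x a * t1 x))) in P0
    by (intros; simpl INR; ring).
  rewrite RInt_plus', !RInt_scal' in P1;
    try (apply cont_ex_RInt; intros; try apply cont_mult; auto using cont_const, Etr_cont, cont_mult, trig_cont).
  rewrite (RInt_ext' (fun x => gauss_sum 0 x a * t2 x) (fun x => - (2 * PI * IZR k) ^ 2 * (gauss_sum 0 x a * trig k phi x))) in P0
    by (intros; unfold t2; ring).
  rewrite !RInt_scal' in P0;
    try (apply cont_ex_RInt; intros; try apply cont_mult; auto using cont_const, Etr_cont, cont_mult, trig_cont).
  fold (fourier_coef k phi a) in P0, P1.
  assert (P1' := P1 ltac:(intros; apply cont_plus; apply cont_mult; auto using cont_const) CT1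
                   ltac:(rewrite Per, trig_shift; reflexivity)).
  assert (P0' := P0 ltac:(intros; apply cont_plus; apply cont_mult; auto using cont_const) CT2
                   ltac:(unfold t1; rewrite Per, trig_shift; reflexivity)).
  set (I2 := RInt (fun x => gauss_sum 2 x a * trig k phi x) b (b + 1)) in *.
  set (int1 := RInt (fun x => gauss_sum 1 x a * t1 x) b (b + 1)) in *.
  assert (int1 = - (2 * PI * IZR k) ^ 2 * fourier_coef k phi a / (2 * PI * a)).
  { apply (Rmult_eq_reg_l (- 2 * PI * a)). rewrite P0'. field. lra.
    assert (0 < PI * a) by (apply Rmult_lt_0_compat; lra). lra. }
  assert (I2 = (fourier_coef k phi a + int1) / (2 * PI * a)).
  { apply (Rmult_eq_reg_l (- 2 * PI * a)). apply (Rplus_eq_reg_l (fourier_coef k phi a)). rewrite P1'. field. lra.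
    assert (0 < PI * a) by (apply Rmult_lt_0_compat; lra). lra. }
  rewrite H1, H0. field. lra.
Qed.

Lemma fourier_coef_derive k phi a : 0 < a ->
  is_derive (fourier_coef k phi) a ((- / (2 * a) + PI * IZR k ^ 2 / a ^ 2) * fourier_coef k phi a).
Proof.
  intros Ha. rewrite <- fourier_coef_ode by auto.
  rewrite <- RInt_scal' by (apply cont_ex_RInt; intros; now apply Etr_cont).
  destruct (gauss_sum_bound 4 (Rabs b + 1) (a / 2) ltac:(lra)) as (M & HM & HB).
  assert (Hu2 : forall u, Rabs (u - a) < a / 2 -> a / 2 <= u).
  { intros u Hu. apply Rabs_def2 in Hu. lra. }
  pose proof PI_RGT_0.
  apply (dfun_derive (RInt_domfun b) (fun u x => gauss_sum 0 x u * trig k phi x)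
    (fun u x => - PI * (gauss_sum 2 x u * trig k phi x)) (fun u x => - PI * (- PI * gauss_sum 4 x u * trig k phi x))
    a (PI * (PI * M)) (a / 2) ltac:(lra)).
  - intros u Hu x. apply Etr_cont. specialize (Hu2 u Hu). lra.
  - intros x. apply cont_mult. apply cont_const. now apply Etr_cont.
  - intros x u Hx Hu. simpl in Hx. specialize (Hu2 u Hu). split; [|split].
    + replace (- PI * (gauss_sum 2 x u * trig k phi x)) with (trig k phi x * (- PI * gauss_sum 2 x u)) by ring.
      apply is_derive_ext with (fun v => trig k phi x * gauss_sum 0 x v). intros; apply Rmult_comm.
      apply is_derive_scal. apply gauss_sum_derive_a. lra.
    + apply is_derive_scal.
      replace (- PI * gauss_sum 4 x u * trig k phi x) with (trig k phi x * (- PI * gauss_sum 4 x u)) by ring.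
      apply is_derive_ext with (fun v => trig k phi x * gauss_sum 2 x v). intros; apply Rmult_comm.
      apply is_derive_scal. apply gauss_sum_derive_a. lra.
    + simpl dwt. rewrite Rmult_1_r. rewrite !Rabs_mult, Rabs_Ropp, (Rabs_pos_eq PI) by lra.
      rewrite Rmult_assoc. apply Rmult_le_compat_l. lra. apply Rmult_le_compat_l. lra.
      rewrite <- (Rmult_1_r M). apply Rmult_le_compat; try apply Rabs_pos.
      apply HB; auto. unfold Rabs. destruct (Rcase_abs b), (Rcase_abs x); lra.
      apply Rabs_le, COS_bound.
  - apply Rmult_le_pos; [lra|]. apply Rmult_le_pos; lra.
Qed.

(** The equation is solved by constant multiples of exp (- pi k^2 / a) / sqrt a, so this product
    does not depend on a. *)
Definition scaled_coef (k : Z) (phi a : R) : R := sqrt a * exp (PI * IZR k ^ 2 / a) * fourier_coef k phi a.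

Lemma scaled_coef_const k phi a a' : 0 < a -> 0 < a' -> scaled_coef k phi a = scaled_coef k phi a'.
Proof.
  assert (D : forall u, 0 < u -> is_derive (scaled_coef k phi) u 0).
  { intros u Hu. unfold scaled_coef. pose proof (fourier_coef_derive k phi u Hu) as F.
    assert (Hs : 0 < sqrt u) by now apply sqrt_lt_R0.
    assert (D1 : is_derive (fun u => sqrt u * exp (PI * IZR k ^ 2 / u)) u
      ((/ (2 * u) - PI * IZR k ^ 2 / u ^ 2) * (sqrt u * exp (PI * IZR k ^ 2 / u)))).
    { auto_derive. repeat split; lra.
      set (e := exp _). clearbody e. clear F.
      assert (Eu : u = sqrt u * sqrt u) by (symmetry; apply sqrt_sqrt; lra).
      set (s := sqrt u) in *. clearbody s. subst u. field. lra. }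
    pose proof (is_derive_mult (K := R_AbsRing) (fun u => sqrt u * exp (PI * IZR k ^ 2 / u)) (fourier_coef k phi) u _ _ D1 F Rmult_comm) as G.
    match type of G with is_derive _ _ ?l => replace 0 with l; auto end.
    unfold plus, mult; simpl. ring. }
  assert (W : forall a a', 0 < a -> a < a' -> scaled_coef k phi a = scaled_coef k phi a').
  { intros u v Hu Huv.
    destruct (MVT_between (scaled_coef k phi) (fun _ => 0) u (v - u)) as (c & _ & Hc).
    - intros w Hw. apply D. replace (u + (v - u)) with v in Hw by ring. rewrite Rmin_left in Hw; lra.
    - replace (u + (v - u)) with v in Hc by ring. lra. }
  intros Ha Ha'. destruct (Rtotal_order a a') as [L|[->|L]]; auto. symmetry; auto.
Qed.

Lemma cos_quadratic phi v : Rabs (cos (v + phi) - cos phi + v * sin phi) <= v ^ 2.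
Proof.
  pose proof (taylor2_bound cos (fun u => - sin u) (fun u => - cos u) phi v 1) as T.
  replace (cos (v + phi) - cos phi + v * sin phi) with (cos (phi + v) - cos phi - v * - sin phi)
    by (rewrite (Rplus_comm phi); ring).
  rewrite <- (Rmult_1_r (v ^ 2)). apply T.
  - intros u _. auto_derive; auto. ring.
  - intros u _. auto_derive; auto. ring.
  - intros u _. rewrite Rabs_Ropp. apply Rabs_le, COS_bound.
Qed.

(** With w = pi a v^2 / 2 the inequality w exp (- w) <= 1 spends half of the Gaussian on the factor
    v^2 and gains 2 / (pi a); the other half is summed. *)
Lemma gauss_sum_2_bound : exists M, 0 <= M /\ forall x a, b <= x <= b + 1 -> 1 <= a -> Rabs (gauss_sum 2 x a) <= M / a.
Proof.
  destruct (gauss_sum_bound 0 (Rabs b + 1) (1 / 2) ltac:(lra)) as (M & HM & HB).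
  pose proof PI_RGT_0 as HPI. exists (2 / PI * M). split.
  { apply Rmult_le_pos; auto. apply Rlt_le, Rdiv_lt_0_compat; lra. }
  intros x a Hx Ha.
  assert (Hq : 0 < 2 / (PI * a)) by (apply Rdiv_lt_0_compat; [lra|apply Rmult_lt_0_compat; lra]).
  apply Rle_trans with (2 / (PI * a) * gauss_sum 0 x (a / 2)).
  - unfold gauss_sum. rewrite <- Zsum_scal by (apply gauss_term_adm; lra).
    apply Zsum_abs. apply gauss_term_adm; lra. apply zadm_scal, gauss_term_adm; lra.
    intros n. unfold gauss_term. set (v := IZR n + x).
    rewrite Rabs_pos_eq by (apply Rmult_le_pos; [apply pow2_ge_0|left; apply exp_pos]).
    simpl (v ^ 0). rewrite Rmult_1_l.
    set (w := PI * (a / 2) * v ^ 2).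
    replace (- PI * (a / 2) * v ^ 2) with (- w) by (unfold w; ring).
    replace (- PI * a * v ^ 2) with (- w + - w) by (unfold w; field).
    replace (v ^ 2) with (2 / (PI * a) * w) by (unfold w; field; lra).
    rewrite Rmult_assoc. apply Rmult_le_compat_l. lra.
    rewrite exp_plus, <- Rmult_assoc. rewrite <- (Rmult_1_l (exp (- w))) at 3.
    apply Rmult_le_compat_r. left; apply exp_pos.
    pose proof (exp_ineq1_le w). rewrite exp_Ropp. pose proof (exp_pos w).
    apply (Rmult_le_reg_r (exp w)); auto. rewrite Rmult_assoc, Rinv_l by lra. lra.
  - replace (2 / PI * M / a) with (2 / (PI * a) * M) by (field; lra).
    apply Rmult_le_compat_l. lra. eapply Rle_trans. apply Rle_abs. apply HB; [|lra].
    unfold Rabs. destruct (Rcase_abs b), (Rcase_abs x); lra.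
Qed.

Lemma gauss_sum_1_int a : 0 < a -> RInt (fun x => gauss_sum 1 x a) b (b + 1) = 0.
Proof.
  intros Ha.
  pose proof PI_RGT_0 as HPI.
  assert (H : RInt (fun x => INR 0 * gauss_sum 0 x a + - 2 * PI * a * gauss_sum 1 x a) b (b + 1) = gauss_sum 0 (b + 1) a - gauss_sum 0 b a).
  { apply (RInt_deriv (fun x => gauss_sum 0 x a)). intros; apply (gauss_sum_derive_x 0); auto.
    intros. apply cont_plus; apply cont_mult; try apply cont_const; now apply gauss_sum_cont. }
  rewrite gauss_sum_periodic in H by auto.
  rewrite (RInt_ext' _ (fun x => - 2 * PI * a * gauss_sum 1 x a)) in H by (intros; simpl INR; ring).
  rewrite RInt_scal' in H by (apply cont_ex_RInt; intros; now apply gauss_sum_cont).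
  assert (0 < PI * a) by (apply Rmult_lt_0_compat; lra).
  apply (Rmult_eq_reg_l (- 2 * PI * a)); lra.
Qed.

(** For large a the mass sits near the integers, where [trig k phi] equals cos phi. The first-order
    term of the cosine integrates to 0 by [gauss_sum_1_int], so the error is a second moment, O(1 /
    a). A first-order error O(1 / sqrt a) would not survive multiplication by sqrt a. *)
Lemma fourier_coef_close k phi : exists M, 0 <= M /\ forall a, 1 <= a ->
  Rabs (fourier_coef k phi a - cos phi * fourier_coef 0 0 a) <= M / a.
Proof.
  destruct gauss_sum_2_bound as (M & HM & HB). pose proof PI_RGT_0 as HPI.
  set (q := 2 * PI * IZR k). exists (q ^ 2 * M). split. { apply Rmult_le_pos; auto. apply pow2_ge_0. }
  intros a Ha.
  assert (Ha0 : 0 < a) by lra.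
  assert (Eq : fourier_coef k phi a - cos phi * fourier_coef 0 0 a =
    RInt (fun x => (gauss_sum 0 x a * trig k phi x + (- cos phi) * (gauss_sum 0 x a * trig 0 0 x)) + (q * sin phi) * gauss_sum 1 x a) b (b + 1)).
  { rewrite RInt_plus', RInt_plus', !RInt_scal', gauss_sum_1_int; auto;
    try (apply cont_ex_RInt; intros; repeat (apply cont_plus || apply cont_mult); auto using cont_const, gauss_sum_cont, trig_cont).
    unfold fourier_coef. ring. }
  rewrite Eq. replace (q ^ 2 * M / a) with ((b + 1 - b) * (q ^ 2 * (M / a))) by (field; lra).
  apply abs_RInt_le_const. lra.
  { apply cont_ex_RInt; intros; repeat (apply cont_plus || apply cont_mult); auto using cont_const, gauss_sum_cont, trig_cont. }
  intros x Hx.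
  eapply Rle_trans; [|apply Rmult_le_compat_l; [apply pow2_ge_0|apply (HB x a); auto]].
  assert (A0 : zadm (gauss_term 0 x a)) by now apply gauss_term_adm.
  assert (A1 : zadm (gauss_term 1 x a)) by now apply gauss_term_adm.
  assert (A2 : zadm (gauss_term 2 x a)) by now apply gauss_term_adm.
  assert (tr0 : trig 0 0 x = 1). { unfold trig. rewrite <- cos_0. f_equal. ring. }
  replace (gauss_sum 0 x a * trig k phi x + - cos phi * (gauss_sum 0 x a * trig 0 0 x) + q * sin phi * gauss_sum 1 x a)
    with (Zsum (fun n => (trig k phi x - cos phi) * gauss_term 0 x a n + (q * sin phi) * gauss_term 1 x a n)).
  2:{ rewrite Zsum_plus, !Zsum_scal by auto using zadm_scal. unfold gauss_sum. rewrite tr0. ring. }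
  apply Rle_trans with (q ^ 2 * gauss_sum 2 x a).
  2:{ apply Rmult_le_compat_l. apply pow2_ge_0. apply Rle_abs. }
  unfold gauss_sum. rewrite <- Zsum_scal by auto.
  apply Zsum_abs; auto using zadm_plus, zadm_scal.
  intros n. rewrite <- (trig_shift_Z k phi x n). unfold gauss_term, trig. fold q. set (v := IZR n + x).
  replace ((cos (q * v + phi) - cos phi) * (v ^ 0 * exp (- PI * a * v ^ 2)) +
    q * sin phi * (v ^ 1 * exp (- PI * a * v ^ 2)))
    with ((cos (q * v + phi) - cos phi + q * v * sin phi) * exp (- PI * a * v ^ 2)) by ring.
  rewrite Rabs_mult, (Rabs_pos_eq (exp _)) by (left; apply exp_pos).
  rewrite <- Rmult_assoc. apply Rmult_le_compat_r. left; apply exp_pos.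
  eapply Rle_trans. apply cos_quadratic. right; ring.
Qed.

(** The integral of the Gaussian over the line in disguise; it is shown to be 1 further on. *)
Definition gauss_mass : R := scaled_coef 0 0 1.

(** The scaled coefficient is constant in a, hence equal to its limit along a = N + 1; there it
    differs from cos phi times the mass by M / sqrt a, after the exponential factor, which tends to
    1, is moved to the other side. *)
Lemma scaled_coef_eq k phi a : 0 < a -> scaled_coef k phi a = cos phi * gauss_mass.
Proof.
  intros Ha. destruct (fourier_coef_close k phi) as (M & HM & HB). pose proof PI_RGT_0 as HPI.
  set (g := scaled_coef k phi a).
  assert (B : forall N : nat, Rabs (exp (- (PI * IZR k ^ 2 / INR (S N))) * g - cos phi * gauss_mass) <= M * / sqrt (INR (S N))).
  { intros N. set (A := INR (S N)). assert (HA : 1 <= A) by (unfold A; rewrite S_INR; pose proof (pos_INR N); lra).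
    assert (Hs : 0 < sqrt A) by (apply sqrt_lt_R0; lra).
    unfold g. rewrite (scaled_coef_const k phi a A) by lra. unfold gauss_mass. rewrite (scaled_coef_const 0 0 1 A) by lra.
    unfold scaled_coef. replace (PI * 0 ^ 2 / A) with 0 by (field; lra). rewrite exp_0, Rmult_1_r.
    replace (exp (- (PI * IZR k ^ 2 / A)) * (sqrt A * exp (PI * IZR k ^ 2 / A) * fourier_coef k phi A))
      with (sqrt A * fourier_coef k phi A * (exp (- (PI * IZR k ^ 2 / A)) * exp (PI * IZR k ^ 2 / A))) by ring.
    rewrite <- exp_plus, Rplus_opp_l, exp_0, Rmult_1_r.
    replace (sqrt A * fourier_coef k phi A - cos phi * (sqrt A * fourier_coef 0 0 A)) with (sqrt A * (fourier_coef k phi A - cos phi * fourier_coef 0 0 A)) by ring.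
    rewrite Rabs_mult, (Rabs_pos_eq (sqrt A)) by lra.
    apply Rle_trans with (sqrt A * (M / A)). apply Rmult_le_compat_l; [lra|auto].
    right. rewrite <- (sqrt_sqrt A) at 2 by lra. field. lra. }
  assert (lattice_sum : is_lim_seq (fun N => / INR (S N)) 0).
  { apply (is_lim_seq_incr_1 (fun N => / INR N)). apply (is_lim_seq_inv INR p_infty).
    apply is_lim_seq_INR. discriminate. }
  assert (L1 : is_lim_seq (fun N => exp (- (PI * IZR k ^ 2 / INR (S N))) * g - cos phi * gauss_mass) (g - cos phi * gauss_mass)).
  { apply is_lim_seq_minus'; [|apply is_lim_seq_const].
    replace (Finite g) with (Rbar_mult (exp (- (PI * IZR k ^ 2 * 0))) g).
    2:{ simpl. rewrite Rmult_0_r, Ropp_0, exp_0. f_equal. ring. }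
    apply (is_lim_seq_scal_r _ g (exp (- (PI * IZR k ^ 2 * 0)))).
    apply (is_lim_seq_continuous exp). apply derivable_continuous_pt, derivable_pt_exp.
    apply (is_lim_seq_opp _ (Finite (PI * IZR k ^ 2 * 0))).
    apply (is_lim_seq_scal_l (fun N => / INR (S N)) (PI * IZR k ^ 2) 0). auto. }
  assert (L2 : is_lim_seq (fun N => M * / sqrt (INR (S N))) (M * 0)).
  { apply (is_lim_seq_scal_l _ M 0).
    apply (is_lim_seq_ext (fun N => sqrt (/ INR (S N)))).
    intros N. apply sqrt_inv.
    replace 0 with (sqrt 0) by apply sqrt_0.
    apply (is_lim_seq_continuous sqrt). apply continuity_pt_sqrt. lra. auto. }
  apply is_lim_seq_abs in L1.
  pose proof (is_lim_seq_le _ _ _ _ B L1 L2) as F. simpl in F. rewrite Rmult_0_r in F.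
  destruct (Req_dec (g - cos phi * gauss_mass) 0). lra. pose proof (Rabs_pos_lt _ H). lra.
Qed.
End Fourier.

(** * Poisson summation and inversion of theta *)

Section Uniqueness.
Variable b : R.
Variable D : R -> R.
Hypothesis HD : forall x, continuous D x.

Definition annihilates (p : R -> R) : Prop :=
  (forall x, continuous p x) /\ forall k phi, RInt (fun x => D x * p x * trig k phi x) b (b + 1) = 0 :> R.

(** The product-to-sum formula moves the frequency to k + 1 and k - 1, and the hypothesis covers all
    frequencies and phases. *)
Lemma annihilates_mult_cos (p : R -> R) (x0 : R) :
  annihilates p -> annihilates (fun x => p x * cos (2 * PI * (x - x0))).
Proof.
  intros [Cp H].
  assert (Cc : forall x, continuous (fun x => cos (2 * PI * (x - x0))) x).
  { intros x. eapply is_derive_cont. auto_derive; auto. }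
  split. { intros x. apply cont_mult; auto. }
  intros k phi.
  rewrite (RInt_ext' _ (fun x => / 2 * (D x * p x * trig (k + 1) (phi - 2 * PI * x0) x)
                               + / 2 * (D x * p x * trig (k - 1) (phi + 2 * PI * x0) x))).
  - rewrite RInt_plus', !RInt_scal', !H; try ring;
    try (apply cont_ex_RInt; intros x); repeat apply cont_mult; auto using trig_cont, cont_const.
  - intros x. unfold trig. rewrite plus_IZR, minus_IZR.
    set (u := 2 * PI * IZR k * x + phi). set (v := 2 * PI * (x - x0)).
    replace (2 * PI * (IZR k + 1) * x + (phi - 2 * PI * x0)) with (u + v) by (unfold u, v; ring).
    replace (2 * PI * (IZR k - 1) * x + (phi + 2 * PI * x0)) with (u - v) by (unfold u, v; ring).
    rewrite cos_plus, cos_minus. field.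
Qed.

Lemma annihilates_affine (p : R -> R) (x0 c : R) :
  annihilates p -> annihilates (fun x => p x * (cos (2 * PI * (x - x0)) + c)).
Proof.
  intros H. pose proof (annihilates_mult_cos p x0 H) as [C1 H1]. destruct H as [Cp H].
  split.
  - intros x. apply cont_mult; auto. apply cont_plus; [|apply cont_const].
    eapply is_derive_cont. auto_derive; auto.
  - intros k phi.
    rewrite (RInt_ext' _ (fun x => D x * (p x * cos (2 * PI * (x - x0))) * trig k phi x
                                  + c * (D x * p x * trig k phi x))) by (intros; ring).
    rewrite RInt_plus', RInt_scal', H1, H; try ring;
    try (apply cont_ex_RInt; intros x); repeat apply cont_mult; auto using trig_cont, cont_const.
    eapply is_derive_cont. auto_derive; auto.
Qed.

(* Lebesgue's argument: powers of [1 + cos 2 pi (x - x0) - cos 2 pi delta] concentrate at [x0]. *)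
Lemma fourier_nonpos :
  (forall k phi, RInt (fun x => D x * trig k phi x) b (b + 1) = 0 :> R) -> D (b + 1 / 2) <= 0.
Proof.
  intros H. set (x0 := b + 1 / 2). pose proof PI_RGT_0 as HPI.
  destruct (Rle_dec (D x0) 0) as [|Hpos]; auto. exfalso. apply Rnot_le_lt in Hpos.
  set (eta := D x0 / 2).

  assert (C1 : exists d, 0 < d /\ d < 1 / 2 /\ forall x, Rabs (x - x0) <= d -> eta <= D x).
  { assert (He : 0 < eta) by (unfold eta; lra).
    pose proof (proj1 (filterlim_locally (F := locally x0) D (D x0)) (HD x0) (mkposreal eta He)) as [d Hd].
    exists (Rmin (d / 2) (1 / 4)). pose proof (cond_pos d).
    split; [|split]. apply Rmin_pos; lra. pose proof (Rmin_r (d / 2) (1 / 4)); lra.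
    intros x Hx. pose proof (Rmin_l (d / 2) (1 / 4)).
    assert (B : ball x0 d x) by (unfold ball; simpl; unfold AbsRing_ball, abs, minus, plus, opp; simpl; unfold Rminus in Hx; lra).
    specialize (Hd x B). unfold ball in Hd; simpl in Hd; unfold AbsRing_ball, abs, minus, plus, opp in Hd; simpl in Hd.
    apply Rabs_def2 in Hd. unfold eta in *. lra. }
  destruct C1 as (d & Hd & Hd2 & HDd).
  (* Normalized so that q = 1 at distance d from x0: q >= 1 inside, |q| <= 1 outside up to distance
     1/2, and q >= 1 + beta within d / 2. *)
  set (c := 1 - cos (2 * PI * d)). set (q := fun x => cos (2 * PI * (x - x0)) + c).
  assert (Hq : forall N, annihilates (fun x => q x ^ N)).
  { induction N as [|N IH].
    - split. intros; apply cont_const. intros k phi. rewrite <- (H k phi). apply RInt_ext'. intros; simpl; ring.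
    - pose proof (annihilates_affine _ x0 c IH) as A.
      destruct A as [A1 A2]. split.
      + intros x. eapply (continuous_ext (fun x => q x ^ N * (cos (2 * PI * (x - x0)) + c))); auto.
        intros y. simpl. unfold q. apply Rmult_comm.
      + intros k phi. rewrite <- (A2 k phi). apply RInt_ext'. intros x. simpl. unfold q. ring. }
  assert (Cq : forall N x, continuous (fun x => D x * q x ^ N) x).
  { intros N x. apply cont_mult; auto. apply Hq. }
  assert (I0 : forall N, RInt (fun x => D x * q x ^ N) b (b + 1) = 0).
  { intros N. rewrite <- (proj2 (Hq N) 0%Z 0). apply RInt_ext'. intros x. unfold trig.
    replace (2 * PI * 0 * x + 0) with 0 by ring. rewrite cos_0. ring. }
  destruct (continuity_ab_maj (fun x => Rabs (D x)) b (b + 1)) as (xM & HM & _).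
  { lra. } { intros x _. apply continuity_pt_filterlim. apply (continuous_comp D Rabs); auto. apply continuous_Rabs. }
  set (M := Rabs (D xM)) in *.
  assert (cosd : forall x, Rabs (x - x0) <= d -> cos (2 * PI * d) <= cos (2 * PI * (x - x0))).
  { intros x Hx. assert (E : cos (2 * PI * (x - x0)) = cos (2 * PI * Rabs (x - x0))).
    { unfold Rabs. destruct (Rcase_abs (x - x0)); auto.
      rewrite <- cos_neg. f_equal. ring. }
    rewrite E. pose proof (Rabs_pos (x - x0)). apply cos_decr_1; nra. }
  assert (cosd' : forall x, d <= Rabs (x - x0) <= 1 / 2 -> cos (2 * PI * (x - x0)) <= cos (2 * PI * d)).
  { intros x Hx. assert (E : cos (2 * PI * (x - x0)) = cos (2 * PI * Rabs (x - x0))).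
    { unfold Rabs. destruct (Rcase_abs (x - x0)); auto.
      rewrite <- cos_neg. f_equal. ring. }
    rewrite E. apply cos_decr_1; nra. }
  set (beta := cos (2 * PI * (d / 2)) - cos (2 * PI * d)).
  assert (Hbeta : 0 < beta). { unfold beta. pose proof (cos_decreasing_1 (2 * PI * (d / 2)) (2 * PI * d)). assert (cos (2 * PI * d) < cos (2 * PI * (d / 2))) by (apply H0; nra). lra. }
  assert (q1 : forall x, Rabs (x - x0) <= d -> 1 <= q x).
  { intros x Hx. unfold q, c. specialize (cosd x Hx). lra. }
  assert (q2 : forall x, Rabs (x - x0) <= d / 2 -> 1 + beta <= q x).
  { intros x Hx. unfold q, c, beta.
    assert (cos (2 * PI * (d / 2)) <= cos (2 * PI * (x - x0))); [|lra].
    assert (E : cos (2 * PI * (x - x0)) = cos (2 * PI * Rabs (x - x0))).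
    { unfold Rabs. destruct (Rcase_abs (x - x0)); auto.
      rewrite <- cos_neg. f_equal. ring. }
    rewrite E. pose proof (Rabs_pos (x - x0)). apply cos_decr_1; nra. }
  assert (q3 : forall x, d <= Rabs (x - x0) <= 1 / 2 -> Rabs (q x) <= 1).
  { intros x Hx. unfold q, c. specialize (cosd' x Hx). apply Rabs_le.
    pose proof (COS_bound (2 * PI * (x - x0))). pose proof (COS_bound (2 * PI * d)). lra. }
  (* The total integral is 0. The core contributes at least the left side, the ring between d / 2
     and d is nonnegative, and the rest of the period costs at most M. *)
  assert (Big : forall N, eta * (1 + beta) ^ N * d <= M).
  { intros N. set (f := fun x => D x * q x ^ N).
    assert (Ch : RInt f b (x0 - d) + RInt f (x0 - d) (x0 - d / 2) + RInt f (x0 - d / 2) (x0 + d / 2)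
        + RInt f (x0 + d / 2) (x0 + d) + RInt f (x0 + d) (b + 1) = 0).
    { rewrite !RInt_Chasles' by apply Cq. apply I0. }
    assert (Out : forall u v, u <= v -> (forall x, u <= x <= v -> b <= x <= b + 1 /\ d <= Rabs (x - x0)) ->
              - M * (v - u) <= RInt f u v).
    { intros u v Huv Hx.
      assert (Rabs (RInt f u v) <= (v - u) * M).
      { apply abs_RInt_le_const; auto. apply cont_ex_RInt, Cq.
        intros x Hx'. destruct (Hx x Hx') as [Hb Ha]. unfold f. rewrite Rabs_mult.
        rewrite <- (Rmult_1_r M). apply Rmult_le_compat; try apply Rabs_pos. now apply HM.
        rewrite <- RPow_abs. rewrite <- (pow1 N). apply pow_incr. split. apply Rabs_pos. apply q3.
        split; auto. unfold x0. apply Rabs_le; lra. }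
      apply Rabs_le_between in H0. lra. }
    assert (O1 : - M * (x0 - d - b) <= RInt f b (x0 - d)).
    { apply Out. unfold x0; lra. intros x Hx. split. unfold x0 in Hx; lra. rewrite Rabs_left1; lra. }
    assert (O2 : - M * (b + 1 - (x0 + d)) <= RInt f (x0 + d) (b + 1)).
    { apply Out. unfold x0; lra. intros x Hx. split. unfold x0 in Hx; lra. rewrite Rabs_pos_eq; lra. }
    assert (P : forall u v, u <= v -> (forall x, u <= x <= v -> Rabs (x - x0) <= d) -> 0 <= RInt f u v).
    { intros u v Huv Hx. apply RInt_ge_0; auto. apply cont_ex_RInt, Cq.
      intros x Hx'. specialize (Hx x ltac:(lra)). unfold f. apply Rmult_le_pos.
      specialize (HDd x Hx). unfold eta in HDd. lra. apply pow_le. specialize (q1 x Hx). lra. }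
    assert (P1 : 0 <= RInt f (x0 - d) (x0 - d / 2)) by (apply P; [lra|intros; apply Rabs_le; lra]).
    assert (P2 : 0 <= RInt f (x0 + d / 2) (x0 + d)) by (apply P; [lra|intros; apply Rabs_le; lra]).
    assert (P3 : eta * (1 + beta) ^ N * d <= RInt f (x0 - d / 2) (x0 + d / 2)).
    { replace (eta * (1 + beta) ^ N * d) with (RInt (fun _ => eta * (1 + beta) ^ N) (x0 - d / 2) (x0 + d / 2)).
      2:{ rewrite RInt_const. unfold scal; simpl; unfold mult; simpl. field. }
      apply RInt_le. lra. apply ex_RInt_const. apply cont_ex_RInt, Cq.
      intros x Hx. assert (Hx' : Rabs (x - x0) <= d / 2) by (apply Rabs_le; lra).
      unfold f. apply Rmult_le_compat. unfold eta; lra. apply pow_le; lra. apply HDd; lra.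
      apply pow_incr. specialize (q2 x Hx'). lra. }
    assert (0 <= M) by apply Rabs_pos. unfold x0 in *. nra. }
  assert (He : 0 < eta * d) by (apply Rmult_lt_0_compat; unfold eta; lra).
  destruct (Pow_x_infinity (1 + beta) ltac:(rewrite Rabs_pos_eq; lra) ((M + 1) / (eta * d))) as [N HN].
  specialize (HN N (Nat.le_refl N)). rewrite Rabs_pos_eq in HN by (apply pow_le; lra).
  specialize (Big N).
  assert ((M + 1) / (eta * d) * (eta * d) <= (1 + beta) ^ N * (eta * d)) by (apply Rmult_le_compat_r; lra).
  replace ((M + 1) / (eta * d) * (eta * d)) with (M + 1) in H0 by (field; split; [lra|unfold eta; lra]).
  lra.
Qed.
End Uniqueness.

Lemma fourier_unique (b : R) (D : R -> R) : (forall x, continuous D x) ->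
  (forall k phi, RInt (fun x => D x * trig k phi x) b (b + 1) = 0 :> R) -> D (b + 1 / 2) = 0.
Proof.
  intros HD H. apply Rle_antisym. now apply fourier_nonpos.
  assert (- D (b + 1 / 2) <= 0); [|lra].
  apply (fourier_nonpos b (fun x => - D x)).
  - intros x. apply (continuous_opp (V := R_NormedModule)). auto.
  - intros k phi. rewrite (RInt_ext' _ (fun x => -1 * (D x * trig k phi x))) by (intros; ring).
    rewrite RInt_scal', H. ring. apply cont_ex_RInt. intros. apply cont_mult; auto using trig_cont.
Qed.

(** Term of frequency n on the dual side of Poisson summation; only cosines appear, since sines
    cancel between n and - n. *)
Definition fourier_term (a : R) (n : Z) (x : R) : R := gauss_term 0 0 a n * trig n 0 x.

Lemma fourier_term_dom a : 0 < a -> exists c K, 0 < c /\ 0 <= K /\ forall x, zdom c K (fun n => fourier_term a n x).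
Proof.
  intros Ha. destruct (gauss_term_dom 0 0 a Ha) as (c & K & Hc & HK & H). exists c, K. split; [|split]; auto.
  intros x n. unfold fourier_term. rewrite Rabs_mult.
  specialize (H 0 a ltac:(rewrite Rabs_R0; lra) ltac:(lra) n).
  rewrite <- (Rmult_1_r (K * _)). apply Rmult_le_compat; auto using Rabs_pos.
  apply Rabs_le, COS_bound.
Qed.

Lemma zsum_cont N (f : Z -> R -> R) x : (forall n, continuous (f n) x) ->
  continuous (fun u => zsum N (fun n => f n u)) x.
Proof.
  intros H. induction N. apply H.
  apply cont_plus; auto. apply cont_plus; auto.
Qed.

Lemma Zsum_cont c K (f : Z -> R -> R) x : 0 < c -> (forall u, zdom c K (fun n => f n u)) ->
  (forall n, continuous (f n) x) -> continuous (fun u => Zsum (fun n => f n u)) x.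
Proof.
  intros Hc Hd Hf. apply filterlim_locally. intros eps.
  pose proof (tail_lim c Hc) as T. apply is_lim_seq_spec in T.
  pose proof (zdom_pos _ _ _ (Hd x)) as HK. pose proof (cond_pos eps) as He.
  destruct (T (mkposreal (eps / (4 * (K + 1))) ltac:(apply Rdiv_lt_0_compat; lra))) as [N HN].
  specialize (HN N (Nat.le_refl N)). simpl in HN. rewrite Rminus_0_r in HN.
  rewrite Rabs_pos_eq in HN by (left; now apply tail_pos).
  assert (B : forall u, Rabs (Zsum (fun n => f n u) - zsum N (fun n => f n u)) <= eps / 4).
  { intros u. eapply Rle_trans. apply (Zsum_tail c K); auto.
    pose proof (tail_pos c N Hc).
    apply Rle_trans with ((K + 1) * ztail c N). nra.
    apply Rle_trans with ((K + 1) * (eps / (4 * (K + 1)))). apply Rmult_le_compat_l; lra.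
    right; field; lra. }
  pose proof (zsum_cont N f x Hf) as C.
  pose proof (proj1 (filterlim_locally (F := locally x) _ _) C (mkposreal (eps / 4) ltac:(lra))) as [d Hd'].
  exists d. intros u Hu. specialize (Hd' u Hu).
  unfold ball in *; simpl in *; unfold AbsRing_ball, abs, minus, plus, opp in *; simpl in *.
  pose proof (B u) as B1. pose proof (B x) as B2.
  apply Rabs_le_between in B1. apply Rabs_le_between in B2. apply Rabs_def2 in Hd'.
  apply Rabs_def1; lra.
Qed.

Lemma RInt_zsum N (f : Z -> R -> R) a b : (forall n x, continuous (f n) x) ->
  RInt (fun x => zsum N (fun n => f n x)) a b = zsum N (fun n => RInt (f n) a b).
Proof.
  intros H. induction N. reflexivity.
  change (RInt (fun x => (zsum N (fun n => f n x) + f (Z.of_nat (S N)) x) + f (- Z.of_nat (S N))%Z x) a b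
    = zsum N (fun n => RInt (f n) a b) + RInt (f (Z.of_nat (S N))) a b + RInt (f (- Z.of_nat (S N))%Z) a b).
  rewrite RInt_plus', RInt_plus', IHN; auto;
  apply cont_ex_RInt; intros; try apply cont_plus; auto; apply zsum_cont; auto.
Qed.

Lemma RInt_Zsum c K (f : Z -> R -> R) b : 0 < c -> (forall u, zdom c K (fun n => f n u)) ->
  (forall n x, continuous (f n) x) ->
  RInt (fun x => Zsum (fun n => f n x)) b (b + 1) = Zsum (fun n => RInt (f n) b (b + 1)).
Proof.
  intros Hc Hd Hf. symmetry. apply Zsum_unique.
  set (S := fun x => Zsum (fun n => f n x)).
  assert (B : forall N, Rabs (RInt S b (b + 1) - zsum N (fun n => RInt (f n) b (b + 1))) <= K * ztail c N).
  { intros N. rewrite <- RInt_zsum by auto. rewrite <- RInt_minus'.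
    replace (K * ztail c N) with ((b + 1 - b) * (K * ztail c N)) by ring.
    apply abs_RInt_le_const. lra.
    - apply cont_ex_RInt. intros x. apply cont_minus. apply (Zsum_cont c K); auto. apply zsum_cont; auto.
    - intros x _. apply Zsum_tail; auto.
    - apply cont_ex_RInt. intros x. apply (Zsum_cont c K); auto.
    - apply cont_ex_RInt. intros x. apply zsum_cont; auto. }
  apply (is_lim_seq_le_le (fun N => RInt S b (b + 1) - K * ztail c N) _ (fun N => RInt S b (b + 1) + K * ztail c N)).
  - intros N. specialize (B N). apply Rabs_le_between in B. lra.
  - replace (Finite (RInt S b (b + 1))) with (Finite (RInt S b (b + 1) - K * 0)) by (f_equal; ring).
    apply is_lim_seq_minus'. apply is_lim_seq_const. apply (is_lim_seq_scal_l _ K 0). now apply tail_lim.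
  - replace (Finite (RInt S b (b + 1))) with (Finite (RInt S b (b + 1) + K * 0)) by (f_equal; ring).
    apply is_lim_seq_plus'. apply is_lim_seq_const. apply (is_lim_seq_scal_l _ K 0). now apply tail_lim.
Qed.

Lemma trig_int k phi b : RInt (trig k phi) b (b + 1) = (if Z.eqb k 0 then cos phi else 0) :> R.
Proof.
  pose proof PI_RGT_0 as HPI. destruct (Z.eqb_spec k 0) as [->|Hk].
  - rewrite (RInt_ext' _ (fun _ => cos phi)).
    rewrite RInt_const. unfold scal; simpl; unfold mult; simpl. ring.
    intros x. unfold trig. f_equal. ring.
  - assert (Hk' : IZR k <> 0) by (intros E; apply Hk; now apply eq_IZR).
    assert (Hq : 2 * PI * IZR k <> 0) by (apply Rmult_integral_contrapositive; split; lra).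
    rewrite (RInt_deriv (fun x => / (2 * PI * IZR k) * trig k (phi - PI / 2) x)).
    + rewrite trig_shift. ring.
    + intros x.
      replace (trig k phi x) with (/ (2 * PI * IZR k) * (2 * PI * IZR k * trig k (phi - PI / 2 + PI / 2) x)).
      apply is_derive_scal. apply trig_derive.
      replace (phi - PI / 2 + PI / 2) with phi by ring. field. repeat split; try lra; auto.
    + intros; apply trig_cont.
Qed.

Lemma trig_mul k n phi x : trig n 0 x * trig k phi x = / 2 * trig (k + n) phi x + / 2 * trig (k - n) phi x.
Proof.
  unfold trig. rewrite plus_IZR, minus_IZR.
  replace (2 * PI * (IZR k + IZR n) * x + phi) with ((2 * PI * IZR k * x + phi) + (2 * PI * IZR n * x + 0)) by ring.
  replace (2 * PI * (IZR k - IZR n) * x + phi) with ((2 * PI * IZR k * x + phi) - (2 * PI * IZR n * x + 0)) by ring.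
  set (u := 2 * PI * IZR k * x + phi). set (v := 2 * PI * IZR n * x + 0).
  rewrite cos_plus, cos_minus. field.
Qed.

Lemma zsum_delta k (c : R) N : (Z.abs_nat k <= N)%nat ->
  zsum N (fun n => if Z.eqb n k then c else 0) = c.
Proof.
  induction N; intros H.
  - simpl. destruct k; simpl; auto; lia.
  - change (zsum N (fun n => if Z.eqb n k then c else 0)
      + (if Z.eqb (Z.of_nat (S N)) k then c else 0) + (if Z.eqb (- Z.of_nat (S N)) k then c else 0) = c).
    destruct (Nat.eq_dec (Z.abs_nat k) (S N)) as [Ek|Ek].
    + assert (Z0 : zsum N (fun n => if Z.eqb n k then c else 0) = 0).
      { clear IHN H. assert (Hk : forall M, (M <= N)%nat -> zsum M (fun n => if Z.eqb n k then c else 0) = 0).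
        { induction M; intros HM. cbn [zsum]. destruct (Z.eqb_spec 0 k); auto; lia.
          change (zsum M (fun n => if Z.eqb n k then c else 0)
            + (if Z.eqb (Z.of_nat (S M)) k then c else 0) + (if Z.eqb (- Z.of_nat (S M)) k then c else 0) = 0).
          rewrite IHM by lia.
          destruct (Z.eqb_spec (Z.of_nat (S M)) k); [lia|]. destruct (Z.eqb_spec (- Z.of_nat (S M)) k); [lia|]. ring. }
        now apply Hk. }
      rewrite Z0.
      destruct (Z.eqb_spec (Z.of_nat (S N)) k), (Z.eqb_spec (- Z.of_nat (S N)) k); try lia; ring.
    + rewrite IHN by lia.
      destruct (Z.eqb_spec (Z.of_nat (S N)) k), (Z.eqb_spec (- Z.of_nat (S N)) k); try lia; ring.
Qed.

Lemma is_lim_seq_eventually_const (u : nat -> R) (l : R) N0 :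
  (forall n, (N0 <= n)%nat -> u n = l) -> is_lim_seq u l.
Proof.
  intros H. apply (is_lim_seq_ext_loc (fun _ => l)). exists N0. intros; symmetry; auto.
  apply is_lim_seq_const.
Qed.

Lemma V_fourier_coef a b k phi : 0 < a ->
  RInt (fun x => Zsum (fun n => fourier_term a n x) * trig k phi x) b (b + 1) = cos phi * exp (- PI * a * IZR k ^ 2) :> R.
Proof.
  intros Ha. destruct (fourier_term_dom a Ha) as (c & K & Hc & HK & H).
  assert (Cv : forall n x, continuous (fourier_term a n) x) by (intros; apply cont_mult; [apply cont_const|apply trig_cont]).
  rewrite (RInt_ext' _ (fun x => Zsum (fun n => fourier_term a n x * trig k phi x))).
  2:{ intros x. rewrite Rmult_comm, <- Zsum_scal. apply Zsum_ext. intros; ring.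
      exists c, K. split; auto. }
  rewrite (RInt_Zsum c K); auto.
  2:{ intros x n. rewrite Rabs_mult. rewrite <- (Rmult_1_r (K * _)).
      apply Rmult_le_compat; auto using Rabs_pos. apply H. apply Rabs_le, COS_bound. }
  2:{ intros n x. apply cont_mult; auto using trig_cont. }
  set (w := cos phi * exp (- PI * a * IZR k ^ 2)).
  (* The frequencies n = k and n = - k each give half of the value; for k = 0 the two halves fall on
     the same index and add up. *)
  rewrite (Zsum_ext _ (fun n => (if Z.eqb n (- k) then w / 2 else 0) + (if Z.eqb n k then w / 2 else 0))).
  - apply Zsum_unique. apply (is_lim_seq_eventually_const _ _ (Z.abs_nat k)).
    intros N HN. rewrite zsum_plus, !zsum_delta; try lia. field.
  - intros n.
    rewrite (RInt_ext' _ (fun x => (gauss_term 0 0 a n / 2) * trig (k + n) phi x + (gauss_term 0 0 a n / 2) * trig (k - n) phi x)).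
    2:{ intros x. unfold fourier_term. rewrite Rmult_assoc, trig_mul. field. }
    rewrite RInt_plus', !RInt_scal', !trig_int;
      try (apply cont_ex_RInt; intros; try apply cont_mult; auto using trig_cont, cont_const).
    assert (En : forall j, IZR n ^ 2 = IZR j ^ 2 -> gauss_term 0 0 a n = exp (- PI * a * IZR j ^ 2)).
    { intros j Ej. unfold gauss_term. simpl (_ ^ 0). rewrite Rmult_1_l, Rplus_0_r, Ej. reflexivity. }
    f_equal.
    + destruct (Z.eqb_spec (k + n) 0), (Z.eqb_spec n (- k)); try lia; try ring.
      subst n. rewrite (En k) by (rewrite opp_IZR; ring). unfold w. field.
    + destruct (Z.eqb_spec (k - n) 0), (Z.eqb_spec n k); try lia; try ring.
      subst n. rewrite (En k) by ring. unfold w. field.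
Qed.

(** Both sides have the same Fourier coefficients, by [scaled_coef_eq] and [V_fourier_coef]. *)
Lemma poisson_gauss_mass x a : 0 < a ->
  sqrt a * gauss_sum 0 x a = gauss_mass (x - 1 / 2) * Zsum (fun n => fourier_term (/ a) n x).
Proof.
  intros Ha. assert (Hia : 0 < / a) by now apply Rinv_0_lt_compat.
  (* Places x at the midpoint of the period, where [fourier_unique] applies. *)
  set (b := x - 1 / 2).
  set (D := fun u => sqrt a * gauss_sum 0 u a + (- gauss_mass b) * Zsum (fun n => fourier_term (/ a) n u)).
  assert (CV : forall u, continuous (fun u => Zsum (fun n => fourier_term (/ a) n u)) u).
  { intros u. destruct (fourier_term_dom (/ a) Hia) as (c & K & Hc & HK & H). apply (Zsum_cont c K); auto.
    intros n. apply cont_mult; [apply cont_const|apply trig_cont]. }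
  assert (CE : forall u, continuous (fun u => gauss_sum 0 u a) u) by (intros; now apply gauss_sum_cont).
  assert (Z : D (b + 1 / 2) = 0).
  { apply fourier_unique.
    - intros u. apply cont_plus; apply cont_mult; auto using cont_const.
    - intros k phi. unfold D.
      rewrite (RInt_ext' _ (fun u => sqrt a * (gauss_sum 0 u a * trig k phi u) +
        (- gauss_mass b) * (Zsum (fun n => fourier_term (/ a) n u) * trig k phi u))) by (intros; ring).
      rewrite RInt_plus', !RInt_scal', V_fourier_coef;
        try (apply cont_ex_RInt; intros; repeat apply cont_mult; auto using cont_const, trig_cont); auto.
      fold (fourier_coef b k phi a). pose proof (scaled_coef_eq b k phi a Ha) as G. unfold scaled_coef in G.
      rewrite Ropp_mult_distr_l_reverse, <- (Rmult_assoc (gauss_mass b)), (Rmult_comm (gauss_mass b)), <- G.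
      replace (sqrt a * exp (PI * IZR k ^ 2 / a) * fourier_coef b k phi a * exp (- PI * / a * IZR k ^ 2))
        with (sqrt a * fourier_coef b k phi a * (exp (PI * IZR k ^ 2 / a) * exp (- PI * / a * IZR k ^ 2))) by ring.
      rewrite <- exp_plus. replace (PI * IZR k ^ 2 / a + - PI * / a * IZR k ^ 2) with 0 by (field; lra).
      rewrite exp_0. ring. }
  unfold D in Z. replace (b + 1 / 2) with x in Z by (unfold b; ring). lra.
Qed.

Lemma gauss_mass_indep b b' : gauss_mass b = gauss_mass b'.
Proof.
  unfold gauss_mass, scaled_coef. f_equal. unfold fourier_coef.
  set (f := fun x => gauss_sum 0 x 1 * trig 0 0 x).
  assert (Cf : forall x, continuous f x) by (intros; apply Etr_cont; lra).
  assert (W : forall b, RInt f b (b + 1) = RInt f 0 1).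
  { intros c. rewrite <- (RInt_Chasles' f c 1 (c + 1)), <- (RInt_Chasles' f c 0 1) by auto.
    assert (Sh : RInt f 1 (c + 1) = RInt f 0 c).
    { pose proof (RInt_comp_lin (V := R_CompleteNormedModule) f 1 1 0 c) as L.
      replace (RInt f 1 (c + 1)) with (RInt f (1 * 0 + 1) (1 * c + 1)) by (f_equal; ring).
      rewrite <- L by (apply cont_ex_RInt; auto). apply RInt_ext.
      intros y _. unfold scal; simpl; unfold mult; simpl. unfold f.
      rewrite Rmult_1_l, Rmult_1_l, gauss_sum_periodic, trig_shift by lra. reflexivity. }
    rewrite Sh.
    pose proof (RInt_Chasles' f c 0 c Cf) as Q. rewrite (RInt_point c f) in Q.
    unfold zero in Q; simpl in Q. lra. }
  now rewrite !W.
Qed.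

Lemma gauss_term_pos x a n : 0 < gauss_term 0 x a n.
Proof. unfold gauss_term. simpl (_ ^ 0). rewrite Rmult_1_l. apply exp_pos. Qed.

(** At x = 0 and a = 1 both sides of the summation formula contain the same positive sum, so the
    constant is 1. *)
Lemma gauss_mass_1 b : gauss_mass b = 1.
Proof.
  rewrite (gauss_mass_indep b (0 - 1 / 2)).
  pose proof (poisson_gauss_mass 0 1 Rlt_0_1) as H. rewrite sqrt_1, Rinv_1, Rmult_1_l in H.
  assert (Ev : Zsum (fun n => fourier_term 1 n 0) = gauss_sum 0 0 1).
  { apply Zsum_ext. intros n. unfold fourier_term, trig. replace (2 * PI * IZR n * 0 + 0) with 0 by ring. rewrite cos_0. ring. }
  rewrite Ev in H.
  assert (Pos : 0 < gauss_sum 0 0 1).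
  { apply Rlt_le_trans with (gauss_term 0 0 1 0). apply gauss_term_pos.
    replace (gauss_term 0 0 1 0) with (Zsum (fun n => if Z.eqb n 0 then gauss_term 0 0 1 0 else 0)).
    - apply Zsum_le.
      + exists 1, (gauss_term 0 0 1 0). split. lra. intros n. unfold zabs. destruct (Z.eqb_spec n 0) as [->|].
        rewrite Rabs_R0, Rmult_0_r, exp_0, Rmult_1_r. rewrite Rabs_pos_eq. lra. left; apply gauss_term_pos.
        rewrite Rabs_R0. apply Rmult_le_pos; left. apply gauss_term_pos. apply exp_pos.
      + apply gauss_term_adm; lra.
      + intros n. destruct (Z.eqb_spec n 0) as [->|]. lra. left; apply gauss_term_pos.
    - apply Zsum_unique. apply (is_lim_seq_eventually_const _ _ 0). intros N _. apply zsum_delta. simpl; lia. }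
  apply (Rmult_eq_reg_r (gauss_sum 0 0 1)); lra.
Qed.

Theorem poisson_gauss x a : 0 < a -> gauss_sum 0 x a = / sqrt a * Zsum (fun n => fourier_term (/ a) n x).
Proof.
  intros Ha. pose proof (poisson_gauss_mass x a Ha) as H. rewrite gauss_mass_1, Rmult_1_l in H.
  rewrite <- H. field. apply Rgt_not_eq, sqrt_lt_R0; auto.
Qed.

(** * The theta function of the lattice *)

Definition qform (x y : R) (m n : Z) : R := ((IZR m * x + IZR n) ^ 2 + (IZR m * y) ^ 2) / y.
Definition theta (x y t : R) : R := Zsum2 (fun m n => exp (- PI * t * qform x y m n)).

(** The terms after Poisson summation in n alone. They are invariant under exchanging m and n
    together with t and 1 / t. *)
Definition dual_term (x y t : R) (m n : Z) : R :=
  exp (- PI * y * (t * IZR m ^ 2 + / t * IZR n ^ 2)) * cos (2 * PI * IZR m * IZR n * x).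

Lemma dual_adm x y t : 0 < y -> 0 < t -> zadm2 (dual_term x y t).
Proof.
  intros Hy Ht. unfold dual_term.
  assert (Hyt : 0 < y / t) by (apply Rdiv_lt_0_compat; auto).
  assert (Ht' : 0 < t * y) by (apply Rmult_lt_0_compat; auto).
  destruct (fourier_term_dom (y / t) Hyt) as (c1 & K1 & Hc1 & HK1 & H1).
  destruct (gauss_term_dom 0 0 (t * y) Ht') as (c2 & K2 & Hc2 & HK2 & H2).
  exists (Rmin c1 c2), (K2 * K1). split. apply Rmin_pos; auto.
    intros m n.
    specialize (H2 0 (t * y) ltac:(rewrite Rabs_R0; lra) ltac:(lra)).
    pose proof (zdom_weaken _ (Rmin c1 c2) _ K1 _ (Rmin_l _ _) (Rle_refl _) (H1 (IZR m * x)) n) as B1.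
    pose proof (zdom_weaken _ (Rmin c1 c2) _ K2 _ (Rmin_r _ _) (Rle_refl _) H2 m) as B2.
    cbv beta in B1, B2.
    replace (exp (- PI * y * (t * IZR m ^ 2 + / t * IZR n ^ 2)) * cos (2 * PI * IZR m * IZR n * x))
      with (gauss_term 0 0 (t * y) m * fourier_term (y / t) n (IZR m * x)).
    - rewrite Rabs_mult.
      replace (K2 * K1 * exp (- Rmin c1 c2 * (zabs m + zabs n)))
        with ((K2 * exp (- Rmin c1 c2 * zabs m)) * (K1 * exp (- Rmin c1 c2 * zabs n))).
      apply Rmult_le_compat; auto using Rabs_pos.
      rewrite Rmult_plus_distr_l, exp_plus. ring.
    - unfold fourier_term, gauss_term, trig. rewrite !pow_O, !Rmult_1_l, !Rplus_0_r, <- Rmult_assoc, <- exp_plus.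
      f_equal. f_equal. field. lra. f_equal. ring.
Qed.

Lemma theta_poisson x y t : 0 < y -> 0 < t ->
  theta x y t = sqrt (y / t) *
    Zsum2 (dual_term x y t).
Proof.
  intros Hy Ht. unfold theta.
  assert (Hty : 0 < t / y) by (apply Rdiv_lt_0_compat; auto).
  assert (Hyt : 0 < y / t) by (apply Rdiv_lt_0_compat; auto).
  assert (Ht' : 0 < t * y) by (apply Rmult_lt_0_compat; auto).
  destruct (fourier_term_dom (y / t) Hyt) as (c1 & K1 & Hc1 & HK1 & H1).
  rewrite <- Zsum2_scal by now apply dual_adm. unfold Zsum2. apply Zsum_ext. intros m.
  (* For fixed m the sum over n is a periodized Gaussian of parameter t / y at the point m x; the
     part of Q coming from m y factors out. *)
  set (e := exp (- PI * t * (IZR m ^ 2 * y))).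
  rewrite (Zsum_ext _ (fun n => e * gauss_term 0 (IZR m * x) (t / y) n)).
  2:{ intros n. unfold e, gauss_term. rewrite pow_O, Rmult_1_l, <- exp_plus. f_equal. unfold qform. field. lra. }
  rewrite Zsum_scal by now apply gauss_term_adm. fold (gauss_sum 0 (IZR m * x) (t / y)). rewrite poisson_gauss by auto.
  replace (/ sqrt (t / y)) with (sqrt (y / t)).
  2:{ rewrite <- sqrt_inv. f_equal. field. lra. }
  rewrite <- Rmult_assoc, <- Zsum_scal.
  2:{ exists c1, K1. split; auto. replace (/ (t / y)) with (y / t) by (field; lra). apply H1. }
  apply Zsum_ext. intros n. unfold e, fourier_term, gauss_term, trig, dual_term.
  rewrite !pow_O, !Rmult_1_l, !Rplus_0_r.
  rewrite (Rmult_comm (exp _) (sqrt _)), Rmult_assoc. f_equal.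
  rewrite <- Rmult_assoc, <- exp_plus. f_equal. f_equal. field. lra. f_equal. ring.
Qed.

(** Exchange m and n in the dual sum; the prefactors compare as sqrt (y t) = t sqrt (y / t). *)
Theorem theta_inv x y t : 0 < y -> 0 < t -> theta x y (/ t) = t * theta x y t.
Proof.
  intros Hy Ht. pose proof (Rinv_0_lt_compat t Ht) as Hit.
  rewrite !theta_poisson by auto.
  rewrite (Zsum2_swap (dual_term x y (/ t))) by now apply dual_adm.
  rewrite (Zsum2_ext _ (dual_term x y t)).
  - rewrite <- Rmult_assoc. f_equal.
    replace (y / / t) with (t * t * (y / t)) by (field; lra).
    rewrite sqrt_mult_alt by nra. rewrite sqrt_square by lra. reflexivity.
  - intros m n. unfold dual_term. rewrite Rinv_inv. f_equal. f_equal. ring. f_equal. ring.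
Qed.

(** * Lattice sums with polynomial weights *)

(** The origin is left out here, so that sums decay as t tends to infinity; with i = j = k = 0 the
    total is theta - 1. *)
Definition lattice_term (i j k : nat) (x y t : R) (m n : Z) : R :=
  if (Z.eqb m 0 && Z.eqb n 0)%bool then 0
  else (IZR m * x + IZR n) ^ i * (IZR m * y) ^ j * (/ y) ^ k * exp (- PI * t * qform x y m n).

Lemma lattice_size (m n : Z) : (Z.eqb m 0 && Z.eqb n 0)%bool = false -> 1 <= zabs m + zabs n.
Proof.
  intros H. unfold zabs. rewrite <- !abs_IZR, <- plus_IZR. apply IZR_le.
  destruct (Z.eqb_spec m 0), (Z.eqb_spec n 0); simpl in H; try discriminate; lia.
Qed.

(** Positive definiteness of Q, uniform for z in a compact rectangle of the upper half-plane. *)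
Lemma qform_lower (X y0 y1 : R) : 0 < y0 -> exists d, 0 < d /\ forall x y m n,
  Rabs x <= X -> y0 <= y <= y1 -> d * (zabs m + zabs n) ^ 2 <= qform x y m n.
Proof.
  (* With A = m x + n and B = m y, the bounds n^2 <= 2 A^2 + 2 m^2 X^2 and m^2 <= B^2 / y0^2 give
     m^2 + n^2 <= k (A^2 + B^2). The further factor 2 comes from (|m| + |n|)^2, and [Rmax 1 y1] from
     the division by y. *)
  intros Hy0. set (k := 2 + (2 * X ^ 2 + 1) / y0 ^ 2).
  assert (Hk : 0 < (2 * X ^ 2 + 1) / y0 ^ 2).
  { apply Rdiv_lt_0_compat. pose proof (pow2_ge_0 X); lra. apply pow_lt; auto. }
  exists (/ (2 * k * Rmax 1 y1)).
  assert (Hm1 : 1 <= Rmax 1 y1) by apply Rmax_l.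
  assert (Hp : 0 < 2 * k * Rmax 1 y1) by (apply Rmult_lt_0_compat; unfold k; lra).
  split. now apply Rinv_0_lt_compat.
  intros x y m n Hx Hy. pose proof (Rmax_r 1 y1) as Hm.
  unfold qform, zabs. set (M := IZR m). set (N := IZR n). set (A := M * x + N). set (B := M * y).
  assert (H1 : (Rabs M + Rabs N) ^ 2 <= 2 * (M ^ 2 + N ^ 2)).
  { rewrite <- (pow2_abs M), <- (pow2_abs N). pose proof (pow2_ge_0 (Rabs M - Rabs N)). nra. }
  assert (Hx2 : x ^ 2 <= X ^ 2).
  { rewrite <- (pow2_abs x). apply pow_incr. split; auto. apply Rabs_pos. }
  assert (H2 : N ^ 2 <= 2 * A ^ 2 + 2 * M ^ 2 * X ^ 2).
  { replace N with (A - M * x) at 1 by (unfold A; ring).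
    pose proof (pow2_ge_0 (A + M * x)). pose proof (pow2_ge_0 M).
    assert (M ^ 2 * x ^ 2 <= M ^ 2 * X ^ 2) by (apply Rmult_le_compat_l; auto). nra. }
  assert (H3 : M ^ 2 * y0 ^ 2 <= B ^ 2).
  { unfold B. rewrite Rpow_mult_distr. apply Rmult_le_compat_l. apply pow2_ge_0. apply pow_incr. lra. }
  assert (H4 : M ^ 2 + N ^ 2 <= k * (A ^ 2 + B ^ 2)).
  { apply Rle_trans with (2 * A ^ 2 + (2 * X ^ 2 + 1) * M ^ 2). nra.
    assert ((2 * X ^ 2 + 1) * M ^ 2 <= (2 * X ^ 2 + 1) / y0 ^ 2 * B ^ 2).
    { replace ((2 * X ^ 2 + 1) * M ^ 2) with ((2 * X ^ 2 + 1) / y0 ^ 2 * (M ^ 2 * y0 ^ 2)) by (field; lra).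
      apply Rmult_le_compat_l; lra. }
    pose proof (pow2_ge_0 A). pose proof (pow2_ge_0 B). unfold k. nra. }
  apply (Rmult_le_reg_l (2 * k * Rmax 1 y1)); auto.
  rewrite <- Rmult_assoc, Rinv_r, Rmult_1_l by lra.
  apply Rle_trans with (2 * k * (A ^ 2 + B ^ 2)). nra.
  rewrite (Rmult_assoc (2 * k) (Rmax 1 y1)). apply Rmult_le_compat_l. unfold k; lra.
  pose proof (pow2_ge_0 A). pose proof (pow2_ge_0 B).
  assert (0 <= (A ^ 2 + B ^ 2) / y) by (apply Rmult_le_pos; [lra|left; apply Rinv_0_lt_compat; lra]).
  apply Rle_trans with (y * ((A ^ 2 + B ^ 2) / y)). right; field; lra.
  apply Rmult_le_compat_r; lra.
Qed.

(** Exponential decay in the lattice point and in t at once, locally uniform in z: the first serves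
    the sums, the second the integrals over [1, oo). *)
Definition lattice_dom (f : R -> R -> R -> Z -> Z -> R) : Prop :=
  forall X y0 y1 t0, 0 < y0 -> 0 < t0 -> exists c K, 0 < c /\ 0 <= K /\
  forall x y t, Rabs x <= X -> y0 <= y <= y1 -> t0 <= t -> zdom2 c (K * exp (- c * t)) (f x y t).

Lemma lattice_term_dom i j k : lattice_dom (lattice_term i j k).
Proof.
  intros X y0 y1 t0 Hy0 Ht0. pose proof PI_RGT_0 as HPI.
  destruct (qform_lower X y0 y1 Hy0) as (d & Hd & Hq).
  (* Half of t Q is used for decay in t, since Q >= d, and half for decay in the lattice, since Q >=
     d N and t >= t0. Half of c0 is later given up to absorb the polynomial of degree i + j. *)
  set (c0 := Rmin (PI * d / 2) (PI * t0 * d / 2)).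
  assert (Hpd : 0 < PI * d) by (apply Rmult_lt_0_compat; auto).
  assert (Hc0 : 0 < c0). { unfold c0. apply Rmin_pos. lra. apply Rdiv_lt_0_compat; [|lra]. apply Rmult_lt_0_compat; auto. apply Rmult_lt_0_compat; auto. }
  assert (L1 : c0 <= PI * d / 2) by apply Rmin_l.
  assert (L2 : c0 <= PI * t0 * d / 2) by apply Rmin_r.
  destruct (pow_exp_bound (i + j) (c0 / 2) ltac:(lra)) as (K' & HK' & Hpe).
  set (X1 := Rabs X + 1). set (Y1 := Rabs y1).
  exists (c0 / 2), (X1 ^ i * Y1 ^ j * (/ y0) ^ k * K').
  assert (HX1 : 0 <= X1) by (unfold X1; pose proof (Rabs_pos X); lra).
  assert (HY1 : 0 <= Y1) by apply Rabs_pos.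
  assert (Hiy0 : 0 < / y0) by now apply Rinv_0_lt_compat.
  assert (HP : 0 <= X1 ^ i * Y1 ^ j * (/ y0) ^ k).
  { repeat apply Rmult_le_pos; apply pow_le; lra. }
  split. lra. split. now apply Rmult_le_pos.
  intros x y t Hx Hy Ht m n. set (N := zabs m + zabs n).
  assert (HN0 : 0 <= N) by (unfold N; pose proof (zabs_pos m); pose proof (zabs_pos n); lra).
  assert (HR : 0 <= X1 ^ i * Y1 ^ j * (/ y0) ^ k * K' * exp (- (c0 / 2) * t) * exp (- (c0 / 2) * N)).
  { apply Rmult_le_pos; [|left; apply exp_pos]. apply Rmult_le_pos; [|left; apply exp_pos]. now apply Rmult_le_pos. }
  unfold lattice_term. destruct (Z.eqb m 0 && Z.eqb n 0)%bool eqn:Emn. rewrite Rabs_R0; auto.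
  pose proof (lattice_size m n Emn) as HN. fold N in HN.
  specialize (Hq x y m n Hx Hy). fold N in Hq.
  assert (HNN : 0 <= d * (N * (N - 1))) by (apply Rmult_le_pos; nra).
  assert (HqN : d * N <= qform x y m n) by lra.
  assert (Hq1 : d <= qform x y m n) by nra.
  rewrite !Rabs_mult, (Rabs_pos_eq (exp _)) by (left; apply exp_pos).
  rewrite <- !RPow_abs.
  assert (B1 : Rabs (IZR m * x + IZR n) <= X1 * N).
  { eapply Rle_trans. apply Rabs_triang. rewrite Rabs_mult. fold (zabs m). fold (zabs n).
    pose proof (Rle_abs X). assert (zabs m * Rabs x <= zabs m * X1) by (apply Rmult_le_compat_l; [apply zabs_pos|unfold X1; lra]).
    assert (zabs n <= zabs n * X1). { rewrite <- (Rmult_1_r (zabs n)) at 1. apply Rmult_le_compat_l. apply zabs_pos. unfold X1. pose proof (Rabs_pos X). lra. }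
    unfold N. lra. }
  assert (B2 : Rabs (IZR m * y) <= Y1 * N).
  { rewrite Rabs_mult. fold (zabs m). rewrite (Rabs_pos_eq y) by lra. rewrite Rmult_comm.
    pose proof (zabs_pos m). pose proof (zabs_pos n). apply Rmult_le_compat; try lra.
    unfold Y1. pose proof (Rle_abs y1). lra. unfold N. lra. }
  assert (B3 : Rabs (/ y) <= / y0).
  { rewrite Rabs_pos_eq. apply Rinv_le_contravar; lra. left; apply Rinv_0_lt_compat; lra. }
  assert (B4 : exp (- PI * t * qform x y m n) <= exp (- c0 * t) * exp (- c0 * N)).
  { rewrite <- exp_plus. apply exp_le.
    assert (0 <= t * (qform x y m n - d)) by (apply Rmult_le_pos; lra).
    assert (0 <= (t - t0) * (qform x y m n)) by (apply Rmult_le_pos; nra).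
    assert (0 <= t0 * (qform x y m n - d * N)) by (apply Rmult_le_pos; lra).
    assert (t * d / 2 + t0 * d * N / 2 <= t * qform x y m n) by lra.
    assert (PI * (t * d / 2 + t0 * d * N / 2) <= PI * (t * qform x y m n)) by (apply Rmult_le_compat_l; lra).
    assert (c0 * t <= PI * d / 2 * t) by (apply Rmult_le_compat_r; lra).
    assert (c0 * N <= PI * t0 * d / 2 * N) by (apply Rmult_le_compat_r; lra).
    lra. }
  assert (B5 : N ^ (i + j) <= K' * exp (c0 / 2 * N)) by now apply Hpe.
  apply Rle_trans with ((X1 * N) ^ i * (Y1 * N) ^ j * (/ y0) ^ k * (exp (- c0 * t) * exp (- c0 * N))).
  { assert (0 <= exp (- c0 * t) * exp (- c0 * N)) by (apply Rmult_le_pos; left; apply exp_pos).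
    repeat (apply Rmult_le_compat; [| | |try apply pow_incr; try (split; [apply Rabs_pos|]); auto]);
    repeat apply Rmult_le_pos; try apply pow_le; try apply Rabs_pos; try (left; apply exp_pos).
    apply pow_incr. split; auto. apply Rabs_pos. }
  replace ((X1 * N) ^ i * (Y1 * N) ^ j * (/ y0) ^ k * (exp (- c0 * t) * exp (- c0 * N)))
    with (X1 ^ i * Y1 ^ j * (/ y0) ^ k * (N ^ (i + j) * (exp (- c0 * t) * exp (- c0 * N)))).
  2:{ rewrite !Rpow_mult_distr, pow_add. ring. }
  rewrite !(Rmult_assoc (X1 ^ i * Y1 ^ j * (/ y0) ^ k)). apply Rmult_le_compat_l; auto.
  apply Rle_trans with (K' * exp (c0 / 2 * N) * (exp (- c0 * t) * exp (- c0 * N))).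
  { apply Rmult_le_compat_r; auto. apply Rmult_le_pos; left; apply exp_pos. }
  rewrite !Rmult_assoc. apply Rmult_le_compat_l; auto.
  rewrite <- !exp_plus. apply exp_le. nra.
Qed.

Lemma lattice_dom_plus f g : lattice_dom f -> lattice_dom g -> lattice_dom (fun x y t m n => f x y t m n + g x y t m n).
Proof.
  intros Hf Hg X y0 y1 t0 Hy0 Ht0.
  destruct (Hf X y0 y1 t0 Hy0 Ht0) as (c & K & Hc & HK & H).
  destruct (Hg X y0 y1 t0 Hy0 Ht0) as (c' & K' & Hc' & HK' & H').
  exists (Rmin c c'), (K + K'). split. apply Rmin_pos; auto. split. lra.
  intros x y t Hx Hy Ht m n. specialize (H x y t Hx Hy Ht m n). specialize (H' x y t Hx Hy Ht m n).
  eapply Rle_trans. apply Rabs_triang.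
  set (N := zabs m + zabs n) in *.
  assert (HN0 : 0 <= N) by (unfold N; pose proof (zabs_pos m); pose proof (zabs_pos n); lra).
  pose proof (Rmin_l c c'). pose proof (Rmin_r c c'). set (r := Rmin c c') in *.
  assert (E : forall q L, r <= q -> 0 <= L -> L * exp (- q * t) * exp (- q * N) <= L * exp (- r * t) * exp (- r * N)).
  { intros q L Hq HL. rewrite !Rmult_assoc. apply Rmult_le_compat_l; auto. rewrite <- !exp_plus. apply exp_le. nra. }
  pose proof (E c K H0 HK). pose proof (E c' K' H1 HK'). lra.
Qed.

Lemma lattice_dom_scal a f : lattice_dom f -> lattice_dom (fun x y t m n => a * f x y t m n).
Proof.
  intros Hf X y0 y1 t0 Hy0 Ht0.
  destruct (Hf X y0 y1 t0 Hy0 Ht0) as (c & K & Hc & HK & H).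
  exists c, (Rabs a * K). split; auto. split. apply Rmult_le_pos; auto. apply Rabs_pos.
  intros x y t Hx Hy Ht m n. rewrite Rabs_mult, !Rmult_assoc. apply Rmult_le_compat_l. apply Rabs_pos.
  rewrite <- Rmult_assoc. now apply H.
Qed.

Lemma lattice_dom_pow_t a f : lattice_dom f -> lattice_dom (fun x y t m n => t ^ a * f x y t m n).
Proof.
  intros Hf X y0 y1 t0 Hy0 Ht0.
  destruct (Hf X y0 y1 t0 Hy0 Ht0) as (c & K & Hc & HK & H).
  destruct (pow_exp_bound a (c / 2) ltac:(lra)) as (K' & HK' & Hpe).
  exists (c / 2), (K' * K). split. lra. split. now apply Rmult_le_pos.
  intros x y t Hx Hy Ht m n. rewrite Rabs_mult, <- RPow_abs, (Rabs_pos_eq t) by lra.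
  set (N := zabs m + zabs n).
  assert (HN0 : 0 <= N) by (unfold N; pose proof (zabs_pos m); pose proof (zabs_pos n); lra).
  apply Rle_trans with (K' * exp (c / 2 * t) * (K * exp (- c * t) * exp (- c * N))).
  - apply Rmult_le_compat. apply pow_le; lra. apply Rabs_pos. apply Hpe; lra. now apply H.
  - replace (K' * exp (c / 2 * t) * (K * exp (- c * t) * exp (- c * N)))
      with (K' * K * (exp (c / 2 * t) * exp (- c * t) * exp (- c * N))) by ring.
    rewrite !(Rmult_assoc (K' * K)). apply Rmult_le_compat_l. now apply Rmult_le_pos.
    rewrite <- !exp_plus. apply exp_le. nra.
Qed.

(* [(c, a, (i, j, k))] stands for the kernel [c t^a (m x + n)^i (m y)^j y^-k exp (- pi t Q)]; lists are sums.
   Since [d/dx (m x + n) = d/dy (m y) = (m y) / y], these are closed under [d/dx], [d/dy], [d/dt]. *)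
Definition kernel_mono : Type := (R * nat * (nat * nat * nat))%type.

Definition mono_val (M : kernel_mono) (x y t : R) (m n : Z) : R :=
  match M with (c, a, (i, j, k)) => c * (t ^ a * lattice_term i j k x y t m n) end.
Fixpoint kernel_val (l : list kernel_mono) (x y t : R) (m n : Z) : R :=
  match l with nil => 0 | M :: l' => mono_val M x y t m n + kernel_val l' x y t m n end.

(** Truncation in [pred i] is harmless: the coefficient contains [INR i], which vanishes for i =
    0. *)
Definition mono_dx (M : kernel_mono) : list kernel_mono :=
  match M with (c, a, (i, j, k)) =>
    (c * INR i, a, (pred i, S j, S k)) :: (c * (- 2 * PI), S a, (S i, S j, S (S k))) :: nil end.
(** As (m y)^j y^-k is homogeneous of degree j - k in y, its derivative keeps the exponent j and
    only raises k. *)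
Definition mono_dy (M : kernel_mono) : list kernel_mono :=
  match M with (c, a, (i, j, k)) =>
    (c * (INR j - INR k), a, (i, j, S k)) :: (c * - PI, S a, (i, S (S j), S (S k)))
    :: (c * PI, S a, (S (S i), j, S (S k))) :: nil end.
Definition mono_dt (M : kernel_mono) : list kernel_mono :=
  match M with (c, a, (i, j, k)) =>
    (c * INR a, pred a, (i, j, k)) :: (c * - PI, a, (S (S i), j, S k))
    :: (c * - PI, a, (i, S (S j), S k)) :: nil end.
Definition ker_dx := flat_map mono_dx.
Definition ker_dy := flat_map mono_dy.
Definition ker_dt := flat_map mono_dt.

Lemma kernel_val_app l l' x y t m n : kernel_val (l ++ l') x y t m n = kernel_val l x y t m n + kernel_val l' x y t m n.
Proof. induction l; simpl. ring. rewrite IHl. ring. Qed.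

Lemma kernel_val_dom l : lattice_dom (kernel_val l).
Proof.
  induction l as [|[[c a] [[i j] k]] l IH].
  - intros X y0 y1 t0 Hy0 Ht0. exists 1, 0. repeat split; try lra. intros x y t _ _ _ m n. simpl. rewrite Rabs_R0. lra.
  - apply (lattice_dom_plus (mono_val (c, a, (i, j, k))) (kernel_val l)); auto.
    apply (lattice_dom_scal c (fun x y t m n => t ^ a * lattice_term i j k x y t m n)). apply (lattice_dom_pow_t a), lattice_term_dom.
Qed.

Lemma is_derive_plus' (f g : R -> R) (x a b : R) : is_derive f x a -> is_derive g x b ->
  is_derive (fun u => f u + g u) x (a + b).
Proof. apply (is_derive_plus (K := R_AbsRing) (V := R_NormedModule)). Qed.

Lemma is_derive_const' (c x : R) : is_derive (fun _ : R => c) x 0.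
Proof. apply (is_derive_const (K := R_AbsRing) (V := R_NormedModule)). Qed.

Lemma is_derive_eq (f : R -> R) (x a b : R) : is_derive f x a -> a = b -> is_derive f x b.
Proof. intros H <-. exact H. Qed.

Definition qexp (x y t : R) (m n : Z) : R := exp (- PI * t * qform x y m n).

Lemma qexp_derive_x x y t m n : 0 < y -> is_derive (fun u => qexp u y t m n) x
  (- 2 * PI * t * ((IZR m * x + IZR n) * (IZR m * y) * / y * / y) * qexp x y t m n).
Proof.
  intros Hy. unfold qexp. eapply is_derive_eq. unfold qform. auto_derive. auto. reflexivity.
  set (e := exp (- PI * t * qform x y m n)).
  change (exp (- PI * t * (((IZR m * x + IZR n) * ((IZR m * x + IZR n) * 1) + IZR m * y * (IZR m * y * 1)) * / y))) with e.
  field. lra.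
Qed.

Lemma qexp_derive_y x y t m n : 0 < y -> is_derive (fun u => qexp x u t m n) y
  (- PI * t * (((IZR m * y) ^ 2 - (IZR m * x + IZR n) ^ 2) * / y * / y) * qexp x y t m n).
Proof.
  intros Hy. unfold qexp. eapply is_derive_eq. unfold qform. auto_derive. lra. reflexivity.
  set (e := exp (- PI * t * qform x y m n)).
  change (exp (- PI * t * (((IZR m * x + IZR n) * ((IZR m * x + IZR n) * 1) + IZR m * y * (IZR m * y * 1)) * / y))) with e.
  field. lra.
Qed.

Lemma qexp_derive_t x y t m n : is_derive (fun u => qexp x y u m n) t
  (- PI * qform x y m n * qexp x y t m n).
Proof. unfold qexp. auto_derive. auto. ring. Qed.

Lemma is_derive_mult' (f g : R -> R) (x a b : R) : is_derive f x a -> is_derive g x b ->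
  is_derive (fun u => f u * g u) x (a * g x + f x * b).
Proof. intros Hf Hg. apply (is_derive_mult (K := R_AbsRing) f g x a b Hf Hg). intros; apply Rmult_comm. Qed.

Lemma mono_val_derive_x M x y t m n : 0 < y ->
  is_derive (fun u => mono_val M u y t m n) x (kernel_val (mono_dx M) x y t m n).
Proof.
  intros Hy. destruct M as [[c a] [[i j] k]]. simpl. unfold lattice_term. fold (qexp x y t m n).
  destruct (Z.eqb m 0 && Z.eqb n 0)%bool.
  - eapply is_derive_eq. apply is_derive_const'. simpl; ring.
  - eapply is_derive_eq.
    + apply is_derive_scal, is_derive_scal.
      apply (is_derive_mult' (fun u => (IZR m * u + IZR n) ^ i * (IZR m * y) ^ j * (/ y) ^ k) (fun u => qexp u y t m n)).
      auto_derive. auto. reflexivity. now apply qexp_derive_x.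
    + generalize (qexp x y t m n). intros e. destruct i; simpl pred; simpl pow; field; lra.
Qed.

Lemma mono_val_derive_y M x y t m n : 0 < y ->
  is_derive (fun u => mono_val M x u t m n) y (kernel_val (mono_dy M) x y t m n).
Proof.
  intros Hy. destruct M as [[c a] [[i j] k]]. simpl. unfold lattice_term. fold (qexp x y t m n).
  destruct (Z.eqb m 0 && Z.eqb n 0)%bool.
  - eapply is_derive_eq. apply is_derive_const'. simpl; ring.
  - eapply is_derive_eq.
    + apply is_derive_scal, is_derive_scal.
      apply (is_derive_mult' (fun u => (IZR m * x + IZR n) ^ i * (IZR m * u) ^ j * (/ u) ^ k) (fun u => qexp x u t m n)).
      auto_derive. lra. reflexivity. now apply qexp_derive_y.
    + generalize (qexp x y t m n). intros e. destruct j, k; rewrite ?S_INR; simpl pred; simpl pow; simpl INR; field; lra.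
Qed.

Lemma mono_val_derive_t M x y t m n : 0 < y ->
  is_derive (fun u => mono_val M x y u m n) t (kernel_val (mono_dt M) x y t m n).
Proof.
  intros Hy. destruct M as [[c a] [[i j] k]]. simpl. unfold lattice_term. fold (qexp x y t m n).
  destruct (Z.eqb m 0 && Z.eqb n 0)%bool.
  - eapply is_derive_eq. apply (is_derive_ext (fun _ : R => 0)). intros; symmetry; rewrite !Rmult_0_r; reflexivity.
    apply is_derive_const'. simpl; ring.
  - eapply is_derive_eq.
    + apply is_derive_scal. apply (is_derive_mult' (fun u => u ^ a)
        (fun u => (IZR m * x + IZR n) ^ i * (IZR m * y) ^ j * (/ y) ^ k * qexp x y u m n)).
      auto_derive. auto. reflexivity. apply is_derive_scal. apply qexp_derive_t.
    + generalize (qexp x y t m n). intros e. unfold qform. destruct a; simpl pred; simpl pow; field; lra.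
Qed.

Lemma kernel_val_derive_x l x y t m n : 0 < y ->
  is_derive (fun u => kernel_val l u y t m n) x (kernel_val (ker_dx l) x y t m n).
Proof.
  intros Hy. induction l as [|M l IH]. exact (is_derive_const' 0 _).
  simpl ker_dx. rewrite kernel_val_app. apply (is_derive_plus' (fun u => mono_val M u y t m n)); auto. now apply mono_val_derive_x.
Qed.

Lemma kernel_val_derive_y l x y t m n : 0 < y ->
  is_derive (fun u => kernel_val l x u t m n) y (kernel_val (ker_dy l) x y t m n).
Proof.
  intros Hy. induction l as [|M l IH]. exact (is_derive_const' 0 _).
  simpl ker_dy. rewrite kernel_val_app. apply (is_derive_plus' (fun u => mono_val M x u t m n)); auto. now apply mono_val_derive_y.
Qed.

Lemma kernel_val_derive_t l x y t m n : 0 < y ->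
  is_derive (fun u => kernel_val l x y u m n) t (kernel_val (ker_dt l) x y t m n).
Proof.
  intros Hy. induction l as [|M l IH]. exact (is_derive_const' 0 _).
  simpl ker_dt. rewrite kernel_val_app. apply (is_derive_plus' (fun u => mono_val M x y u m n)); auto. now apply mono_val_derive_t.
Qed.

Definition lattice_sum (l : list kernel_mono) (x y t : R) : R := Zsum2 (kernel_val l x y t).

Lemma kernel_val_adm l x y t : 0 < y -> 0 < t -> zadm2 (kernel_val l x y t).
Proof.
  intros Hy Ht. destruct (kernel_val_dom l (Rabs x) y y t Hy Ht) as (c & K & Hc & HK & H).
  exists c, (K * exp (- c * t)). split; auto. apply H; lra.
Qed.

(** Commutation is a polynomial identity for each monomial. The two lists differ, so only their
    values are compared. *)
Lemma kernel_val_Dxy l x y t m n : 0 < y -> kernel_val (ker_dx (ker_dy l)) x y t m n = kernel_val (ker_dy (ker_dx l)) x y t m n.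
Proof.
  intros Hy. induction l as [|M l IH]. reflexivity.
  change (ker_dx (ker_dy (M :: l))) with (ker_dx (mono_dy M ++ ker_dy l)). change (ker_dy (ker_dx (M :: l))) with (ker_dy (mono_dx M ++ ker_dx l)).
  unfold ker_dx at 1. unfold ker_dy at 2. rewrite !flat_map_app. fold ker_dx ker_dy. rewrite !kernel_val_app, IH. f_equal.
  destruct M as [[c a] [[i j] k]]. cbn [mono_dx mono_dy ker_dx ker_dy flat_map app kernel_val mono_val]. unfold lattice_term.
  destruct (Z.eqb m 0 && Z.eqb n 0)%bool. ring.
  fold (qexp x y t m n). generalize (qexp x y t m n). intros e.
  rewrite !S_INR.
  destruct i; simpl pred; rewrite ?S_INR; simpl pow; simpl INR; field; lra.
Qed.

Lemma lattice_sum_bound l X y0 y1 t0 : 0 < y0 -> 0 < t0 -> exists c K, 0 < c /\ 0 <= K /\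
  forall x y t, Rabs x <= X -> y0 <= y <= y1 -> t0 <= t -> Rabs (lattice_sum l x y t) <= K * exp (- c * t).
Proof.
  intros Hy0 Ht0. destruct (kernel_val_dom l X y0 y1 t0 Hy0 Ht0) as (c & K & Hc & HK & H).
  pose proof (mass_ge_1 c Hc) as Hm.
  exists c, (K * mass c * mass c). split; auto. split. { apply Rmult_le_pos. apply Rmult_le_pos. auto. lra. lra. }
  intros x y t Hx Hy Ht.
  replace (K * mass c * mass c * exp (- c * t)) with (K * exp (- c * t) * mass c * mass c) by ring.
  apply Zsum2_bound; auto.
Qed.

Lemma lattice_sum_derive_gen (K0 K1 K2 : R -> Z -> Z -> R) (x c M delta : R) : 0 < c -> 0 < delta ->
  (forall u, Rabs (u - x) < delta -> zadm2 (K0 u)) -> zadm2 (K1 x) ->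
  (forall u m n, Rabs (u - x) < delta -> is_derive (fun v => K0 v m n) u (K1 u m n)) ->
  (forall u m n, Rabs (u - x) < delta -> is_derive (fun v => K1 v m n) u (K2 u m n)) ->
  (forall u, Rabs (u - x) < delta -> zdom2 c M (K2 u)) ->
  is_derive (fun u => Zsum2 (K0 u)) x (Zsum2 (K1 x)).
Proof.
  intros Hc Hd A0 A1 D0 D1 B.
  apply (dfun_derive (Zsum2_domfun c Hc) (fun u p => K0 u (fst p) (snd p)) (fun u p => K1 u (fst p) (snd p))
    (fun u p => K2 u (fst p) (snd p)) x M delta Hd); simpl; auto.
  - intros [m n] u _ Hu. simpl. split; [|split]; auto. now apply B.
  - apply (zdom2_pos c M (K2 x)). apply B. rewrite Rminus_diag, Rabs_R0; auto.
Qed.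

Lemma lattice_sum_derive_x l x y t : 0 < y -> 0 < t -> is_derive (fun u => lattice_sum l u y t) x (lattice_sum (ker_dx l) x y t).
Proof.
  intros Hy Ht. destruct (kernel_val_dom (ker_dx (ker_dx l)) (Rabs x + 1) y y t Hy Ht) as (c & K & Hc & HK & H).
  apply (lattice_sum_derive_gen (fun u => kernel_val l u y t) (fun u => kernel_val (ker_dx l) u y t) (fun u => kernel_val (ker_dx (ker_dx l)) u y t)
    x c (K * exp (- c * t)) 1 Hc Rlt_0_1).
  - intros; now apply kernel_val_adm.
  - now apply kernel_val_adm.
  - intros; now apply kernel_val_derive_x.
  - intros; now apply kernel_val_derive_x.
  - intros u Hu. apply H; try lra. replace u with ((u - x) + x) by ring. eapply Rle_trans. apply Rabs_triang. lra.
Qed.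

Lemma lattice_sum_derive_y l x y t : 0 < y -> 0 < t -> is_derive (fun u => lattice_sum l x u t) y (lattice_sum (ker_dy l) x y t).
Proof.
  intros Hy Ht.
  destruct (kernel_val_dom (ker_dy (ker_dy l)) (Rabs x) (y / 2) (2 * y) t ltac:(lra) Ht) as (c & K & Hc & HK & H).
  assert (P : forall u, Rabs (u - y) < y / 2 -> y / 2 <= u <= 2 * y) by (intros u Hu; apply Rabs_def2 in Hu; lra).
  apply (lattice_sum_derive_gen (fun u => kernel_val l x u t) (fun u => kernel_val (ker_dy l) x u t) (fun u => kernel_val (ker_dy (ker_dy l)) x u t)
    y c (K * exp (- c * t)) (y / 2) Hc ltac:(lra)).
  - intros u Hu; specialize (P u Hu). apply kernel_val_adm; lra.
  - now apply kernel_val_adm.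
  - intros u m n Hu; specialize (P u Hu). apply kernel_val_derive_y; lra.
  - intros u m n Hu; specialize (P u Hu). apply kernel_val_derive_y; lra.
  - intros u Hu. apply H; try lra; auto.
Qed.

Lemma lattice_sum_derive_t l x y t : 0 < y -> 0 < t -> is_derive (fun u => lattice_sum l x y u) t (lattice_sum (ker_dt l) x y t).
Proof.
  intros Hy Ht.
  destruct (kernel_val_dom (ker_dt (ker_dt l)) (Rabs x) y y (t / 2) Hy ltac:(lra)) as (c & K & Hc & HK & H).
  assert (P : forall u, Rabs (u - t) < t / 2 -> t / 2 <= u) by (intros u Hu; apply Rabs_def2 in Hu; lra).
  apply (lattice_sum_derive_gen (fun u => kernel_val l x y u) (fun u => kernel_val (ker_dt l) x y u) (fun u => kernel_val (ker_dt (ker_dt l)) x y u)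
    t c (K * exp (- c * 0)) (t / 2) Hc ltac:(lra)).
  - intros u Hu; specialize (P u Hu). apply kernel_val_adm; lra.
  - now apply kernel_val_adm.
  - intros u m n Hu. now apply kernel_val_derive_t.
  - intros u m n Hu. now apply kernel_val_derive_t.
  - intros u Hu. specialize (P u Hu). apply (zdom2_weaken c c (K * exp (- c * u)) _ _ (Rle_refl _)).
    + apply Rmult_le_compat_l; auto. apply exp_le. nra.
    + apply H; lra.
Qed.

Lemma lattice_sum_cont_t l x y t : 0 < y -> 0 < t -> continuous (fun u => lattice_sum l x y u) t.
Proof. intros Hy Ht. eapply is_derive_cont. now apply lattice_sum_derive_t. Qed.

Lemma lattice_sum_Dxy l x y t : 0 < y -> lattice_sum (ker_dx (ker_dy l)) x y t = lattice_sum (ker_dy (ker_dx l)) x y t.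
Proof. intros Hy. apply Zsum2_ext. intros. now apply kernel_val_Dxy. Qed.

Definition theta_ker : list kernel_mono := (1, O, (O, O, O)) :: nil.

(** The origin contributes exactly 1; it is split off as an indicator function whose double sum is
    evaluated. *)
Lemma theta_lattice_sum x y t : 0 < y -> 0 < t -> theta x y t = 1 + lattice_sum theta_ker x y t.
Proof.
  intros Hy Ht.
  set (d := fun m n : Z => if (Z.eqb m 0 && Z.eqb n 0)%bool then 1 else 0).
  assert (Ad : zadm2 d).
  { exists 1, 1. split. lra. intros m n. unfold d.
    destruct (Z.eqb_spec m 0), (Z.eqb_spec n 0); simpl; try (rewrite Rabs_R0; apply Rmult_le_pos; [lra|left; apply exp_pos]).
    subst. unfold zabs. rewrite !Rabs_R0, Rplus_0_r, Rmult_0_r, exp_0, Rabs_R1. lra. }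
  assert (Ed : Zsum2 d = 1).
  { unfold Zsum2. rewrite (Zsum_ext _ (fun m => if Z.eqb m 0 then 1 else 0)).
    - apply Zsum_unique. apply (is_lim_seq_eventually_const _ _ 0). intros N _. apply zsum_delta. simpl; lia.
    - intros m. unfold d. destruct (Z.eqb_spec m 0) as [->|Hm]; simpl.
      + apply Zsum_unique. apply (is_lim_seq_eventually_const _ _ 0). intros N _. apply zsum_delta. simpl; lia.
      + apply Zsum_unique. apply (is_lim_seq_eventually_const _ _ 0). intros N _. induction N; simpl; auto. simpl in IHN; rewrite IHN. ring. }
  rewrite <- Ed. unfold lattice_sum, theta. rewrite <- Zsum2_plus; auto. 2: now apply kernel_val_adm.
  apply Zsum2_ext. intros m n. unfold d. simpl. unfold lattice_term.
  destruct (Z.eqb_spec m 0), (Z.eqb_spec n 0); simpl; try ring.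
  subst. unfold qform. replace ((0 * x + 0) ^ 2 + (0 * y) ^ 2) with 0 by ring. unfold Rdiv. rewrite Rmult_0_l, Rmult_0_r, exp_0. ring.
Qed.

(** * Integrals over [1, oo) *)

Definition continuous_ge_1 (f : R -> R) : Prop := forall t, 1 <= t -> continuous f t.
(** Domination by t^(-1-d). Powers instead of exponentials, because the part of a Mellin integral
    near 0 becomes a power after t -> 1/t. *)
Definition power_dom (C d : R) (f : R -> R) : Prop := forall t, 1 <= t -> Rabs (f t) <= C * Rpower t (- (1 + d)).
Definition int1_adm (f : R -> R) : Prop := continuous_ge_1 f /\ exists C d, 0 < d /\ power_dom C d f.
(** The limit is taken along integer endpoints from 1 on; [int1_tail] gives back arbitrary real
    endpoints. *)
Definition int1 (f : R -> R) : R := real (Lim_seq (fun N => RInt f 1 (INR (S N)))).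

Lemma continuous_ge_1_ex_RInt f a b : continuous_ge_1 f -> 1 <= a -> 1 <= b -> ex_RInt f a b.
Proof.
  intros H Ha Hb. apply (ex_RInt_continuous (V := R_CompleteNormedModule)). intros t Ht. apply H.
  unfold Rmin, Rmax in Ht. destruct (Rle_dec a b); lra.
Qed.

Lemma continuous_ge_1_plus f g : continuous_ge_1 f -> continuous_ge_1 g -> continuous_ge_1 (fun t => f t + g t).
Proof. intros Hf Hg t Ht. apply cont_plus; auto. Qed.
Lemma continuous_ge_1_mult f g : continuous_ge_1 f -> continuous_ge_1 g -> continuous_ge_1 (fun t => f t * g t).
Proof. intros Hf Hg t Ht. apply cont_mult; auto. Qed.
Lemma continuous_ge_1_const c : continuous_ge_1 (fun _ => c).
Proof. intros t Ht. apply cont_const. Qed.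
Lemma continuous_ge_1_derive f f' : (forall t, 0 < t -> is_derive f t (f' t)) -> continuous_ge_1 f.
Proof. intros H t Ht. eapply is_derive_cont. apply H. lra. Qed.

Lemma RInt_Chasles1 f a b c : continuous_ge_1 f -> 1 <= a -> 1 <= b -> 1 <= c ->
  RInt f a b + RInt f b c = RInt f a c.
Proof.
  intros. apply (RInt_Chasles (V := R_CompleteNormedModule) f); now apply continuous_ge_1_ex_RInt.
Qed.

Lemma Rpower_pos t e : 0 < Rpower t e.
Proof. apply exp_pos. Qed.

Lemma RInt_power_dom f C d a b : continuous_ge_1 f -> 0 < d -> power_dom C d f -> 1 <= a <= b ->
  Rabs (RInt f a b) <= C / d * Rpower a (- d).
Proof.
  intros Hf Hd Hp Hab.
  assert (HC : 0 <= C).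
  { specialize (Hp 1 ltac:(lra)). pose proof (Rabs_pos (f 1)). pose proof (Rpower_pos 1 (- (1 + d))). nra. }
  set (w := fun t => C * Rpower t (- (1 + d))).
  assert (Dw : forall t, 0 < t -> is_derive (fun t => - (C / d) * Rpower t (- d)) t (w t)).
  { intros t Ht. unfold w, Rpower. auto_derive. auto.
    replace (- (1 + d) * ln t) with (- d * ln t + - ln t) by ring.
    rewrite exp_plus, exp_Ropp, exp_ln by auto. field. lra. }
  assert (Cw : continuous_ge_1 w).
  { apply (continuous_ge_1_derive w (fun t => C * (- (1 + d) * / t * Rpower t (- (1 + d))))).
    intros t Ht. unfold w, Rpower. auto_derive. auto. field. lra. }
  assert (Iw : RInt w a b = C / d * Rpower a (- d) - C / d * Rpower b (- d)).
  { apply is_RInt_unique.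
    replace (C / d * Rpower a (- d) - C / d * Rpower b (- d))
      with (minus (- (C / d) * Rpower b (- d)) (- (C / d) * Rpower a (- d)))
      by (unfold minus, plus, opp; simpl; ring).
    apply (is_RInt_derive (V := R_CompleteNormedModule) (fun t => - (C / d) * Rpower t (- d)) w).
    - intros t Ht. rewrite Rmin_left, Rmax_right in Ht by lra. apply Dw. lra.
    - intros t Ht. rewrite Rmin_left, Rmax_right in Ht by lra. apply Cw. lra. }
  assert (Hb : 0 <= C / d * Rpower b (- d)).
  { apply Rmult_le_pos. apply Rmult_le_pos; auto. left; now apply Rinv_0_lt_compat. left; apply Rpower_pos. }
  apply Rle_trans with (RInt w a b); [|lra].
  apply Rle_trans with (RInt (fun t => Rabs (f t)) a b).
  { apply abs_RInt_le. lra. apply continuous_ge_1_ex_RInt; auto; lra. }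
  apply RInt_le. lra.
  - apply continuous_ge_1_ex_RInt; try lra. intros t Ht. apply (continuous_comp f Rabs); auto. apply continuous_Rabs.
  - apply continuous_ge_1_ex_RInt; auto; lra.
  - intros t Ht. apply Hp. lra.
Qed.

Lemma Rpower_small d eps : 0 < d -> 0 < eps -> exists T0, 1 <= T0 /\ forall T, T0 <= T -> Rpower T (- d) < eps.
Proof.
  intros Hd He. exists (Rmax 1 (exp (- ln eps / d) + 1)). split. apply Rmax_l.
  intros T HT. assert (H1 : exp (- ln eps / d) + 1 <= T) by (eapply Rle_trans; [apply Rmax_r|exact HT]).
  assert (H2 : 1 <= T) by (eapply Rle_trans; [apply Rmax_l|exact HT]).
  assert (H3 : - ln eps / d < ln T).
  { rewrite <- (ln_exp (- ln eps / d)). apply ln_increasing. apply exp_pos. lra. }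
  unfold Rpower. rewrite <- (exp_ln eps) by auto. apply exp_increasing.
  apply (Rmult_lt_compat_l d) in H3; auto. replace (d * (- ln eps / d)) with (- ln eps) in H3 by (field; lra). lra.
Qed.

Lemma INR_S_ge_1 N : 1 <= INR (S N).
Proof. rewrite S_INR. pose proof (pos_INR N). lra. Qed.

Lemma int1_limit f : int1_adm f -> is_lim_seq (fun N => RInt f 1 (INR (S N))) (int1 f).
Proof.
  intros (Hf & C & d & Hd & Hp). unfold int1. apply Lim_seq_correct'. apply ex_lim_seq_cauchy_corr.
  intros eps. pose proof (cond_pos eps) as He.
  assert (HC : 0 <= C).
  { specialize (Hp 1 ltac:(lra)). pose proof (Rabs_pos (f 1)). pose proof (Rpower_pos 1 (- (1 + d))). nra. }
  destruct (Rpower_small d (eps * d / (C + 1))) as (T0 & HT0 & HT); auto.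
  { apply Rdiv_lt_0_compat; [|lra]. now apply Rmult_lt_0_compat. }
  destruct (nfloor_ex T0 ltac:(lra)) as [N0 HN0].
  assert (B : forall n m, (S N0 <= n <= m)%nat -> Rabs (RInt f 1 (INR (S n)) - RInt f 1 (INR (S m))) < eps).
  { intros n m Hnm. pose proof (INR_S_ge_1 n). pose proof (INR_S_ge_1 m).
    rewrite <- (RInt_Chasles1 f 1 (INR (S n)) (INR (S m))) by (auto; lra).
    replace (RInt f 1 (INR (S n)) - (RInt f 1 (INR (S n)) + RInt f (INR (S n)) (INR (S m))))
      with (- RInt f (INR (S n)) (INR (S m))) by lra. rewrite Rabs_Ropp.
    assert (INR (S n) <= INR (S m)) by (apply le_INR; lia).
    eapply Rle_lt_trans. apply (RInt_power_dom f C d); auto; lra.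
    assert (INR (S N0) <= INR n) by (apply le_INR; lia). rewrite S_INR in *.
    specialize (HT (INR n + 1) ltac:(lra)).
    apply Rle_lt_trans with ((C + 1) / d * Rpower (INR n + 1) (- d)).
    - apply Rmult_le_compat_r. left; apply Rpower_pos. apply Rmult_le_compat_r. left; now apply Rinv_0_lt_compat. lra.
    - apply Rlt_le_trans with ((C + 1) / d * (eps * d / (C + 1))).
      apply Rmult_lt_compat_l; auto. apply Rdiv_lt_0_compat; lra. right; field; lra. }
  exists (S N0). intros n m Hn Hm. destruct (Nat.le_ge_cases n m).
  - apply B; lia.
  - rewrite Rabs_minus_sym. apply B; lia.
Qed.

Lemma int1_tail f C d T : continuous_ge_1 f -> 0 < d -> power_dom C d f -> 1 <= T ->
  Rabs (int1 f - RInt f 1 T) <= C / d * Rpower T (- d).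
Proof.
  intros Hf Hd Hp HT.
  destruct (nfloor_ex T ltac:(lra)) as [N0 HN0].
  apply (is_lim_seq_abs_le (fun N => RInt f 1 (INR (S (N + N0))) - RInt f 1 T)).
  - apply is_lim_seq_minus'; [|apply is_lim_seq_const].
    apply (is_lim_seq_incr_n (fun N => RInt f 1 (INR (S N))) N0). apply int1_limit. split; eauto.
  - intros N. assert (T <= INR (S (N + N0))).
    { rewrite S_INR, plus_INR. pose proof (pos_INR N). lra. }
    rewrite <- (RInt_Chasles1 f 1 T (INR (S (N + N0)))) by (auto; lra).
    replace (RInt f 1 T + RInt f T (INR (S (N + N0))) - RInt f 1 T) with (RInt f T (INR (S (N + N0)))) by lra.
    apply RInt_power_dom; auto.
Qed.

Lemma int1_bound f C d : continuous_ge_1 f -> 0 < d -> power_dom C d f -> Rabs (int1 f) <= C / d.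
Proof.
  intros Hf Hd Hp. pose proof (int1_tail f C d 1 Hf Hd Hp ltac:(lra)) as T.
  rewrite RInt_point in T. unfold zero in T; simpl in T. rewrite Rminus_0_r in T.
  unfold Rpower in T. rewrite ln_1, Rmult_0_r, exp_0, Rmult_1_r in T. exact T.
Qed.

Lemma power_dom_pos C d f : power_dom C d f -> 0 <= C.
Proof.
  intros Hp. specialize (Hp 1 ltac:(lra)). pose proof (Rabs_pos (f 1)). pose proof (Rpower_pos 1 (- (1 + d))). nra.
Qed.

Lemma power_dom_weaken C d C' d' f : C <= C' -> d' <= d -> power_dom C d f -> power_dom C' d' f.
Proof.
  intros HC Hd H t Ht. eapply Rle_trans. now apply H. pose proof (power_dom_pos C d f H).
  apply Rmult_le_compat; auto. left; apply Rpower_pos. unfold Rpower. apply exp_le.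
  assert (0 <= ln t). { rewrite <- ln_1. destruct (Req_dec 1 t) as [<-|]. lra. left; apply ln_increasing; lra. }
  nra.
Qed.

Lemma int1_adm_plus f g : int1_adm f -> int1_adm g -> int1_adm (fun t => f t + g t).
Proof.
  intros (Hf & C & d & Hd & Hp) (Hg & C' & d' & Hd' & Hp'). split. now apply continuous_ge_1_plus.
  exists (C + C'), (Rmin d d'). split. now apply Rmin_pos.
  pose proof (power_dom_weaken _ _ C (Rmin d d') _ (Rle_refl _) (Rmin_l _ _) Hp) as A.
  pose proof (power_dom_weaken _ _ C' (Rmin d d') _ (Rle_refl _) (Rmin_r _ _) Hp') as A'.
  intros t Ht. eapply Rle_trans. apply Rabs_triang. specialize (A t Ht). specialize (A' t Ht). lra.
Qed.

Lemma int1_adm_scal k f : int1_adm f -> int1_adm (fun t => k * f t).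
Proof.
  intros (Hf & C & d & Hd & Hp). split. apply continuous_ge_1_mult; auto. apply continuous_ge_1_const.
  exists (Rabs k * C), d. split; auto. intros t Ht. rewrite Rabs_mult, Rmult_assoc.
  apply Rmult_le_compat_l; auto. apply Rabs_pos.
Qed.

Lemma int1_unique f (l : R) : is_lim_seq (fun N => RInt f 1 (INR (S N))) l -> int1 f = l.
Proof. intros H. unfold int1. now rewrite (is_lim_seq_unique _ _ H). Qed.

Lemma int1_plus f g : int1_adm f -> int1_adm g -> int1 (fun t => f t + g t) = int1 f + int1 g.
Proof.
  intros Hf Hg. apply int1_unique.
  apply (is_lim_seq_ext (fun N => RInt f 1 (INR (S N)) + RInt g 1 (INR (S N)))).
  - intros N. symmetry. pose proof (INR_S_ge_1 N).
    apply RInt_plus'; apply continuous_ge_1_ex_RInt; try lra; [apply Hf|apply Hg].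
  - apply is_lim_seq_plus'; now apply int1_limit.
Qed.

Lemma int1_scal k f : int1_adm f -> int1 (fun t => k * f t) = k * int1 f.
Proof.
  intros Hf. apply int1_unique.
  apply (is_lim_seq_ext (fun N => k * RInt f 1 (INR (S N)))).
  - intros N. symmetry. pose proof (INR_S_ge_1 N).
    apply RInt_scal'; apply continuous_ge_1_ex_RInt; try lra; apply Hf.
  - apply (is_lim_seq_scal_l _ k (int1 f)). now apply int1_limit.
Qed.

Lemma int1_ext f g : (forall t, 1 <= t -> f t = g t) -> int1 f = int1 g.
Proof.
  intros E. unfold int1. f_equal. apply Lim_seq_ext. intros N. pose proof (INR_S_ge_1 N).
  apply RInt_ext. intros t Ht. rewrite Rmin_left in Ht by auto. apply E. lra.
Qed.

Definition int1_domfun (d : R) (Hd : 0 < d) : domfun R.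
Proof.
  refine {| dadm := int1_adm; dfun := int1; dwt := fun t => Rpower t (- (1 + d)); dset := fun t => 1 <= t;
            dcst := / d |}.
  - apply int1_adm_plus.
  - apply int1_adm_scal.
  - apply int1_plus.
  - intros; now apply int1_scal.
  - intros f e [Hf _] He H. apply int1_bound; auto.
Defined.

(** Cut at T: beyond T the common majorant bounds both integrals, up to T convergence is uniform. *)
Theorem int1_dominated (f : nat -> R -> R) (g : R -> R) C d : 0 < d -> (forall N, continuous_ge_1 (f N)) -> continuous_ge_1 g ->
  (forall N, power_dom C d (f N)) -> power_dom C d g ->
  (forall T eps, 1 <= T -> 0 < eps -> exists N0, forall N t, (N0 <= N)%nat -> 1 <= t <= T ->
     Rabs (f N t - g t) <= eps) ->
  is_lim_seq (fun N => int1 (f N)) (int1 g).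
Proof.
  intros Hd Cf Cg Df Dg H. apply is_lim_seq_spec. intros eps. pose proof (cond_pos eps) as He.
  pose proof (power_dom_pos C d g Dg) as HC.
  (* Each of the two tails is at most eps / 4 and so is the middle part; C + 1 avoids division by
     zero. *)
  destruct (Rpower_small d (eps / 4 * d / (C + 1))) as (T & HT1 & HT); auto.
  { apply Rdiv_lt_0_compat; [|lra]. apply Rmult_lt_0_compat; lra. }
  specialize (HT T (Rle_refl T)).
  destruct (H T (eps / 4 / T) HT1 ltac:(apply Rdiv_lt_0_compat; lra)) as [N0 HN0].
  exists N0. intros N HN.
  assert (B : forall h, continuous_ge_1 h -> power_dom C d h -> Rabs (int1 h - RInt h 1 T) <= eps / 4).
  { intros h Ch Dh. eapply Rle_trans. apply (int1_tail h C d); auto.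
    apply Rle_trans with ((C + 1) / d * Rpower T (- d)).
    - apply Rmult_le_compat_r. left; apply Rpower_pos. apply Rmult_le_compat_r. left; now apply Rinv_0_lt_compat. lra.
    - apply Rle_trans with ((C + 1) / d * (eps / 4 * d / (C + 1))).
      apply Rmult_le_compat_l. apply Rlt_le, Rdiv_lt_0_compat; lra. lra. right; field; lra. }
  pose proof (B (f N) (Cf N) (Df N)) as B1. pose proof (B g Cg Dg) as B2.
  assert (B3 : Rabs (RInt (f N) 1 T - RInt g 1 T) <= eps / 4).
  { rewrite <- RInt_minus' by (apply continuous_ge_1_ex_RInt; auto; lra).
    apply Rle_trans with ((T - 1) * (eps / 4 / T)).
    - apply abs_RInt_le_const. lra.
      + apply continuous_ge_1_ex_RInt; try lra. intros t Ht. apply cont_minus; auto. now apply Cf.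
      + intros t Ht. now apply HN0.
    - apply Rle_trans with (T * (eps / 4 / T)). apply Rmult_le_compat_r. apply Rlt_le, Rdiv_lt_0_compat; lra. lra.
      right; field; lra. }
  replace (int1 (f N) - int1 g) with ((int1 (f N) - RInt (f N) 1 T) - (int1 g - RInt g 1 T) + (RInt (f N) 1 T - RInt g 1 T)) by lra.
  apply Rabs_le_between in B1. apply Rabs_le_between in B2. apply Rabs_le_between in B3.
  apply Rabs_def1; lra.
Qed.

Lemma exp_le_power c : 0 < c -> exists K, 0 <= K /\ forall t, 1 <= t -> exp (- c * t) <= K * Rpower t (- (1 + 1)).
Proof.
  intros Hc. destruct (pow_exp_bound 2 c Hc) as (K & HK & H). exists K. split; auto.
  intros t Ht. specialize (H t ltac:(lra)).
  replace (Rpower t (- (1 + 1))) with (/ t ^ 2).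
  2:{ rewrite Rpower_Ropp. f_equal. replace (1 + 1) with (INR 2) by (simpl; ring). symmetry; apply Rpower_pow. lra. }
  replace (- c * t) with (- (c * t)) by ring. rewrite exp_Ropp.
  pose proof (exp_pos (c * t)). assert (0 < t ^ 2) by (apply pow_lt; lra).
  apply (Rmult_le_reg_l (t ^ 2 * exp (c * t))). now apply Rmult_lt_0_compat.
  replace (t ^ 2 * exp (c * t) * / exp (c * t)) with (t ^ 2) by (field; lra).
  replace (t ^ 2 * exp (c * t) * (K * / t ^ 2)) with (K * exp (c * t)) by (field; lra). exact H.
Qed.

Definition exp_dom (f : R -> R) : Prop := exists c K, 0 < c /\ 0 <= K /\ forall t, 1 <= t -> Rabs (f t) <= K * exp (- c * t).
(** The class of admissible weights: closed under sums and products, containing powers, logarithms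
    and the components of t^s, and harmless against [exp_dom]. *)
Definition subexp (w : R -> R) : Prop := continuous_ge_1 w /\
  forall e, 0 < e -> exists K, 0 <= K /\ forall t, 1 <= t -> Rabs (w t) <= K * exp (e * t).

Lemma exp_dom_int1_adm f : continuous_ge_1 f -> exp_dom f -> int1_adm f.
Proof.
  intros Hf (c & K & Hc & HK & H). split; auto. destruct (exp_le_power c Hc) as (K' & HK' & H').
  exists (K * K'), 1. split. lra. intros t Ht. eapply Rle_trans. now apply H. rewrite Rmult_assoc.
  apply Rmult_le_compat_l; auto.
Qed.

Lemma exp_dom_weight f w : exp_dom f -> subexp w -> exp_dom (fun t => f t * w t).
Proof.
  intros (c & K & Hc & HK & H) [_ Hw]. destruct (Hw (c / 2) ltac:(lra)) as (K' & HK' & H').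
  exists (c / 2), (K * K'). split. lra. split. now apply Rmult_le_pos.
  intros t Ht. rewrite Rabs_mult.
  apply Rle_trans with (K * exp (- c * t) * (K' * exp (c / 2 * t))).
  apply Rmult_le_compat; auto using Rabs_pos.
  right. replace (- (c / 2) * t) with (- c * t + c / 2 * t) by field. rewrite exp_plus. ring.
Qed.

Lemma subexp_mult w w' : subexp w -> subexp w' -> subexp (fun t => w t * w' t).
Proof.
  intros [C H] [C' H']. split. now apply continuous_ge_1_mult.
  intros e He. destruct (H (e / 2) ltac:(lra)) as (K & HK & B). destruct (H' (e / 2) ltac:(lra)) as (K' & HK' & B').
  exists (K * K'). split. now apply Rmult_le_pos. intros t Ht. rewrite Rabs_mult.
  apply Rle_trans with (K * exp (e / 2 * t) * (K' * exp (e / 2 * t))).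
  apply Rmult_le_compat; auto using Rabs_pos.
  right. replace (e * t) with (e / 2 * t + e / 2 * t) by field. rewrite exp_plus. ring.
Qed.

Lemma subexp_plus w w' : subexp w -> subexp w' -> subexp (fun t => w t + w' t).
Proof.
  intros [C H] [C' H']. split. now apply continuous_ge_1_plus.
  intros e He. destruct (H e He) as (K & HK & B). destruct (H' e He) as (K' & HK' & B').
  exists (K + K'). split. lra. intros t Ht. eapply Rle_trans. apply Rabs_triang.
  specialize (B t Ht). specialize (B' t Ht). lra.
Qed.

Lemma subexp_bounded w M : continuous_ge_1 w -> (forall t, 1 <= t -> Rabs (w t) <= M) -> subexp w.
Proof.
  intros C H. split; auto. intros e He. exists (Rabs M). split. apply Rabs_pos.
  intros t Ht. eapply Rle_trans. now apply H. rewrite <- (Rmult_1_r M) at 1.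
  apply Rle_trans with (Rabs M * 1). pose proof (Rle_abs M); lra. apply Rmult_le_compat_l. apply Rabs_pos.
  rewrite <- exp_0. apply exp_le. nra.
Qed.

Lemma subexp_const c : subexp (fun _ => c).
Proof. apply (subexp_bounded _ (Rabs c)). apply continuous_ge_1_const. intros; lra. Qed.

Lemma subexp_id : subexp (fun t => t).
Proof.
  split. intros t _. apply continuous_id. intros e He.
  destruct (pow_exp_bound 1 e He) as (K & HK & H). exists K. split; auto.
  intros t Ht. rewrite Rabs_pos_eq by lra. specialize (H t ltac:(lra)). simpl in H. lra.
Qed.

Lemma subexp_inv : subexp Rinv.
Proof.
  apply (subexp_bounded _ 1). apply (continuous_ge_1_derive _ (fun t => - / t ^ 2)).
  intros t Ht. auto_derive. lra. field. lra.
  intros t Ht. rewrite Rabs_pos_eq by (left; apply Rinv_0_lt_compat; lra).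
  rewrite <- Rinv_1. apply Rinv_le_contravar; lra.
Qed.

Lemma ln_continuous_ge_1 : continuous_ge_1 ln.
Proof. apply (continuous_ge_1_derive _ Rinv). intros t Ht. auto_derive. auto. ring. Qed.

Lemma ln_bounds t : 1 <= t -> 0 <= ln t <= t.
Proof.
  intros Ht. split.
  - rewrite <- ln_1. destruct (Req_dec 1 t) as [<-|]. lra. left; apply ln_increasing; lra.
  - pose proof (exp_ineq1_le (ln t)) as H. rewrite exp_ln in H by lra. lra.
Qed.

Lemma subexp_ln : subexp ln.
Proof.
  split. apply ln_continuous_ge_1. intros e He. destruct subexp_id as [_ H]. destruct (H e He) as (K & HK & B).
  exists K. split; auto. intros t Ht. specialize (B t Ht). pose proof (ln_bounds t Ht).
  rewrite Rabs_pos_eq in * by lra. lra.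
Qed.

Lemma subexp_pow w n : subexp w -> subexp (fun t => w t ^ n).
Proof.
  intros H. induction n. apply (subexp_const 1). apply (subexp_mult w (fun t => w t ^ n)); auto.
Qed.

Lemma subexp_power a : subexp (fun t => exp (a * ln t)).
Proof.
  split.
  - apply (continuous_ge_1_derive _ (fun t => a * / t * exp (a * ln t))). intros t Ht. auto_derive. auto. ring.
  - intros e He. destruct (nfloor_ex (Rabs a) (Rabs_pos a)) as [n Hn].
    destruct (pow_exp_bound (S n) e He) as (K & HK & H). exists K. split; auto.
    intros t Ht. rewrite Rabs_pos_eq by (left; apply exp_pos). eapply Rle_trans; [|apply H; lra].
    rewrite <- Rpower_pow by lra. unfold Rpower. apply exp_le. apply Rmult_le_compat_r. apply ln_bounds; auto.
    rewrite S_INR. pose proof (Rle_abs a). lra.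
Qed.

(** * Integrals of lattice sums against weights *)

Definition weighted_int (l : list kernel_mono) (w : R -> R) (x y : R) : R := int1 (fun t => lattice_sum l x y t * w t).

Lemma lattice_sum_continuous_ge_1 l x y : 0 < y -> continuous_ge_1 (lattice_sum l x y).
Proof. intros Hy t Ht. apply lattice_sum_cont_t; lra. Qed.

Lemma lattice_sum_exp_dom l x y : 0 < y -> exp_dom (lattice_sum l x y).
Proof.
  intros Hy. destruct (lattice_sum_bound l (Rabs x) y y 1 Hy Rlt_0_1) as (c & K & Hc & HK & H).
  exists c, K. split; auto. split; auto. intros t Ht. apply H; lra.
Qed.

Lemma weighted_sum_adm l w x y : 0 < y -> subexp w -> int1_adm (fun t => lattice_sum l x y t * w t).
Proof.
  intros Hy Hw. apply exp_dom_int1_adm. apply continuous_ge_1_mult. now apply lattice_sum_continuous_ge_1. apply Hw.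
  apply exp_dom_weight; auto. now apply lattice_sum_exp_dom.
Qed.

Lemma weighted_sum_bound l w X y0 y1 : 0 < y0 -> subexp w -> exists M, 0 <= M /\
  forall x y t, Rabs x <= X -> y0 <= y <= y1 -> 1 <= t -> Rabs (lattice_sum l x y t * w t) <= M * Rpower t (- (1 + 1)).
Proof.
  intros Hy0 [_ Hw]. destruct (lattice_sum_bound l X y0 y1 1 Hy0 Rlt_0_1) as (c & K & Hc & HK & H).
  destruct (Hw (c / 2) ltac:(lra)) as (K' & HK' & H').
  destruct (exp_le_power (c / 2) ltac:(lra)) as (K2 & HK2 & H2).
  exists (K * K' * K2). split. { apply Rmult_le_pos; auto. now apply Rmult_le_pos. }
  intros x y t Hx Hy Ht. rewrite Rabs_mult.
  apply Rle_trans with (K * exp (- c * t) * (K' * exp (c / 2 * t))).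
  { apply Rmult_le_compat; auto using Rabs_pos. }
  replace (K * exp (- c * t) * (K' * exp (c / 2 * t))) with (K * K' * exp (- (c / 2) * t)).
  { rewrite Rmult_assoc. rewrite (Rmult_assoc (K * K')). rewrite <- Rmult_assoc. apply Rmult_le_compat_l. now apply Rmult_le_pos. now apply H2. }
  replace (- (c / 2) * t) with (- c * t + c / 2 * t) by field. rewrite exp_plus. ring.
Qed.

Lemma weighted_int_derive_x l w x y : 0 < y -> subexp w -> is_derive (fun u => weighted_int l w u y) x (weighted_int (ker_dx l) w x y).
Proof.
  intros Hy Hw. destruct (weighted_sum_bound (ker_dx (ker_dx l)) w (Rabs x + 1) y y Hy Hw) as (M & HM & H).
  apply (dfun_derive (int1_domfun 1 Rlt_0_1) (fun u t => lattice_sum l u y t * w t) (fun u t => lattice_sum (ker_dx l) u y t * w t)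
    (fun u t => lattice_sum (ker_dx (ker_dx l)) u y t * w t) x M 1 Rlt_0_1); simpl; auto.
  - intros; now apply weighted_sum_adm.
  - now apply weighted_sum_adm.
  - intros t u Ht Hu. split; [|split].
    + eapply is_derive_eq. apply (is_derive_mult' (fun v => lattice_sum l v y t) (fun _ => w t)).
      apply lattice_sum_derive_x; lra. apply is_derive_const'. ring.
    + eapply is_derive_eq. apply (is_derive_mult' (fun v => lattice_sum (ker_dx l) v y t) (fun _ => w t)).
      apply lattice_sum_derive_x; lra. apply is_derive_const'. ring.
    + apply H; try lra. replace u with ((u - x) + x) by ring. eapply Rle_trans. apply Rabs_triang. lra.
Qed.

Lemma weighted_int_derive_y l w x y : 0 < y -> subexp w -> is_derive (fun u => weighted_int l w x u) y (weighted_int (ker_dy l) w x y).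
Proof.
  intros Hy Hw. destruct (weighted_sum_bound (ker_dy (ker_dy l)) w (Rabs x) (y / 2) (2 * y) ltac:(lra) Hw) as (M & HM & H).
  assert (P : forall u, Rabs (u - y) < y / 2 -> y / 2 <= u <= 2 * y) by (intros u Hu; apply Rabs_def2 in Hu; lra).
  apply (dfun_derive (int1_domfun 1 Rlt_0_1) (fun u t => lattice_sum l x u t * w t) (fun u t => lattice_sum (ker_dy l) x u t * w t)
    (fun u t => lattice_sum (ker_dy (ker_dy l)) x u t * w t) y M (y / 2) ltac:(lra)); simpl; auto.
  - intros u Hu. specialize (P u Hu). apply weighted_sum_adm; auto; lra.
  - now apply weighted_sum_adm.
  - intros t u Ht Hu. specialize (P u Hu). split; [|split].
    + eapply is_derive_eq. apply (is_derive_mult' (fun v => lattice_sum l x v t) (fun _ => w t)).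
      apply lattice_sum_derive_y; lra. apply is_derive_const'. ring.
    + eapply is_derive_eq. apply (is_derive_mult' (fun v => lattice_sum (ker_dy l) x v t) (fun _ => w t)).
      apply lattice_sum_derive_y; lra. apply is_derive_const'. ring.
    + apply H; try lra.
Qed.

Lemma weighted_int_Dxy l w x y : 0 < y -> weighted_int (ker_dx (ker_dy l)) w x y = weighted_int (ker_dy (ker_dx l)) w x y.
Proof. intros Hy. apply int1_ext. intros t Ht. now rewrite lattice_sum_Dxy. Qed.

(** * The Laplacian of the Taylor coefficients *)

Lemma is_derive_id' (x : R) : is_derive (fun t : R => t) x 1.
Proof. apply (is_derive_id (K := R_AbsRing)). Qed.

Lemma exp_dom_lim (P : R -> R) : exp_dom P -> is_lim_seq (fun N => P (INR (S N))) 0.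
Proof.
  intros (c & K & Hc & HK & H). pose proof (exp_neg_lt_1 c Hc). pose proof (exp_pos (- c)).
  assert (L : is_lim_seq (fun N => K * exp (- c) ^ (S N)) (K * 0)).
  { apply (is_lim_seq_scal_l _ K 0). apply (is_lim_seq_incr_1 (fun N => exp (- c) ^ N)).
    apply is_lim_seq_geom. rewrite Rabs_pos_eq; lra. }
  rewrite Rmult_0_r in L. apply is_lim_seq_abs_0.
  apply (is_lim_seq_le_le (fun _ => 0) _ (fun N => K * exp (- c) ^ (S N))); auto.
  2: apply is_lim_seq_const.
  intros N. split. apply Rabs_pos. eapply Rle_trans. apply H. apply INR_S_ge_1.
  right. f_equal. rewrite <- Rpower_pow by auto. unfold Rpower. rewrite ln_exp. f_equal. ring.
Qed.

Lemma int1_deriv (P p : R -> R) : (forall t, 1 <= t -> is_derive P t (p t)) -> continuous_ge_1 p -> exp_dom P ->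
  int1 p = - P 1.
Proof.
  intros D C E. apply int1_unique.
  apply (is_lim_seq_ext (fun N => P (INR (S N)) - P 1)).
  - intros N. symmetry. pose proof (INR_S_ge_1 N). apply is_RInt_unique.
    apply (is_RInt_derive (V := R_CompleteNormedModule) P p);
      intros t Ht; rewrite Rmin_left, Rmax_right in Ht by lra; [apply D|apply C]; lra.
  - replace (- P 1) with (0 - P 1) by ring. apply is_lim_seq_minus'. now apply exp_dom_lim. apply is_lim_seq_const.
Qed.

(** The coefficient of s^j in t^s. *)
Definition log_weight (j : nat) (t : R) : R := ln t ^ j / INR (fact j).
Definition log_weight_prev (j : nat) (t : R) : R := match j with O => 0 | S i => log_weight i t end.
(** The coefficient of s^j in (t^(s-1) + t^(-s)) / 2. *)
Definition taylor_weight (j : nat) (t : R) : R := (log_weight j t * / t + (-1) ^ j * log_weight j t) / 2.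
Definition taylor_weight_prev (j : nat) (t : R) : R := match j with O => 0 | S i => taylor_weight i t end.
(** The coefficient of s^j in s (s - 1) (t^(s-1) + t^(-s)) / 2: entry j - 2 minus entry j - 1 of
    [taylor_weight], with zero for negative indices. *)
Definition F_weight (j : nat) (t : R) : R := match j with O => 0 | S i => taylor_weight_prev i t - taylor_weight i t end.

Lemma log_weight_derive j t : 0 < t -> is_derive (log_weight j) t (log_weight_prev j t / t).
Proof.
  intros Ht. unfold log_weight, log_weight_prev. destruct j.
  - eapply is_derive_eq. apply (is_derive_ext (fun _ => 1)). intros u. simpl. field. apply is_derive_const'. field. lra.
  - apply (is_derive_ext (fun t => / INR (fact (S j)) * ln t ^ S j)). intros u. apply Rmult_comm.
    eapply is_derive_eq. apply is_derive_scal. apply is_derive_pow. apply is_derive_Reals, derivable_pt_lim_ln. exact Ht.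
    unfold log_weight. rewrite fact_simpl, mult_INR. change (pred (S j)) with j.
    pose proof (INR_fact_neq_0 j). pose proof (not_0_INR (S j) ltac:(lia)).
    field. repeat split; auto; lra.
Qed.

Lemma log_weight_subexp j : subexp (log_weight j).
Proof.
  apply (subexp_mult (fun t => ln t ^ j) (fun _ => / INR (fact j))). apply subexp_pow, subexp_ln. apply subexp_const.
Qed.

Lemma log_weight_prev_subexp j : subexp (log_weight_prev j).
Proof. destruct j. apply subexp_const. apply log_weight_subexp. Qed.

Lemma subexp_scal k w : subexp w -> subexp (fun t => k * w t).
Proof. intros. apply subexp_mult; auto. apply subexp_const. Qed.

Lemma subexp_ext w w' : (forall t, w t = w' t) -> subexp w -> subexp w'.
Proof.
  intros E [C H]. split.
  - intros t Ht. apply (continuous_ext w); auto.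
  - intros e He. destruct (H e He) as (K & HK & B). exists K. split; auto. intros t Ht. rewrite <- E. auto.
Qed.

Lemma taylor_weight_subexp j : subexp (taylor_weight j).
Proof.
  apply (subexp_ext (fun t => / 2 * (log_weight j t * / t + (-1) ^ j * log_weight j t))). intros; unfold taylor_weight, Rdiv; ring.
  apply subexp_scal, subexp_plus. apply subexp_mult. apply log_weight_subexp. apply subexp_inv. apply subexp_scal, log_weight_subexp.
Qed.

Lemma taylor_weight_prev_subexp j : subexp (taylor_weight_prev j).
Proof. destruct j. apply subexp_const. apply taylor_weight_subexp. Qed.

Lemma F_weight_subexp j : subexp (F_weight j).
Proof.
  destruct j. apply subexp_const.
  apply (subexp_ext (fun t => taylor_weight_prev j t + (-1) * taylor_weight j t)). intros; unfold F_weight; ring.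
  apply subexp_plus. apply taylor_weight_prev_subexp. apply subexp_scal, taylor_weight_subexp.
Qed.

(** This is t^2 times the derivative of [taylor_weight j]. *)
Definition taylor_flux (j : nat) (t : R) : R := (log_weight_prev j t - log_weight j t + (-1) ^ j * (t * log_weight_prev j t)) / 2.

Lemma taylor_flux_subexp j : subexp (taylor_flux j).
Proof.
  apply (subexp_ext (fun t => / 2 * ((log_weight_prev j t + (-1) * log_weight j t) + (-1) ^ j * (t * log_weight_prev j t)))). intros; unfold taylor_flux; field.
  apply subexp_scal, subexp_plus. apply subexp_plus. apply log_weight_prev_subexp. apply subexp_scal, log_weight_subexp.
  apply subexp_scal. apply (subexp_mult (fun t => t)). apply subexp_id. apply log_weight_prev_subexp.
Qed.

Lemma taylor_weight_derive j t : 0 < t -> is_derive (taylor_weight j) t (taylor_flux j t / t ^ 2).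
Proof.
  intros Ht. pose proof (log_weight_derive j t Ht) as D.
  apply (is_derive_ext (fun t => / 2 * (log_weight j t * / t + (-1) ^ j * log_weight j t))).
  intros u; unfold taylor_weight, Rdiv. apply Rmult_comm.
  eapply is_derive_eq. apply is_derive_scal. apply is_derive_plus'.
  - apply is_derive_mult'. exact D. auto_derive. lra. reflexivity.
  - apply is_derive_scal. exact D.
  - unfold taylor_flux. field. lra.
Qed.

(** Both t^(s-1) and t^(-s) are eigenfunctions of d/dt t^2 d/dt with eigenvalue s (s - 1); the lemma
    is the coefficient of s^j of this fact. *)
Lemma taylor_flux_derive j t : 0 < t -> is_derive (taylor_flux j) t (F_weight j t).
Proof.
  intros Ht. pose proof (log_weight_derive j t Ht) as D.
  assert (D' : is_derive (log_weight_prev j) t (match j with O => 0 | S i => log_weight_prev i t / t end)).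
  { destruct j. apply is_derive_const'. now apply log_weight_derive. }
  apply (is_derive_ext (fun t => / 2 * ((log_weight_prev j t + (-1) * log_weight j t) + (-1) ^ j * (t * log_weight_prev j t)))).
  intros u. match goal with |- @eq _ ?a ?b => change (@eq R a b) end. unfold taylor_flux. field.
  eapply is_derive_eq. apply is_derive_scal. apply is_derive_plus'. apply is_derive_plus'. exact D'.
  apply is_derive_scal. exact D. apply is_derive_scal. apply is_derive_mult'. apply is_derive_id'. exact D'.
  destruct j as [|[|j]]; unfold F_weight, taylor_weight_prev, taylor_weight, log_weight_prev; simpl pow; field; lra.
Qed.

Lemma log_weight_1 j : log_weight j 1 = match j with O => 1 | _ => 0 end.
Proof. unfold log_weight. rewrite ln_1. destruct j. simpl. field. rewrite pow_ne_zero by discriminate. unfold Rdiv. ring. Qed.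

Lemma weighted_int_plus l w w' x y : 0 < y -> subexp w -> subexp w' -> weighted_int l (fun t => w t + w' t) x y = weighted_int l w x y + weighted_int l w' x y.
Proof.
  intros Hy Hw Hw'. unfold weighted_int. rewrite <- int1_plus by now apply weighted_sum_adm. apply int1_ext. intros; ring.
Qed.

Lemma weighted_int_scal l k w x y : 0 < y -> subexp w -> weighted_int l (fun t => k * w t) x y = k * weighted_int l w x y.
Proof.
  intros Hy Hw. unfold weighted_int. rewrite <- int1_scal by now apply weighted_sum_adm. apply int1_ext. intros; ring.
Qed.

Lemma weighted_int_ext l w w' x y : (forall t, 1 <= t -> w t = w' t) -> weighted_int l w x y = weighted_int l w' x y.
Proof. intros E. apply int1_ext. intros t Ht. now rewrite E. Qed.

Lemma weighted_int_0 l x y : weighted_int l (fun _ => 0) x y = 0.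
Proof.
  apply int1_unique. apply (is_lim_seq_ext (fun _ => 0)); [|apply is_lim_seq_const].
  intros N. symmetry. rewrite (RInt_ext' _ (fun _ => 0)) by (intros; ring).
  rewrite RInt_const. unfold scal; simpl; unfold mult; simpl. apply Rmult_0_r.
Qed.

Lemma lattice_sum_lin2 l l' l1 l2 x y t (a b c d : R) : 0 < y -> 0 < t ->
  (forall m n, a * kernel_val l x y t m n + b * kernel_val l' x y t m n = c * kernel_val l1 x y t m n + d * kernel_val l2 x y t m n) ->
  a * lattice_sum l x y t + b * lattice_sum l' x y t = c * lattice_sum l1 x y t + d * lattice_sum l2 x y t.
Proof.
  intros Hy Ht H. unfold lattice_sum. rewrite <- !Zsum2_scal by now apply kernel_val_adm.
  rewrite <- !Zsum2_plus by (apply zadm2_scal; now apply kernel_val_adm).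
  apply Zsum2_ext. exact H.
Qed.

Lemma lattice_sum_laplacian x y t : 0 < y -> 0 < t ->
  y ^ 2 * lattice_sum (ker_dx (ker_dx theta_ker)) x y t + y ^ 2 * lattice_sum (ker_dy (ker_dy theta_ker)) x y t
  = t ^ 2 * lattice_sum (ker_dt (ker_dt theta_ker)) x y t + 2 * t * lattice_sum (ker_dt theta_ker) x y t.
Proof.
  intros Hy Ht. apply lattice_sum_lin2; auto. intros m n.
  cbn [mono_dx mono_dy mono_dt ker_dx ker_dy ker_dt flat_map app kernel_val mono_val theta_ker]. unfold lattice_term.
  destruct (Z.eqb m 0 && Z.eqb n 0)%bool. ring.
  fold (qexp x y t m n). generalize (qexp x y t m n). intros e. simpl. field. lra.
Qed.

(** Differentiate theta(1/t) = t theta(t) at its fixed point t = 1: - theta' = theta + theta'. *)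
Lemma theta_deriv_1 x y : 0 < y -> lattice_sum (ker_dt theta_ker) x y 1 = - (1 + lattice_sum theta_ker x y 1) / 2.
Proof.
  intros Hy. pose proof (lattice_sum_derive_t theta_ker x y 1 Hy Rlt_0_1) as D.
  assert (D1 : is_derive (fun t => 1 + lattice_sum theta_ker x y (/ t)) 1 (- lattice_sum (ker_dt theta_ker) x y 1)).
  { eapply is_derive_eq. apply is_derive_plus'. apply is_derive_const'.
    apply (is_derive_comp (K := R_AbsRing) (V := R_NormedModule) (lattice_sum theta_ker x y) Rinv).
    rewrite Rinv_1. exact D. auto_derive. lra. reflexivity.
    unfold scal; simpl; unfold mult; simpl. field. }
  assert (D2 : is_derive (fun t => t * (1 + lattice_sum theta_ker x y t)) 1 (1 + lattice_sum theta_ker x y 1 + lattice_sum (ker_dt theta_ker) x y 1)).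
  { eapply is_derive_eq. apply is_derive_mult'. apply is_derive_id'. apply is_derive_plus'. apply is_derive_const'.
    exact D. cbv beta. ring. }
  assert (Eq : - lattice_sum (ker_dt theta_ker) x y 1 = 1 + lattice_sum theta_ker x y 1 + lattice_sum (ker_dt theta_ker) x y 1).
  { apply is_derive_unique in D1. apply is_derive_unique in D2. rewrite <- D1, <- D2.
    apply Derive_ext_loc. exists (mkposreal (1 / 2) ltac:(lra)). intros t Ht.
    unfold ball in Ht; simpl in Ht; unfold AbsRing_ball, abs, minus, plus, opp in Ht; simpl in Ht.
    apply Rabs_def2 in Ht. assert (0 < t) by lra. assert (0 < / t) by now apply Rinv_0_lt_compat.
    rewrite <- !theta_lattice_sum by auto. now apply theta_inv. }
  lra.
Qed.

Definition delta0 (n : nat) : R := match n with O => 1 | _ => 0 end.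
Definition F_real (n : nat) (x y : R) : R := delta0 n / 2 + weighted_int theta_ker (F_weight n) x y.

(* Integration by parts against [d/dt (t^2 d/dt theta)]; the boundary term is evaluated with
   [theta'(1) = - theta(1) / 2], a consequence of the inversion formula. *)
Theorem weighted_int_laplacian_taylor_weight j x y : 0 < y ->
  y ^ 2 * (weighted_int (ker_dx (ker_dx theta_ker)) (taylor_weight j) x y + weighted_int (ker_dy (ker_dy theta_ker)) (taylor_weight j) x y) = F_real j x y.
Proof.
  intros Hy. unfold F_real.
  set (L := lattice_sum theta_ker x y). set (L1 := lattice_sum (ker_dt theta_ker) x y). set (L2 := lattice_sum (ker_dt (ker_dt theta_ker)) x y).
  assert (DL : forall t, 1 <= t -> is_derive L t (L1 t)) by (intros; apply lattice_sum_derive_t; lra).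
  assert (DL1 : forall t, 1 <= t -> is_derive L1 t (L2 t)) by (intros; apply lattice_sum_derive_t; lra).
  assert (CL : continuous_ge_1 L) by now apply lattice_sum_continuous_ge_1.
  assert (CL1 : continuous_ge_1 L1) by now apply lattice_sum_continuous_ge_1.
  assert (CL2 : continuous_ge_1 L2) by now apply lattice_sum_continuous_ge_1.
  assert (Cid : continuous_ge_1 (fun t => t)) by apply subexp_id.
  assert (W1 : subexp (fun t => (2 * t) * taylor_weight j t)).
  { apply (subexp_mult (fun t => 2 * t)). apply subexp_scal, subexp_id. apply taylor_weight_subexp. }
  assert (W2 : subexp (fun t => t ^ 2 * taylor_weight j t)).
  { apply (subexp_mult (fun t => t ^ 2)). apply (subexp_pow (fun t => t)), subexp_id. apply taylor_weight_subexp. }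
  (* Green's formula for d/dt t^2 d/dt: P is the boundary expression, and p, its derivative,
     contains the operator applied to L minus the operator applied to the weight. *)
  set (P := fun t => L1 t * (t ^ 2 * taylor_weight j t) + L t * (- 1 * taylor_flux j t)).
  set (p := fun t => (L2 t * (t ^ 2 * taylor_weight j t) + L1 t * ((2 * t) * taylor_weight j t)) + (-1) * (L t * F_weight j t)).
  assert (A0 : int1_adm (fun t => L t * F_weight j t)) by (apply weighted_sum_adm; auto; apply F_weight_subexp).
  assert (A1 : int1_adm (fun t => L1 t * ((2 * t) * taylor_weight j t))) by (apply weighted_sum_adm; auto).
  assert (A2 : int1_adm (fun t => L2 t * (t ^ 2 * taylor_weight j t))) by (apply weighted_sum_adm; auto).
  assert (Ip : int1 p = - P 1).
  { apply int1_deriv.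
    - intros t Ht. unfold P, p. eapply is_derive_eq. apply is_derive_plus'.
      apply is_derive_mult'. apply DL1; auto. apply is_derive_mult'. auto_derive. auto. reflexivity. apply taylor_weight_derive; lra.
      apply is_derive_mult'. apply DL; auto. apply is_derive_scal. apply taylor_flux_derive; lra.
      simpl. field. lra.
    - apply (proj1 (int1_adm_plus _ _ (int1_adm_plus _ _ A2 A1) (int1_adm_scal (-1) _ A0))).
    - destruct (exp_dom_weight L1 (fun t => t ^ 2 * taylor_weight j t) (lattice_sum_exp_dom _ _ _ Hy) W2) as (c & K & Hc & HK & B).
      destruct (exp_dom_weight L (fun t => -1 * taylor_flux j t) (lattice_sum_exp_dom _ _ _ Hy) (subexp_scal (-1) _ (taylor_flux_subexp j))) as (c' & K' & Hc' & HK' & B').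
      exists (Rmin c c'), (K + K'). split. now apply Rmin_pos. split. lra.
      intros t Ht. unfold P. eapply Rle_trans. apply Rabs_triang.
      specialize (B t Ht). specialize (B' t Ht). pose proof (Rmin_l c c'). pose proof (Rmin_r c c'). set (r := Rmin c c') in *.
      assert (E : forall q M, r <= q -> 0 <= M -> M * exp (- q * t) <= M * exp (- r * t)).
      { intros q M Hq HM. apply Rmult_le_compat_l; auto. apply exp_le. nra. }
      pose proof (E c K H HK). pose proof (E c' K' H0 HK'). lra. }
  unfold p in Ip. rewrite int1_plus, int1_scal in Ip; auto using int1_adm_plus, int1_adm_scal.
  assert (EP : - P 1 = delta0 j / 2).
  { unfold P, L, L1. rewrite theta_deriv_1 by auto.
    unfold taylor_flux, taylor_weight. rewrite !log_weight_1. unfold log_weight_prev. destruct j as [|[|j]]; rewrite ?log_weight_1; simpl; field. }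
  assert (EI : y ^ 2 * (weighted_int (ker_dx (ker_dx theta_ker)) (taylor_weight j) x y + weighted_int (ker_dy (ker_dy theta_ker)) (taylor_weight j) x y)
     = int1 (fun t => L2 t * (t ^ 2 * taylor_weight j t) + L1 t * (2 * t * taylor_weight j t))).
  { unfold weighted_int. rewrite <- int1_plus, <- int1_scal; try (apply int1_adm_plus); try (apply weighted_sum_adm; auto; apply taylor_weight_subexp).
    apply int1_ext. intros t Ht. pose proof (lattice_sum_laplacian x y t Hy ltac:(lra)) as E. unfold L1, L2.
    replace (y ^ 2 * (lattice_sum (ker_dx (ker_dx theta_ker)) x y t * taylor_weight j t + lattice_sum (ker_dy (ker_dy theta_ker)) x y t * taylor_weight j t))
      with ((y ^ 2 * lattice_sum (ker_dx (ker_dx theta_ker)) x y t + y ^ 2 * lattice_sum (ker_dy (ker_dy theta_ker)) x y t) * taylor_weight j t) by ring.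
    rewrite E. ring. }
  rewrite EI. change (weighted_int theta_ker (F_weight j) x y) with (int1 (fun t => L t * F_weight j t)). lra.
Qed.

Definition F_real_prev (n : nat) (x y : R) : R := match n with O => 0 | S i => F_real i x y end.
Definition F_real_diff (n : nat) (x y : R) : R := match n with O => 0 | S i => F_real_prev i x y - F_real i x y end.

(** [F_weight] is a difference of two Taylor weights, to each of which the previous theorem applies;
    the constant 1/2 in [F_real] has no derivative. *)
Theorem F_real_laplacian n x y : 0 < y ->
  y ^ 2 * (weighted_int (ker_dx (ker_dx theta_ker)) (F_weight n) x y + weighted_int (ker_dy (ker_dy theta_ker)) (F_weight n) x y) = F_real_diff n x y.
Proof.
  intros Hy. destruct n as [|i]; cbn [F_real_diff].
  - unfold F_weight. rewrite !weighted_int_0. ring.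
  - assert (E : forall l, weighted_int l (F_weight (S i)) x y = weighted_int l (taylor_weight_prev i) x y + (-1) * weighted_int l (taylor_weight i) x y).
    { intros l. rewrite <- weighted_int_scal by (auto; apply taylor_weight_subexp).
      rewrite <- weighted_int_plus by (auto; try apply subexp_scal; apply taylor_weight_subexp || apply taylor_weight_prev_subexp).
      apply weighted_int_ext. intros; unfold F_weight; ring. }
    rewrite !E. rewrite <- (weighted_int_laplacian_taylor_weight i x y Hy).
    destruct i as [|j]; cbn [F_real_prev].
    + unfold taylor_weight_prev. rewrite !weighted_int_0. ring.
    + rewrite <- (weighted_int_laplacian_taylor_weight j x y Hy). change (taylor_weight_prev (S j)) with (taylor_weight j). ring.
Qed.

(** * Mellin transforms and Taylor coefficients *)

Definition cint1 (f : R -> C) : C := (int1 (fun t => Re (f t)), int1 (fun t => Im (f t))).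
Definition cint1_adm (f : R -> C) : Prop := int1_adm (fun t => Re (f t)) /\ int1_adm (fun t => Im (f t)).

Lemma cint1_ext f g : (forall t, 1 <= t -> f t = g t) -> cint1 f = cint1 g.
Proof. intros E. unfold cint1. f_equal; apply int1_ext; intros t Ht; now rewrite E. Qed.

Lemma cint1_adm_plus f g : cint1_adm f -> cint1_adm g -> cint1_adm (fun t => (f t + g t)%C).
Proof. intros [H1 H2] [H3 H4]. split; [apply (int1_adm_plus _ _ H1 H3)|apply (int1_adm_plus _ _ H2 H4)]. Qed.

Lemma int1_adm_ext f g : (forall t, f t = g t) -> int1_adm f -> int1_adm g.
Proof.
  intros E [C (K & d & Hd & H)]. split.
  - intros t Ht. apply (continuous_ext f); auto.
  - exists K, d. split; auto. intros t Ht. rewrite <- E. auto.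
Qed.

Lemma cint1_adm_scal c f : cint1_adm f -> cint1_adm (fun t => (c * f t)%C).
Proof.
  intros [H1 H2]. destruct c as [a b]. split.
  - apply (int1_adm_ext (fun t => a * Re (f t) + (- b) * Im (f t))).
    intros t. unfold Re, Im, Cmult; simpl. ring. auto using int1_adm_plus, int1_adm_scal.
  - apply (int1_adm_ext (fun t => a * Im (f t) + b * Re (f t))).
    intros t. unfold Re, Im, Cmult; simpl. ring. auto using int1_adm_plus, int1_adm_scal.
Qed.

Lemma cint1_plus f g : cint1_adm f -> cint1_adm g -> cint1 (fun t => (f t + g t)%C) = (cint1 f + cint1 g)%C.
Proof.
  intros [H1 H2] [H3 H4]. unfold cint1, Cplus; simpl. f_equal.
  - exact (int1_plus _ _ H1 H3).
  - exact (int1_plus _ _ H2 H4).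
Qed.

Lemma cint1_scal c f : cint1_adm f -> cint1 (fun t => (c * f t)%C) = (c * cint1 f)%C.
Proof.
  intros [H1 H2]. destruct c as [a b]. unfold cint1, Cmult; simpl. f_equal.
  - rewrite (int1_ext _ (fun t => a * Re (f t) + (- b) * Im (f t))).
    rewrite int1_plus, !int1_scal by auto using int1_adm_scal. unfold Re, Im; ring.
    intros t _. unfold Re, Im; simpl. ring.
  - rewrite (int1_ext _ (fun t => a * Im (f t) + b * Re (f t))).
    rewrite int1_plus, !int1_scal by auto using int1_adm_scal. unfold Re, Im; ring.
    intros t _. unfold Re, Im; simpl. ring.
Qed.

Lemma cint1_bound f K d : cint1_adm f -> 0 < d -> (forall t, 1 <= t -> Cmod (f t) <= K * Rpower t (- (1 + d))) ->
  Cmod (cint1 f) <= 2 * (K / d).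
Proof.
  intros [[H1 _] [H2 _]] Hd H. eapply Rle_trans. apply Cmod_le_sum. unfold cint1; simpl.
  assert (Rabs (int1 (fun t => Re (f t))) <= K / d).
  { apply int1_bound; auto. intros t Ht. eapply Rle_trans. apply Re_le_Cmod. now apply H. }
  assert (Rabs (int1 (fun t => Im (f t))) <= K / d).
  { apply int1_bound; auto. intros t Ht. eapply Rle_trans. apply Im_le_Cmod. now apply H. }
  lra.
Qed.

Definition cpow (s : C) (t : R) : C := Cexp (s * RtoC (ln t)).

Lemma cpow_Re s t : Re (cpow s t) = exp (Re s * ln t) * cos (Im s * ln t).
Proof.
  unfold cpow, Cexp. simpl. unfold Re, Im; simpl. f_equal; f_equal; ring.
Qed.
Lemma cpow_Im s t : Im (cpow s t) = exp (Re s * ln t) * sin (Im s * ln t).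
Proof.
  unfold cpow, Cexp. simpl. unfold Re, Im; simpl. f_equal; f_equal; ring.
Qed.

Lemma Cmod_cpow s t : Cmod (cpow s t) = exp (Re s * ln t).
Proof. unfold cpow. rewrite Cmod_Cexp. f_equal. unfold Re; simpl. ring. Qed.

Lemma cpow_subexp s : subexp (fun t => Re (cpow s t)) /\ subexp (fun t => Im (cpow s t)).
Proof.
  split.
  - apply (subexp_ext (fun t => exp (Re s * ln t) * cos (Im s * ln t))). intros; symmetry; apply cpow_Re.
    apply subexp_mult. apply subexp_power. apply (subexp_bounded _ 1).
    apply (continuous_ge_1_derive _ (fun t => - sin (Im s * ln t) * (Im s / t))). intros t Ht. auto_derive. auto. field. lra.
    intros. apply Rabs_le, COS_bound.
  - apply (subexp_ext (fun t => exp (Re s * ln t) * sin (Im s * ln t))). intros; symmetry; apply cpow_Im.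
    apply subexp_mult. apply subexp_power. apply (subexp_bounded _ 1).
    apply (continuous_ge_1_derive _ (fun t => cos (Im s * ln t) * (Im s / t))). intros t Ht. auto_derive. auto. field. lra.
    intros. apply Rabs_le, SIN_bound.
Qed.

Definition exp_decaying (k : R -> R) : Prop := continuous_ge_1 k /\ exp_dom k.

Lemma exp_decaying_weight k w : exp_decaying k -> subexp w -> exp_decaying (fun t => k t * w t).
Proof. intros [C H] Hw. split. apply continuous_ge_1_mult; auto. apply Hw. now apply exp_dom_weight. Qed.

Lemma exp_decaying_cpow k s : exp_decaying k -> cint1_adm (fun t => (RtoC (k t) * cpow s t)%C).
Proof.
  intros H. destruct (cpow_subexp s) as [W1 W2]. split.
  - apply (int1_adm_ext (fun t => k t * Re (cpow s t))). intros t. unfold Re, Im; simpl. ring.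
    apply exp_dom_int1_adm; now apply (exp_decaying_weight k).
  - apply (int1_adm_ext (fun t => k t * Im (cpow s t))). intros t. unfold Re, Im; simpl. ring.
    apply exp_dom_int1_adm; now apply (exp_decaying_weight k).
Qed.

(** The j-th derivative in s of the integral of k(t) t^s over [1, oo), taken with respect to dt
    rather than dt / t. *)
Definition mellin (k : R -> R) (j : nat) (s : C) : C := cint1 (fun t => (RtoC (k t * ln t ^ j) * cpow s t)%C).

Lemma exp_decaying_ln k j : exp_decaying k -> exp_decaying (fun t => k t * ln t ^ j).
Proof. intros H. apply exp_decaying_weight; auto. apply subexp_pow, subexp_ln. Qed.

Lemma mellin_adm k j s : exp_decaying k -> cint1_adm (fun t => (RtoC (k t * ln t ^ j) * cpow s t)%C).
Proof. intros H. apply (exp_decaying_cpow (fun t => k t * ln t ^ j)). now apply exp_decaying_ln. Qed.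

Lemma cpow_plus s h t : cpow (s + h) t = (cpow s t * cpow h t)%C.
Proof. unfold cpow. rewrite <- Cexp_plus. f_equal. ring. Qed.

Lemma mellin_cdiff k j s : exp_decaying k -> cdiff (mellin k j) s (mellin k (S j) s).
Proof.
  intros Hk.
  (* Majorant of the remainder for |h| <= 1: two more logarithms from the quadratic term of
     [Cexp_remainder], and one factor t bounding exp (|h| ln t). *)
  assert (Hw : exp_decaying (fun t => k t * (ln t ^ (S (S j)) * exp ((Re s + 1) * ln t)))).
  { apply exp_decaying_weight; auto. apply subexp_mult. apply subexp_pow, subexp_ln. apply subexp_power. }
  destruct Hw as [_ (c & K & Hc & HK & B)]. destruct (exp_le_power c Hc) as (K' & HK' & B').
  assert (Q : forall h : C, Cmod h <= 1 ->
    Cmod (mellin k j (s + h) - mellin k j s - h * mellin k (S j) s) <= 12 * Cmod h ^ 2 * (K * K')).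
  { intros h Hh.
    pose proof (mellin_adm k j (s + h) Hk) as A1. pose proof (mellin_adm k j s Hk) as A2. pose proof (mellin_adm k (S j) s Hk) as A3.
    replace (mellin k j (s + h) - mellin k j s - h * mellin k (S j) s)%C
      with (mellin k j (s + h) + ((- (1)) * mellin k j s + (- h) * mellin k (S j) s))%C by ring.
    unfold mellin. rewrite <- !cint1_scal, <- !cint1_plus by auto using cint1_adm_scal, cint1_adm_plus.
    replace (12 * Cmod h ^ 2 * (K * K')) with (2 * (6 * Cmod h ^ 2 * (K * K') / 1)) by field.
    apply cint1_bound. auto using cint1_adm_scal, cint1_adm_plus. lra.
    intros t Ht. rewrite cpow_plus.
    replace (RtoC (k t * ln t ^ j) * (cpow s t * cpow h t) +
      (- (1) * (RtoC (k t * ln t ^ j) * cpow s t) + - h * (RtoC (k t * ln t ^ S j) * cpow s t)))%C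
      with (RtoC (k t * ln t ^ j) * cpow s t * (cpow h t - 1 - h * RtoC (ln t)))%C.
    2:{ simpl pow. rewrite !RtoC_mult. ring. }
    rewrite !Cmod_mult, Cmod_cpow, Cmod_R.
    pose proof (ln_bounds t Ht) as Hln.
    pose proof (Cexp_remainder (h * RtoC (ln t))%C) as R. fold (cpow h t) in R.
    rewrite Cmod_mult, Cmod_R, (Rabs_pos_eq (ln t)) in R by lra.
    assert (E1 : exp (Cmod h * ln t) <= exp (1 * ln t)) by (apply exp_le, Rmult_le_compat_r; lra).
    specialize (B t Ht). specialize (B' t Ht).
    rewrite !Rabs_mult in B. rewrite (Rabs_pos_eq (ln t ^ S (S j))) in B by (apply pow_le; lra).
    rewrite (Rabs_pos_eq (exp _)) in B by (left; apply exp_pos).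
    rewrite Rabs_mult, (Rabs_pos_eq (ln t ^ j)) by (apply pow_le; lra).
    replace ((Re s + 1) * ln t) with (Re s * ln t + 1 * ln t) in B by ring. rewrite exp_plus in B.
    apply Rle_trans with (Rabs (k t) * ln t ^ j * exp (Re s * ln t) * (6 * (Cmod h * ln t) ^ 2 * exp (1 * ln t))).
    { apply Rmult_le_compat_l.
      - repeat apply Rmult_le_pos. apply Rabs_pos. apply pow_le; lra. left; apply exp_pos.
      - eapply Rle_trans. exact R. apply Rmult_le_compat_l; auto.
        apply Rmult_le_pos. lra. apply pow2_ge_0. }
    replace (Rabs (k t) * ln t ^ j * exp (Re s * ln t) * (6 * (Cmod h * ln t) ^ 2 * exp (1 * ln t)))
      with (6 * Cmod h ^ 2 * (Rabs (k t) * (ln t ^ S (S j) * (exp (Re s * ln t) * exp (1 * ln t))))) by (simpl; ring).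
    rewrite !(Rmult_assoc (6 * Cmod h ^ 2)). apply Rmult_le_compat_l.
    { apply Rmult_le_pos. lra. apply pow2_ge_0. }
    eapply Rle_trans. exact B. rewrite Rmult_assoc. apply Rmult_le_compat_l; auto. }
  intros eps Heps. set (M := 12 * (K * K') + 1).
  assert (HM : 0 < M) by (unfold M; pose proof (Rmult_le_pos K K' HK HK'); lra).
  exists (Rmin 1 (eps / M)). split. apply Rmin_pos. lra. now apply Rdiv_lt_0_compat.
  intros u Hu. set (h := (u - s)%C) in *.
  assert (H1 : Cmod h < 1) by (eapply Rlt_le_trans; [exact Hu|apply Rmin_l]).
  assert (H2 : Cmod h < eps / M) by (eapply Rlt_le_trans; [exact Hu|apply Rmin_r]).
  replace u with (s + h)%C by (unfold h; ring).
  eapply Rle_trans. apply Q. lra. pose proof (Cmod_ge_0 h).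
  assert (Cmod h * M <= eps).
  { apply Rle_trans with (eps / M * M). apply Rmult_le_compat_r; lra. right; field; lra. }
  replace (12 * Cmod h ^ 2 * (K * K')) with (Cmod h * (12 * (K * K')) * Cmod h) by ring.
  apply Rmult_le_compat_r; auto. unfold M in *. lra.
Qed.

(** The sign comes from differentiating j times in the argument - s. *)
Definition folded_mellin (ka kb : R -> R) (j : nat) (s : C) : C :=
  (RtoC (1 / 2) * (mellin ka j s + RtoC ((-1) ^ j) * mellin kb j (- s)))%C.

Lemma folded_mellin_cdiff ka kb j s : exp_decaying ka -> exp_decaying kb -> cdiff (folded_mellin ka kb j) s (folded_mellin ka kb (S j) s).
Proof.
  intros Ha Hb. unfold folded_mellin. apply cdiff_scal. apply cdiff_plus. now apply mellin_cdiff.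
  replace (RtoC ((-1) ^ S j) * mellin kb (S j) (- s))%C
    with (RtoC ((-1) ^ j) * (- (1) * mellin kb (S j) (- s)))%C.
  2:{ simpl pow. rewrite RtoC_mult. change (RtoC (-1)) with (RtoC (- (1))). rewrite RtoC_opp. ring. }
  apply cdiff_scal. apply (cdiff_comp (mellin kb j) (fun u => - u)%C). now apply mellin_cdiff.
  apply (cdiff_ext (fun u => - (1) * u)%C). intros; ring.
  rewrite <- (Cmult_1_r (- (1))) at 1. apply cdiff_scal, cdiff_id.
Qed.

Lemma cpow_0 t : cpow 0 t = 1%C.
Proof. unfold cpow. rewrite Cmult_0_l. apply Cexp_0. Qed.

Lemma int1_0 : int1 (fun _ => 0) = 0.
Proof.
  apply int1_unique. apply (is_lim_seq_ext (fun _ => 0)); [|apply is_lim_seq_const].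
  intros N. symmetry. rewrite RInt_const. unfold scal; simpl; unfold mult; simpl. apply Rmult_0_r.
Qed.

Lemma cint1_real f : cint1 (fun t => RtoC (f t)) = RtoC (int1 f).
Proof. unfold cint1, RtoC. f_equal. simpl. apply int1_0. Qed.

Lemma mellin_0 k j : mellin k j 0 = RtoC (int1 (fun t => k t * ln t ^ j)).
Proof.
  unfold mellin. rewrite <- cint1_real. apply cint1_ext. intros t _. rewrite cpow_0. apply Cmult_1_r.
Qed.

Lemma folded_mellin_0 ka kb j : exp_decaying ka -> exp_decaying kb ->
  folded_mellin ka kb j 0 = RtoC (int1 (fun t => (ka t + (-1) ^ j * kb t) * ln t ^ j / 2)).
Proof.
  intros Ha Hb. unfold folded_mellin. replace (- 0)%C with (RtoC 0) by ring. rewrite !mellin_0, <- RtoC_mult, <- RtoC_plus, <- RtoC_mult.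
  f_equal.
  assert (A1 : int1_adm (fun t => ka t * ln t ^ j)) by (apply exp_dom_int1_adm; now apply (exp_decaying_ln ka)).
  assert (A2 : int1_adm (fun t => kb t * ln t ^ j)) by (apply exp_dom_int1_adm; now apply (exp_decaying_ln kb)).
  rewrite <- !int1_scal, <- int1_plus, <- int1_scal by auto using int1_adm_scal, int1_adm_plus.
  apply int1_ext. intros; field.
Qed.

(** A derivative exists, so the choice in [Cderiv] satisfies its specification, and derivatives are
    unique. *)
Lemma Cderiv_eq g s l : cdiff g s l -> Cderiv g s = l.
Proof.
  intros H. unfold Cderiv.
  pose proof (epsilon_spec (inhabits (RtoC 0)) (fun l => @is_derive C_AbsRing C_NormedModule g s l)
    (ex_intro _ l (proj1 (cdiff_is_derive g s l) H))) as E.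
  apply cdiff_is_derive in E. eapply cdiff_unique; eauto.
Qed.

Lemma RtoC_2 : RtoC 2 = (1 + 1)%C.
Proof. rewrite <- RtoC_plus. f_equal. Qed.

(** * Taylor coefficients of c0 + s (s - b) H(s) *)

Section Taylor.
Variables (g : C -> C) (H : nat -> C -> C) (c0 b : C).
Hypothesis HH : forall j s, cdiff (H j) s (H (S j) s).
Hypothesis Hg : forall s, g s = (c0 + s * (s - b) * H 0 s)%C.

(** Leibniz's rule with a quadratic factor has three terms. The truncated predecessors for n = 0 and
    n = 1 stand next to vanishing coefficients. *)
Lemma iter_Cderiv n : forall s, Nat.iter n Cderiv g s =
  (RtoC (delta0 n) * c0 + s * (s - b) * H n s
   + (RtoC (INR n) * ((RtoC 2 * s - b) * H (pred n) s)
      + RtoC (INR n * (INR n - 1)) * H (pred (pred n)) s))%C.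
Proof.
  induction n as [|n IH]; intros s.
  - simpl. rewrite Hg. unfold delta0. rewrite Rmult_0_l. ring.
  - change (Nat.iter (S n) Cderiv g) with (Cderiv (Nat.iter n Cderiv g)).
    apply Cderiv_eq. apply (cdiff_ext _ _ _ _ (fun u => eq_sym (IH u))).
    assert (L1 : cdiff (fun u => u * (u - b))%C s (RtoC 2 * s - b)%C).
    { replace (RtoC 2 * s - b)%C with (1 * (s - b) + s * (1 + 0))%C by (rewrite RtoC_2; ring).
      apply (cdiff_mult (fun u => u) (fun u => (u - b)%C)). apply cdiff_id. apply cdiff_plus. apply cdiff_id. apply cdiff_const. }
    assert (L2 : cdiff (fun u => RtoC 2 * u - b)%C s (RtoC 2)).
    { pose proof (cdiff_plus _ _ s _ _ (cdiff_scal (RtoC 2) _ s _ (cdiff_id s)) (cdiff_const (- b)%C s)) as Q.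
      replace (RtoC 2 * 1 + 0)%C with (RtoC 2) in Q by ring. exact Q. }
    assert (D : cdiff (fun s => RtoC (delta0 n) * c0 + s * (s - b) * H n s
      + (RtoC (INR n) * ((RtoC 2 * s - b) * H (pred n) s) + RtoC (INR n * (INR n - 1)) * H (pred (pred n)) s))%C s
      ((0 + ((RtoC 2 * s - b) * H n s + s * (s - b) * H (S n) s)) +
       (RtoC (INR n) * (RtoC 2 * H (pred n) s + (RtoC 2 * s - b) * H (S (pred n)) s)
        + RtoC (INR n * (INR n - 1)) * H (S (pred (pred n))) s))%C).
    { repeat apply cdiff_plus. apply cdiff_const.
      apply (cdiff_mult (fun u => u * (u - b))%C); auto.
      apply cdiff_scal. apply (cdiff_mult (fun u => RtoC 2 * u - b)%C); auto. apply cdiff_scal; auto. }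
    match type of D with cdiff _ _ ?l => match goal with |- cdiff _ _ ?l' => replace l' with l; auto end end.
    destruct n as [|[|n]]; simpl pred; rewrite ?S_INR; simpl INR; unfold delta0;
      rewrite ?RtoC_mult, ?RtoC_minus, ?RtoC_plus, ?RtoC_mult; try ring.
    all: rewrite ?RtoC_2; ring.
Qed.

(** With h_k the Taylor coefficients of H, coefficient n is h_(n-2) - b h_(n-1). Weight 0 uses b = 1
    and weight 2 uses b = -1. *)
Lemma taylor_affine n : taylor_coef g n =
  (RtoC (delta0 n) * c0 + match n with O => 0 | S i =>
     match i with O => 0 | S j => H j 0 / RtoC (INR (fact j)) end - b * (H i 0 / RtoC (INR (fact i))) end)%C.
Proof.
  unfold taylor_coef. rewrite iter_Cderiv.
  assert (F : forall k, RtoC (INR (fact k)) <> RtoC 0).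
  { intros k E. apply RtoC_inj in E. now apply INR_fact_neq_0 in E. }
  assert (P : forall k, RtoC (INR (S k)) <> RtoC 0).
  { intros k E. apply RtoC_inj in E. now apply (not_0_INR (S k)) in E. }
  destruct n as [|[|n]].
  - simpl pred. unfold delta0. simpl INR. rewrite Rmult_0_l. change (INR (fact 0)) with 1. field.
  - simpl pred. unfold delta0. simpl INR. replace (1 * (1 - 1)) with 0 by ring. field.
  - simpl pred. unfold delta0. rewrite (fact_simpl (S n)), (fact_simpl n), !mult_INR.
    replace (INR (S (S n)) - 1) with (INR (S n)) by (rewrite (S_INR (S n)); ring).
    rewrite !RtoC_mult. field. auto.
Qed.
End Taylor.

(** * Integrals over (0, oo) and the Gamma function *)

(** The integrand after t = 1/u, which carries (0, 1] to [1, oo), so that [int1] is the only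
    improper integral to be studied. *)
Definition invert_var (f : R -> R) (u : R) : R := f (/ u) * / u ^ 2.
Definition int0 (f : R -> R) : R := int1 f + int1 (invert_var f).
Definition int0_adm (f : R -> R) : Prop := (forall t, 0 < t -> continuous f t) /\ int1_adm f /\ int1_adm (invert_var f).

Lemma pos_ex_RInt (f : R -> R) a b : (forall t, 0 < t -> continuous f t) -> 0 < a -> 0 < b -> ex_RInt f a b.
Proof.
  intros H Ha Hb. apply (ex_RInt_continuous (V := R_CompleteNormedModule)). intros t Ht. apply H.
  unfold Rmin in Ht. destruct (Rle_dec a b); lra.
Qed.

Lemma RInt_invert_var (f : R -> R) a : (forall t, 0 < t -> continuous f t) -> 0 < a <= 1 -> RInt f a 1 = RInt (invert_var f) 1 (/ a).
Proof.
  intros H Ha.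
  assert (H1 : 1 <= / a) by (rewrite <- Rinv_1; apply Rinv_le_contravar; lra).
  pose proof (RInt_comp (V := R_CompleteNormedModule) f Rinv (fun u => - / u ^ 2) 1 (/ a)) as E.
  rewrite Rinv_1, Rinv_inv in E.
  rewrite Rmin_left, Rmax_right in E by lra.
  rewrite <- (opp_RInt_swap (V := R_CompleteNormedModule) f 1 a) by (apply pos_ex_RInt; auto; lra).
  rewrite <- E.
  - rewrite <- (RInt_opp (V := R_CompleteNormedModule)).
    + apply RInt_ext. intros u _. unfold opp, scal; simpl. unfold mult; simpl. unfold invert_var. simpl. ring.
    + apply (ex_RInt_continuous (V := R_CompleteNormedModule)). intros u Hu. rewrite Rmin_left, Rmax_right in Hu by lra.
      apply (cont_mult (fun y => - / y ^ 2) (fun y => f (/ y))).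
      * eapply is_derive_cont. auto_derive. nra. reflexivity.
      * apply (continuous_comp Rinv f). eapply is_derive_cont. auto_derive. lra. reflexivity.
        apply H. apply Rinv_0_lt_compat; lra.
  - intros u Hu. apply H. apply Rinv_0_lt_compat; lra.
  - intros u Hu. split.
    + auto_derive. lra. field. lra.
    + eapply is_derive_cont. auto_derive. nra. reflexivity.
Qed.

Lemma int1_tail_eps f eps : int1_adm f -> 0 < eps -> exists T0, 1 <= T0 /\
  forall T, T0 <= T -> Rabs (RInt f 1 T - int1 f) < eps.
Proof.
  intros (Hf & K & d & Hd & Hp) He. pose proof (power_dom_pos _ _ _ Hp) as HK.
  destruct (Rpower_small d (eps * d / (K + 1)) Hd) as (T0 & H1 & HT).
  { apply Rdiv_lt_0_compat; [|lra]. now apply Rmult_lt_0_compat. }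
  exists T0. split; auto. intros T HTT. rewrite Rabs_minus_sym.
  eapply Rle_lt_trans. apply (int1_tail f K d); auto; lra.
  specialize (HT T HTT).
  apply Rle_lt_trans with ((K + 1) / d * Rpower T (- d)).
  - apply Rmult_le_compat_r. left; apply Rpower_pos. apply Rmult_le_compat_r. left; now apply Rinv_0_lt_compat. lra.
  - apply Rlt_le_trans with ((K + 1) / d * (eps * d / (K + 1))).
    apply Rmult_lt_compat_l; auto. apply Rdiv_lt_0_compat; lra. right; field; lra.
Qed.

Lemma int0_lim f eps : int0_adm f -> 0 < eps -> exists T0, 1 <= T0 /\
  forall a b, 0 < a -> a <= / T0 -> T0 <= b -> Rabs (RInt f a b - int0 f) < eps.
Proof.
  intros (C & A1 & A2) He.
  destruct (int1_tail_eps f (eps / 2) A1 ltac:(lra)) as (T1 & H1 & B1).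
  destruct (int1_tail_eps (invert_var f) (eps / 2) A2 ltac:(lra)) as (T2 & H2 & B2).
  exists (Rmax T1 T2). split. eapply Rle_trans; [exact H1|apply Rmax_l].
  intros a b Ha Ha2 Hb.
  pose proof (Rmax_l T1 T2). pose proof (Rmax_r T1 T2).
  assert (H3 : T2 <= / a). { rewrite <- (Rinv_inv T2). apply Rinv_le_contravar; auto.
    eapply Rle_trans. exact Ha2. apply Rinv_le_contravar; lra. }
  assert (Ha1 : a <= 1).
  { rewrite <- (Rinv_inv a), <- Rinv_1. apply Rinv_le_contravar; lra. }
  specialize (B1 b ltac:(lra)). specialize (B2 (/ a) H3).
  rewrite <- RInt_invert_var in B2 by (auto; lra).
  rewrite <- (RInt_Chasles (V := R_CompleteNormedModule) f a 1 b) by (apply pos_ex_RInt; auto; lra).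
  unfold plus; simpl. unfold int0. apply Rabs_def2 in B1. apply Rabs_def2 in B2. apply Rabs_def1; lra.
Qed.

Lemma is_RInt_gen_of_lim (f : R -> R) (l : R) :
  (forall t, 0 < t -> continuous f t) ->
  (forall eps, 0 < eps -> exists T0, 1 <= T0 /\
    forall a b, 0 < a -> a <= / T0 -> T0 <= b -> Rabs (RInt f a b - l) < eps) ->
  is_RInt_gen (V := R_NormedModule) f (at_right 0) (Rbar_locally p_infty) l.
Proof.
  intros C H P [eps HP].
  destruct (H eps (cond_pos eps)) as (T0 & HT & B).
  assert (Hi : 0 < / T0) by (apply Rinv_0_lt_compat; lra).
  apply (Filter_prod _ _ _ (fun a => 0 < a < / T0) (fun b => T0 < b)).
  - exists (mkposreal _ Hi). intros a Ha Hpos. split; auto.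
    unfold ball in Ha; simpl in Ha; unfold AbsRing_ball, abs, minus, plus, opp in Ha; simpl in Ha.
    apply Rabs_def2 in Ha. lra.
  - exists T0. auto.
  - intros a b Ha Hb. exists (RInt f a b). simpl. split.
    + apply (RInt_correct (V := R_CompleteNormedModule)). apply pos_ex_RInt; auto; lra.
    + apply HP. apply B; lra.
Qed.

Lemma int0_gen f : int0_adm f -> is_RInt_gen (V := R_NormedModule) f (at_right 0) (Rbar_locally p_infty) (int0 f).
Proof.
  intros H. apply is_RInt_gen_of_lim. apply H. intros eps He. now apply int0_lim.
Qed.

Lemma RInt_gen_int0 f : int0_adm f -> RInt_gen (V := R_CompleteNormedModule) f (at_right 0) (Rbar_locally p_infty) = int0 f.
Proof. intros H. apply is_RInt_gen_unique. now apply int0_gen. Qed.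

(** The substitution is made on compact intervals [a, b], which it maps to [r a, r b]; both families
    exhaust (0, oo). *)
Lemma int0_scale f r : 0 < r -> int0_adm f -> int0_adm (fun t => r * f (r * t)) -> int0 (fun t => r * f (r * t)) = int0 f.
Proof.
  intros Hr Hf Hg. rewrite <- (RInt_gen_int0 _ Hg).
  apply is_RInt_gen_unique. apply is_RInt_gen_of_lim. apply Hg.
  intros eps He. destruct (int0_lim f eps Hf He) as (T0 & HT & B).
  assert (Hir : 0 < / r) by now apply Rinv_0_lt_compat.
  (* Large enough for r a <= 1 / T0 and T0 <= r b, whether r is above or below 1. *)
  exists (T0 * Rmax 1 (Rmax r (/ r))).
  assert (M1 : 1 <= Rmax 1 (Rmax r (/ r))) by apply Rmax_l.
  assert (M2 : r <= Rmax 1 (Rmax r (/ r))) by (eapply Rle_trans; [apply Rmax_l|apply Rmax_r]).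
  assert (M3 : / r <= Rmax 1 (Rmax r (/ r))) by (eapply Rle_trans; [apply Rmax_r|apply Rmax_r]).
  set (M := Rmax 1 (Rmax r (/ r))) in *. split. nra.
  intros a b Ha Ha2 Hb.
  assert (Hra : r * a <= / T0).
  { apply Rle_trans with (r * / (T0 * M)). apply Rmult_le_compat_l; lra.
    rewrite Rinv_mult. rewrite (Rmult_comm (/ T0)), <- Rmult_assoc.
    rewrite <- (Rmult_1_l (/ T0)) at 2. apply Rmult_le_compat_r. left; apply Rinv_0_lt_compat; lra.
    apply (Rmult_le_reg_r M). lra. rewrite Rmult_assoc, Rinv_l by lra. lra. }
  assert (Hrb : T0 <= r * b).
  { apply Rle_trans with (r * (T0 * M)). 2: apply Rmult_le_compat_l; lra.
    apply Rle_trans with (r * (T0 * / r)). right; field; lra.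
    apply Rmult_le_compat_l. lra. apply Rmult_le_compat_l; lra. }
  assert (Hb0 : 0 < b) by nra.
  pose proof (RInt_comp (V := R_CompleteNormedModule) f (fun t => r * t) (fun _ => r) a b) as E.
  assert (E' : RInt (fun t => r * f (r * t)) a b = RInt f (r * a) (r * b)).
  { apply E.
    - intros t Ht. apply (proj1 Hf). apply Rmult_lt_0_compat; auto.
      unfold Rmin in Ht. destruct (Rle_dec a b); lra.
    - intros t Ht. split. auto_derive. auto. ring. apply cont_const. }
  rewrite E'. apply B; auto. now apply Rmult_lt_0_compat.
Qed.

Definition cint0 (f : R -> C) : C := (int0 (fun t => Re (f t)), int0 (fun t => Im (f t))).
Definition cint0_adm (f : R -> C) : Prop := int0_adm (fun t => Re (f t)) /\ int0_adm (fun t => Im (f t)).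
Definition cinvert_var (f : R -> C) (u : R) : C := (RtoC (/ u ^ 2) * f (/ u)%R)%C.

Lemma cint0_cint1 f : cint0 f = (cint1 f + cint1 (cinvert_var f))%C.
Proof.
  unfold cint0, cint1, int0, cinvert_var, Cplus; simpl. f_equal; f_equal; apply int1_ext; intros u Hu; unfold invert_var; simpl; unfold Re, Im; ring.
Qed.

Lemma cint0_ext f g : (forall t, 0 < t -> f t = g t) -> cint0 f = cint0 g.
Proof.
  intros H. rewrite !cint0_cint1. f_equal; apply cint1_ext; intros t Ht. apply H; lra.
  unfold cinvert_var. rewrite H; auto. apply Rinv_0_lt_compat; lra.
Qed.

Lemma cint0_adm_cint1 f : cint0_adm f -> cint1_adm f /\ cint1_adm (cinvert_var f).
Proof.
  intros [(C1 & A1 & B1) (C2 & A2 & B2)]. repeat split; try apply A1; try apply A2.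
  - apply (int1_adm_ext (invert_var (fun t => Re (f t)))); auto. intros; unfold invert_var, cinvert_var; simpl; unfold Re, Im; ring.
  - apply (int1_adm_ext (invert_var (fun t => Re (f t)))); auto. intros; unfold invert_var, cinvert_var; simpl; unfold Re, Im; ring.
  - apply (int1_adm_ext (invert_var (fun t => Im (f t)))); auto. intros; unfold invert_var, cinvert_var; simpl; unfold Re, Im; ring.
  - apply (int1_adm_ext (invert_var (fun t => Im (f t)))); auto. intros; unfold invert_var, cinvert_var; simpl; unfold Re, Im; ring.
Qed.

Lemma cint0_scal c f : cint0_adm f -> cint0 (fun t => (c * f t)%C) = (c * cint0 f)%C.
Proof.
  intros H. destruct (cint0_adm_cint1 f H) as [H1 H2]. rewrite !cint0_cint1, Cmult_plus_distr_l.
  rewrite <- !cint1_scal by auto. f_equal. apply cint1_ext. intros; unfold cinvert_var; ring.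
Qed.

Lemma cpow_cont s t : 0 < t -> continuous (fun t => Re (cpow s t)) t /\ continuous (fun t => Im (cpow s t)) t.
Proof.
  intros Ht. split.
  - apply (continuous_ext (fun t => exp (Re s * ln t) * cos (Im s * ln t))). intros; symmetry; apply cpow_Re.
    eapply is_derive_cont. auto_derive. auto. reflexivity.
  - apply (continuous_ext (fun t => exp (Re s * ln t) * sin (Im s * ln t))). intros; symmetry; apply cpow_Im.
    eapply is_derive_cont. auto_derive. auto. reflexivity.
Qed.

Lemma cpow_mult s a b : 0 < a -> 0 < b -> cpow s (a * b) = (cpow s a * cpow s b)%C.
Proof.
  intros Ha Hb. unfold cpow. rewrite ln_mult by auto. rewrite <- Cexp_plus. f_equal. rewrite RtoC_plus. ring.
Qed.

Lemma cpow_inv_arg s a : 0 < a -> cpow s (/ a) = cpow (- s) a.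
Proof. intros Ha. unfold cpow. f_equal. rewrite ln_Rinv by auto. rewrite RtoC_opp. ring. Qed.

Lemma cpow_opp s a : (cpow s a * cpow (- s) a)%C = 1%C.
Proof. rewrite <- cpow_plus. replace (s + - s)%C with (RtoC 0) by ring. apply cpow_0. Qed.

Lemma cpow_neq_0 s a : cpow s a <> 0%C.
Proof. intros E. pose proof (cpow_opp s a) as H. rewrite E, Cmult_0_l in H. apply RtoC_inj in H. lra. Qed.

Lemma cpow_nat (n : nat) a : 0 < a -> cpow (RtoC (INR n)) a = RtoC (a ^ n).
Proof.
  intros Ha. apply injective_projections.
  - change (Re (cpow (RtoC (INR n)) a) = a ^ n). rewrite cpow_Re. simpl. rewrite Rmult_0_l, cos_0, Rmult_1_r.
    rewrite <- Rpower_pow by auto. reflexivity.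
  - change (Im (cpow (RtoC (INR n)) a) = 0). rewrite cpow_Im. simpl. rewrite Rmult_0_l, sin_0. ring.
Qed.

Lemma cpowR_cpow a s : cpowR a s = cpow s a.
Proof.
  apply injective_projections.
  - change (Re (cpowR a s) = Re (cpow s a)). rewrite cpow_Re. unfold cpowR, Re, Im; simpl. ring.
  - change (Im (cpowR a s) = Im (cpow s a)). rewrite cpow_Im. unfold cpowR, Re, Im; simpl. ring.
Qed.

(* Decay at infinity and the bound [|k t| <= M], which suffices near [0] when [Re s > -1]. *)
Definition bounded_decaying (k : R -> R) : Prop :=
  (forall t, 0 < t -> continuous k t) /\ exp_dom k /\ exists M, forall t, 0 < t -> Rabs (k t) <= M.

Lemma bounded_decaying_cint0 k s : bounded_decaying k -> -1 < Re s -> cint0_adm (fun t => (RtoC (k t) * cpow s t)%C).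
Proof.
  intros (Kc & Ke & M & HM) Hs.
  assert (Hk : exp_decaying k) by (split; auto; intros t Ht; apply Kc; lra).
  destruct (exp_decaying_cpow k s Hk) as [A1 A2].
  assert (HM0 : 0 <= M) by (eapply Rle_trans; [apply Rabs_pos|apply (HM 1); lra]).
  assert (B : forall t, 0 < t -> Cmod (RtoC (k t) * cpow s t)%C <= M * exp (Re s * ln t)).
  { intros t Ht. rewrite Cmod_mult, Cmod_cpow, Cmod_R. apply Rmult_le_compat_r; auto. left; apply exp_pos. }
  (* After inversion t^(Re s) dt becomes u^(- Re s - 2) du, integrable at infinity exactly with the
     exponent d = Re s + 1 > 0. *)
  assert (B' : forall u, 1 <= u -> M * exp (Re s * ln (/ u)) * / u ^ 2 = M * Rpower u (- (1 + (Re s + 1)))).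
  { intros u Hu. rewrite ln_Rinv by lra. rewrite Rmult_assoc. f_equal.
    replace (/ u ^ 2) with (exp (- (ln u + ln u))).
    - unfold Rpower. rewrite <- exp_plus. f_equal. ring.
    - rewrite exp_Ropp, exp_plus, exp_ln by lra. f_equal. ring. }
  assert (Ck : forall t, 0 < t -> continuous (fun t => Re (RtoC (k t) * cpow s t)%C) t /\ continuous (fun t => Im (RtoC (k t) * cpow s t)%C) t).
  { intros t Ht. destruct (cpow_cont s t Ht) as [K1 K2]. split.
    - apply (continuous_ext (fun t => k t * Re (cpow s t))). intros; simpl; unfold Re, Im; ring. apply cont_mult; auto.
    - apply (continuous_ext (fun t => k t * Im (cpow s t))). intros; simpl; unfold Re, Im; ring. apply cont_mult; auto. }
  assert (Inv : forall (p : C -> R), (forall c, Rabs (p c) <= Cmod c) ->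
     (forall t, 0 < t -> continuous (fun t => p (RtoC (k t) * cpow s t)%C) t) ->
     int1_adm (invert_var (fun t => p (RtoC (k t) * cpow s t)%C))).
  { intros p Hp Cp. split.
    - intros u Hu. unfold invert_var. apply cont_mult.
      + apply (continuous_comp Rinv (fun t => p (RtoC (k t) * cpow s t)%C)).
        eapply is_derive_cont. auto_derive. lra. reflexivity. apply Cp. apply Rinv_0_lt_compat; lra.
      + eapply is_derive_cont. auto_derive. nra. reflexivity.
    - exists M, (Re s + 1). split. lra. intros u Hu. rewrite <- B' by auto. unfold invert_var. rewrite Rabs_mult.
      rewrite (Rabs_pos_eq (/ u ^ 2)) by (left; apply Rinv_0_lt_compat, pow_lt; lra).
      apply Rmult_le_compat_r. left; apply Rinv_0_lt_compat, pow_lt; lra.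
      eapply Rle_trans. apply Hp. apply B. apply Rinv_0_lt_compat; lra. }
  split; (split; [|split]); auto.
  - intros t Ht; apply Ck; auto.
  - apply (Inv Re). apply Re_le_Cmod. intros t Ht; apply Ck; auto.
  - intros t Ht; apply Ck; auto.
  - apply (Inv Im). apply Im_le_Cmod. intros t Ht; apply Ck; auto.
Qed.

Lemma exp_bounded_decaying r : 0 < r -> bounded_decaying (fun t => exp (- r * t)).
Proof.
  intros Hr. split; [|split].
  - intros t Ht. eapply is_derive_cont. auto_derive. auto. reflexivity.
  - exists r, 1. repeat split; try lra. intros t Ht. rewrite Rabs_pos_eq by (left; apply exp_pos). lra.
  - exists 1. intros t Ht. rewrite Rabs_pos_eq by (left; apply exp_pos). rewrite <- exp_0. apply exp_le. nra.
Qed.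

(** The substitution t -> r t in the Gamma integral; the argument s + 1 makes the power in the
    integrand t^s. *)
Lemma Gamma_scale r s : 0 < r -> -1 < Re s ->
  Cgamma (s + 1) = (cpow (s + 1) r * cint0 (fun t => RtoC (exp (- r * t)) * cpow s t))%C.
Proof.
  intros Hr Hs.
  set (f := fun t => (RtoC (exp (- (1) * t)) * cpow s t)%C).
  assert (Af : cint0_adm f) by (apply bounded_decaying_cint0; auto; apply (exp_bounded_decaying 1); lra).
  set (g := fun t => (RtoC (exp (- r * t)) * cpow s t)%C).
  assert (Ag : cint0_adm g) by (apply bounded_decaying_cint0; auto; now apply exp_bounded_decaying).
  assert (EG : Cgamma (s + 1) = cint0 f).
  { unfold Cgamma, cint0.
    assert (E1 : forall t, cpowR t (s + 1 - 1)%C = cpow s t).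
    { intros t. rewrite cpowR_cpow. f_equal. ring. }
    f_equal.
    - rewrite <- (RInt_gen_int0 (fun t => Re (f t))) by apply Af.
      f_equal. apply functional_extensionality_dep. intros t. rewrite E1. unfold f; simpl; unfold Re, Im.
      replace (- (1) * t) with (- t) by ring. ring.
    - rewrite <- (RInt_gen_int0 (fun t => Im (f t))) by apply Af.
      f_equal. apply functional_extensionality_dep. intros t. rewrite E1. unfold f; simpl; unfold Re, Im.
      replace (- (1) * t) with (- t) by ring. ring. }
  rewrite EG. fold g. rewrite <- cint0_scal by auto.
  assert (Es : forall t, 0 < t -> (cpow (s + 1) r * g t)%C = (RtoC r * f (r * t)%R)%C).
  { intros t Ht. unfold f, g. rewrite cpow_mult by auto. rewrite cpow_plus.
    replace (RtoC 1) with (RtoC (INR 1)) by reflexivity. rewrite cpow_nat by auto. rewrite pow_1.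
    replace (- (1) * (r * t)) with (- r * t) by ring. ring. }
  rewrite (cint0_ext _ _ Es).
  assert (Adm : cint0_adm (fun t => (RtoC r * f (r * t)%R)%C)).
  {
    destruct Ag as [(G1 & G2 & G3) (G4 & G5 & G6)].
    destruct (cpow (s + 1) r) as [p q] eqn:Ep.
    assert (R1 : forall t, 0 < t -> p * Re (g t) + (- q) * Im (g t) = Re (RtoC r * f (r * t)%R)%C).
    { intros t Ht. rewrite <- Es by auto. unfold Re, Im; simpl. ring. }
    assert (R2 : forall t, 0 < t -> p * Im (g t) + q * Re (g t) = Im (RtoC r * f (r * t)%R)%C).
    { intros t Ht. rewrite <- Es by auto. unfold Re, Im; simpl. ring. }
    (* Admissibility of the rescaled integrand is inherited from g, of which it is a complex
       multiple. The equality holds for t > 0 only, hence the local arguments for continuity. *)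
    assert (X : forall a b (h1 h2 h : R -> R), int0_adm h1 -> int0_adm h2 -> (forall t, 0 < t -> a * h1 t + b * h2 t = h t) -> int0_adm h).
    { intros a b h1 h2 h (X1 & X2 & X3) (Y1 & Y2 & Y3) E. split; [|split].
      - intros t Ht. apply (continuous_ext_loc _ (fun t => a * h1 t + b * h2 t)).
        + exists (mkposreal t Ht). intros u Hu.
          unfold ball in Hu; simpl in Hu; unfold AbsRing_ball, abs, minus, plus, opp in Hu; simpl in Hu.
          apply Rabs_def2 in Hu. apply E. lra.
        + apply cont_plus; apply cont_mult; auto using cont_const.
      - pose proof (int1_adm_plus _ _ (int1_adm_scal a _ X2) (int1_adm_scal b _ Y2)) as [Z1 (K & d & Hd & Z2)]. split.
        + intros t Ht. apply (continuous_ext_loc _ (fun t => a * h1 t + b * h2 t)).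
          * exists (mkposreal 1 Rlt_0_1). intros u Hu.
            unfold ball in Hu; simpl in Hu; unfold AbsRing_ball, abs, minus, plus, opp in Hu; simpl in Hu.
            apply Rabs_def2 in Hu. apply E. lra.
          * apply Z1; auto.
        + exists K, d. split; auto. intros t Ht. rewrite <- E by lra. apply Z2; auto.
      - pose proof (int1_adm_plus _ _ (int1_adm_scal a _ X3) (int1_adm_scal b _ Y3)) as [Z1 (K & d & Hd & Z2)]. split.
        + intros t Ht. apply (continuous_ext_loc _ (fun t => a * invert_var h1 t + b * invert_var h2 t)).
          * exists (mkposreal 1 Rlt_0_1). intros u Hu.
            unfold ball in Hu; simpl in Hu; unfold AbsRing_ball, abs, minus, plus, opp in Hu; simpl in Hu.
            apply Rabs_def2 in Hu. unfold invert_var. rewrite <- E by (apply Rinv_0_lt_compat; lra). simpl. ring.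
          * apply Z1; auto.
        + exists K, d. split; auto. intros t Ht.
          replace (invert_var h t) with (a * invert_var h1 t + b * invert_var h2 t). apply Z2; auto.
          unfold invert_var. rewrite <- E by (apply Rinv_0_lt_compat; lra). ring. }
    split.
    - apply (X p (- q) (fun t => Re (g t)) (fun t => Im (g t))); auto; split; auto.
    - apply (X p q (fun t => Im (g t)) (fun t => Re (g t))); auto; split; auto. }
  assert (Sc : forall (p : C -> R), (forall c, p (RtoC r * c)%C = r * p c) ->
    int0_adm (fun t => p (f t)) -> int0_adm (fun t => p (RtoC r * f (r * t)%R)%C) ->
    int0 (fun t => p (f t)) = int0 (fun t => p (RtoC r * f (r * t)%R)%C)).
  { intros p Hp A B.
    assert (Ef : (fun t => p (RtoC r * f (r * t)%R)%C) = (fun t => r * (fun v => p (f v)) (r * t))).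
    { apply functional_extensionality_dep. intros t. apply Hp. }
    rewrite Ef in *. symmetry. apply (int0_scale (fun v => p (f v))); auto. }
  unfold cint0. f_equal.
  - apply (Sc Re). intros; simpl; unfold Re; ring. apply Af. apply Adm.
  - apply (Sc Im). intros; simpl; unfold Im; ring. apply Af. apply Adm.
Qed.

(** * Convergence of lattice partial sums *)

Definition square_sum (N : nat) (f : Z -> Z -> R) : R := zsum N (fun m => zsum N (f m)).

Lemma zsum_abs N f g : (forall n, Rabs (f n) <= g n) -> Rabs (zsum N f) <= zsum N g.
Proof.
  intros H. induction N. apply H.
  change (Rabs (zsum N f + f (Z.of_nat (S N)) + f (- Z.of_nat (S N))%Z)
    <= zsum N g + g (Z.of_nat (S N)) + g (- Z.of_nat (S N))%Z).
  eapply Rle_trans. apply Rabs_triang. apply Rplus_le_compat; auto.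
  eapply Rle_trans. apply Rabs_triang. apply Rplus_le_compat; auto.
Qed.

Lemma zsum_le_Zsum N f : zadm f -> (forall n, 0 <= f n) -> zsum N f <= Zsum f.
Proof.
  intros Hf H. apply (is_lim_seq_incr_compare (fun N => zsum N f)). now apply Zsum_limit.
  intros M. change (zsum M f <= zsum M f + f (Z.of_nat (S M)) + f (- Z.of_nat (S M))%Z).
  pose proof (H (Z.of_nat (S M))). pose proof (H (- Z.of_nat (S M))%Z). lra.
Qed.

Lemma square_sum_abs N f g : (forall m n, Rabs (f m n) <= g m n) -> Rabs (square_sum N f) <= square_sum N g.
Proof. intros H. apply zsum_abs. intros m. now apply zsum_abs. Qed.

Lemma square_sum_le_Zsum2 N f : zadm2 f -> (forall m n, 0 <= f m n) -> square_sum N f <= Zsum2 f.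
Proof.
  intros Hf H. apply Rle_trans with (zsum N (fun m => Zsum (f m))).
  - eapply Rle_trans. apply Rle_abs. apply zsum_abs. intros m. rewrite Rabs_pos_eq.
    apply zsum_le_Zsum; auto. now apply zadm2_inner.
    induction N. apply H. change (0 <= zsum N (f m) + f m (Z.of_nat (S N)) + f m (- Z.of_nat (S N))%Z).
    pose proof (H m (Z.of_nat (S N))). pose proof (H m (- Z.of_nat (S N))%Z). lra.
  - apply zsum_le_Zsum. now apply zadm2_outer.
    intros m. apply Rle_trans with (zsum 0 (f m)). apply H. apply zsum_le_Zsum; auto. now apply zadm2_inner.
Qed.

Lemma square_sum_bound c K f N : 0 < c -> zdom2 c K f -> Rabs (square_sum N f) <= K * mass c * mass c.
Proof.
  intros Hc H. apply (zsum_bound c); auto. intros m.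
  replace (K * mass c * exp (- c * zabs m)) with (K * exp (- c * zabs m) * mass c) by ring.
  apply zsum_bound; auto. now apply zdom2_inner.
Qed.

Lemma square_sum_scal N k f : square_sum N (fun m n => k * f m n) = k * square_sum N f.
Proof.
  unfold square_sum. rewrite <- zsum_scal. apply zsum_ext_in. intros m. apply zsum_scal.
Qed.

Lemma int1_adm_zsum N (f : Z -> R -> R) : (forall n, int1_adm (f n)) -> int1_adm (fun t => zsum N (fun n => f n t)).
Proof.
  intros H. induction N. apply H. apply int1_adm_plus; auto. apply int1_adm_plus; auto.
Qed.

Lemma int1_zsum N (f : Z -> R -> R) : (forall n, int1_adm (f n)) ->
  int1 (fun t => zsum N (fun n => f n t)) = zsum N (fun n => int1 (f n)).
Proof.
  intros H. induction N. reflexivity.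
  change (int1 (fun t => (zsum N (fun n => f n t) + f (Z.of_nat (S N)) t) + f (- Z.of_nat (S N))%Z t)
    = zsum N (fun n => int1 (f n)) + int1 (f (Z.of_nat (S N))) + int1 (f (- Z.of_nat (S N))%Z)).
  rewrite int1_plus, int1_plus, IHN; auto using int1_adm_plus, int1_adm_zsum.
Qed.

Lemma int1_square_sum N (f : Z -> Z -> R -> R) : (forall m n, int1_adm (f m n)) ->
  int1 (fun t => square_sum N (fun m n => f m n t)) = square_sum N (fun m n => int1 (f m n)).
Proof.
  intros H. unfold square_sum. rewrite (int1_zsum N (fun m t => zsum N (fun n => f m n t))).
  - apply zsum_ext_in. intros m. now apply int1_zsum.
  - intros m. now apply int1_adm_zsum.
Qed.

(** The exponential bounds degenerate as t tends to 0. There the kernels are compared with the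
    positive terms of theta at t / 2, whose total is known from the inversion formula. *)
Definition dominated_near_0 (l : list kernel_mono) (x y : R) : Prop := exists K, 0 <= K /\
  forall t m n, 0 < t -> Rabs (kernel_val l x y t m n) <= K * kernel_val theta_ker x y (t / 2) m n.

Lemma kernel_val_theta_ker x y t m n : kernel_val theta_ker x y t m n = lattice_term 0 0 0 x y t m n.
Proof. simpl. ring. Qed.

Lemma lattice_term0_nonneg x y t m n : 0 <= lattice_term 0 0 0 x y t m n.
Proof.
  unfold lattice_term. destruct (Z.eqb m 0 && Z.eqb n 0)%bool. lra. simpl. rewrite !Rmult_1_l. left; apply exp_pos.
Qed.

Lemma lattice_term0_le_1 x y t m n : 0 < y -> 0 < t -> lattice_term 0 0 0 x y t m n <= 1.
Proof.
  intros Hy Ht. unfold lattice_term. destruct (Z.eqb m 0 && Z.eqb n 0)%bool. lra. simpl. rewrite !Rmult_1_l.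
  rewrite <- exp_0. apply exp_le.
  assert (0 <= qform x y m n).
  { unfold qform. apply Rmult_le_pos. pose proof (pow2_ge_0 (IZR m * x + IZR n)). pose proof (pow2_ge_0 (IZR m * y)). lra.
    left; now apply Rinv_0_lt_compat. }
  pose proof PI_RGT_0. assert (0 <= PI * t * qform x y m n) by (apply Rmult_le_pos; auto; apply Rmult_le_pos; lra). lra.
Qed.

Lemma qform_nonneg x y m n : 0 < y -> 0 <= qform x y m n.
Proof.
  intros Hy. unfold qform. apply Rmult_le_pos. pose proof (pow2_ge_0 (IZR m * x + IZR n)). pose proof (pow2_ge_0 (IZR m * y)). lra.
  left; now apply Rinv_0_lt_compat.
Qed.

Lemma dominated_near_0_theta_ker x y : 0 < y -> dominated_near_0 theta_ker x y.
Proof.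
  intros Hy. exists 1. split. lra. intros t m n Ht. rewrite !kernel_val_theta_ker, Rmult_1_l.
  rewrite Rabs_pos_eq by apply lattice_term0_nonneg. unfold lattice_term. destruct (Z.eqb m 0 && Z.eqb n 0)%bool. lra.
  simpl. rewrite !Rmult_1_l. apply exp_le. pose proof (qform_nonneg x y m n Hy). pose proof PI_RGT_0.
  assert (0 <= PI * t * qform x y m n) by (apply Rmult_le_pos; auto; apply Rmult_le_pos; lra). lra.
Qed.

(** With v = pi t Q, half of the exponential absorbs the factor v: v exp (- v) <= 2 exp (- v / 2).
    First derivatives of theta satisfy the hypothesis because |A^2 - B^2| and |2 A B| are at most
    A^2 + B^2. *)
Lemma dominated_near_0_quadratic l x y : 0 < y ->
  (forall t m n, 0 < t -> Rabs (kernel_val l x y t m n) <= / y * (PI * t * qform x y m n * lattice_term 0 0 0 x y t m n)) ->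
  dominated_near_0 l x y.
Proof.
  intros Hy H. assert (Hiy : 0 < / y) by now apply Rinv_0_lt_compat. exists (2 * / y). split. lra.
  intros t m n Ht. rewrite kernel_val_theta_ker. eapply Rle_trans. now apply H.
  rewrite (Rmult_comm 2), (Rmult_assoc (/ y) 2). apply Rmult_le_compat_l. lra.
  unfold lattice_term. destruct (Z.eqb m 0 && Z.eqb n 0)%bool. lra. simpl. rewrite !Rmult_1_l.
  set (v := PI * t * qform x y m n).
  replace (- PI * t * qform x y m n) with (- (v / 2) + - (v / 2)) by (unfold v; field).
  replace (- PI * (t / 2) * qform x y m n) with (- (v / 2)) by (unfold v; field).
  rewrite exp_plus, <- Rmult_assoc. apply Rmult_le_compat_r. left; apply exp_pos.
  pose proof (exp_ineq1_le (v / 2)). rewrite exp_Ropp. pose proof (exp_pos (v / 2)).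
  apply (Rmult_le_reg_r (exp (v / 2))); auto. rewrite Rmult_assoc, Rinv_l by lra. lra.
Qed.

Lemma dominated_near_0_ker_dy x y : 0 < y -> dominated_near_0 (ker_dy theta_ker) x y.
Proof.
  intros Hy. apply dominated_near_0_quadratic; auto. intros t m n Ht.
  cbn [mono_dy ker_dy flat_map app kernel_val mono_val theta_ker]. unfold lattice_term. destruct (Z.eqb m 0 && Z.eqb n 0)%bool.
  - rewrite !Rmult_0_r, !Rplus_0_r, Rabs_R0. lra.
  - fold (qexp x y t m n). pose proof (exp_pos (- PI * t * qform x y m n)) as He. fold (qexp x y t m n) in He.
    set (e := qexp x y t m n) in *. unfold qform. set (A := IZR m * x + IZR n). set (B := IZR m * y).
    replace (1 * (INR 0 - INR 0) * (t ^ 0 * (A ^ 0 * B ^ 0 * (/ y) ^ 1 * e)) +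
      (1 * - PI * (t ^ 1 * (A ^ 0 * B ^ 2 * (/ y) ^ 2 * e)) +
       (1 * PI * (t ^ 1 * (A ^ 2 * B ^ 0 * (/ y) ^ 2 * e)) + 0)))
      with ((PI * t * / y ^ 2 * e) * (A ^ 2 - B ^ 2)) by (simpl; field; lra).
    replace (/ y * (PI * t * ((A ^ 2 + B ^ 2) / y) * (A ^ 0 * B ^ 0 * (/ y) ^ 0 * e)))
      with ((PI * t * / y ^ 2 * e) * (A ^ 2 + B ^ 2)) by (simpl; field; lra).
    assert (Hp : 0 <= PI * t * / y ^ 2 * e).
    { pose proof PI_RGT_0. apply Rmult_le_pos; [|lra]. apply Rmult_le_pos. apply Rmult_le_pos; lra. left. apply Rinv_0_lt_compat, pow_lt; auto. }
    rewrite Rabs_mult, (Rabs_pos_eq _ Hp). apply Rmult_le_compat_l; auto.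
    pose proof (pow2_ge_0 A). pose proof (pow2_ge_0 B). apply Rabs_le. lra.
Qed.

Lemma dominated_near_0_ker_dx x y : 0 < y -> dominated_near_0 (ker_dx theta_ker) x y.
Proof.
  intros Hy. apply dominated_near_0_quadratic; auto. intros t m n Ht.
  cbn [mono_dx ker_dx flat_map app kernel_val mono_val theta_ker]. unfold lattice_term. destruct (Z.eqb m 0 && Z.eqb n 0)%bool.
  - rewrite !Rmult_0_r, !Rplus_0_r, Rabs_R0. lra.
  - fold (qexp x y t m n). pose proof (exp_pos (- PI * t * qform x y m n)) as He. fold (qexp x y t m n) in He.
    set (e := qexp x y t m n) in *. unfold qform. set (A := IZR m * x + IZR n). set (B := IZR m * y).
    replace (1 * INR 0 * (t ^ 0 * (A ^ pred 0 * B ^ 1 * (/ y) ^ 1 * e)) +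
      (1 * (-2 * PI) * (t ^ 1 * (A ^ 1 * B ^ 1 * (/ y) ^ 2 * e)) + 0))
      with ((PI * t * / y ^ 2 * e) * (-2 * A * B)) by (simpl; field; lra).
    replace (/ y * (PI * t * ((A ^ 2 + B ^ 2) / y) * (A ^ 0 * B ^ 0 * (/ y) ^ 0 * e)))
      with ((PI * t * / y ^ 2 * e) * (A ^ 2 + B ^ 2)) by (simpl; field; lra).
    assert (Hp : 0 <= PI * t * / y ^ 2 * e).
    { pose proof PI_RGT_0. apply Rmult_le_pos; [|lra]. apply Rmult_le_pos. apply Rmult_le_pos; lra. left. apply Rinv_0_lt_compat, pow_lt; auto. }
    rewrite Rabs_mult, (Rabs_pos_eq _ Hp). apply Rmult_le_compat_l; auto.
    pose proof (pow2_ge_0 (A - B)). pose proof (pow2_ge_0 (A + B)). apply Rabs_le. nra.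
Qed.

Section Limit.
Variables (l : list kernel_mono) (x y : R) (w : R -> R) (sg : R).
Hypothesis Hy : 0 < y.
Hypothesis Hl : dominated_near_0 l x y.
Hypothesis Cw : forall t, 0 < t -> continuous w t.
Hypothesis Ww : subexp w.
Hypothesis Hsg : 0 < sg.
(** In terms of t = 1/u: |w t| <= t^sg on (0, 1]. *)
Hypothesis Bw : forall u, 1 <= u -> Rabs (w (/ u) * / u ^ 2) <= Rpower u (- (2 + sg)).

Lemma kernel_val_cont_t t m n : continuous (fun t => kernel_val l x y t m n) t.
Proof. eapply is_derive_cont. now apply kernel_val_derive_t. Qed.

Lemma square_sum_kernel_val_cont_t N t : continuous (fun t => square_sum N (kernel_val l x y t)) t.
Proof.
  unfold square_sum. apply (zsum_cont N (fun m t => zsum N (kernel_val l x y t m))). intros m.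
  apply (zsum_cont N (fun n t => kernel_val l x y t m n)). intros n. apply kernel_val_cont_t.
Qed.

Lemma inv_cont (f : R -> R) u : (forall t, 0 < t -> continuous f t) -> 0 < u -> continuous (fun u => f (/ u)) u.
Proof.
  intros H Hu. apply (continuous_comp Rinv f). eapply is_derive_cont. auto_derive. lra. reflexivity.
  apply H. now apply Rinv_0_lt_compat.
Qed.

Lemma inv_weight_cont : continuous_ge_1 (fun u => w (/ u) * / u ^ 2).
Proof.
  intros u Hu. apply cont_mult. apply (inv_cont w); auto; lra.
  eapply is_derive_cont. auto_derive. nra. reflexivity.
Qed.

(** By positivity a partial sum of the majorant is at most its total, and theta(1 / (2 u)) = 2 u
    theta(2 u) grows linearly in u. The bound is uniform in N, as dominated convergence requires. *)
Lemma square_sum_dominated_near_0 : exists K, 0 <= K /\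
  (forall N u, 1 <= u -> Rabs (square_sum N (kernel_val l x y (/ u))) <= K * u).
Proof.
  destruct Hl as (K & HK & B).
  destruct (lattice_sum_bound theta_ker (Rabs x) y y 1 Hy Rlt_0_1) as (c & K0 & Hc & HK0 & B0).
  exists (K * (2 * (1 + K0))). split. { apply Rmult_le_pos; lra. }
  intros N u Hu. assert (Hiu : 0 < / u) by (apply Rinv_0_lt_compat; lra).
  assert (Hiu2 : 0 < / u / 2) by lra.
  eapply Rle_trans. apply (square_sum_abs N _ (fun m n => K * kernel_val theta_ker x y (/ u / 2) m n)). intros; now apply B.
  rewrite square_sum_scal, Rmult_assoc. apply Rmult_le_compat_l; auto.
  eapply Rle_trans. apply square_sum_le_Zsum2. now apply kernel_val_adm. intros; rewrite kernel_val_theta_ker; apply lattice_term0_nonneg.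
  change (lattice_sum theta_ker x y (/ u / 2) <= 2 * (1 + K0) * u).
  pose proof (theta_lattice_sum x y (/ u / 2) Hy Hiu2) as E1.
  pose proof (theta_lattice_sum x y (2 * u) Hy ltac:(lra)) as E2.
  pose proof (theta_inv x y (2 * u) Hy ltac:(lra)) as E3.
  replace (/ (2 * u)) with (/ u / 2) in E3 by (field; lra).
  specialize (B0 x y (2 * u) ltac:(lra) ltac:(lra) ltac:(lra)).
  assert (exp (- c * (2 * u)) <= 1). { rewrite <- exp_0. apply exp_le. nra. }
  pose proof (Rle_abs (lattice_sum theta_ker x y (2 * u))).
  assert (lattice_sum theta_ker x y (2 * u) <= K0) by nra. nra.
Qed.

Lemma square_sum_uniform t0 : 0 < t0 -> exists c K, 0 < c /\ 0 <= K /\ forall N t, t0 <= t ->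
  Rabs (square_sum N (kernel_val l x y t)) <= K * exp (- c * t) /\
  Rabs (square_sum N (kernel_val l x y t) - lattice_sum l x y t) <= K * ztail c N.
Proof.
  intros Ht0. destruct (kernel_val_dom l (Rabs x) y y t0 Hy Ht0) as (c & K & Hc & HK & B).
  pose proof (mass_ge_1 c Hc) as Hm. exists c, (2 * K * mass c * mass c). split; auto.
  assert (HK1 : 0 <= K * mass c) by (apply Rmult_le_pos; lra).
  assert (HK2 : K * mass c <= K * mass c * mass c) by nra.
  split. nra.
  intros N t Ht. specialize (B x y t ltac:(lra) ltac:(lra) Ht).
  pose proof (exp_pos (- c * t)) as He.
  split.
  - eapply Rle_trans. apply (square_sum_bound c _ _ N Hc B).
    replace (K * exp (- c * t) * mass c * mass c) with (K * mass c * mass c * exp (- c * t)) by ring.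
    apply Rmult_le_compat_r. lra. nra.
  - rewrite Rabs_minus_sym. eapply Rle_trans. apply (Zsum2_tail c _ _ N Hc B).
    pose proof (tail_pos c N Hc). apply Rmult_le_compat_r. lra.
    assert (exp (- c * t) <= 1). { rewrite <- exp_0. apply exp_le. nra. }
    assert (K * exp (- c * t) <= K) by nra.
    assert (K * exp (- c * t) * mass c <= K * mass c) by (apply Rmult_le_compat_r; lra). nra.
Qed.

Lemma tail_small c e : 0 < c -> 0 < e -> exists N0, forall N, (N0 <= N)%nat -> ztail c N < e.
Proof.
  intros Hc He. pose proof (tail_lim c Hc) as T. apply is_lim_seq_spec in T.
  destruct (T (mkposreal e He)) as [N0 H]. exists N0. intros N HN. specialize (H N HN). simpl in H.
  rewrite Rminus_0_r in H. pose proof (Rle_abs (ztail c N)). lra.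
Qed.

Lemma lim_at_infinity :
  is_lim_seq (fun N => int1 (fun t => square_sum N (kernel_val l x y t) * w t)) (int1 (fun t => lattice_sum l x y t * w t)).
Proof.
  destruct (square_sum_uniform 1 Rlt_0_1) as (c & K & Hc & HK & B).
  destruct Ww as [Cw1 Bw1]. destruct (Bw1 (c / 2) ltac:(lra)) as (K1 & HK1 & B1).
  destruct (exp_le_power (c / 2) ltac:(lra)) as (K2 & HK2 & B2).
  destruct (weighted_sum_bound l w (Rabs x) y y Hy Ww) as (M & HM & BM).
  assert (HKK : 0 <= K * K1) by now apply Rmult_le_pos.
  apply (int1_dominated _ _ (Rmax M (K * K1 * K2)) 1 Rlt_0_1).
  - intros N t Ht. apply cont_mult. apply square_sum_kernel_val_cont_t. auto.
  - intros t Ht. apply cont_mult. apply lattice_sum_cont_t; lra. auto.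
  - intros N t Ht. rewrite Rabs_mult. destruct (B N t Ht) as [BB _].
    apply Rle_trans with (K * exp (- c * t) * (K1 * exp (c / 2 * t))).
    { apply Rmult_le_compat; auto using Rabs_pos. }
    replace (K * exp (- c * t) * (K1 * exp (c / 2 * t))) with (K * K1 * exp (- (c / 2) * t)).
    2:{ replace (- (c / 2) * t) with (- c * t + c / 2 * t) by field. rewrite exp_plus. ring. }
    apply Rle_trans with (K * K1 * K2 * Rpower t (- (1 + 1))).
    rewrite (Rmult_assoc (K * K1)). apply Rmult_le_compat_l; auto.
    apply Rmult_le_compat_r. left; apply Rpower_pos. apply Rmax_r.
  - intros t Ht. eapply Rle_trans. apply BM; lra. apply Rmult_le_compat_r. left; apply Rpower_pos. apply Rmax_l.
  - intros T eps HT He.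
    set (q := (K + 1) * (K1 * exp (c / 2 * T) + 1)).
    assert (Hq : 0 < q). { unfold q. pose proof (exp_pos (c / 2 * T)). assert (0 <= K1 * exp (c / 2 * T)) by (apply Rmult_le_pos; lra). apply Rmult_lt_0_compat; lra. }
    destruct (tail_small c (eps / q) Hc ltac:(now apply Rdiv_lt_0_compat)) as [N0 HN0].
    exists N0. intros N t HN Ht. specialize (HN0 N HN).
    rewrite <- Rmult_minus_distr_r, Rabs_mult. destruct (B N t ltac:(lra)) as [_ BB].
    assert (Bt : Rabs (w t) <= K1 * exp (c / 2 * T) + 1).
    { eapply Rle_trans. apply B1; lra. assert (exp (c / 2 * t) <= exp (c / 2 * T)) by (apply exp_le; nra). nra. }
    pose proof (tail_pos c N Hc).
    apply Rle_trans with ((K + 1) * ztail c N * (K1 * exp (c / 2 * T) + 1)).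
    { apply Rmult_le_compat; auto using Rabs_pos. nra. }
    replace ((K + 1) * ztail c N * (K1 * exp (c / 2 * T) + 1)) with (q * ztail c N) by (unfold q; ring).
    apply Rle_trans with (q * (eps / q)). apply Rmult_le_compat_l; lra. right; field; lra.
Qed.

(** The growth u of the sums against u^(-2-sg) from the weight leaves the integrable majorant
    u^(-1-sg). *)
Lemma lim_at_zero :
  is_lim_seq (fun N => int1 (invert_var (fun t => square_sum N (kernel_val l x y t) * w t))) (int1 (invert_var (fun t => lattice_sum l x y t * w t))).
Proof.
  destruct square_sum_dominated_near_0 as (K & HK & B).
  assert (BL : forall u, 1 <= u -> Rabs (lattice_sum l x y (/ u)) <= K * u).
  { intros u Hu. assert (Hiu : 0 < / u) by (apply Rinv_0_lt_compat; lra).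
    apply (is_lim_seq_abs_le (fun N => square_sum N (kernel_val l x y (/ u)))). apply Zsum2_limit. now apply kernel_val_adm. intros; now apply B. }
  assert (Pw : forall u, 1 <= u -> u * Rpower u (- (2 + sg)) = Rpower u (- (1 + sg))).
  { intros u Hu. replace (- (1 + sg)) with (1 + - (2 + sg)) by ring. rewrite Rpower_plus, Rpower_1 by lra. reflexivity. }
  apply (int1_dominated _ _ K sg Hsg).
  - intros N u Hu. unfold invert_var.
    apply (continuous_ext (fun u => square_sum N (kernel_val l x y (/ u)) * (w (/ u) * / u ^ 2))).
    intros; rewrite Rmult_assoc; reflexivity.
    apply cont_mult. apply (inv_cont (fun t => square_sum N (kernel_val l x y t))). intros; apply square_sum_kernel_val_cont_t. lra. now apply inv_weight_cont.
  - intros u Hu. unfold invert_var.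
    apply (continuous_ext (fun u => lattice_sum l x y (/ u) * (w (/ u) * / u ^ 2))).
    intros; rewrite Rmult_assoc; reflexivity.
    apply cont_mult. apply (inv_cont (lattice_sum l x y)). intros; now apply lattice_sum_cont_t. lra. now apply inv_weight_cont.
  - intros N u Hu. unfold invert_var. rewrite Rmult_assoc, Rabs_mult, <- Pw, <- Rmult_assoc by auto.
    apply Rmult_le_compat; auto using Rabs_pos.
  - intros u Hu. unfold invert_var. rewrite Rmult_assoc, Rabs_mult, <- Pw, <- Rmult_assoc by auto.
    apply Rmult_le_compat; auto using Rabs_pos.
  - intros T eps HT He.
    assert (HiT : 0 < / T) by (apply Rinv_0_lt_compat; lra).
    (* For u <= T the argument 1/u stays above 1/T, where the square sums converge uniformly. *)
    destruct (square_sum_uniform (/ T) HiT) as (c & K1 & Hc & HK1 & B1).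
    destruct (tail_small c (eps / (K1 + 1)) Hc ltac:(apply Rdiv_lt_0_compat; lra)) as [N0 HN0].
    exists N0. intros N u HN Hu. specialize (HN0 N HN). unfold invert_var.
    rewrite !(Rmult_assoc _ (w (/ u))), <- Rmult_minus_distr_r, Rabs_mult.
    destruct (B1 N (/ u)) as [_ BB]. { apply Rinv_le_contravar; lra. }
    assert (B2 : Rabs (w (/ u) * / u ^ 2) <= 1).
    { eapply Rle_trans. apply Bw; lra. unfold Rpower. rewrite <- exp_0. apply exp_le.
      pose proof (ln_bounds u ltac:(lra)). nra. }
    pose proof (tail_pos c N Hc).
    apply Rle_trans with ((K1 + 1) * ztail c N * 1).
    { apply Rmult_le_compat; auto using Rabs_pos. nra. }
    rewrite Rmult_1_r. apply Rle_trans with ((K1 + 1) * (eps / (K1 + 1))). apply Rmult_le_compat_l; lra. right; field; lra.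
Qed.

Lemma kernel_val_int0_adm m n : int0_adm (fun t => kernel_val l x y t m n * w t).
Proof.
  split; [|split].
  - intros t Ht. apply cont_mult; auto. apply kernel_val_cont_t.
  - apply exp_dom_int1_adm. { intros t Ht. apply cont_mult. apply kernel_val_cont_t. apply Cw; lra. }
    apply (exp_dom_weight (fun t => kernel_val l x y t m n)); auto.
    destruct (kernel_val_dom l (Rabs x) y y 1 Hy Rlt_0_1) as (c & K & Hc & HK & B).
    exists c, K. split; auto. split; auto. intros t Ht. eapply Rle_trans. apply (B x y t); lra.
    rewrite <- (Rmult_1_r (K * exp (- c * t))) at 2. apply Rmult_le_compat_l.
    apply Rmult_le_pos; auto. left; apply exp_pos. rewrite <- exp_0. apply exp_le.
    pose proof (zabs_pos m). pose proof (zabs_pos n). nra.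
  - destruct Hl as (K & HK & B). split.
    + intros u Hu. unfold invert_var.
      apply (continuous_ext (fun u => kernel_val l x y (/ u) m n * (w (/ u) * / u ^ 2))).
      intros; rewrite Rmult_assoc; reflexivity.
      apply cont_mult. apply (inv_cont (fun t => kernel_val l x y t m n)). intros; apply kernel_val_cont_t. lra. now apply inv_weight_cont.
    + exists K, (1 + sg). split. lra. intros u Hu. unfold invert_var. rewrite Rmult_assoc, Rabs_mult.
      assert (0 < / u) by (apply Rinv_0_lt_compat; lra).
      replace (1 + (1 + sg)) with (2 + sg) by ring.
      apply Rmult_le_compat; auto using Rabs_pos.
      eapply Rle_trans. now apply B. rewrite kernel_val_theta_ker. rewrite <- (Rmult_1_r K) at 2.
      apply Rmult_le_compat_l; auto. apply lattice_term0_le_1; auto; lra.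
Qed.

(** Interchange of lattice sum and integral over (0, oo). For each N it is finite additivity, and
    the limit is taken separately on the two sides of t = 1. *)
Theorem lattice_limit :
  is_lim_seq (fun N => square_sum N (fun m n => int0 (fun t => kernel_val l x y t m n * w t))) (int0 (fun t => lattice_sum l x y t * w t)).
Proof.
  apply (is_lim_seq_ext (fun N => int1 (fun t => square_sum N (kernel_val l x y t) * w t) + int1 (invert_var (fun t => square_sum N (kernel_val l x y t) * w t)))).
  - intros N. unfold int0.
    assert (Esum : forall f g : Z -> Z -> R, square_sum N (fun m n => f m n + g m n) = square_sum N f + square_sum N g).
    { intros f g. unfold square_sum. rewrite <- zsum_plus. apply zsum_ext_in. intros m. apply zsum_plus. }
    rewrite Esum. rewrite <- !int1_square_sum by (intros m n; apply kernel_val_int0_adm).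
    f_equal; apply int1_ext; intros t Ht; unfold invert_var.
    + rewrite Rmult_comm, <- square_sum_scal. unfold square_sum. apply zsum_ext_in; intros m; apply zsum_ext_in; intros n; ring.
    + rewrite Rmult_assoc, Rmult_comm, <- square_sum_scal. unfold square_sum. apply zsum_ext_in; intros m; apply zsum_ext_in; intros n; ring.
  - unfold int0. apply is_lim_seq_plus'. apply lim_at_infinity. apply lim_at_zero.
Qed.
End Limit.

(** * Summation of the Eisenstein series *)

Lemma int0_ext f g : (forall t, 0 < t -> f t = g t) -> int0 f = int0 g.
Proof.
  intros E. unfold int0. f_equal; apply int1_ext; intros t Ht. apply E; lra.
  unfold invert_var. rewrite E; auto. apply Rinv_0_lt_compat; lra.
Qed.

Definition over_t (f : R -> R) (t : R) : R := f t * / t.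

Definition Clim (u : nat -> C) (l : C) : Prop :=
  is_lim_seq (fun N => Re (u N)) (Re l) /\ is_lim_seq (fun N => Im (u N)) (Im l).

Lemma Clim_ext u v l : (forall N, u N = v N) -> Clim u l -> Clim v l.
Proof.
  intros E [H1 H2]. split; [apply (is_lim_seq_ext (fun N => Re (u N)))|apply (is_lim_seq_ext (fun N => Im (u N)))]; auto;
  intros N; now rewrite E.
Qed.

Lemma Clim_unique u l l' : Clim u l -> Clim u l' -> l = l'.
Proof.
  intros [H1 H2] [H3 H4]. apply is_lim_seq_unique in H1, H2, H3, H4.
  apply injective_projections; [rewrite H1 in H3; now injection H3|rewrite H2 in H4; now injection H4].
Qed.

Lemma Clim_plus u v a b : Clim u a -> Clim v b -> Clim (fun N => (u N + v N)%C) (a + b)%C.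
Proof. intros [H1 H2] [H3 H4]. split; simpl; apply is_lim_seq_plus'; auto. Qed.

Lemma Clim_scal c u a : Clim u a -> Clim (fun N => (c * u N)%C) (c * a)%C.
Proof.
  intros [H1 H2]. destruct c as [p q]. split; simpl.
  - apply is_lim_seq_minus'; apply (is_lim_seq_scal_l _ _ (Finite _)); auto.
  - apply is_lim_seq_plus'; apply (is_lim_seq_scal_l _ _ (Finite _)); auto.
Qed.

(** [lim] is known only through [complete_cauchy], so the filter of tails is first shown to be
    Cauchy; closeness to both limits then forces equality. *)
Lemma Clim_lim u l : Clim u l ->
  @lim (CompleteNormedModule.CompleteSpace _ C_CompleteNormedModule) (filtermap u eventually) = l.
Proof.
  intros [H1 H2].
  assert (FL : forall eps : posreal, filtermap u eventually
     (@ball (CompleteNormedModule.CompleteSpace _ C_CompleteNormedModule) l eps)).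
  { intros eps. apply is_lim_seq_spec in H1. apply is_lim_seq_spec in H2.
    destruct (H1 eps) as [N1 K1]. destruct (H2 eps) as [N2 K2].
    exists (Nat.max N1 N2). intros N HN. split.
    - apply K1. lia.
    - apply K2. lia. }
  assert (PF : ProperFilter (filtermap u eventually)) by (apply filtermap_proper_filter, eventually_filter).
  pose proof (@complete_cauchy (CompleteNormedModule.CompleteSpace _ C_CompleteNormedModule) (filtermap u eventually) PF) as CC.
  assert (Ca : @cauchy (CompleteNormedModule.CompleteSpace _ C_CompleteNormedModule) (filtermap u eventually)).
  { intros eps. exists l. exact (FL eps). }
  specialize (CC Ca). set (L := @lim (CompleteNormedModule.CompleteSpace _ C_CompleteNormedModule) (filtermap u eventually)) in *.
  assert (B : forall eps : posreal, Rabs (Re L - Re l) < 2 * eps /\ Rabs (Im L - Im l) < 2 * eps).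
  { intros eps. destruct (CC eps) as [N1 K1]. destruct (FL eps) as [N2 K2].
    specialize (K1 (Nat.max N1 N2) ltac:(lia)). specialize (K2 (Nat.max N1 N2) ltac:(lia)).
    destruct K1 as [K1 K1']. destruct K2 as [K2 K2'].
    set (v := u (Nat.max N1 N2)) in *.
    change (Rabs (Re v - Re L) < eps) in K1. change (Rabs (Im v - Im L) < eps) in K1'.
    change (Rabs (Re v - Re l) < eps) in K2. change (Rabs (Im v - Im l) < eps) in K2'.
    apply Rabs_def2 in K1, K1', K2, K2'. split; apply Rabs_def1; lra. }
  assert (Z : forall a, (forall eps : posreal, Rabs a < 2 * eps) -> a = 0).
  { intros a Ha. destruct (Req_dec a 0) as [|Hn]; auto. pose proof (Rabs_pos_lt a Hn) as P.
    specialize (Ha (mkposreal (Rabs a / 2) ltac:(lra))). simpl in Ha. lra. }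
  apply injective_projections.
  - change (Re L = Re l). apply Rminus_diag_uniq. apply Z. intros; apply B.
  - change (Im L = Im l). apply Rminus_diag_uniq. apply Z. intros; apply B.
Qed.

(* The case [Q = 0] is included so that the nonvanishing of Gamma is never needed. *)
Lemma Clim_const_mult_lim (Q Z : C) (u : nat -> C) : Clim (fun N => (Q * u N)%C) Z ->
  (Q * @lim (CompleteNormedModule.CompleteSpace _ C_CompleteNormedModule) (filtermap u eventually))%C = Z.
Proof.
  intros H. destruct (Ceq_dec Q 0) as [->|HQ].
  - rewrite Cmult_0_l. apply (Clim_unique (fun N => (0 * u N)%C)); auto.
    apply (Clim_ext (fun _ => RtoC 0)). intros; ring. split; simpl; apply is_lim_seq_const.
  - rewrite (Clim_lim u (/ Q * Z)%C). field; auto.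
    apply (Clim_scal (/ Q)) in H. eapply Clim_ext; [|exact H]. intros N. simpl. field; auto.
Qed.

Definition csquare_sum (N : nat) (g : Z -> Z -> C) : C := (square_sum N (fun m n => Re (g m n)), square_sum N (fun m n => Im (g m n))).

Lemma square_sum_ext N f g : (forall m n, f m n = g m n) -> square_sum N f = square_sum N g.
Proof. intros E. apply zsum_ext_in. intros m. now apply zsum_ext_in. Qed.

Lemma square_sum_plus N f g : square_sum N (fun m n => f m n + g m n) = square_sum N f + square_sum N g.
Proof. unfold square_sum. rewrite <- zsum_plus. apply zsum_ext_in. intros m. apply zsum_plus. Qed.

Lemma csquare_sum_ext N f g : (forall m n, f m n = g m n) -> csquare_sum N f = csquare_sum N g.
Proof. intros E. unfold csquare_sum. f_equal; apply square_sum_ext; intros; now rewrite E. Qed.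

Lemma csquare_sum_plus N f g : csquare_sum N (fun m n => (f m n + g m n)%C) = (csquare_sum N f + csquare_sum N g)%C.
Proof. unfold csquare_sum, Cplus; simpl. f_equal; apply square_sum_plus. Qed.

Lemma csquare_sum_scal N c f : csquare_sum N (fun m n => (c * f m n)%C) = (c * csquare_sum N f)%C.
Proof.
  destruct c as [a b]. unfold csquare_sum, Cmult; simpl. f_equal.
  - rewrite (square_sum_ext N _ (fun m n => a * Re (f m n) + (- b) * Im (f m n))) by (intros; simpl; unfold Re, Im; ring).
    rewrite square_sum_plus, !square_sum_scal. unfold Re, Im. ring.
  - rewrite (square_sum_ext N _ (fun m n => a * Im (f m n) + b * Re (f m n))) by (intros; simpl; unfold Re, Im; ring).
    rewrite square_sum_plus, !square_sum_scal. unfold Re, Im. ring.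
Qed.

(** The shift by N turns the indices 0, ..., 2N of [Epartial] into the symmetric range. *)
Lemma sum_n_zsum (f : Z -> R) N :
  sum_n (G := R_AbelianMonoid) (fun i => f (Z.of_nat i - Z.of_nat N)%Z) (2 * N) = zsum N f.
Proof.
  induction N.
  - simpl. rewrite sum_O. reflexivity.
  - replace (2 * S N)%nat with (S (S (2 * N))) by lia. rewrite sum_Sn.
    unfold sum_n. rewrite sum_Sn_m by lia. rewrite <- (sum_n_m_S (fun i => f (Z.of_nat i - Z.of_nat (S N))%Z)).
    change (zsum (S N) f) with (zsum N f + f (Z.of_nat (S N)) + f (- Z.of_nat (S N))%Z).
    rewrite <- IHN. unfold sum_n.
    rewrite (sum_n_m_ext (fun n => f (Z.of_nat (S n) - Z.of_nat (S N))%Z) (fun i => f (Z.of_nat i - Z.of_nat N)%Z)).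
    2:{ intros i. f_equal. lia. }
    replace (Z.of_nat 0 - Z.of_nat (S N))%Z with (- Z.of_nat (S N))%Z by lia.
    replace (Z.of_nat (S (S (2 * N))) - Z.of_nat (S N))%Z with (Z.of_nat (S N)) by lia.
    unfold plus; simpl. ring.
Qed.

Lemma sum_n_C (u : nat -> C) n : sum_n (G := C_AbelianMonoid) u n =
  (sum_n (G := R_AbelianMonoid) (fun i => Re (u i)) n, sum_n (G := R_AbelianMonoid) (fun i => Im (u i)) n).
Proof.
  induction n.
  - rewrite !sum_O. now destruct (u O).
  - rewrite !sum_Sn, IHn. reflexivity.
Qed.

Lemma Epartial_csquare_sum k z s N : Epartial k z s N = csquare_sum N (Eterm k z s).
Proof.
  unfold Epartial. rewrite sum_n_C. unfold csquare_sum, square_sum. f_equal.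
  - rewrite <- sum_n_zsum. apply sum_n_ext. intros i. rewrite sum_n_C. simpl.
    now rewrite <- sum_n_zsum.
  - rewrite <- sum_n_zsum. apply sum_n_ext. intros i. rewrite sum_n_C. simpl.
    now rewrite <- sum_n_zsum.
Qed.

(** The free constant c lets statements about real parts yield imaginary parts as well, by a
    multiplication by i. *)
Lemma cpow_derive_Re b c t : 0 < t ->
  is_derive (fun u => Re (c * cpow b u)%C) t (Re (c * b * cpow (b - 1) t)%C).
Proof.
  intros Ht. destruct b as [b1 b2], c as [c1 c2].
  apply (is_derive_ext (fun u => c1 * (exp (b1 * ln u) * cos (b2 * ln u)) - c2 * (exp (b1 * ln u) * sin (b2 * ln u)))).
  { intros u. change (Re ((c1, c2) * cpow (b1, b2) u)%C) with (c1 * Re (cpow (b1, b2) u) - c2 * Im (cpow (b1, b2) u)).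
    rewrite cpow_Re, cpow_Im. reflexivity. }
  eapply is_derive_eq. auto_derive. auto. reflexivity.
  set (v := cpow ((b1, b2) - 1)%C t).
  assert (E1 : Re v = exp (b1 * ln t) / t * cos (b2 * ln t)).
  { unfold v. rewrite cpow_Re. simpl. replace ((b1 + - (1)) * ln t) with (b1 * ln t + - ln t) by ring.
    rewrite exp_plus, exp_Ropp, exp_ln by auto. replace (b2 + - 0) with b2 by ring. reflexivity. }
  assert (E2 : Im v = exp (b1 * ln t) / t * sin (b2 * ln t)).
  { unfold v. rewrite cpow_Im. simpl. replace ((b1 + - (1)) * ln t) with (b1 * ln t + - ln t) by ring.
    rewrite exp_plus, exp_Ropp, exp_ln by auto. replace (b2 + - 0) with b2 by ring. reflexivity. }
  change (Re ((c1, c2) * (b1, b2) * v)%C) with ((c1 * b1 - c2 * b2) * Re v - (c1 * b2 + c2 * b1) * Im v).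
  rewrite E1, E2. field. lra.
Qed.

Lemma cpow_power_dom (s : C) (p : C -> R) : (forall c, Rabs (p c) <= Cmod c) ->
  power_dom 1 (- Re s - 1) (fun t => p (cpow s t)).
Proof.
  intros Hp t Ht. eapply Rle_trans. apply Hp. rewrite Cmod_cpow. unfold Rpower. right.
  rewrite Rmult_1_l. f_equal. ring.
Qed.

Lemma cpow_cint1_adm a : 0 < Re a -> cint1_adm (fun u => cpow (- a - 1) u).
Proof.
  intros Ha. assert (E : Re (- a - 1)%C = - Re a - 1) by (unfold Re; simpl; ring).
  split; split.
  - intros t Ht. apply (proj1 (cpow_cont (- a - 1)%C t ltac:(lra))).
  - exists 1, (Re a). split; auto. replace (Re a) with (- Re (- a - 1)%C - 1) by (rewrite E; ring). apply cpow_power_dom. apply Re_le_Cmod.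
  - intros t Ht. apply (proj2 (cpow_cont (- a - 1)%C t ltac:(lra))).
  - exists 1, (Re a). split; auto. replace (Re a) with (- Re (- a - 1)%C - 1) by (rewrite E; ring). apply cpow_power_dom. apply Im_le_Cmod.
Qed.

Lemma cint1_pow_Re a c : 0 < Re a -> int1 (fun u => Re (c * (- a) * cpow (- a - 1) u)%C) = - Re c.
Proof.
  intros Ha. apply int1_unique.
  set (P := fun u => Re (c * cpow (- a) u)%C).
  assert (CC : continuous_ge_1 (fun u => Re (c * (- a) * cpow (- a - 1) u)%C)).
  { apply (proj1 (proj1 (cint1_adm_scal (c * - a)%C _ (cpow_cint1_adm a Ha)))). }
  apply (is_lim_seq_ext (fun N => P (INR (S N)) - P 1)).
  - intros N. symmetry. pose proof (INR_S_ge_1 N). apply is_RInt_unique.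
    apply (is_RInt_derive (V := R_CompleteNormedModule) P).
    + intros t Ht. rewrite Rmin_left, Rmax_right in Ht by lra. apply cpow_derive_Re. lra.
    + intros t Ht. rewrite Rmin_left, Rmax_right in Ht by lra. apply CC. lra.
  - assert (P1 : P 1 = Re c). { unfold P, cpow. rewrite ln_1, Cmult_0_r, Cexp_0, Cmult_1_r. reflexivity. }
    rewrite P1. replace (- Re c) with (0 - Re c) by ring.
    apply is_lim_seq_minus'; [|apply is_lim_seq_const].
    apply is_lim_seq_abs_0. apply is_lim_seq_spec. intros eps.
    pose proof (Cmod_ge_0 c) as Hc0.
    destruct (Rpower_small (Re a) (eps / (Cmod c + 1)) Ha) as (T0 & HT0 & HT).
    { apply Rdiv_lt_0_compat. apply cond_pos. lra. }
    destruct (nfloor_ex T0 ltac:(lra)) as [N0 HN0]. exists N0. intros N HN.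
    assert (INR N0 <= INR N) by now apply le_INR.
    specialize (HT (INR (S N)) ltac:(rewrite S_INR; lra)).
    rewrite Rminus_0_r, Rabs_Rabsolu. unfold P. eapply Rle_lt_trans. apply Re_le_Cmod.
    rewrite Cmod_mult, Cmod_cpow. replace (Re (- a)%C) with (- Re a) by (unfold Re; simpl; ring).
    change (exp (- Re a * ln (INR (S N)))) with (Rpower (INR (S N)) (- Re a)).
    pose proof (Rpower_pos (INR (S N)) (- Re a)).
    apply Rle_lt_trans with ((Cmod c + 1) * Rpower (INR (S N)) (- Re a)). nra.
    apply Rlt_le_trans with ((Cmod c + 1) * (eps / (Cmod c + 1))). apply Rmult_lt_compat_l; lra. right; field; lra.
Qed.

Lemma cint1_pow a : 0 < Re a -> cint1 (fun u => cpow (- a - 1) u) = (/ a)%C.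
Proof.
  intros Ha. assert (Hn : a <> 0%C). { intros E. rewrite E in Ha. simpl in Ha. lra. }
  assert (R1 : int1 (fun u => Re (cpow (- a - 1) u)) = Re (/ a)%C).
  { rewrite (int1_ext _ (fun u => Re (- / a * - a * cpow (- a - 1) u)%C)).
    rewrite cint1_pow_Re by auto. unfold Re, Im; simpl. ring.
    intros u _. f_equal. field; auto. }
  assert (R2 : int1 (fun u => Im (cpow (- a - 1) u)) = Im (/ a)%C).
  { rewrite (int1_ext _ (fun u => Re ((Ci * / a) * - a * cpow (- a - 1) u)%C)).
    rewrite cint1_pow_Re by auto. unfold Re, Im, Ci; simpl. ring.
    intros u _. replace (Ci * / a * - a * cpow (- a - 1) u)%C with (- Ci * cpow (- a - 1) u)%C by (field; auto).
    unfold Re, Im, Ci; simpl. ring. }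
  unfold cint1. rewrite R1, R2. now destruct (/ a)%C.
Qed.

Lemma cpow_minus_1 s t : 0 < t -> cpow (s - 1) t = (RtoC (/ t) * cpow s t)%C.
Proof.
  intros Ht. unfold Cminus. rewrite cpow_plus.
  replace (cpow (- (1)) t) with (RtoC (/ t)). ring.
  rewrite <- (cpow_inv_arg 1 t Ht). replace (RtoC 1) with (RtoC (INR 1)) by reflexivity.
  rewrite cpow_nat by now apply Rinv_0_lt_compat. now rewrite pow_1.
Qed.

Lemma cpow_plus_1 s t : 0 < t -> cpow (s + 1) t = (RtoC t * cpow s t)%C.
Proof.
  intros Ht. rewrite cpow_plus. replace (RtoC 1) with (RtoC (INR 1)) by reflexivity.
  rewrite cpow_nat by auto. rewrite pow_1. ring.
Qed.

Section Match.
Variables (x y : R).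
Hypothesis Hy : 0 < y.

Lemma lattice_Clim l s : dominated_near_0 l x y -> 0 < Re s ->
  Clim (fun N => csquare_sum N (fun m n => cint0 (fun t => (RtoC (kernel_val l x y t m n) * cpow s t)%C)))
       (cint0 (fun t => (RtoC (lattice_sum l x y t) * cpow s t)%C)).
Proof.
  intros Hl Hs. destruct (cpow_subexp s) as [W1 W2].
  assert (B : forall p : C -> R, (forall c, Rabs (p c) <= Cmod c) ->
     forall u, 1 <= u -> Rabs (p (cpow s (/ u)) * / u ^ 2) <= Rpower u (- (2 + Re s))).
  { intros p Hp u Hu. rewrite Rabs_mult. rewrite (Rabs_pos_eq (/ u ^ 2)) by (left; apply Rinv_0_lt_compat, pow_lt; lra).
    apply Rle_trans with (exp (Re s * ln (/ u)) * / u ^ 2).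
    - apply Rmult_le_compat_r. left; apply Rinv_0_lt_compat, pow_lt; lra.
      eapply Rle_trans. apply Hp. rewrite Cmod_cpow. lra.
    - right. rewrite ln_Rinv by lra. replace (/ u ^ 2) with (exp (- (ln u + ln u))).
      unfold Rpower. rewrite <- exp_plus. f_equal. ring.
      rewrite exp_Ropp, exp_plus, exp_ln by lra. f_equal. ring. }
  split.
  - simpl. rewrite (int0_ext _ (fun t => lattice_sum l x y t * Re (cpow s t))) by (intros; simpl; unfold Re, Im; ring).
    eapply is_lim_seq_ext; [|apply (lattice_limit l x y (fun t => Re (cpow s t)) (Re s)); auto].
    + intros N. apply square_sum_ext. intros m n. simpl. apply int0_ext. intros; simpl; unfold Re, Im; ring.
    + intros t Ht. exact (proj1 (cpow_cont s t Ht)).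
    + apply (B Re). apply Re_le_Cmod.
  - simpl. rewrite (int0_ext _ (fun t => lattice_sum l x y t * Im (cpow s t))) by (intros; simpl; unfold Re, Im; ring).
    eapply is_lim_seq_ext; [|apply (lattice_limit l x y (fun t => Im (cpow s t)) (Re s)); auto].
    + intros N. apply square_sum_ext. intros m n. simpl. apply int0_ext. intros; simpl; unfold Re, Im; ring.
    + intros t Ht. exact (proj2 (cpow_cont s t Ht)).
    + apply (B Im). apply Im_le_Cmod.
Qed.

Lemma lattice_sum_exp_decaying l : exp_decaying (lattice_sum l x y).
Proof. split. now apply lattice_sum_continuous_ge_1. now apply lattice_sum_exp_dom. Qed.

Lemma lattice_sum_inv_theta_ker u : 0 < u -> lattice_sum theta_ker x y (/ u) = u * lattice_sum theta_ker x y u + u - 1.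
Proof.
  intros Hu. pose proof (Rinv_0_lt_compat u Hu).
  pose proof (theta_lattice_sum x y (/ u) Hy H). pose proof (theta_lattice_sum x y u Hy Hu). pose proof (theta_inv x y u Hy Hu).
  rewrite H0, H1 in H2. lra.
Qed.
End Match.

(** The inhomogeneous term u - 1 of the inversion formula does not depend on z and disappears. Hence
    weight 2 has neither polar terms nor a constant. *)
Lemma lattice_sum_inv_Dx x y u : 0 < y -> 0 < u -> lattice_sum (ker_dx theta_ker) x y (/ u) = u * lattice_sum (ker_dx theta_ker) x y u.
Proof.
  intros Hy Hu. pose proof (Rinv_0_lt_compat u Hu) as Hiu.
  pose proof (lattice_sum_derive_x theta_ker x y (/ u) Hy Hiu) as D1.
  assert (D2 : is_derive (fun v => lattice_sum theta_ker v y (/ u)) x (u * lattice_sum (ker_dx theta_ker) x y u)).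
  { apply (is_derive_ext (fun v => u * lattice_sum theta_ker v y u + (u - 1))).
    - intros v. rewrite lattice_sum_inv_theta_ker by auto. unfold Rminus. rewrite Rplus_assoc. reflexivity.
    - eapply is_derive_eq. apply is_derive_plus'. apply is_derive_scal. apply lattice_sum_derive_x; auto. apply is_derive_const'. ring. }
  apply is_derive_unique in D1. apply is_derive_unique in D2. now rewrite <- D1, <- D2.
Qed.

Lemma lattice_sum_inv_Dy x y u : 0 < y -> 0 < u -> lattice_sum (ker_dy theta_ker) x y (/ u) = u * lattice_sum (ker_dy theta_ker) x y u.
Proof.
  intros Hy Hu. pose proof (Rinv_0_lt_compat u Hu) as Hiu.
  pose proof (lattice_sum_derive_y theta_ker x y (/ u) Hy Hiu) as D1.
  assert (D2 : is_derive (fun v => u * lattice_sum theta_ker x v u + (u - 1)) y (u * lattice_sum (ker_dy theta_ker) x y u)).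
  { eapply is_derive_eq. apply is_derive_plus'. apply is_derive_scal. apply lattice_sum_derive_y; auto. apply is_derive_const'. ring. }
  apply is_derive_unique in D1. apply is_derive_unique in D2. rewrite <- D1, <- D2.
  apply Derive_ext_loc. exists (mkposreal y Hy). intros v Hv.
  unfold ball in Hv; simpl in Hv; unfold AbsRing_ball, abs, minus, plus, opp in Hv; simpl in Hv.
  apply Rabs_def2 in Hv. rewrite lattice_sum_inv_theta_ker by lra. ring.
Qed.

(* The part of the integral over [(0, 1)] is folded onto [(1, oo)] by [t -> 1/t]. *)
Lemma cint0_mellin_quadratic D x y s : 0 < y -> (forall u, 0 < u -> lattice_sum D x y (/ u) = u * lattice_sum D x y u) ->
  cint0 (fun t => (RtoC (lattice_sum D x y t) * cpow s t)%C)
  = (mellin (lattice_sum D x y) 0 s + mellin (over_t (lattice_sum D x y)) 0 (- s))%C.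
Proof.
  intros Hy HD. rewrite cint0_cint1. unfold mellin. f_equal; apply cint1_ext; intros u Hu.
  - rewrite pow_O, Rmult_1_r. reflexivity.
  - unfold cinvert_var. unfold over_t. rewrite HD, cpow_inv_arg, pow_O by lra.
    rewrite !RtoC_mult. replace (RtoC (/ u ^ 2)) with (RtoC (/ u) * RtoC (/ u))%C.
    replace (RtoC (/ u) * RtoC (/ u) * (RtoC u * RtoC (lattice_sum D x y u) * cpow (- s) u))%C
      with (RtoC (/ u) * RtoC u * (RtoC (lattice_sum D x y u) * RtoC (/ u) * cpow (- s) u))%C by ring.
    rewrite <- RtoC_mult, Rinv_l by lra. ring.
    rewrite <- RtoC_mult. f_equal. field. lra.
Qed.

(** The inhomogeneous term u - 1 of the inversion formula integrates to 1 / (s - 1) - 1 / s;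
    convergence of its first part requires Re s > 1. *)
Lemma cint0_mellin_theta_ker x y s : 0 < y -> 1 < Re s ->
  cint0 (fun t => (RtoC (lattice_sum theta_ker x y t) * cpow (s - 1) t)%C)
  = (mellin (over_t (lattice_sum theta_ker x y)) 0 s + mellin (lattice_sum theta_ker x y) 0 (- s) + (/ (s - 1) - / s))%C.
Proof.
  intros Hy Hs. rewrite cint0_cint1, <- Cplus_assoc. f_equal.
  - unfold mellin. apply cint1_ext. intros t Ht. unfold over_t. rewrite cpow_minus_1 by lra.
    rewrite pow_O, Rmult_1_r, RtoC_mult. ring.
  - assert (A1 : cint1_adm (fun u => cpow (- (s - 1) - 1) u)) by (apply cpow_cint1_adm; unfold Re in *; simpl; lra).
    assert (A2 : cint1_adm (fun u => cpow (- s - 1) u)) by (apply cpow_cint1_adm; unfold Re in *; simpl; lra).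
    rewrite <- (cint1_pow (s - 1)%C) by (unfold Re in *; simpl; lra).
    rewrite <- (cint1_pow s) by (unfold Re in *; simpl; lra).
    assert (A3 : cint1_adm (fun t => (RtoC (lattice_sum theta_ker x y t * ln t ^ 0) * cpow (- s) t)%C)) by (apply (mellin_adm (lattice_sum theta_ker x y) 0); now apply lattice_sum_exp_decaying).
    replace (cint1 (fun u => cpow (- (s - 1) - 1) u) - cint1 (fun u => cpow (- s - 1) u))%C
      with (cint1 (fun u => cpow (- (s - 1) - 1) u) + - (1) * cint1 (fun u => cpow (- s - 1) u))%C by ring.
    unfold mellin. rewrite <- cint1_scal by auto. rewrite <- cint1_plus by auto using cint1_adm_scal.
    rewrite <- cint1_plus by auto using cint1_adm_scal, cint1_adm_plus.
    apply cint1_ext. intros u Hu. unfold cinvert_var.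
    rewrite lattice_sum_inv_theta_ker, cpow_inv_arg by lra.
    replace (- (s - 1))%C with (- s + 1)%C by ring. rewrite cpow_plus_1 by lra.
    replace (- s + 1 - 1)%C with (- s)%C by ring. rewrite cpow_minus_1 by lra.
    rewrite pow_O, Rmult_1_r.
    replace (RtoC (/ u ^ 2) * (RtoC (u * lattice_sum theta_ker x y u + u - 1) * (RtoC u * cpow (- s) u)))%C
      with (RtoC (/ u ^ 2 * (u * lattice_sum theta_ker x y u + u - 1) * u) * cpow (- s) u)%C by (rewrite !RtoC_mult; ring).
    replace (/ u ^ 2 * (u * lattice_sum theta_ker x y u + u - 1) * u) with (lattice_sum theta_ker x y u + (1 - / u)) by (field; lra).
    rewrite RtoC_plus, RtoC_minus. ring.
Qed.

(** * Continuation of the Eisenstein series *)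

Lemma cint0_0 : cint0 (fun _ => RtoC 0) = RtoC 0.
Proof.
  rewrite cint0_cint1. rewrite (cint1_ext (cinvert_var _) (fun _ => RtoC 0)).
  rewrite (cint1_real (fun _ => 0)), int1_0. ring. intros; unfold cinvert_var; ring.
Qed.

Section Terms.
Variables (x y : R).
Hypothesis Hy : 0 < y.
Variables m n : Z.

Let w : C := (IZR m * x + IZR n, IZR m * y).
Let W : R := (IZR m * x + IZR n) ^ 2 + (IZR m * y) ^ 2.

Lemma lattice_vector : (RtoC (IZR m) * (x, y) + RtoC (IZR n))%C = w.
Proof. unfold w. apply injective_projections; simpl; ring. Qed.

Lemma lattice_norm : Cmod w ^ 2 = W.
Proof. unfold w, W, Cmod; simpl fst; simpl snd. rewrite pow2_sqrt; auto. pose proof (pow2_ge_0 (IZR m * x + IZR n)). pose proof (pow2_ge_0 (IZR m * y)). lra. Qed.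

Hypothesis Hmn : (Z.eqb m 0 && Z.eqb n 0)%bool = false.

Lemma lattice_norm_pos : 0 < W.
Proof.
  pose proof (lattice_size m n Hmn) as H.
  destruct (qform_lower (Rabs x) y y Hy) as (d & Hd & Hq). specialize (Hq x y m n ltac:(lra) ltac:(lra)).
  assert (1 <= (zabs m + zabs n) ^ 2) by nra.
  assert (0 < qform x y m n) by nra.
  replace W with (qform x y m n * y) by (unfold qform, W; field; lra). now apply Rmult_lt_0_compat.
Qed.

Lemma cpow_qform s : cpow s (PI * qform x y m n) = (cpow s PI * cpow s W / cpow s y)%C.
Proof.
  pose proof lattice_norm_pos as HW. pose proof PI_RGT_0.
  assert (Hiy : 0 < / y) by now apply Rinv_0_lt_compat.
  change (qform x y m n) with (W * / y). rewrite cpow_mult, cpow_mult; auto. 2: now apply Rmult_lt_0_compat.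
  rewrite cpow_inv_arg by auto. replace (cpow (- s) y) with (/ cpow s y)%C. unfold Cdiv; ring.
  rewrite <- (Cmult_1_r (/ cpow s y)), <- (cpow_opp s y). field. apply cpow_neq_0.
Qed.

Lemma qform_pos : 0 < PI * qform x y m n.
Proof.
  pose proof lattice_norm_pos as HW. pose proof PI_RGT_0.
  apply Rmult_lt_0_compat; auto. change (qform x y m n) with (W / y). now apply Rdiv_lt_0_compat.
Qed.

Lemma lattice_term0_exp t : lattice_term 0 0 0 x y t m n = exp (- (PI * qform x y m n) * t).
Proof. unfold lattice_term. rewrite Hmn. simpl. rewrite !Rmult_1_l. f_equal. ring. Qed.

Lemma cpow_opp_inv s a : cpow (- s) a = (/ cpow s a)%C.
Proof. rewrite <- (Cmult_1_r (/ cpow s a)), <- (cpow_opp s a). field. apply cpow_neq_0. Qed.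

(** The rescaled Gamma integral with r = pi Q, where Q = |w|^2 / y. *)
Lemma Eterm0_integral s : 0 < Re s ->
  (cpowR PI (- s) * Cgamma s * Eterm 0 (x, y) s m n)%C
  = cint0 (fun t => (RtoC (kernel_val theta_ker x y t m n) * cpow (s - 1) t)%C).
Proof.
  intros Hs. unfold Eterm. rewrite Hmn, lattice_vector, lattice_norm, !cpowR_cpow. simpl Im. simpl Czpow.
  replace (Cgamma s) with (Cgamma (s - 1 + 1)) by (f_equal; ring).
  rewrite (Gamma_scale (PI * qform x y m n)) by (try apply qform_pos; unfold Re in *; simpl; lra).
  replace (s - 1 + 1)%C with s by ring. rewrite cpow_qform, cpow_opp_inv.
  rewrite (cint0_ext (fun t => RtoC (kernel_val theta_ker x y t m n) * cpow (s - 1) t)%C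
    (fun t => RtoC (exp (- (PI * qform x y m n) * t)) * cpow (s - 1) t)%C).
  - field. repeat split; apply cpow_neq_0.
  - intros t _. now rewrite kernel_val_theta_ker, lattice_term0_exp.
Qed.

(** Applying d/dy + i d/dx to exp (- pi t Q) produces the factor pi t conj(w)^2 / y^2. Since conj(w)
    = |w|^2 / w, this is where w^-2 comes from, and the extra t raises the Gamma argument to s +
    2. *)
Lemma Eterm2_integral s : 0 < Re s ->
  (cpowR PI (- (s + 1)) * Cgamma (s + 1 + 1) * Eterm 2 (x, y) s m n)%C
  = (cint0 (fun t => (RtoC (kernel_val (ker_dy theta_ker) x y t m n) * cpow s t)%C)
     + Ci * cint0 (fun t => (RtoC (kernel_val (ker_dx theta_ker) x y t m n) * cpow s t)%C))%C.
Proof.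
  intros Hs. unfold Eterm. rewrite Hmn, lattice_vector, lattice_norm, !cpowR_cpow. simpl Im.
  pose proof lattice_norm_pos as HW. pose proof PI_RGT_0 as HPI. pose proof qform_pos as Hr.
  rewrite (Gamma_scale (PI * qform x y m n)) by (auto; unfold Re in *; simpl; lra).
  set (f := fun t => (RtoC (exp (- (PI * qform x y m n) * t)) * cpow (s + 1) t)%C).
  assert (Af : cint0_adm f) by (apply bounded_decaying_cint0; [now apply exp_bounded_decaying|unfold Re in *; simpl; lra]).
  set (A := IZR m * x + IZR n). set (B := IZR m * y).
  rewrite (cint0_ext (fun t => RtoC (kernel_val (ker_dy theta_ker) x y t m n) * cpow s t)%C
    (fun t => RtoC (PI * (A ^ 2 - B ^ 2) * / y ^ 2) * f t)%C).
  2:{ intros t Ht. unfold f. rewrite <- lattice_term0_exp, cpow_plus_1 by auto.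
      cbn [mono_dy ker_dy flat_map app kernel_val mono_val theta_ker]. unfold lattice_term. rewrite Hmn. fold (qexp x y t m n). fold A B.
      rewrite !Cmult_assoc, <- !RtoC_mult. f_equal. f_equal. simpl. field. lra. }
  rewrite (cint0_ext (fun t => RtoC (kernel_val (ker_dx theta_ker) x y t m n) * cpow s t)%C
    (fun t => RtoC (PI * (-2 * A * B) * / y ^ 2) * f t)%C).
  2:{ intros t Ht. unfold f. rewrite <- lattice_term0_exp, cpow_plus_1 by auto.
      cbn [mono_dx ker_dx flat_map app kernel_val mono_val theta_ker]. unfold lattice_term. rewrite Hmn. fold (qexp x y t m n). fold A B.
      rewrite !Cmult_assoc, <- !RtoC_mult. f_equal. f_equal. simpl. field. lra. }
  rewrite !cint0_scal by auto. set (J := cint0 f).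
  rewrite (cpow_plus_1 (s + 1)), (cpow_plus_1 s) by auto. rewrite cpow_qform, cpow_opp_inv, cpow_plus_1 by auto.
  change (Czpow w 2) with (w * (w * 1))%C.
  assert (Hw : w <> 0%C). { intros E. pose proof lattice_norm as H. rewrite E, Cmod_0 in H. simpl in H. lra. }
  assert (Ew : (w * (A, Ropp B))%C = RtoC W).
  { unfold w, W, A, B. apply injective_projections; simpl; ring. }
  assert (E3 : (RtoC (PI * (A ^ 2 - B ^ 2) * / y ^ 2) + Ci * RtoC (PI * (-2 * A * B) * / y ^ 2))%C
     = (RtoC (PI * / y ^ 2) * ((A, Ropp B) * (A, Ropp B)))%C).
  { apply injective_projections; simpl; ring. }
  replace (RtoC (PI * (A ^ 2 - B ^ 2) * / y ^ 2) * J + Ci * (RtoC (PI * (-2 * A * B) * / y ^ 2) * J))%C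
    with ((RtoC (PI * (A ^ 2 - B ^ 2) * / y ^ 2) + Ci * RtoC (PI * (-2 * A * B) * / y ^ 2)) * J)%C by ring.
  rewrite E3. replace ((A, Ropp B) : C) with (RtoC W / w)%C by (rewrite <- Ew; field; auto).
  change (qform x y m n) with (W * / y).
  assert (Hyc : RtoC y <> 0%C) by (intros E; apply RtoC_inj in E; lra).
  assert (HPc : RtoC PI <> 0%C) by (intros E; apply RtoC_inj in E; lra).
  replace (/ y ^ 2) with (/ y * / y) by (field; lra).
  rewrite !RtoC_mult, !RtoC_inv. field. repeat split; auto; apply cpow_neq_0. lra.
Qed.
End Terms.

Definition continuation0 (x y : R) (s : C) : C :=
  (RtoC (1 / 2) + s * (s - 1) * folded_mellin (over_t (lattice_sum theta_ker x y)) (lattice_sum theta_ker x y) 0 s)%C.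

Definition folded_mellin2 (x y : R) (j : nat) (s : C) : C :=
  (folded_mellin (lattice_sum (ker_dy theta_ker) x y) (over_t (lattice_sum (ker_dy theta_ker) x y)) j s
   + Ci * folded_mellin (lattice_sum (ker_dx theta_ker) x y) (over_t (lattice_sum (ker_dx theta_ker) x y)) j s)%C.

(** The unsimplified shape is that of [taylor_affine] with c0 = 0 and b = -1. *)
Definition continuation2 (x y : R) (s : C) : C := (0 + s * (s - - (1)) * folded_mellin2 x y 0 s)%C.

Theorem EEhat0_conv_eq x y s : 0 < y -> 1 < Re s -> EEhat_conv 0 (x, y) s = continuation0 x y s.
Proof.
  intros Hy Hs. unfold EEhat_conv, Ehat, Eis. simpl Z.abs.
  replace (RtoC (0 / 2)) with (RtoC 0) by (f_equal; field).
  replace (RtoC (0 / 2 + 0 / 2)) with (RtoC 0) by (f_equal; field).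
  replace (RtoC (0 / 2 - 1)) with (- (1))%C by (rewrite <- RtoC_opp; f_equal; field).
  replace (s + 0)%C with s by ring.
  set (Q := (cpowR PI (- s) * Cgamma s)%C).
  set (Z := cint0 (fun t => (RtoC (lattice_sum theta_ker x y t) * cpow (s - 1) t)%C)).
  assert (HZ : Clim (fun N => (Q * Epartial 0 (x, y) s N)%C) Z).
  { eapply Clim_ext; [|apply lattice_Clim; auto]. 2: now apply dominated_near_0_theta_ker. 2: unfold Re in *; simpl; lra.
    intros N. rewrite Epartial_csquare_sum, <- csquare_sum_scal. apply csquare_sum_ext. intros m n.
    destruct (Z.eqb m 0 && Z.eqb n 0)%bool eqn:Emn.
    - unfold Eterm. rewrite Emn, Cmult_0_r. rewrite (cint0_ext _ (fun _ => RtoC 0)). apply cint0_0.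
      intros t _. rewrite kernel_val_theta_ker. unfold lattice_term. rewrite Emn. ring.
    - symmetry. unfold Q. apply Eterm0_integral; auto. lra. }
  apply Clim_const_mult_lim in HZ.
  set (Lm := lim _) in *.
  replace (s * (s + - (1)) * (Q * (RtoC (1 / 2) * Lm)))%C with (RtoC (1 / 2) * (s * (s - 1)) * (Q * Lm))%C by ring.
  rewrite HZ. unfold Z. rewrite cint0_mellin_theta_ker by auto. unfold continuation0, folded_mellin.
  assert (H0 : s <> 0%C) by (intros E; rewrite E in Hs; simpl in Hs; lra).
  assert (H1 : (s - 1)%C <> 0%C).
  { intros E. apply (f_equal Re) in E. unfold Re in *; simpl in E. lra. }
  rewrite pow_O.
  set (a := mellin _ 0 s). set (b := mellin _ 0 (- s)%C).
  (* The polar terms contribute s (s - 1) / 2 times 1 / (s - 1) - 1 / s, which is the constant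
     1/2. *)
  replace (RtoC (1 / 2) * (s * (s - 1)) * (a + b + (/ (s - 1) - / s)))%C
    with (RtoC (1 / 2) * (s * (s - 1)) * (a + b) + RtoC (1 / 2))%C. ring.
  field. auto.
Qed.

Theorem EEhat2_conv_eq x y s : 0 < y -> 0 < Re s -> EEhat_conv 2 (x, y) s = continuation2 x y s.
Proof.
  intros Hy Hs. unfold EEhat_conv, Ehat, Eis. simpl Z.abs.
  replace (RtoC (2 / 2)) with (RtoC 1) by (f_equal; field).
  replace (s + RtoC (2 / 2 + 2 / 2))%C with (s + 1 + 1)%C.
  2:{ replace (2 / 2 + 2 / 2) with (1 + 1) by field. rewrite RtoC_plus. ring. }
  replace (RtoC (2 / 2 - 1)) with (RtoC 0) by (f_equal; field).
  set (Q := (cpowR PI (- (s + 1)) * Cgamma (s + 1 + 1))%C).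
  set (ZY := cint0 (fun t => (RtoC (lattice_sum (ker_dy theta_ker) x y t) * cpow s t)%C)).
  set (ZX := cint0 (fun t => (RtoC (lattice_sum (ker_dx theta_ker) x y t) * cpow s t)%C)).
  assert (HZ : Clim (fun N => (Q * Epartial 2 (x, y) s N)%C) (ZY + Ci * ZX)%C).
  { eapply Clim_ext; [|apply Clim_plus; [|apply Clim_scal]; apply lattice_Clim; auto].
    2: now apply dominated_near_0_ker_dy. 2: now apply dominated_near_0_ker_dx.
    intros N. cbv beta. rewrite Epartial_csquare_sum, <- !csquare_sum_scal, <- csquare_sum_plus. apply csquare_sum_ext. intros m n.
    destruct (Z.eqb m 0 && Z.eqb n 0)%bool eqn:Emn.
    - unfold Eterm. rewrite Emn, Cmult_0_r.
      rewrite (cint0_ext (fun t => RtoC (kernel_val (ker_dy theta_ker) x y t m n) * cpow s t)%C (fun _ => RtoC 0)).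
      rewrite (cint0_ext (fun t => RtoC (kernel_val (ker_dx theta_ker) x y t m n) * cpow s t)%C (fun _ => RtoC 0)).
      rewrite cint0_0. ring.
      intros t _. cbn [mono_dx ker_dx flat_map app kernel_val mono_val theta_ker]. unfold lattice_term. rewrite Emn, !Rmult_0_r, !Rplus_0_r. ring.
      intros t _. cbn [mono_dy ker_dy flat_map app kernel_val mono_val theta_ker]. unfold lattice_term. rewrite Emn, !Rmult_0_r, !Rplus_0_r. ring.
    - symmetry. unfold Q. apply Eterm2_integral; auto. }
  apply Clim_const_mult_lim in HZ.
  set (Lm := lim _) in *.
  replace ((s + 1) * (s + 0) * (Q * (RtoC (1 / 2) * Lm)))%C with (RtoC (1 / 2) * (s * (s + 1)) * (Q * Lm))%C by ring.
  rewrite HZ. unfold ZX, ZY. rewrite !cint0_mellin_quadratic; auto.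
  2: intros; now apply lattice_sum_inv_Dx. 2: intros; now apply lattice_sum_inv_Dy.
  unfold continuation2, folded_mellin2, folded_mellin. rewrite pow_O. ring.
Qed.

Lemma lattice_sum_over_t_exp_decaying l x y : 0 < y -> exp_decaying (over_t (lattice_sum l x y)).
Proof. intros Hy. apply (exp_decaying_weight (lattice_sum l x y)). now apply lattice_sum_exp_decaying. apply subexp_inv. Qed.

Lemma folded_mellin2_cdiff x y j s : 0 < y -> cdiff (folded_mellin2 x y j) s (folded_mellin2 x y (S j) s).
Proof.
  intros Hy. unfold folded_mellin2. apply cdiff_plus; [|apply cdiff_scal]; apply folded_mellin_cdiff;
  auto using lattice_sum_exp_decaying, lattice_sum_over_t_exp_decaying.
Qed.

Lemma affine_entire (H : nat -> C -> C) (c0 b : C) : (forall j s, cdiff (H j) s (H (S j) s)) ->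
  entire (fun s => (c0 + s * (s - b) * H O s)%C).
Proof.
  intros HH. apply centire_entire. intros s. eexists. apply cdiff_plus. apply cdiff_const.
  apply (cdiff_mult (fun s => s * (s - b))%C). apply cdiff_mult. apply cdiff_id.
  apply cdiff_plus. apply cdiff_id. apply cdiff_const. apply HH.
Qed.

(** Exhibiting g makes the specification of the choice operator available; the identity theorem on
    Re s > (2 - k) / 2 then identifies the chosen function with g. *)
Lemma EEhat_unique k z (g : C -> C) : entire g ->
  (forall s, 2 < 2 * Re s + IZR k -> g s = EEhat_conv k z s) -> forall s, EEhat k z s = g s.
Proof.
  intros Hg Hc.
  pose proof (epsilon_spec (inhabits (fun _ : C => RtoC 0))
    (fun g => entire g /\ forall s : C, 2 < 2 * Re s + IZR k -> g s = EEhat_conv k z s)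
    (ex_intro _ g (conj Hg Hc))) as [H1 H2].
  fold (EEhat k z) in H1, H2.
  apply (entire_identity (EEhat k z) g ((2 - IZR k) / 2)); auto.
  intros s Hs. rewrite H2, Hc; auto; lra.
Qed.

Lemma EEhat0_eq x y s : 0 < y -> EEhat 0 (x, y) s = continuation0 x y s.
Proof.
  intros Hy. apply EEhat_unique.
  - apply (affine_entire (folded_mellin (over_t (lattice_sum theta_ker x y)) (lattice_sum theta_ker x y)) (RtoC (1 / 2)) 1).
    intros; apply folded_mellin_cdiff; auto using lattice_sum_exp_decaying, lattice_sum_over_t_exp_decaying.
  - intros u Hu. symmetry. apply EEhat0_conv_eq; auto. lra.
Qed.

Lemma EEhat2_eq x y s : 0 < y -> EEhat 2 (x, y) s = continuation2 x y s.
Proof.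
  intros Hy. apply EEhat_unique.
  - apply (affine_entire (folded_mellin2 x y) 0 (- (1))). intros; now apply folded_mellin2_cdiff.
  - intros u Hu. symmetry. apply EEhat2_conv_eq; auto. lra.
Qed.

Lemma iter_Cderiv_ext g h : (forall s, g s = h s) -> forall n s, Nat.iter n Cderiv g s = Nat.iter n Cderiv h s.
Proof. intros E n s. replace g with h; auto. apply functional_extensionality_dep. auto. Qed.

(** Both weights lead to the same [taylor_weight j]. Exchanging the roles of t^(s-1) and t^(-s), as
    weight 2 does, costs the sign (-1)^j. *)
Lemma folded_mellin_weight l x y j : 0 < y ->
  folded_mellin (over_t (lattice_sum l x y)) (lattice_sum l x y) j 0 = RtoC (INR (fact j) * weighted_int l (taylor_weight j) x y) /\
  folded_mellin (lattice_sum l x y) (over_t (lattice_sum l x y)) j 0 = RtoC ((-1) ^ j * (INR (fact j) * weighted_int l (taylor_weight j) x y)).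
Proof.
  intros Hy. rewrite !folded_mellin_0 by auto using lattice_sum_exp_decaying, lattice_sum_over_t_exp_decaying.
  pose proof (INR_fact_neq_0 j) as Hf.
  assert (S : (-1) ^ j * (-1) ^ j = 1) by (rewrite <- Rpow_mult_distr; replace (-1 * -1) with 1 by ring; apply pow1).
  split; f_equal.
  - unfold weighted_int. rewrite <- int1_scal by (apply weighted_sum_adm; auto using taylor_weight_subexp).
    apply int1_ext. intros t Ht. unfold over_t, taylor_weight, log_weight. field. split; auto; lra.
  - unfold weighted_int. rewrite <- Rmult_assoc, <- int1_scal by (apply weighted_sum_adm; auto using taylor_weight_subexp).
    apply int1_ext. intros t Ht. unfold over_t, taylor_weight, log_weight.
    replace ((-1) ^ j * INR (fact j) * (lattice_sum l x y t * ((ln t ^ j / INR (fact j) * / t + (-1) ^ j * (ln t ^ j / INR (fact j))) / 2)))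
      with (lattice_sum l x y t * ((-1) ^ j * / t + (-1) ^ j * (-1) ^ j) * ln t ^ j / 2) by (field; split; auto; lra).
    rewrite S. field. lra.
Qed.

Lemma weighted_int_F_weight l x y n : 0 < y -> weighted_int l (F_weight n) x y = match n with O => 0 | S i =>
  match i with O => 0 | S j => weighted_int l (taylor_weight j) x y end - weighted_int l (taylor_weight i) x y end.
Proof.
  intros Hy. destruct n as [|i]. apply weighted_int_0.
  rewrite (weighted_int_ext l _ (fun t => taylor_weight_prev i t + (-1) * taylor_weight i t)) by (intros; unfold F_weight; ring).
  rewrite weighted_int_plus, weighted_int_scal by (auto using taylor_weight_prev_subexp, subexp_scal, taylor_weight_subexp).
  destruct i as [|j].
  - change (taylor_weight_prev 0) with (fun _ : R => 0). rewrite weighted_int_0. ring.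
  - change (taylor_weight_prev (S j)) with (taylor_weight j). ring.
Qed.

Theorem F_eq n x y : 0 < y -> F n (x, y) = RtoC (F_real n x y).
Proof.
  intros Hy. unfold F, Fnk, taylor_coef.
  rewrite (iter_Cderiv_ext _ (continuation0 x y)) by (intros; now apply EEhat0_eq).
  fold (taylor_coef (continuation0 x y) n).
  rewrite (taylor_affine (continuation0 x y) (folded_mellin (over_t (lattice_sum theta_ker x y)) (lattice_sum theta_ker x y)) (RtoC (1 / 2)) 1).
  2: intros; apply folded_mellin_cdiff; auto using lattice_sum_exp_decaying, lattice_sum_over_t_exp_decaying. 2: reflexivity.
  assert (P : forall k, (folded_mellin (over_t (lattice_sum theta_ker x y)) (lattice_sum theta_ker x y) k 0 / RtoC (INR (fact k)))%C = RtoC (weighted_int theta_ker (taylor_weight k) x y)).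
  { intros k. rewrite (proj1 (folded_mellin_weight theta_ker x y k Hy)). pose proof (INR_fact_neq_0 k).
    rewrite RtoC_mult. field. intros E. now apply RtoC_inj in E. }
  unfold F_real. rewrite weighted_int_F_weight by auto.
  replace (delta0 n / 2) with (delta0 n * (1 / 2)) by field.
  rewrite RtoC_plus, (RtoC_mult (delta0 n)). f_equal.
  destruct n as [|[|j]]; rewrite ?P, ?RtoC_minus; auto; ring.
Qed.

(** The sign (-1)^k of the coefficient of index k combines with b = -1: (-1)^(n-2) and (-1)^(n-1) on
    the two terms become (-1)^n times the difference in [F_weight n]. *)
Theorem G_eq n x y : 0 < y ->
  G n (x, y) = ((-1) ^ n * weighted_int (ker_dy theta_ker) (F_weight n) x y, (-1) ^ n * weighted_int (ker_dx theta_ker) (F_weight n) x y).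
Proof.
  intros Hy. unfold G, Gnk, taylor_coef.
  rewrite (iter_Cderiv_ext _ (continuation2 x y)) by (intros; now apply EEhat2_eq).
  fold (taylor_coef (continuation2 x y) n).
  rewrite (taylor_affine (continuation2 x y) (folded_mellin2 x y) 0 (- (1))).
  2: intros; now apply folded_mellin2_cdiff. 2: reflexivity.
  assert (P : forall k, (folded_mellin2 x y k 0 / RtoC (INR (fact k)))%C
    = (RtoC ((-1) ^ k) * (RtoC (weighted_int (ker_dy theta_ker) (taylor_weight k) x y) + Ci * RtoC (weighted_int (ker_dx theta_ker) (taylor_weight k) x y)))%C).
  { intros k. unfold folded_mellin2. rewrite !(proj2 (folded_mellin_weight _ x y k Hy)). pose proof (INR_fact_neq_0 k).
    rewrite !RtoC_mult. field. intros E. now apply RtoC_inj in E. }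
  rewrite !weighted_int_F_weight by auto. rewrite Cmult_0_r, Cplus_0_l.
  destruct n as [|[|j]]; rewrite ?P; apply injective_projections; unfold Ci; simpl; ring.
Qed.

(** * The modified Taylor coefficients *)

Definition sum_from_1 (g : nat -> R) (n : nat) : R := sum_n_m (G := R_AbelianMonoid) g 1 n.

Lemma sum_from_1_S g n : sum_from_1 g (S n) = sum_from_1 g n + g (S n).
Proof. unfold sum_from_1. rewrite sum_n_Sm by lia. reflexivity. Qed.

Lemma sum_from_1_0 g : sum_from_1 g 0 = 0.
Proof. unfold sum_from_1. rewrite sum_n_m_zero by lia. reflexivity. Qed.

Lemma sum_from_1_ext g h n : (forall l, (l <= n)%nat -> g l = h l) -> sum_from_1 g n = sum_from_1 h n.
Proof. intros E. apply sum_n_m_ext_loc. intros k Hk. apply E. lia. Qed.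

Lemma sum_from_1_scal k g n : sum_from_1 (fun l => k * g l) n = k * sum_from_1 g n.
Proof. induction n. rewrite !sum_from_1_0; ring. rewrite !sum_from_1_S, IHn. ring. Qed.

(** The combination defining [Ft], as a linear operation on real sequences; it will be applied to
    constants, weights and integrals alike. *)
Definition binomial_mix (n : nat) (u : nat -> R) : R :=
  (-1) ^ n * (u n + sum_from_1 (fun l => Binomial.C (n + l) n * u (n - l)%nat) n).

Lemma sum_n_m_C (a : nat -> R) (u : nat -> C) n :
  sum_n_m (G := C_AbelianMonoid) (fun l => (RtoC (a l) * u l)%C) 1 n
  = (sum_from_1 (fun l => a l * Re (u l)) n, sum_from_1 (fun l => a l * Im (u l)) n).
Proof.
  induction n.
  - rewrite !sum_from_1_0, sum_n_m_zero by lia. reflexivity.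
  - rewrite !sum_from_1_S, sum_n_Sm, IHn by lia. unfold plus; simpl. unfold Cplus; simpl.
    f_equal; unfold Re, Im; simpl; ring.
Qed.

(** Abel summation, where [Cb] is the sequence of partial sums of [c]. *)
Lemma partial_summation (Cb c v : nat -> R) : Cb O = c O -> (forall l, Cb (S l) = Cb l + c (S l)) ->
  forall M, Cb O * (v 1%nat - v O) + sum_from_1 (fun l => Cb l * (v (S l) - v l)) M
    = Cb M * v (S M) - (c O * v O + sum_from_1 (fun l => c l * v l) M).
Proof.
  intros H0 HS M. induction M.
  - rewrite !sum_from_1_0, H0. ring.
  - rewrite !sum_from_1_S, <- Rplus_assoc, IHM, HS. ring.
Qed.

Lemma binomial_diag n : Binomial.C n n = 1.
Proof. unfold Binomial.C. rewrite Nat.sub_diag. simpl. field. apply INR_fact_neq_0. Qed.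

Definition seq_prev (u : nat -> R) (n : nat) : R := match n with O => 0 | S i => u i end.
Definition seq_diff (u : nat -> R) (n : nat) : R := match n with O => 0 | S i => seq_prev u i - u i end.

(* Summation by parts and Pascal's rule. *)
Lemma binomial_mix_diff n u : binomial_mix n (seq_diff u) = match n with O => 0 | S p => binomial_mix p u end.
Proof.
  destruct n as [|p].
  - unfold binomial_mix. rewrite sum_from_1_0. simpl. ring.
  (* The reversed sequence, extended by 0 beyond p. The extension makes the differences correct at
     the end, where [seq_diff] has fewer terms. *)
  - set (v := fun l => if Nat.leb l p then u (p - l)%nat else 0).
    assert (Hd : forall l, (l <= S p)%nat -> seq_diff u (S p - l)%nat = v (S l) - v l).
    { intros l Hl. unfold v. destruct (Nat.eq_dec l (S p)) as [->|Hne].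
      - replace (S p - S p)%nat with O by lia. simpl seq_diff.
        destruct (Nat.leb_spec (S (S p)) p); [lia|]. destruct (Nat.leb_spec (S p) p); [lia|]. ring.
      - replace (S p - l)%nat with (S (p - l)) by lia. cbn [seq_diff].
        destruct (Nat.leb_spec l p); [|lia]. destruct (Nat.leb_spec (S l) p).
        + replace (p - l)%nat with (S (p - S l)) at 1 by lia. reflexivity.
        + replace (p - l)%nat with O by lia. reflexivity. }
    (* By Pascal's rule the coefficients of index S p are the partial sums of those of index p. *)
    pose proof (partial_summation (fun l => Binomial.C (S p + l) (S p)) (fun l => Binomial.C (p + l) p) v) as PS.
    specialize (PS ltac:(cbv beta; rewrite !Nat.add_0_r, !binomial_diag; reflexivity)).
    assert (HP : forall l, Binomial.C (S p + S l) (S p) = Binomial.C (S p + l) (S p) + Binomial.C (p + S l) p).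
    { intros l. replace (S p + S l)%nat with (S (S p + l)) by lia. rewrite <- pascal by lia.
      replace (p + S l)%nat with (S p + l)%nat by lia. ring. }
    specialize (PS HP (S p)). cbv beta in PS. rewrite Nat.add_0_r, Nat.add_0_r, !binomial_diag in PS.
    unfold binomial_mix.
    rewrite (sum_from_1_ext _ (fun l => Binomial.C (S p + l) (S p) * (v (S l) - v l))) by (intros; now rewrite Hd).
    replace (seq_diff u (S p)) with (v 1%nat - v O) by (rewrite <- (Hd O) by lia; reflexivity).
    rewrite Rmult_1_l in PS. rewrite PS.
    rewrite sum_from_1_S.
    rewrite (sum_from_1_ext _ (fun l => Binomial.C (p + l) p * u (p - l)%nat)).
    2:{ intros l Hl. unfold v. destruct (Nat.leb_spec l p); [reflexivity|lia]. }
    assert (V1 : v (S (S p)) = 0) by (unfold v; destruct (Nat.leb_spec (S (S p)) p); [lia|reflexivity]).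
    assert (V2 : v (S p) = 0) by (unfold v; destruct (Nat.leb_spec (S p) p); [lia|reflexivity]).
    assert (V0 : v O = u p) by (unfold v; simpl; now rewrite Nat.sub_0_r).
    rewrite V1, V2, V0. simpl pow. ring.
Qed.

Lemma binomial_mix_plus n u v : binomial_mix n (fun k => u k + v k) = binomial_mix n u + binomial_mix n v.
Proof.
  unfold binomial_mix.
  assert (H : forall (a : nat -> R) (b c : nat -> R) m, sum_from_1 (fun l => a l * (b l + c l)) m = sum_from_1 (fun l => a l * b l) m + sum_from_1 (fun l => a l * c l) m).
  { intros a b c m. induction m. rewrite !sum_from_1_0; ring. rewrite !sum_from_1_S, IHm. ring. }
  rewrite (H _ (fun l => u (n - l)%nat) (fun l => v (n - l)%nat)). ring.
Qed.

Lemma binomial_mix_scal n k u : binomial_mix n (fun i => k * u i) = k * binomial_mix n u.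
Proof.
  unfold binomial_mix.
  assert (H : forall (a : nat -> R) (b : nat -> R) m, sum_from_1 (fun l => a l * (k * b l)) m = k * sum_from_1 (fun l => a l * b l) m).
  { intros a b m. induction m. rewrite !sum_from_1_0; ring. rewrite !sum_from_1_S, IHm. ring. }
  rewrite (H _ (fun l => u (n - l)%nat)). ring.
Qed.

(** Mixing the weights instead of the integrals turns [Ft n], up to a constant, into a single
    weighted integral that can be differentiated as such. *)
Definition Ft_weight (n : nat) (t : R) : R := binomial_mix n (fun k => F_weight k t).

Lemma sum_from_1_subexp (a : nat -> R) (g : nat -> R -> R) n : (forall k, subexp (g k)) ->
  subexp (fun t => sum_from_1 (fun l => a l * g l t) n).
Proof.
  intros H. induction n.
  - apply (subexp_ext (fun _ => 0)). intros; now rewrite sum_from_1_0. apply subexp_const.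
  - apply (subexp_ext (fun t => sum_from_1 (fun l => a l * g l t) n + a (S n) * g (S n) t)). intros; now rewrite sum_from_1_S.
    apply subexp_plus; auto. now apply subexp_scal.
Qed.

Lemma Ft_weight_subexp n : subexp (Ft_weight n).
Proof.
  unfold Ft_weight, binomial_mix. apply subexp_scal, subexp_plus. apply F_weight_subexp.
  apply (sum_from_1_subexp _ (fun l => F_weight (n - l))). intros; apply F_weight_subexp.
Qed.

Lemma weighted_int_Ft_weight l n x y : 0 < y -> weighted_int l (Ft_weight n) x y = binomial_mix n (fun k => weighted_int l (F_weight k) x y).
Proof.
  intros Hy. unfold Ft_weight, binomial_mix.
  assert (H : forall (a : nat -> R) (g : nat -> R -> R) m, (forall k, subexp (g k)) ->
    weighted_int l (fun t => sum_from_1 (fun i => a i * g i t) m) x y = sum_from_1 (fun i => a i * weighted_int l (g i) x y) m).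
  { intros a g m Hg. induction m.
    - rewrite sum_from_1_0, <- (weighted_int_0 l x y). apply weighted_int_ext. intros; apply sum_from_1_0.
    - rewrite sum_from_1_S, <- IHm, <- weighted_int_scal, <- weighted_int_plus; auto using sum_from_1_subexp, subexp_scal.
      apply weighted_int_ext. intros; apply sum_from_1_S. }
  rewrite <- (H _ (fun i => F_weight (n - i))) by (intros; apply F_weight_subexp).
  pose proof (sum_from_1_subexp (fun i => Binomial.C (n + i) n) (fun i => F_weight (n - i)) n ltac:(intros; apply F_weight_subexp)) as W.
  rewrite <- weighted_int_plus, <- weighted_int_scal; auto using F_weight_subexp, subexp_plus.
Qed.

Definition Ft_real (n : nat) (x y : R) : R := binomial_mix n (fun k => delta0 k / 2) + weighted_int theta_ker (Ft_weight n) x y.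

Lemma Ft_real_binomial_mix n x y : 0 < y -> Ft_real n x y = binomial_mix n (fun k => F_real k x y).
Proof. intros Hy. unfold Ft_real. rewrite weighted_int_Ft_weight by auto. unfold F_real. now rewrite binomial_mix_plus. Qed.

Definition Ft_real_prev (n : nat) (x y : R) : R := match n with O => 0 | S p => Ft_real p x y end.

Lemma Ft_real_laplacian n x y : 0 < y ->
  y ^ 2 * (weighted_int (ker_dx (ker_dx theta_ker)) (Ft_weight n) x y + weighted_int (ker_dy (ker_dy theta_ker)) (Ft_weight n) x y) = Ft_real_prev n x y.
Proof.
  intros Hy. rewrite !weighted_int_Ft_weight by auto. rewrite <- binomial_mix_plus, <- binomial_mix_scal.
  transitivity (binomial_mix n (seq_diff (fun k => F_real k x y))).
  - unfold binomial_mix. rewrite F_real_laplacian by auto. f_equal. f_equal.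
    apply sum_from_1_ext. intros l Hl. now rewrite F_real_laplacian.
  - rewrite binomial_mix_diff. destruct n. reflexivity. symmetry. now apply Ft_real_binomial_mix.
Qed.

Lemma Ft_eq n x y : 0 < y -> Ft n (x, y) = (Ft_real n x y, 0).
Proof.
  intros Hy. unfold Ft. rewrite (sum_n_m_ext _ (fun l => RtoC (Binomial.C (n + l) n) * RtoC (F_real (n - l) x y))%C).
  2: intros; now rewrite F_eq. rewrite sum_n_m_C, F_eq, Ft_real_binomial_mix by auto. unfold binomial_mix.
  assert (Z0 : sum_from_1 (fun l => Binomial.C (n + l) n * Im (RtoC (F_real (n - l) x y))) n = 0).
  { rewrite (sum_from_1_ext _ (fun l => 0 * Binomial.C (n + l) n)), sum_from_1_scal. ring. intros; simpl; ring. }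
  rewrite Z0. apply injective_projections; simpl; ring.
Qed.

(** The alternating signs in [Gt] and the sign of G multiply to (-1)^l (-1)^(n-l) = (-1)^n, the
    prefactor of [Ft]. Hence both families share the same weight. *)
Lemma Gt_eq n x y : 0 < y -> Gt n (x, y) = (weighted_int (ker_dy theta_ker) (Ft_weight n) x y, weighted_int (ker_dx theta_ker) (Ft_weight n) x y).
Proof.
  intros Hy. unfold Gt. rewrite sum_n_m_C, !weighted_int_Ft_weight by auto. rewrite G_eq by auto. unfold binomial_mix.
  assert (S : forall k, (k <= n)%nat -> (-1) ^ k * (-1) ^ (n - k) = (-1) ^ n).
  { intros k Hk. rewrite <- pow_add. f_equal. lia. }
  assert (H : forall (u : nat -> R) (p : nat -> R), (forall k, p k = (-1) ^ k * u k) ->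
    sum_from_1 (fun l => (-1) ^ l * Binomial.C (n + l) n * p (n - l)%nat) n
    = (-1) ^ n * sum_from_1 (fun l => Binomial.C (n + l) n * u (n - l)%nat) n).
  { intros u p Hp. rewrite (sum_from_1_ext _ (fun l => (-1) ^ n * (Binomial.C (n + l) n * u (n - l)%nat))).
    - apply sum_from_1_scal.
    - intros l Hl. rewrite Hp, <- (S l Hl). ring. }
  unfold Cplus; cbn [fst snd]; f_equal.
  - rewrite (H (fun k => weighted_int (ker_dy theta_ker) (F_weight k) x y) (fun k => Re (G k (x, y)))). ring.
    intros k. now rewrite G_eq.
  - rewrite (H (fun k => weighted_int (ker_dx theta_ker) (F_weight k) x y) (fun k => Im (G k (x, y)))). ring.
    intros k. now rewrite G_eq.
Qed.

(** * The operators on the upper half-plane *)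

Lemma is_derive_shift (f : R -> R) (x a : R) : is_derive f x a -> is_derive (fun t => f (x + t)) 0 a.
Proof.
  intros H. eapply is_derive_eq.
  - apply (is_derive_comp (K := R_AbsRing) (V := R_NormedModule) f (fun t => x + t)).
    + rewrite Rplus_0_r. exact H.
    + auto_derive. auto. reflexivity.
  - unfold scal; simpl; unfold mult; simpl. ring.
Qed.

Lemma dx_eq (f : C -> C) (u v : R -> R -> R) (a b x y : R) :
  (forall x y, 0 < y -> f (x, y) = (u x y, v x y)) -> 0 < y ->
  is_derive (fun t => u t y) x a -> is_derive (fun t => v t y) x b -> dx f (x, y) = (a, b).
Proof.
  intros Hf Hy Hu Hv. unfold dx, RDer. simpl Re. simpl Im. f_equal.
  - rewrite (Derive_ext _ (fun t => u (x + t) y)) by (intros; now rewrite Hf).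
    apply is_derive_unique. now apply (is_derive_shift (fun t => u t y)).
  - rewrite (Derive_ext _ (fun t => v (x + t) y)) by (intros; now rewrite Hf).
    apply is_derive_unique. now apply (is_derive_shift (fun t => v t y)).
Qed.

Lemma dy_eq (f : C -> C) (u v : R -> R -> R) (a b x y : R) :
  (forall x y, 0 < y -> f (x, y) = (u x y, v x y)) -> 0 < y ->
  is_derive (fun t => u x t) y a -> is_derive (fun t => v x t) y b -> dy f (x, y) = (a, b).
Proof.
  intros Hf Hy Hu Hv. unfold dy, RDer. simpl Re. simpl Im.
  (* The formula for f holds in the upper half-plane only, so vertical derivatives use it near the
     point. *)
  assert (L : locally 0 (fun t => 0 < y + t)).
  { exists (mkposreal y Hy). intros t Ht.
    unfold ball in Ht; simpl in Ht; unfold AbsRing_ball, abs, minus, plus, opp in Ht; simpl in Ht.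
    apply Rabs_def2 in Ht. lra. }
  f_equal.
  - rewrite (Derive_ext_loc _ (fun t => u x (y + t))).
    apply is_derive_unique. now apply (is_derive_shift (u x)).
    apply (filter_imp (fun t => 0 < y + t)); auto. intros t Ht. now rewrite Hf.
  - rewrite (Derive_ext_loc _ (fun t => v x (y + t))).
    apply is_derive_unique. now apply (is_derive_shift (v x)).
    apply (filter_imp (fun t => 0 < y + t)); auto. intros t Ht. now rewrite Hf.
Qed.

Lemma locally_pos y : 0 < y -> locally y (fun t => 0 < t).
Proof.
  intros Hy. exists (mkposreal y Hy). intros t Ht.
  unfold ball in Ht; simpl in Ht; unfold AbsRing_ball, abs, minus, plus, opp in Ht; simpl in Ht.
  apply Rabs_def2 in Ht. lra.
Qed.

(** Transports the commutation of [ker_dx] and [ker_dy] through one further derivative, as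
    third-order terms require. *)
Lemma weighted_int_ext_x l l' w x y : 0 < y -> subexp w -> (forall x, weighted_int l w x y = weighted_int l' w x y) ->
  weighted_int (ker_dx l) w x y = weighted_int (ker_dx l') w x y.
Proof.
  intros Hy Hw E. pose proof (weighted_int_derive_x l w x y Hy Hw) as D. pose proof (weighted_int_derive_x l' w x y Hy Hw) as D'.
  apply is_derive_unique in D. apply is_derive_unique in D'. rewrite <- D, <- D'. apply Derive_ext. auto.
Qed.

Lemma weighted_int_ext_y l l' w x y : 0 < y -> subexp w -> (forall y, 0 < y -> weighted_int l w x y = weighted_int l' w x y) ->
  weighted_int (ker_dy l) w x y = weighted_int (ker_dy l') w x y.
Proof.
  intros Hy Hw E. pose proof (weighted_int_derive_y l w x y Hy Hw) as D. pose proof (weighted_int_derive_y l' w x y Hy Hw) as D'.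
  apply is_derive_unique in D. apply is_derive_unique in D'. rewrite <- D, <- D'. apply Derive_ext_loc.
  apply (filter_imp (fun t => 0 < t)). auto. now apply locally_pos.
Qed.

Section Final.
Variable n : nat.
Let W := Ft_weight n.
Let HW : subexp W := Ft_weight_subexp n.

Lemma Ft_real_derive_x m x y : 0 < y -> is_derive (fun t => Ft_real m t y) x (weighted_int (ker_dx theta_ker) (Ft_weight m) x y).
Proof.
  intros Hy. unfold Ft_real. eapply is_derive_eq. apply is_derive_plus'. apply is_derive_const'.
  apply weighted_int_derive_x; auto using Ft_weight_subexp. ring.
Qed.

Lemma Ft_real_derive_y m x y : 0 < y -> is_derive (fun t => Ft_real m x t) y (weighted_int (ker_dy theta_ker) (Ft_weight m) x y).
Proof.
  intros Hy. unfold Ft_real. eapply is_derive_eq. apply is_derive_plus'. apply is_derive_const'.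
  apply weighted_int_derive_y; auto using Ft_weight_subexp. ring.
Qed.

Lemma dx_Ft x y : 0 < y -> dx (Ft n) (x, y) = (weighted_int (ker_dx theta_ker) W x y, 0).
Proof. intros Hy. apply (dx_eq _ (Ft_real n) (fun _ _ => 0)); auto using Ft_eq, is_derive_const'. now apply Ft_real_derive_x. Qed.

Lemma dy_Ft x y : 0 < y -> dy (Ft n) (x, y) = (weighted_int (ker_dy theta_ker) W x y, 0).
Proof. intros Hy. apply (dy_eq _ (Ft_real n) (fun _ _ => 0)); auto using Ft_eq, is_derive_const'. now apply Ft_real_derive_y. Qed.

Lemma dxx_Ft x y : 0 < y -> dx (dx (Ft n)) (x, y) = (weighted_int (ker_dx (ker_dx theta_ker)) W x y, 0).
Proof. intros Hy. apply (dx_eq _ (weighted_int (ker_dx theta_ker) W) (fun _ _ => 0)); auto using dx_Ft, is_derive_const'. now apply weighted_int_derive_x. Qed.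

Lemma dyy_Ft x y : 0 < y -> dy (dy (Ft n)) (x, y) = (weighted_int (ker_dy (ker_dy theta_ker)) W x y, 0).
Proof. intros Hy. apply (dy_eq _ (weighted_int (ker_dy theta_ker) W) (fun _ _ => 0)); auto using dy_Ft, is_derive_const'. now apply weighted_int_derive_y. Qed.

Lemma dx_Gt x y : 0 < y -> dx (Gt n) (x, y) = (weighted_int (ker_dx (ker_dy theta_ker)) W x y, weighted_int (ker_dx (ker_dx theta_ker)) W x y).
Proof. intros Hy. apply (dx_eq _ (weighted_int (ker_dy theta_ker) W) (weighted_int (ker_dx theta_ker) W)); auto using Gt_eq; now apply weighted_int_derive_x. Qed.

Lemma dy_Gt x y : 0 < y -> dy (Gt n) (x, y) = (weighted_int (ker_dy (ker_dy theta_ker)) W x y, weighted_int (ker_dy (ker_dx theta_ker)) W x y).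
Proof. intros Hy. apply (dy_eq _ (weighted_int (ker_dy theta_ker) W) (weighted_int (ker_dx theta_ker) W)); auto using Gt_eq; now apply weighted_int_derive_y. Qed.

Lemma dxx_Gt x y : 0 < y -> dx (dx (Gt n)) (x, y) = (weighted_int (ker_dx (ker_dx (ker_dy theta_ker))) W x y, weighted_int (ker_dx (ker_dx (ker_dx theta_ker))) W x y).
Proof. intros Hy. apply (dx_eq _ (weighted_int (ker_dx (ker_dy theta_ker)) W) (weighted_int (ker_dx (ker_dx theta_ker)) W)); auto using dx_Gt; now apply weighted_int_derive_x. Qed.

Lemma dyy_Gt x y : 0 < y -> dy (dy (Gt n)) (x, y) = (weighted_int (ker_dy (ker_dy (ker_dy theta_ker))) W x y, weighted_int (ker_dy (ker_dy (ker_dx theta_ker))) W x y).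
Proof. intros Hy. apply (dy_eq _ (weighted_int (ker_dy (ker_dy theta_ker)) W) (weighted_int (ker_dy (ker_dx theta_ker)) W)); auto using dy_Gt; now apply weighted_int_derive_y. Qed.

Lemma Ftm1_eq x y : 0 < y -> Ftm1 n (x, y) = (Ft_real_prev n x y, 0).
Proof. intros Hy. destruct n. reflexivity. now apply Ft_eq. Qed.

(** The components of the predecessor of [Gt] are the y- and x-derivatives of the predecessor of
    [Ft], which is a Laplacian. The identity for Delta_2 thus follows by differentiating the one for
    Delta_0. *)
Lemma Gtm1_derive (x y a b : R) : 0 < y -> is_derive (fun t => Ft_real_prev n x t) y a -> is_derive (fun t => Ft_real_prev n t y) x b ->
  Gtm1 n (x, y) = (a, b).
Proof.
  intros Hy Ha Hb. apply is_derive_unique in Ha. apply is_derive_unique in Hb. rewrite <- Ha, <- Hb.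
  destruct n as [|p]; cbn [Gtm1 Ft_real_prev].
  - rewrite !Derive_const. reflexivity.
  - rewrite Gt_eq by auto. f_equal; symmetry; apply is_derive_unique. now apply Ft_real_derive_y. now apply Ft_real_derive_x.
Qed.

Lemma Ft_real_prev_derive_x x y : 0 < y -> is_derive (fun t => Ft_real_prev n t y) x
  (y ^ 2 * (weighted_int (ker_dx (ker_dx (ker_dx theta_ker))) W x y + weighted_int (ker_dy (ker_dy (ker_dx theta_ker))) W x y)).
Proof.
  intros Hy. apply (is_derive_ext (fun t => y ^ 2 * (weighted_int (ker_dx (ker_dx theta_ker)) W t y + weighted_int (ker_dy (ker_dy theta_ker)) W t y))).
  { intros t. now apply Ft_real_laplacian. }
  apply is_derive_scal. apply is_derive_plus'. now apply weighted_int_derive_x.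
  replace (weighted_int (ker_dy (ker_dy (ker_dx theta_ker))) W x y) with (weighted_int (ker_dx (ker_dy (ker_dy theta_ker))) W x y). now apply weighted_int_derive_x.
  rewrite weighted_int_Dxy by auto. apply weighted_int_ext_y; auto. intros; now apply weighted_int_Dxy.
Qed.

(** Differentiating the factor y^2 gives the additional term 2 y, absent from the x-derivative. *)
Lemma Ft_real_prev_derive_y x y : 0 < y -> is_derive (fun t => Ft_real_prev n x t) y
  (2 * y * (weighted_int (ker_dx (ker_dx theta_ker)) W x y + weighted_int (ker_dy (ker_dy theta_ker)) W x y)
   + y ^ 2 * (weighted_int (ker_dx (ker_dx (ker_dy theta_ker))) W x y + weighted_int (ker_dy (ker_dy (ker_dy theta_ker))) W x y)).
Proof.
  intros Hy. apply (is_derive_ext_loc (fun t => t ^ 2 * (weighted_int (ker_dx (ker_dx theta_ker)) W x t + weighted_int (ker_dy (ker_dy theta_ker)) W x t))).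
  { apply (filter_imp (fun t => 0 < t)); [|now apply locally_pos]. intros t Ht. now apply Ft_real_laplacian. }
  eapply is_derive_eq. apply is_derive_mult'. auto_derive. auto. reflexivity.
  apply is_derive_plus'; now apply weighted_int_derive_y.
  replace (weighted_int (ker_dx (ker_dx (ker_dy theta_ker))) W x y) with (weighted_int (ker_dy (ker_dx (ker_dx theta_ker))) W x y). simpl; ring.
  rewrite <- weighted_int_Dxy by auto. apply weighted_int_ext_x; auto. intros; symmetry; now apply weighted_int_Dxy.
Qed.

Lemma main_identities x y : 0 < y ->
  (Lap 0%Z (Ft n) (x, y) = Ftm1 n (x, y) /\ xiop 0%Z (Ft n) (x, y) = Gt n (x, y)) /\
  (Lap 2%Z (Gt n) (x, y) = Gtm1 n (x, y) /\ xiop 2%Z (Gt n) (x, y) = Ftm1 n (x, y)).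
Proof.
  intros Hy. pose proof (Ft_real_laplacian n x y Hy) as HL. fold W in HL.
  pose proof (weighted_int_Dxy theta_ker W x y Hy) as HS.
  split; split.
  - unfold Lap. rewrite dxx_Ft, dyy_Ft, dx_Ft, dy_Ft, Ftm1_eq, <- HL by auto.
    apply injective_projections; unfold Ci; simpl; ring.
  - unfold xiop, dzbar. rewrite dx_Ft, dy_Ft, Gt_eq by auto. fold W.
    apply injective_projections; unfold Ci; simpl; field.
  (* The real first-order part of Delta_2 is precisely the term with 2 y; its imaginary part is a
     difference of mixed derivatives and vanishes by [HS]. *)
  - rewrite (Gtm1_derive x y _ _ Hy (Ft_real_prev_derive_y x y Hy) (Ft_real_prev_derive_x x y Hy)).
    unfold Lap. rewrite dxx_Gt, dyy_Gt, dx_Gt, dy_Gt, HS by auto.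
    apply injective_projections; unfold Ci; simpl; ring.
  (* The antiholomorphic derivative has half the difference of the mixed derivatives as its real
     part and half the Euclidean Laplacian as its imaginary part. *)
  - unfold xiop, dzbar. rewrite dx_Gt, dy_Gt, Ftm1_eq, HS, <- HL by auto.
    apply injective_projections; unfold Ci; simpl; field.
Qed.
End Final.

Theorem theorem1p3 : forall (n : nat) (z : C), 0 < Im z ->
  (Lap 0%Z (Ft n) z = Ftm1 n z /\ xiop 0%Z (Ft n) z = Gt n z) /\
  (Lap 2%Z (Gt n) z = Gtm1 n z /\ xiop 2%Z (Gt n) z = Ftm1 n z).
Proof. intros n [x y] Hy. now apply main_identities. Qed.
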